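(* Let $N\ge 2$, let $b^-<b^+$ be real numbers and let $\Omega=\{(x',x_N)\in\mathbb R^{N-1}\times\mathbb R: b^-<x_N<b^+\}$. Let $0<s<1$, $1<p<\infty$ and $sp>1$. (1) There exists $C=C(N,s,p,b^+-b^-)>0$ such that for all $u\in \dot W^{s,p}(\Omega)$, $$\int_{\mathbb R^{N-1}}|\mathrm{Tr}(u)(x',b^+)-\mathrm{Tr}(u)(x',b^-)|^p\,dx'\le C|u|_{\dot W^{s,p}(\Omega)}^p,$$ $$|\mathrm{Tr}(u)(\cdot,b^\pm)|_{\tilde W^{s-1/p,p}_{\le b^+-b^-}(\mathbb R^{N-1})}\le C|u|_{\dot W^{s,p}(\Omega)},\qquad |\mathrm{Tr}(u)(\cdot,b^\pm)|_{\tilde W^{s+1/p,p}_{\ge b^+-b^-}(\mathbb R^{N-1})}\le C|u|_{\dot W^{s,p}(\Omega)}.$$ (2) Let $f^+,f^-\in L^p_{\rm loc}(\mathbb R^{N-1})$ be such that $$\int_{\mathbb R^{N-1}}|f^+(x')-f^-(x')|^p\,dx'<\infty,\quad |f^\pm|_{\tilde W^{s-1/p,p}_{\le b^+-b^-}(\mathbb R^{N-1})}<\infty,\quad |f^\pm|_{\tilde W^{s+1/p,p}_{\ge b^+-b^-}(\mathbb R^{N-1})}<\infty .$$ Then there exists $u\in\dot W^{s,p}(\Omega)$ such that $\mathrm{Tr}(u)(x',b^\pm)=f^\pm(x')$. Furthermore, $u$ can be chosen so that the map $(f^+,f^-)\mapsto u$ is linear and, for some $C=C(N,s,p,b^+-b^-)>0$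 (independent of $f^\pm$), $$|u|_{\dot W^{s,p}(\Omega)}\le C\|f^+-f^-\|_{L^p(\mathbb R^{N-1})}+C|f^+|_{\tilde W^{s-1/p,p}_{\le b^+-b^-}(\mathbb R^{N-1})}+C|f^-|_{\tilde W^{s-1/p,p}_{\le b^+-b^-}(\mathbb R^{N-1})}+C|f^+|_{\tilde W^{s+1/p,p}_{\ge b^+-b^-}(\mathbb R^{N-1})}+C|f^-|_{\tilde W^{s+1/p,p}_{\ge b^+-b^-}(\mathbb R^{N-1})}.$$
   Context: For $U\subseteq\mathbb R^d$ open, $0<s<1$, $1\le p<\infty$, $\dot W^{s,p}(U)$ is the space of $u\in L^p_{\rm loc}(U)$ with finite seminorm $|u|_{\dot W^{s,p}(U)}=\left(\int_U\int_U\frac{|u(x)-u(y)|^p}{\|x-y\|^{d+sp}}\,dy\,dx\right)^{1/p}$. For $\sigma>0$, a positive function $\eta$ on $U$ (possibly a positive constant), and $g$ measurable on $U\subseteq\mathbb R^d$, define the screened seminorms $$|g|_{\tilde W^{\sigma,p}_{\le\eta}(U)}=\left(\int_U\int_{U\cap B(x,\eta(x))}\frac{|g(x)-g(y)|^p}{\|x-y\|^{d+\sigma p}}\,dy\,dx\right)^{1/p},$$ $$|g|_{\tilde W^{\sigma,p}_{\ge\eta}(U)}=\left(\int_U\int_{U\setminus B(x,\eta(x))}\eta(x)\eta(y)\frac{|g(x)-g(y)|^p}{\|x-y\|^{d+\sigma p}}\,dy\,dx\right)^{1/p}.$$ Here they are used with $U=\mathbb R^{N-1}$, $d=N-1$,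 so for $\sigma=s-1/p$ the kernel exponent is $N-2+sp$ and for $\sigma=s+1/p$ it is $N+sp$. $\mathrm{Tr}(u)$ denotes the boundary trace of $u$ on $\partial\Omega$: for $sp>1$ a function $u\in\dot W^{s,p}(\Omega)$ belongs to $W^{s,p}$ of every bounded Lipschitz subdomain, and $\mathrm{Tr}(u)$ is given locally by the standard continuous trace operator on $W^{s,p}$ of Lipschitz domains (the continuous extension of restriction to the boundary). *)

(* Defs.v *)
From HB Require Import structures.
From mathcomp Require Import all_boot all_order all_algebra.
From mathcomp Require Import all_classical all_reals all_analysis.
Set Implicit Arguments.
Unset Strict Implicit.
Unset Printing Implicit Defensive.
Import Order.TTheory GRing.Theory Num.Theory.
Import numFieldTopology.Exports numFieldNormedType.Exports.
Local Open Scope classical_set_scope.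
Local Open Scope ring_scope.

(* R^d is 'rV[R]_d.  Its sigma-algebra is generated by the coordinates, as the
   library does for tuples; it is the Borel sigma-algebra. *)
Section measurable_rV.
Context {R : realType} {d : nat}.

Let coord (i : 'I_d) (x : 'rV[R]_d) : measurableTypeR R := x 0 i.

Let rV_set0 : g_sigma_preimage coord set0.
Proof. exact: sigma_algebra0. Qed.

Let rV_setC A : g_sigma_preimage coord A -> g_sigma_preimage coord (~` A).
Proof. exact: sigma_algebraC. Qed.

Let rV_bigcup (F : (set 'rV[R]_d)^nat) :
  (forall i, g_sigma_preimage coord (F i)) ->
  g_sigma_preimage coord (\bigcup_i (F i)).
Proof. exact: sigma_algebra_bigcup. Qed.

HB.instance Definition _ := @isMeasurable.Build
  (measure_tuple_display default_measure_display) 'rV[R]_d (g_sigma_preimage coord) rV_set0 rV_setC rV_bigcup.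

Lemma measurable_coord (i : 'I_d) :
  measurable_fun [set: 'rV[R]_d] (fun x => x 0 i : measurableTypeR R).
Proof.
move=> _ Y mY; rewrite setTI; apply: sub_sigma_algebra => /=.
rewrite -bigcup_seq/=; exists i => /=; first by rewrite mem_index_enum.
by exists Y => //; rewrite setTI.
Qed.

Lemma measurable_fun_rV d' (T : measurableType d') (f : T -> 'rV[R]_d) :
  (forall i, measurable_fun [set: T] (fun t => f t 0 i : measurableTypeR R)) ->
  measurable_fun [set: T] f.
Proof.
move=> mf _ A mA; rewrite setTI.
have : preimage_set_system [set: T] f (g_sigma_preimage coord) `<=` measurable.
  rewrite -g_sigma_preimage_comp.
  apply: smallest_sub; first exact: sigma_algebra_measurable.
  rewrite -bigcup_seq; apply: bigcup_sub => i _ B [C mC <-].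
  exact: mf.
by apply; exists A => //; rewrite setTI.
Qed.

End measurable_rV.

(* The point (x', t) of R^n x R = R^(n+1); conversely x' and t are
   [rV_tail x] and [rV_last x]. *)
Definition rV_join {R : realType} {n : nat} (z : 'rV[R]_n * measurableTypeR R)
  : 'rV[R]_n.+1 :=
  \row_i (if unlift ord_max i is Some j then z.1 0 j else z.2).

Definition rV_tail {R : realType} {n : nat} (x : 'rV[R]_n.+1) : 'rV[R]_n :=
  col' ord_max x.

Definition rV_last {R : realType} {n : nat} (x : 'rV[R]_n.+1)
  : measurableTypeR R := x 0 ord_max.

Section rV_join_theory.
Context {R : realType} {n : nat}.

Lemma rV_joinK :
  cancel (@rV_join R n) (fun x => (rV_tail x, rV_last x)).
Proof.
move=> [x t]; congr pair; last by rewrite /rV_last mxE unlift_none.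
by apply/rowP => j; rewrite !mxE /= liftK.
Qed.

Lemma rV_splitK :
  cancel (fun x => (rV_tail x, rV_last x)) (@rV_join R n).
Proof.
move=> x; apply/rowP => i; rewrite !mxE /=.
by case: unliftP => [j ->|->] //; rewrite mxE.
Qed.

Lemma measurable_rV_join :
  measurable_fun [set: 'rV[R]_n * measurableTypeR R] rV_join.
Proof.
apply: measurable_fun_rV => i.
case: (unliftP ord_max i) => [j ->|->].
  rewrite (_ : (fun _ => _) =
    (fun x : 'rV[R]_n => x 0 j : measurableTypeR R) \o fst).
    by apply: measurableT_comp; [exact: measurable_coord|exact: measurable_fst].
  by apply/funext => z; rewrite mxE liftK.
rewrite (_ : (fun _ => _) = snd); first exact: measurable_snd.
by apply/funext => z; rewrite mxE unlift_none.
Qed.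

Lemma measurable_rV_split :
  measurable_fun [set: 'rV[R]_n.+1] (fun x => (rV_tail x, rV_last x)).
Proof.
apply: measurable_fun_pair; last exact: measurable_coord.
apply: measurable_fun_rV => i.
rewrite (_ : (fun _ => _) =
    fun x : 'rV[R]_n.+1 => x 0 (lift ord_max i) : measurableTypeR R).
  exact: measurable_coord.
by apply/funext => x; rewrite mxE.
Qed.

End rV_join_theory.

Section rV_prod.
Context {R : realType} {n : nat}.
Variables (mu : {sigma_finite_measure set 'rV[R]_n -> \bar R})
  (nu : {sigma_finite_measure set (measurableTypeR R) -> \bar R}).

Definition rV_prod : set 'rV[R]_n.+1 -> \bar R :=
  pushforward (mu \x nu)%E rV_join.

Let rV_prod0 : rV_prod set0 = 0%E.
Proof. by rewrite /rV_prod /pushforward preimage_set0 measure0. Qed.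

Let rV_prod_ge0 A : (0 <= rV_prod A)%E.
Proof. by rewrite /rV_prod /pushforward measure_ge0. Qed.

Let rV_prod_sigma_additive : semi_sigma_additive rV_prod.
Proof.
move=> F mF tF mUF; rewrite /rV_prod /pushforward preimage_bigcup.
apply: measure_semi_sigma_additive.
- by move=> k; rewrite -[X in measurable X]setTI; exact: measurable_rV_join.
- apply/trivIsetP => /= i j _ _ ij; rewrite -preimage_setI.
  by move/trivIsetP : tF => /(_ _ _ _ _ ij) ->//; rewrite preimage_set0.
- rewrite -preimage_bigcup -[X in measurable X]setTI.
  exact: measurable_rV_join.
Qed.

HB.instance Definition _ := isMeasure.Build _ _ _ rV_prod
  rV_prod0 rV_prod_ge0 rV_prod_sigma_additive.

Let rV_prod_sigma_finite : sigma_finite setT rV_prod.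
Proof.
have [F UF mF] : sigma_finite setT (mu \x nu)%E.
  have /sigma_finiteP[F [TF ndF Foo]] := sigma_finiteT mu.
  have /sigma_finiteP[G [TG ndG Goo]] := sigma_finiteT nu.
  exists (fun k => F k `*` G k).
    rewrite -setXTT TF TG predeqE => -[x y]; split.
      move=> [/= [i _ Fix] [j _ Gjy]]; exists (maxn i j) => //; split.
      - by move: x Fix; exact/subsetPset/ndF/leq_maxl.
      - by move: y Gjy; exact/subsetPset/ndG/leq_maxr.
    by move=> [i _ []/= ? ?]; split; exists i.
  move=> k; have [? ?] := Foo k; have [? ?] := Goo k.
  split; first exact: measurableX.
  by rewrite product_measure1E// lte_mul_pinfty// ge0_fin_numE.
exists (fun k => (fun x => (rV_tail x, rV_last x)) @^-1` F k).
  by rewrite -preimage_bigcup -UF preimage_setT.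
move=> k; have [mFk Fk] := mF k; split.
  by rewrite -[X in measurable X]setTI; exact: measurable_rV_split.
rewrite /rV_prod /pushforward -comp_preimage.
by rewrite (_ : _ \o _ = id) // funeqE => z; rewrite /= rV_joinK.
Qed.

HB.instance Definition _ := Measure_isSigmaFinite.Build _ _ _ rV_prod
  rV_prod_sigma_finite.

End rV_prod.

(* Lebesgue measure on R^d. *)
Fixpoint leb (R : realType) (d : nat)
  : {sigma_finite_measure set 'rV[R]_d -> \bar R} :=
  match d with
  | 0 => @dirac _ 'rV[R]_0 0 R
  | n.+1 => rV_prod (leb R n) (@lebesgue_measure R)
  end.

Section screened_sobolev.
Context {R : realType} {d : nat}.
Implicit Types (x y : 'rV[R]_d) (U : set 'rV[R]_d) (u g : 'rV[R]_d -> R).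
Implicit Types (eta : 'rV[R]_d -> R).

(* The norm of the library on 'rV[R]_d is the sup norm. *)
Definition enorm x : R := Num.sqrt (\sum_i x 0 i ^+ 2).

Definition eball x (r : R) : set 'rV[R]_d := [set y | enorm (y - x) < r].

Definition gagliardo (sigma p : R) g x y : R :=
  `|g x - g y| `^ p / enorm (x - y) `^ (d%:R + sigma * p).

Local Open Scope ereal_scope.

Definition Lp_norm_on (p : R) U g : \bar R :=
  (\int[leb R d]_(x in U) (`|g x| `^ p)%:E) `^ p^-1.

Definition Lp_loc (p : R) U g : Prop :=
  measurable_fun U g /\
  forall K, compact K -> K `<=` U -> \int[leb R d]_(x in K) (`|g x| `^ p)%:E < +oo.

Definition sobolev_seminorm (s p : R) U u : \bar R :=
  (\int[leb R d]_(x in U) \int[leb R d]_(y in U) (gagliardo s p u x y)%:E) `^ p^-1.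

Definition homogeneous_sobolev (s p : R) U : set ('rV[R]_d -> R) :=
  [set u | Lp_loc p U u /\ sobolev_seminorm s p U u < +oo].

Definition sobolev_norm (s p : R) U u : \bar R :=
  Lp_norm_on p U u + sobolev_seminorm s p U u.

Definition screened_le (sigma p : R) eta U g : \bar R :=
  (\int[leb R d]_(x in U) \int[leb R d]_(y in U `&` eball x (eta x))
     (gagliardo sigma p g x y)%:E) `^ p^-1.

Definition screened_ge (sigma p : R) eta U g : \bar R :=
  (\int[leb R d]_(x in U) \int[leb R d]_(y in U `\` eball x (eta x))
     (eta x * eta y * gagliardo sigma p g x y)%:E) `^ p^-1.

End screened_sobolev.

Section trace.
Context {R : realType} {n : nat}.

Definition strip (bm bp : R) : set 'rV[R]_n.+1 :=
  [set x | bm < rV_last x < bp].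

Definition cylinder (bm bp r : R) : set 'rV[R]_n.+1 :=
  [set x | strip bm bp x /\ enorm (rV_tail x) < r].

(* [is_trace s p bm bp u b f]: f is the trace of u on the hyperplane x_N = b
   (meant for b = bm or b = bp).  On each bounded cylinder V over a ball, which
   is a Lipschitz subdomain of the strip, the trace operator of W^{s,p}(V) is
   the continuous extension of v |-> v(., b) from the functions that are
   continuous up to the boundary (all such functions are restrictions of
   continuous functions on the whole space, the closure of V being compact). *)
Definition is_trace (s p bm bp : R) (u : 'rV[R]_n.+1 -> R) (b : R)
    (f : 'rV[R]_n -> R) : Prop :=
  measurable_fun setT f /\
  forall r : R, 0 < r -> exists v : nat -> 'rV[R]_n.+1 -> R,
    [/\ forall k, continuous (v k),
        (fun k => sobolev_norm s p (cylinder bm bp r) (v k \- u))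
          @ \oo --> (0 : \bar R) &
        (fun k => Lp_norm_on p (eball 0 r) (fun x => v k (rV_join (x, b)) - f x))
          @ \oo --> (0 : \bar R)].

Definition trace_data (s p L : R) (fp fm : 'rV[R]_n -> R) : Prop :=
  [/\ Lp_loc p setT fp, Lp_loc p setT fm,
      (\int[leb R n]_x (`|fp x - fm x| `^ p)%:E < +oo)%E,
      (screened_le (s - p^-1) p (cst L) setT fp < +oo)%E /\
      (screened_le (s - p^-1) p (cst L) setT fm < +oo)%E &
      (screened_ge (s + p^-1) p (cst L) setT fp < +oo)%E /\
      (screened_ge (s + p^-1) p (cst L) setT fm < +oo)%E].

End trace.

(* Main.v *)
Require Import Defs.
From mathcomp Require Import all_boot all_order all_algebra.
From mathcomp Require Import all_classical all_reals all_analysis.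
From mathcomp Require Import measurable_realfun.
From mathcomp Require Import ring lra.
Set Implicit Arguments.
Unset Strict Implicit.
Unset Printing Implicit Defensive.
Import Order.TTheory GRing.Theory Num.Theory.
Import numFieldTopology.Exports numFieldNormedType.Exports.
Local Open Scope classical_set_scope.
Local Open Scope ring_scope.

(* Let t denote the distance to one face of the strip, n = N - 1 and m = s p > 1.
   The bridge between a function u on the strip and a function f on the face is
     T_k(f, u) = int int_{0 < t < L, |y - x| < k t} |f x - u(y, t)|^p t^(-n - m).
   If f is the trace of u, a Hardy inequality on the lines h |-> (x + h z, h),
   telescoped along h, th h, th^2 h, ... and averaged over th and z, gives
   T_k(f, u) <= C |u|^p. Averaging f x - u(a) over points a above x then bounds
   the screened seminorms and f^+ - f^- by T_3 and |u|^p.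
   Conversely, let F(x, t) be the mean of f over B(x, t) with a tent weight. Pairs
   at distance below half their height are handled by the Lipschitz dependence of
   the mean on centre and radius, the others by comparison with f, so |F|^p is
   bounded by the two screened energies; the extension is F^- + (t / L) (F^+ - F^-).
   Existence of traces, and the fact that T_1(f, u) < oo forces f to be the trace,
   come from mollifying u at scale e around centres pushed to distance at least 3e
   from the boundary: the boundary values form a geometric Cauchy sequence in L^p. *)

(** The two screened exponents come from counting heights. Two face points at distance r < L see
    pairs of slab points with both heights of order r: integrating |a - c|^(-n-1-m) over the two
    heights gains r^2 and leaves r^(-(n+m-1)), the kernel for s - 1/p. For r >= L the heights are
    confined to ]0, L[, the gain is only L^2, and the exponent stays n + 1 + m, that of s + 1/p; the
    weight eta(x) eta(y) is this L^2. The condition m > 1 makes sums over scales converge at the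
    face, and m < p, which is s < 1, makes |a - c|^(p-n-1-m) integrable at the diagonal. The
    obstacle in the direct part is that a trace is known only through continuous approximations on
    bounded cylinders, while the Hardy inequality needs actual boundary values. It is proved for
    continuous functions on cylinders and transferred to f and u after removing a layer next to the
    face, where t^(-n-m) is unbounded. The constant depends neither on the cylinder nor on the
    layer, so both restrictions are lifted at the end. A sign sg treats both faces at once. *)

Lemma le_of_eq (R : realType) (x y : \bar R) : x = y -> (x <= y)%E.
Proof. by move=> ->. Qed.

(** * Integrals of nonnegative functions *)

Section ge0_integral.
Local Open Scope ereal_scope.
Context d (T : measurableType d) (R : realType) (mu : {measure set T -> \bar R}).
Implicit Types F G : T -> \bar R.

(** The integral of a nonnegative function is a supremum over the simple functions below it, and a
    larger function has more of these. This covers arbitrary nonnegative functions. *)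
Lemma le_int F G : (forall x, 0 <= F x) -> (forall x, F x <= G x) ->
  \int[mu]_x F x <= \int[mu]_x G x.
Proof.
move=> F0 FG; have G0 x : 0 <= G x by exact: le_trans (F0 x) (FG x).
rewrite !ge0_integralTE//; apply: le_ereal_sup => _ [h hF <-]; exists h => // x.
exact: le_trans (hF x) (FG x).
Qed.

Lemma int0_le F (B : \bar R) : (forall x, F x = 0) -> 0 <= B ->
  \int[mu]_x F x <= B.
Proof. by move=> F0 B0; rewrite integral0_eq. Qed.

Import HBNNSimple.

Let intZ_le (c : R) F : (0 < c)%R -> (forall x, 0 <= F x) ->
  \int[mu]_x (c%:E * F x) <= c%:E * \int[mu]_x F x.
Proof.
move=> c0 F0; rewrite !ge0_integralTE//; last first.
  by move=> x; rewrite mule_ge0// lee_fin ltW.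
apply: ge_ereal_sup => _ [h hF <-].
have ci0 : (0 <= c^-1)%R by rewrite invr_ge0 ltW.
rewrite -lee_pdivrMl//.
pose h' := scale_nnsfun h ci0.
apply: ereal_sup_ubound; exists h'.
  by move=> x /=; rewrite EFinM lee_pdivrMl//; exact: hF.
by rewrite -sintegralrM.
Qed.

Lemma intZ (c : R) F : (0 <= c)%R -> (forall x, 0 <= F x) ->
  \int[mu]_x (c%:E * F x) = c%:E * \int[mu]_x F x.
Proof.
rewrite le_eqVlt => /predU1P[<- F0|c0 F0].
  by under eq_integral do rewrite mul0e; rewrite integral0 mul0e.
apply/eqP; rewrite eq_le intZ_le//= -lee_pdivlMl//.
(* The reverse inequality is [intZ_le] for [c^-1] and the function c F. *)
have := @intZ_le c^-1 (fun x => c%:E * F x).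
under eq_integral do rewrite muleA -EFinM mulVf ?gt_eqF// mul1e.
apply; first by rewrite invr_gt0.
by move=> x; rewrite mule_ge0// lee_fin ltW.
Qed.

Lemma int_eqZ (c : R) F G : (0 <= c)%R -> (forall x, 0 <= G x) ->
  (forall x, F x = c%:E * G x) -> \int[mu]_x F x = c%:E * \int[mu]_x G x.
Proof. by move=> c0 G0 FG; rewrite -intZ//; apply: eq_integral => x _. Qed.

Lemma intZr (c : R) F : (0 <= c)%R -> (forall x, 0 <= F x) ->
  \int[mu]_x (F x * c%:E) = (\int[mu]_x F x) * c%:E.
Proof.
by move=> c0 F0; under eq_integral do rewrite muleC; rewrite intZ// muleC.
Qed.

End ge0_integral.

Section iterated.
Local Open Scope ereal_scope.
Context d1 d2 (T1 : measurableType d1) (T2 : measurableType d2) (R : realType).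
Variables (m1 : {sigma_finite_measure set T1 -> \bar R})
  (m2 : {sigma_finite_measure set T2 -> \bar R}).
Variable F : T1 -> T2 -> \bar R.
Hypothesis mF : measurable_fun [set: T1 * T2] (fun z : T1 * T2 => F z.1 z.2).
Hypothesis F0 : forall x y, 0 <= F x y.

Lemma swap_int : \int[m1]_x \int[m2]_y F x y = \int[m2]_y \int[m1]_x F x y.
Proof. exact: (@fubini_tonelli _ _ _ _ R m1 m2 (fun z => F z.1 z.2)). Qed.

Lemma int_prod : \int[(m1 \x m2)%E]_z F z.1 z.2 = \int[m1]_x \int[m2]_y F x y.
Proof. exact: (@fubini_tonelli1 _ _ _ _ R m1 m2 (fun z => F z.1 z.2)). Qed.

Lemma measurable_int1 : measurable_fun [set: T1] (fun x => \int[m2]_y F x y).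
Proof. exact: (@measurable_fun_fubini_tonelli_F _ _ _ _ R m2 (fun z => F z.1 z.2)). Qed.

End iterated.

(** * Measurability of arithmetic and vector expressions *)

Lemma measurable_nat_of_bool d (T : measurableType d) (R : realType) (b : T -> bool) :
  measurable_fun setT b -> measurable_fun setT (fun x => (b x)%:R : R).
Proof.
by move=> mb; exact: (@measurableT_comp _ _ _ _ _ _ (fun c : bool => c%:R : R)).
Qed.

Section mfs.
Context d (T : measurableType d) (R : realType).
Implicit Types f g : T -> R.

Lemma measurable_fun_powR f p : measurable_fun setT f ->
  measurable_fun setT (fun x => f x `^ p).
Proof. exact: (@measurableT_comp _ _ _ _ _ _ (@powR R ^~ p)). Qed.

Lemma measurable_fun_norm f : measurable_fun setT f ->
  measurable_fun setT (fun x => `|f x|).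
Proof. exact: (@measurableT_comp _ _ _ _ _ _ (@Num.norm R R)). Qed.

Lemma measurable_funV f : measurable_fun setT f ->
  measurable_fun setT (fun x => (f x)^-1).
Proof.
move=> mf.
(* The inverse of y is y |y|^(-2), also at 0 where both sides vanish; this reduces inversion to a
   real power. *)
have -> : (fun x => (f x)^-1) = (fun x => (f x * (`|f x| `^ 2)^-1)).
  apply/funext => x; have [->|fx0] := eqVneq (f x) 0; first by rewrite invr0 mul0r.
  by rewrite powR_mulrn// real_normK ?num_real// expr2 invfM mulrA divff ?mul1r.
under eq_fun do rewrite -powRN.
apply: measurable_funM => //; apply: measurable_fun_powR; exact: measurable_fun_norm.
Qed.

Lemma measurable_fun_sqrt f : measurable_fun setT f ->
  measurable_fun setT (fun x => Num.sqrt (f x)).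
Proof.
move=> mf.
have -> : (fun x => Num.sqrt (f x)) = (fun x => (Num.max 0 (f x)) `^ 2^-1).
  apply/funext => x; rewrite powR12_sqrt; last by rewrite le_max lexx.
  by rewrite /Order.max; case: ltP => // fx; rewrite ler0_sqrtr// sqrtr0.
by apply: measurable_fun_powR; apply: measurable_maxr.
Qed.
End mfs.

Section rV_measurable.
Context d (T : measurableType d) (R : realType) (n : nat).
Implicit Types f g : T -> 'rV[R]_n.

Lemma measurable_fun_coord f i : measurable_fun setT f ->
  measurable_fun setT (fun x => f x 0 i : R).
Proof. exact: (measurableT_comp (measurable_coord i)). Qed.

Lemma measurable_rVD f g : measurable_fun setT f -> measurable_fun setT g ->
  measurable_fun setT (fun x => f x + g x).
Proof.
move=> mf mg; apply: measurable_fun_rV => i; under eq_fun do rewrite mxE.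
by apply: measurable_funD; exact: measurable_fun_coord.
Qed.

Lemma measurable_rVN f : measurable_fun setT f -> measurable_fun setT (fun x => - f x).
Proof.
move=> mf; apply: measurable_fun_rV => i; under eq_fun do rewrite mxE.
by apply: measurable_funN; exact: measurable_fun_coord.
Qed.

Lemma measurable_rVZ (k : T -> R) f : measurable_fun setT k ->
  measurable_fun setT f -> measurable_fun setT (fun x => k x *: f x).
Proof.
move=> mk mf; apply: measurable_fun_rV => i; under eq_fun do rewrite mxE.
by apply: measurable_funM => //; exact: measurable_fun_coord.
Qed.

Lemma measurable_fun_join f (k : T -> R) : measurable_fun setT k ->
  measurable_fun setT f -> measurable_fun setT (fun x => rV_join (f x, k x)).
Proof.
move=> mk mf; apply: (measurableT_comp (@measurable_rV_join R n)).
exact: measurable_fun_pair.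
Qed.

Lemma measurable_enorm f : measurable_fun setT f ->
  measurable_fun setT (fun x => enorm (f x)).
Proof.
move=> mf; apply: measurable_fun_sqrt; apply: measurable_sum => i.
by apply: measurable_funX; exact: measurable_fun_coord.
Qed.

End rV_measurable.
Lemma measurable_fun2 d d1 d2 d3 (T : measurableType d) (T1 : measurableType d1)
  (T2 : measurableType d2) (T3 : measurableType d3) (w : T1 -> T2 -> T3) f g :
  measurable_fun setT (fun z : T1 * T2 => w z.1 z.2) ->
  measurable_fun setT f -> measurable_fun setT g ->
  measurable_fun setT (fun x : T => w (f x) (g x)).
Proof.
move=> mw mf mg.
exact: (measurableT_comp mw (measurable_fun_pair mf mg)).
Qed.

Lemma measurable_EFin_fun d (T : measurableType d) (R : realType) (f : T -> R) :
  measurable_fun setT f -> measurable_fun setT (fun x => (f x)%:E).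
Proof. by move/measurable_EFinP. Qed.

Lemma measurable_fun_ite d d' (T : measurableType d) (T' : measurableType d')
    (b : T -> bool) (f g : T -> T') :
  measurable_fun setT b -> measurable_fun setT f -> measurable_fun setT g ->
  measurable_fun setT (fun x => if b x then f x else g x).
Proof. by move=> mb mf mg; exact: measurable_fun_ifT. Qed.

Ltac nneg1 :=
  match goal with
  | |- is_true (_ <= integral _ _ _)%E => apply: integral_ge0; intros
  | |- is_true (_ <= EFin _)%E => rewrite lee_fin
  | |- is_true (_ <= _ * _)%E => apply: mule_ge0
  | |- is_true (_ <= _ + _)%E => apply: adde_ge0
  | |- is_true (_ <= _) => assumption
  | |- is_true (_ <= Num.norm _) => exact: normr_ge0
  | |- is_true (_ <= _ `^ _) => exact: powR_ge0
  | |- is_true (_ <= Num.sqrt _) => exact: sqrtr_ge0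
  | |- is_true (_ <= (nat_of_bool _)%:R) => exact: ler0n
  | |- is_true (_ <= _ * _) => apply: mulr_ge0
  | |- is_true (_ <= _ + _) => apply: addr_ge0
  | |- is_true (_ <= _ ^+ _) => apply: exprn_ge0
  | |- is_true (_ <= GRing.inv _) => rewrite invr_ge0
  | |- is_true (_ <= \sum_(_ <- _ | _) _) => apply: sumr_ge0; intros
  | _ => first [assumption | done | apply: ltW; assumption]
  end.
Ltac nneg := intros; cbv beta; repeat (nneg1; cbv beta).

(** Recursion on the expression. A function of two variables is used through its joint
    measurability, written as measurability of [fun z => w z.1 z.2]; hypotheses on functions of two
    variables are stated in that form for this reason. *)
Ltac mfstep :=
  match goal with
  | |- measurable_fun _ (fun _ => ?c) => exact: measurable_cst
  | |- measurable_fun _ (fun x => x) => exact: measurable_id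
  | |- measurable_fun _ id => exact: measurable_id
  | H : measurable_fun _ ?f |- measurable_fun _ ?g => constr_eq f g; exact: H
  | |- measurable_fun _ (fun x => EFin _) => apply: measurable_EFin_fun
  | |- measurable_fun _ (fun x => (_ + _)%E) => apply: emeasurable_funD
  | |- measurable_fun _ (fun x => (_ * _)%E) => apply: emeasurable_funM
  | |- measurable_fun _ (fun x => integral _ setT (fun y => @?F x y)) =>
      apply: (@measurable_int1 _ _ _ _ _ _ F); [cbv beta | try solve [nneg]]
  | H : measurable_fun _ (fun z => ?w (fst z) (snd z))
    |- measurable_fun _ (fun x => ?v (@?f x) (@?g x)) =>
      constr_eq v w; apply: (measurable_fun2 (f := f) (g := g) H); cbv beta
  | H : measurable_fun _ ?u |- measurable_fun _ (fun x => ?v (@?f x)) =>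
      constr_eq v u; apply: (measurableT_comp H (g := f)); cbv beta
  | |- measurable_fun _ (fun x => enorm _) => apply: measurable_enorm
  | |- measurable_fun _ (fun x => rV_join (_, _)) => apply: measurable_fun_join
  | |- measurable_fun _ (fun x => (nat_of_bool _)%:R) => apply: measurable_nat_of_bool
  | |- measurable_fun _ (fun x => _ && _) => apply: measurable_and
  | |- measurable_fun _ (fun x => _ < _) => apply: measurable_fun_ltr
  | |- measurable_fun _ (fun x => _ <= _) => apply: measurable_fun_ler
  | |- measurable_fun _ (fun x => if _ then _ else _) => apply: measurable_fun_ite
  | |- measurable_fun _ (fun x => _ `^ _) => apply: measurable_fun_powR
  | |- measurable_fun _ (fun x => _ ^+ _) => apply: measurable_funX
  | |- measurable_fun _ (fun x => `| _ |) => apply: measurable_fun_norm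
  | |- measurable_fun _ (fun x => Num.sqrt _) => apply: measurable_fun_sqrt
  | |- measurable_fun _ (fun x => Num.max _ _) => apply: measurable_maxr
  | |- measurable_fun _ (fun x => Num.min _ _) => apply: measurable_minr
  | |- measurable_fun _ (fun x => GRing.inv _) => apply: measurable_funV
  | |- measurable_fun _ (fun x => _ * _) => apply: measurable_funM
  | |- measurable_fun _ (fun x => _ *: _) => apply: measurable_rVZ
  | |- measurable_fun _ (fun x => _ + _) =>
      first [apply: measurable_funD | apply: measurable_rVD]
  | |- measurable_fun _ (fun x => - _) =>
      first [apply: measurable_funN | apply: measurable_rVN]
  | |- measurable_fun _ (fun x => (_, _)) => apply: measurable_fun_pair
  | |- measurable_fun _ fst => exact: measurable_fst
  | |- measurable_fun _ snd => exact: measurable_snd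
  | |- measurable_fun _ (fun x => fst x) => exact: measurable_fst
  | |- measurable_fun _ (fun x => snd x) => exact: measurable_snd
  | |- measurable_fun _ (fun x => fst (@?f x)) =>
      apply: (measurableT_comp measurable_fst (g := f)); cbv beta
  | |- measurable_fun _ (fun x => snd (@?f x)) =>
      apply: (measurableT_comp measurable_snd (g := f)); cbv beta
  | |- measurable_fun _ (fun x => fun_of_matrix _ _ _) => apply: measurable_fun_coord
  | |- measurable_fun ?D ?f =>
      lazymatch f with fun _ => _ => fail | _ => change (measurable_fun D (fun x => f x)) end
  end.
Ltac mf := cbv beta; repeat (mfstep; cbv beta).

Definition nu (R : realType) :
  {sigma_finite_measure set (measurableTypeR R) -> \bar R} := @lebesgue_measure R.

(** * Lebesgue measure on R^d *)

Section lebesgue_affine.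
Context (R : realType).
Notation mu := (@lebesgue_measure R).
Variables (a b : R).
Hypothesis a0 : a != 0.
Let phi (t : measurableTypeR R) : measurableTypeR R := a * t + b.
Let mphi : measurable_fun setT phi.
Proof. by rewrite /phi; mf. Qed.

Let na : 0 <= `|a|. Proof. by []. Qed.

Let preim (u v : R) (X : set R) : X = `]u, v]%classic ->
  (`|a|%:E * mu (phi @^-1` X) = mu X)%E.
Proof.
move=> ->; have [agt0|alt0|aeq0] := ltgtP a 0; last by move: a0; rewrite aeq0 eqxx.
- have -> : phi @^-1` `]u, v] = `[(v - b) / a, (u - b) / a[%classic.
    apply/seteqP; split => t /=; rewrite !in_itv/= /phi => /andP[h1 h2].
      by rewrite ler_ndivrMr// ltr_ndivlMr// lerBrDr ltrBlDr mulrC h2 h1.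
    move: h1 h2; rewrite ler_ndivrMr// ltr_ndivlMr// lerBrDr ltrBlDr mulrC.
    by move=> -> ->.
  rewrite !lebesgue_measure_itv/= !lte_fin ltr_ndivrMr// -mulrA mulVf// mulr1 ltrD2r.
  case: ifPn => _; last by rewrite mule0.
  rewrite -!EFinB -EFinM ltr0_norm//; congr (_ %:E).
  by field.
- have -> : phi @^-1` `]u, v] = `](u - b) / a, (v - b) / a]%classic.
    apply/seteqP; split => t /=; rewrite !in_itv/= /phi => /andP[h1 h2].
      by rewrite ltr_pdivrMr// ler_pdivlMr// lerBrDr ltrBlDr mulrC h2 h1.
    move: h1 h2; rewrite ltr_pdivrMr// ler_pdivlMr// lerBrDr ltrBlDr mulrC.
    by move=> -> ->.
  rewrite !lebesgue_measure_itv/= !lte_fin ltr_pdivrMr// -mulrA mulVf// mulr1 ltrD2r.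
  case: ifPn => _; last by rewrite mule0.
  rewrite -!EFinB -EFinM gtr0_norm//; congr (_ %:E).
  by field.
Qed.

(** The pushforward of Lebesgue measure under the affine map, multiplied by |a|, agrees with
    Lebesgue measure on half-open intervals, hence on all measurable sets by uniqueness. *)
Lemma lebesgue_integral_affine (F : R -> \bar R) : measurable_fun setT F ->
  (forall x, (0 <= F x)%E) ->
  (\int[nu R]_t F (a * t + b)%R = `|a|^-1%:E * \int[nu R]_t F t)%E.
Proof.
move=> mF F0; change (\int[mu]_t F (a * t + b)%R = `|a|^-1%:E * \int[mu]_t F t)%E.
pose pm : {measure set (measurableTypeR R) -> \bar R} :=
  measure_function_pushforward__canonical__measure_function_Measure mu mphi.
pose m : {measure set (measurableTypeR R) -> \bar R} := mscale (NngNum na) pm.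
have mE (A : set (measurableTypeR R)) : measurable A -> mu A = m A.
  move=> mA; apply: lebesgue_measure_unique => // X [[u v] _ <-].
  by rewrite /m /= /mscale /= /pushforward (@preim u v).
transitivity (`|a|^-1%:E * \int[m]_t F t)%E; last first.
  congr (_ * _)%E; apply: eq_measure_integral => A mA _; exact/esym/mE.
rewrite ge0_integral_mscale//= muleA -EFinM mulVf ?normr_eq0// mul1e.
by rewrite ge0_integral_pushforward// => x _.
Qed.

End lebesgue_affine.

Lemma indic_bool T (R : realType) (b : T -> bool) x :
  \1_[set y | b y] x = (b x)%:R :> R.
Proof.
rewrite indicE; congr (nat_of_bool _)%:R.
by apply/idP/idP => [/set_mem//|h]; exact/mem_set.
Qed.

(** * The Euclidean norm *)

Section enorm.
Context {R : realType}.

Lemma enorm_ge0 d (x : 'rV[R]_d) : 0 <= enorm x.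
Proof. exact: sqrtr_ge0. Qed.

Lemma sqr_enorm d (x : 'rV[R]_d) : enorm x ^+ 2 = \sum_i x 0 i ^+ 2.
Proof. by rewrite sqr_sqrtr// sumr_ge0// => i _; rewrite sqr_ge0. Qed.

Lemma enorm0 d : enorm (0 : 'rV[R]_d) = 0.
Proof.
by rewrite /enorm big1 ?sqrtr0// => i _; rewrite mxE expr0n.
Qed.

Lemma enormZ d k (x : 'rV[R]_d) : enorm (k *: x) = `|k| * enorm x.
Proof.
rewrite /enorm -sqrtr_sqr -sqrtrM ?sqr_ge0// mulr_sumr.
by congr Num.sqrt; apply: eq_bigr => i _; rewrite mxE exprMn.
Qed.

Lemma enormN d (x : 'rV[R]_d) : enorm (- x) = enorm x.
Proof. by rewrite -scaleN1r enormZ normrN1 mul1r. Qed.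

Lemma enormBC d (x y : 'rV[R]_d) : enorm (x - y) = enorm (y - x).
Proof. by rewrite -enormN opprB. Qed.

Lemma coord_enorm d (x : 'rV[R]_d) i : `|x 0 i| <= enorm x.
Proof.
rewrite -sqrtr_sqr ler_wsqrtr// (bigD1 i)//= lerDl sumr_ge0// => j _.
exact: sqr_ge0.
Qed.

Lemma enorm_eq0 d (x : 'rV[R]_d) : (enorm x == 0) = (x == 0).
Proof.
apply/idP/idP => [/eqP x0|/eqP ->]; last by rewrite enorm0.
apply/eqP/rowP => i; rewrite mxE; apply/eqP; rewrite -normr_le0 -x0.
exact: coord_enorm.
Qed.

Lemma cauchy_schwarz_sum d (x y : 'rV[R]_d) :
  (\sum_i x 0 i * y 0 i) ^+ 2 <= (\sum_i x 0 i ^+ 2) * (\sum_i y 0 i ^+ 2).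
Proof.
set A := \sum_i x 0 i * y 0 i; set B := \sum_i y 0 i ^+ 2.
set C := \sum_i x 0 i ^+ 2.
have B0 : 0 <= B by rewrite sumr_ge0// => i _; rewrite sqr_ge0.
have [B0'|Bn0] := eqVneq B 0.
  have y0 i : y 0 i = 0.
    move/eqP: B0'; rewrite psumr_eq0; last by move=> j _; rewrite sqr_ge0.
    by move/allP/(_ i (mem_index_enum i)); rewrite /= sqrf_eq0 => /eqP.
  by rewrite /A big1 ?expr0n ?B0' ?mulr0// => i _; rewrite y0 mulr0.
(* Expanding this sum of squares gives B (C B - A^2), and B > 0 can be divided out. *)
have : 0 <= \sum_i (x 0 i * B - y 0 i * A) ^+ 2.
  by rewrite sumr_ge0// => i _; rewrite sqr_ge0.
have -> : \sum_i (x 0 i * B - y 0 i * A) ^+ 2 =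
    C * B ^+ 2 - A * B * A *+ 2 + B * A ^+ 2.
  rewrite (eq_bigr (fun i => x 0 i ^+ 2 * B ^+ 2 - x 0 i * y 0 i * (B * A *+ 2)
      + y 0 i ^+ 2 * A ^+ 2)); last by move=> i _; ring.
  rewrite big_split sumrB/= -!mulr_suml -/A -/B -/C; ring.
have -> : C * B ^+ 2 - A * B * A *+ 2 + B * A ^+ 2 = B * (C * B - A ^+ 2) by ring.
by rewrite pmulr_rge0 ?lt_neqAle ?B0 1?eq_sym ?Bn0// subr_ge0.
Qed.

Lemma ler_enormD d (x y : 'rV[R]_d) : enorm (x + y) <= enorm x + enorm y.
Proof.
rewrite -(@ler_pXn2r _ 2)// ?nnegrE ?addr_ge0 ?enorm_ge0//.
rewrite sqrrD !sqr_enorm.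
have -> : \sum_i (x + y) 0 i ^+ 2 =
   \sum_i x 0 i ^+ 2 + (\sum_i x 0 i * y 0 i) *+ 2 + \sum_i y 0 i ^+ 2.
  by rewrite -sumrMnl -!big_split/=; apply: eq_bigr => i _; rewrite mxE sqrrD.
rewrite lerD2r lerD2l lerMn2r/=.
rewrite (le_trans (ler_norm _))// -(@ler_pXn2r _ 2)// ?nnegrE ?mulr_ge0 ?enorm_ge0//.
by rewrite real_normK ?num_real// exprMn !sqr_enorm cauchy_schwarz_sum.
Qed.

Lemma ler_enormB d (x y z : 'rV[R]_d) : enorm (x - z) <= enorm (x - y) + enorm (y - z).
Proof. by rewrite (le_trans _ (ler_enormD _ _))// addrA subrK. Qed.

Lemma rV_joinB n (x y : 'rV[R]_n) (t u : R) :
  rV_join (x, t) - rV_join (y, u) = rV_join (x - y, t - u).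
Proof.
apply/rowP => i; case: (unliftP ord_max i) => [j ->|->];
by rewrite !mxE ?liftK ?unlift_none ?mxE.
Qed.

Lemma sqr_enorm_join n (x : 'rV[R]_n) (t : R) :
  enorm (rV_join (x, t)) ^+ 2 = enorm x ^+ 2 + t ^+ 2.
Proof.
rewrite !sqr_enorm (bigD1_ord ord_max)//= mxE unlift_none addrC; congr (_ + _).
by apply: eq_bigr => i _; rewrite mxE liftK.
Qed.

Lemma enorm_join_le n (x : 'rV[R]_n) (t : R) :
  enorm (rV_join (x, t)) <= enorm x + `|t|.
Proof.
rewrite -(@ler_pXn2r _ 2)// ?nnegrE ?addr_ge0 ?enorm_ge0// sqr_enorm_join.
rewrite sqrrD real_normK ?num_real// -addrA lerD2l lerDr mulrn_wge0//.
by rewrite mulr_ge0 ?enorm_ge0.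
Qed.

Lemma enorm_join_ge1 n (x : 'rV[R]_n) (t : R) : enorm x <= enorm (rV_join (x, t)).
Proof.
rewrite -(@ler_pXn2r _ 2)// ?nnegrE ?enorm_ge0// sqr_enorm_join lerDl.
exact: sqr_ge0.
Qed.

Lemma enorm_join_ge2 n (x : 'rV[R]_n) (t : R) : `|t| <= enorm (rV_join (x, t)).
Proof.
rewrite -(@ler_pXn2r _ 2)// ?nnegrE ?enorm_ge0// sqr_enorm_join.
by rewrite real_normK ?num_real// lerDr sqr_ge0.
Qed.

Lemma enorm_joinNr n (x : 'rV[R]_n) (t : R) :
  enorm (rV_join (x, - t)) = enorm (rV_join (x, t)).
Proof.
apply/eqP; rewrite -(@eqrXn2 _ 2) ?enorm_ge0//.
by rewrite !sqr_enorm_join sqrrN.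
Qed.

Lemma enorm_le_sum d (x : 'rV[R]_d) : enorm x <= \sum_i `|x 0 i|.
Proof.
elim: d x => [|d ih] x; first by rewrite big_ord0 /enorm big_ord0 sqrtr0.
rewrite -[x in enorm x]rV_splitK (le_trans (enorm_join_le _ _))//.
rewrite (bigD1_ord ord_max)//= [leRHS]addrC lerD2r (le_trans (ih _))//.
by rewrite le_eqVlt; apply/orP; left; apply/eqP/eq_bigr => i _; rewrite mxE.
Qed.

End enorm.

Section leb.
Context {R : realType}.
Local Open Scope ereal_scope.

Lemma int_leb n (F : 'rV[R]_n.+1 -> \bar R) : measurable_fun setT F ->
  (forall x, 0 <= F x) ->
  \int[leb R n.+1]_x F x = \int[leb R n]_x \int[nu R]_t F (rV_join (x, t)).
Proof.
move=> mF F0; rewrite /= /rV_prod -/(nu R).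
rewrite (@ge0_integral_pushforward _ _ _ _ _ _ (@measurable_rV_join R n))//.
rewrite preimage_setT.
rewrite -(@int_prod _ _ _ _ R (leb R n) (nu R) (fun x t => F (rV_join (x, t))))//.
by mf.
Qed.

(** Diagonal maps keep their form when the last coordinate is split off, which is what the induction
    on the dimension needs; the one-dimensional substitution then acts on the last variable. *)
Lemma leb_affine n (l c : 'rV[R]_n) (F : 'rV[R]_n -> \bar R) :
  measurable_fun setT F -> (forall x, 0 <= F x) ->
  (forall i, l 0%R i != 0%R) ->
  \int[leb R n]_x F (\row_i (l 0 i * x 0 i + c 0 i))%R =
  (`|\prod_i l 0 i|^-1)%:E * \int[leb R n]_x F x.
Proof.
elim: n l c F => [|n ih] l c F mF F0 l0.
  rewrite big_ord0 normr1 invr1 mul1e; apply: eq_integral => x _; congr F.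
  by apply/rowP => -[].
have mG : measurable_fun setT (fun x : 'rV[R]_n.+1 => F (\row_i (l 0 i * x 0 i + c 0 i))%R).
  mf; apply: measurable_fun_rV => i.
  rewrite (_ : (fun _ => _) = (fun x : 'rV[R]_n.+1 => l 0 i * x 0 i + c 0 i)%R); first by mf.
  by apply/funext => x; rewrite mxE.
rewrite (int_leb mF F0) (int_leb mG)//.
pose lt := rV_tail l; pose ct := rV_tail c.
pose G (x : 'rV[R]_n) (t : R) := F (rV_join (x, t)).
have rowE (x : 'rV[R]_n) (t : R) : F (\row_i (l 0 i * rV_join (x, t) 0 i + c 0 i))%R =
    G (\row_i (lt 0 i * x 0 i + ct 0 i))%R (l 0 ord_max * t + c 0 ord_max)%R.
  rewrite /G; congr F; apply/rowP => i; rewrite !mxE /= /lt /ct.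
  by case: unliftP => [j ->|->] //; rewrite !mxE.
have mG2 x : measurable_fun setT (G x) by rewrite /G; mf.
have G0 x t : 0 <= G x t by exact: F0.
under eq_integral => x _.
  under eq_integral => t _ do rewrite rowE.
  over.
rewrite -[X in _ = _ * X]/(\int[leb R n]_x \int[nu R]_t G x t).
have {}mG : measurable_fun setT (fun z : 'rV[R]_n * measurableTypeR R => G z.1 z.2).
  by rewrite /G; mf.
move: G {rowE} mG2 mG G0 => {mF F0 F} G mG2 mG G0.
under eq_integral => x _.
  rewrite (lebesgue_integral_affine _ (l0 ord_max) (mG2 _) (G0 _)); over.
rewrite /= intZ//; last by nneg.
rewrite (ih lt ct (fun x => \int[nu R]_t G x t)); last 3 first.
  mf.
  nneg.
  by move=> i; rewrite /lt mxE.
rewrite muleA -EFinM; congr (_%:E * _).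
rewrite (bigD1_ord ord_max)//= normrM invfM; congr (_ * `| _ |^-1)%R.
by apply: eq_bigr => i _; rewrite mxE.
Qed.

Lemma leb_scale n (k : R) (c : 'rV[R]_n) (F : 'rV[R]_n -> \bar R) :
  measurable_fun setT F -> (forall x, 0 <= F x) -> k != 0%R ->
  \int[leb R n]_x F (k *: x + c)%R = (`|k| ^- n)%:E * \int[leb R n]_x F x.
Proof.
move=> mF F0 k0.
have := @leb_affine n (const_mx k) c F mF F0.
rewrite (_ : \prod_i _ = k ^+ n)%R; last first.
  by under eq_bigr do rewrite mxE; rewrite prodr_const card_ord.
rewrite normrX => <-; last by move=> i; rewrite mxE.
by apply: eq_integral => x _; congr F; apply/rowP => i; rewrite !mxE.
Qed.

Lemma leb_shift n (c : 'rV[R]_n) (F : 'rV[R]_n -> \bar R) :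
  measurable_fun setT F -> (forall x, 0 <= F x) ->
  \int[leb R n]_x F (x + c)%R = \int[leb R n]_x F x.
Proof.
move=> mF F0; have := @leb_scale n 1 c F mF F0 (oner_neq0 _).
rewrite normr1 expr1n invr1 mul1e => <-.
by apply: eq_integral => x _; rewrite scale1r.
Qed.

Lemma leb_cube n (r : R) : (0 <= r)%R ->
  \int[leb R n]_x (\prod_i (`|x 0 i| < r)%R%:R)%:E = ((r *+ 2) ^+ n)%:E.
Proof.
move=> r0; have mP m : measurable_fun setT (fun x : 'rV[R]_m => (\prod_i (`|x 0 i| < r)%R%:R : R)%R).
  by apply: measurable_prod => i _; mf.
elim: n => [|n ih].
  rewrite /= integral_dirac//; last by apply/measurable_EFinP; exact: mP.
  by rewrite diracT mul1e big_ord0 expr0.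
rewrite int_leb//; last 2 first.
- by apply/measurable_EFinP; exact: mP.
- by move=> x; rewrite lee_fin prodr_ge0.
transitivity (\int[leb R n]_x ((\prod_(i < n) (`|x 0 i| < r)%R%:R)%:E *
    \int[nu R]_t (`|t| < r)%R%:R%:E)).
  apply: eq_integral => x _; rewrite -intZ//; last by apply: prodr_ge0.
  apply: eq_integral => t _; rewrite (bigD1_ord ord_max)//= mxE unlift_none.
  rewrite (eq_bigr (fun i => (`|x 0 i| < r)%R%:R)%R) 1?EFinM 1?muleC//.
  by move=> i _; rewrite mxE liftK.
have E1 : \int[nu R]_x (`|x| < r)%R%:R%:E = (r *+ 2)%:E.
  rewrite -[RHS](@lebesgue_measure_ball R 0)// /nu -[ball _ _]setIT -integral_indic//; last exact: measurable_ball.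
  rewrite -[ball _ _]/[set y | (`|0 - y| < r)%R].
  by apply: eq_integral => t _; rewrite indic_bool sub0r normrN.
rewrite /= E1 intZr//; last 2 first.
- by rewrite mulrn_wge0.
- by move=> x; rewrite lee_fin; exact: prodr_ge0.
by rewrite ih -EFinM -exprSr.
Qed.

(** The unit ball lies between two cubes, so its volume [om] is positive and finite; scaling and
    translation give all other balls. The inner cube has half-side 1 / (n + 1), so that the sum of
    the coordinates stays strictly below 1, in dimension 0 as well. *)
Lemma enorm_ball_bounds n : exists2 om : R, (0 < om)%R &
  forall (a : 'rV[R]_n) (r : R), (0 < r)%R ->
  \int[leb R n]_x (enorm (x - a) < r)%R%:R%:E = (om * r ^+ n)%:E.
Proof.
have mI : measurable_fun setT (fun x : 'rV[R]_n => (enorm x < 1)%R%:R%:E : \bar R) by mf.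
have I0 (x : 'rV[R]_n) : 0 <= ((enorm x < 1)%R%:R%:E : \bar R) by [].
have ub : \int[leb R n]_x (enorm x < 1)%R%:R%:E <= ((1 *+ 2) ^+ n)%:E :> \bar R.
  rewrite -leb_cube//; apply: le_int => // x; rewrite lee_fin.
  case: ltP => [x1|_]; last exact: prodr_ge0.
  rewrite big1// => i _; rewrite (le_lt_trans (coord_enorm _ _))//.
have lb : ((n.+1%:R^-1 *+ 2) ^+ n)%:E <= \int[leb R n]_x (enorm x < 1)%R%:R%:E :> \bar R.
  rewrite -leb_cube ?invr_ge0//; apply: le_int => x; rewrite lee_fin; first exact: prodr_ge0.
  have [x1|x1] := boolP [forall i, `|x 0%R i| < n.+1%:R^-1]%R; last first.
    move: x1; rewrite negb_forall => /existsP[i /negbTE xi].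
    by rewrite (bigD1 i)//= xi mul0r.
  move/forallP : x1 => x1; rewrite big1; last by move=> i _; rewrite x1.
  suff -> : (enorm x < 1)%R by [].
  rewrite (le_lt_trans (enorm_le_sum _))//.
  rewrite (@le_lt_trans _ _ (\sum_(i < n) n.+1%:R^-1)%R)//.
    by apply: ler_sum => i _; exact: ltW.
  by rewrite sumr_const card_ord -[ltLHS]mulr_natl ltr_pdivrMr// mul1r ltr_nat.
pose om := fine (\int[leb R n]_x (enorm x < 1)%R%:R%:E : \bar R).
have omE : \int[leb R n]_x (enorm x < 1)%R%:R%:E = om%:E :> \bar R.
  by rewrite fineK// ge0_fin_numE ?(le_lt_trans ub) ?ltry// (le_trans _ lb)// lee_fin exprn_ge0// mulrn_wge0// invr_ge0.
exists om.
  by rewrite -lte_fin -omE (lt_le_trans _ lb)// lte_fin exprn_gt0// pmulrn_lgt0 ?invr_gt0.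
move=> a r r0; have ri0 : (r^-1 != 0)%R by rewrite invr_eq0 gt_eqF.
have := @leb_scale n r^-1 (- (r^-1 *: a))%R _ mI I0 ri0.
rewrite omE gtr0_norm ?invr_gt0// -exprVn invrK -EFinM mulrC => <-.
apply: eq_integral => x _; rewrite -scalerBr enormZ gtr0_norm ?invr_gt0//.
by rewrite ltr_pdivrMl// mulr1.
Qed.

End leb.

(** * Radial integrals *)

Section powR_ineq.
Context {R : realType}.
Implicit Types a b c e p x y z : R.

Lemma powR_le a b p : 0 <= p -> 0 <= a -> a <= b -> a `^ p <= b `^ p.
Proof.
by move=> p0 a0 ab; apply: ge0_ler_powR; rewrite ?nnegrE// (le_trans a0).
Qed.

Lemma powR_leN a b p : 0 <= p -> 0 < a -> a <= b -> b `^ (- p) <= a `^ (- p).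
Proof.
move=> p0 a0 ab; rewrite !powRN lef_pV2 ?posrE ?powR_gt0 ?(lt_le_trans a0)//.
by apply: powR_le => //; exact: ltW.
Qed.

Lemma powRXn a b k : 0 <= a -> (a ^+ k) `^ b = (a `^ b) ^+ k.
Proof.
by move=> a0; rewrite -powR_mulrn// -powRrM mulrC powRrM powR_mulrn// powR_ge0.
Qed.

Lemma gt1_powR2 p : 0 < p -> 1 < 2 `^ p.
Proof.
move=> p0; have {1}<- : 1 `^ p = 1 :> R by rewrite powR1.
by rewrite gt0_ltr_powR ?nnegrE// ltr1n.
Qed.

Lemma powR_normD2 x y p : 0 <= p ->
  `|x + y| `^ p <= 2 `^ p * (`|x| `^ p + `|y| `^ p).
Proof.
move=> p0; have H (u v : R) : `|u| <= `|v| ->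
    `|u + v| `^ p <= 2 `^ p * (`|u| `^ p + `|v| `^ p).
  move=> uv; rewrite (@le_trans _ _ ((2 * `|v|) `^ p))//.
    apply: powR_le => //; rewrite (le_trans (ler_normD _ _))// mulr_natl mulr2n.
    by rewrite lerD2r.
  by rewrite powRM// ler_wpM2l ?powR_ge0// lerDr powR_ge0.
have [xy|/ltW yx] := leP `|x| `|y|; first exact: H.
by rewrite addrC [X in _ * X]addrC; exact: H.
Qed.

Lemma powR_normD3 x y z p : 0 <= p ->
  `|x + y + z| `^ p <= 4 `^ p * (`|x| `^ p + `|y| `^ p + `|z| `^ p).
Proof.
move=> p0; rewrite (le_trans (powR_normD2 _ _ p0))//.
have -> : 4 = 2 * 2 :> R by ring.
rewrite powRM// -mulrA ler_wpM2l ?powR_ge0// mulrDr lerD//.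
  exact: powR_normD2.
rewrite -[leLHS]mul1r ler_wpM2r ?powR_ge0//.
by have := @powR_le 1 2 p p0 ler01 (ler1n _ 2%N); rewrite powR1.
Qed.

Lemma powR_normB_split2 x y z p : 0 <= p ->
  `|x - z| `^ p <= 2 `^ p * (`|x - y| `^ p + `|y - z| `^ p).
Proof.
move=> p0; rewrite (_ : x - z = (x - y) + (y - z)); last by ring.
exact: powR_normD2.
Qed.

(** Either |y| <= e |x| or |x| <= |y| / e, and in each case one term suffices. The point is that the
    factor of |x|^p can be made as close to 1 as desired at the expense of the other: the Hardy
    iteration contracts because of this. *)
Lemma powR_normD_small e x y p : 0 <= p -> 0 < e ->
  `|x + y| `^ p <= (1 + e) `^ p * `|x| `^ p + (1 + e^-1) `^ p * `|y| `^ p.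
Proof.
move=> p0 e0; have e1 : 0 <= 1 + e by rewrite addr_ge0// ltW.
have e2 : 0 <= 1 + e^-1 by rewrite addr_ge0// invr_ge0 ltW.
have [yx|/ltW xy] := leP `|y| (e * `|x|).
  rewrite -powRM// ler_wpDr ?mulr_ge0 ?powR_ge0//; apply: powR_le => //.
  by rewrite (le_trans (ler_normD _ _))// mulrDl mul1r lerD2l.
rewrite -[(1 + e^-1) `^ p * _]powRM ?normr_ge0// ler_wpDl ?mulr_ge0 ?powR_ge0//; apply: powR_le => //.
by rewrite (le_trans (ler_normD _ _))// mulrDl mul1r addrC lerD2l ler_pdivlMl.
Qed.

Lemma exists_pow2 (y : R) : 1 <= y -> exists k, 2 ^+ k <= y < 2 ^+ k.+1.
Proof.
move=> y1; have ex : exists m, y < 2 ^+ m.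
  exists (Num.bound y); rewrite (lt_le_trans (archi_boundP _))//.
    by rewrite (le_trans _ y1).
  by rewrite -natrX ler_nat ltnW// ltn_expl.
case: (ex_minnP ex) => -[|m] ym mmin.
  by move: ym; rewrite expr0 ltNge y1.
exists m; rewrite ym andbT leNgt; apply/negP => /mmin.
by rewrite ltnn.
Qed.

End powR_ineq.

Section geometric.
Context {R : realType}.
Local Open Scope ereal_scope.

Lemma nneseries_le (f : nat -> \bar R) (M : \bar R) : (forall k, 0 <= f k) ->
  (forall m, \sum_(0 <= k < m) f k <= M) -> \sum_(k <oo) f k <= M.
Proof.
move=> f0 fM; apply: lime_le; first by apply: is_cvg_nneseries => k _ _; exact: f0.
by apply: nearW => m; exact: fM.
Qed.

Lemma geometric_sum_le (a q : R) m : (0 <= a)%R -> (0 <= q < 1)%R ->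
  (\sum_(0 <= k < m) a * q ^+ k <= a / (1 - q))%R.
Proof.
move=> a0 /andP[q0 q1]; rewrite -mulr_sumr ler_wpM2l//.
have q1' : (0 < 1 - q)%R by rewrite subr_gt0.
rewrite big_mkord -[leRHS]mul1r ler_pdivlMr// mulrC.
by rewrite -opprB mulNr -subrX1 opprB gerBl exprn_ge0.
Qed.

Lemma nneseries_geometric_le (f : nat -> \bar R) (a q : R) :
  (0 <= a)%R -> (0 <= q < 1)%R -> (forall k, 0 <= f k) ->
  (forall k, f k <= (a * q ^+ k)%:E) -> \sum_(k <oo) f k <= (a / (1 - q))%:E.
Proof.
move=> a0 q01 f0 fq; apply: nneseries_le => // m.
rewrite (@le_trans _ _ (\sum_(0 <= k < m) (a * q ^+ k)%:E))//.
  exact: lee_sum.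
by rewrite sumEFin lee_fin geometric_sum_le.
Qed.

End geometric.

Section radial.
Context d (T : measurableType d) (R : realType) (mu : {measure set T -> \bar R}).
Variables (rho : T -> R) (c D : R).
Hypothesis mrho : measurable_fun setT rho.
Hypothesis c0 : 0 <= c.
Hypothesis D0 : 0 <= D.
Hypothesis volb : forall r, 0 < r ->
  (\int[mu]_x (rho x < r)%R%:R%:E <= (c * r `^ D)%:E)%E.

(** At each point [F] is below one member of a countable family of multiples of ball indicators,
    hence below their sum, whose integrals form a geometric series. *)
Lemma int_dyadic (F : T -> R) (r b : nat -> R) (a q : R) :
  (forall x, 0 <= F x) -> (forall k, 0 < r k) -> (forall k, 0 <= b k) ->
  (forall x, exists k, F x <= b k * (rho x < r k)%R%:R) ->
  0 <= a -> 0 <= q < 1 -> (forall k, b k * (c * r k `^ D) <= a * q ^+ k) ->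
  (\int[mu]_x (F x)%:E <= (a / (1 - q))%:E)%E.
Proof.
move=> F0 r0 b0 Fb a0 q01 bq.
pose f k x := (b k * (rho x < r k)%R%:R)%:E.
have f0 k x : (0 <= f k x)%E by rewrite lee_fin mulr_ge0.
apply: (@le_trans _ _ (\int[mu]_x \sum_(k <oo) f k x)%E).
  apply: le_int => [x|x]; first by rewrite lee_fin.
  have [k Fk] := Fb x; apply: (@le_trans _ _ (f k x)); first by rewrite lee_fin.
  apply: le_trans (@nneseries_lim_ge R (fun k => f k x) xpredT 0 k.+1 _); last by move=> *; exact: f0.
  by rewrite big_nat_recr//= leeDr// sume_ge0.
rewrite integral_nneseries//; last first.
  by move=> k; rewrite /f; mf.
apply: nneseries_geometric_le => //.
  by move=> k; exact: integral_ge0.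
move=> k; rewrite /f; under eq_integral do rewrite EFinM.
rewrite intZ//; apply: (@le_trans _ _ ((b k)%:E * (c * r k `^ D)%:E)%E).
  by apply: lee_wpmul2l; [rewrite lee_fin|exact: volb].
by rewrite -EFinM lee_fin.
Qed.

(** On the ring 2^k r <= rho < 2^(k+1) r the integrand is at most (2^k r)^(-(D+al)), while the
    volume is of order (2^k r)^D; the ratio of the resulting series is 2^(-al). *)
Lemma int_radial_out (al : R) : 0 < al -> exists2 C : R, 0 <= C &
  forall r, 0 < r ->
  (\int[mu]_x ((r <= rho x)%R%:R * rho x `^ (- (D + al)))%:E <= (C * r `^ (- al))%:E)%E.
Proof.
move=> al0; set q := 2 `^ (- al).
have q01 : 0 <= q < 1.
  rewrite powR_ge0/= /q powRN invf_lt1 ?powR_gt0//.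
  exact: gt1_powR2.
exists (c * 2 `^ D / (1 - q)).
  by rewrite divr_ge0 ?mulr_ge0 ?powR_ge0// subr_ge0 ltW//; case/andP: q01.
move=> r r0.
have E k : (2 ^+ k * r) `^ (- (D + al)) * (c * (2 ^+ k.+1 * r) `^ D) =
    (c * 2 `^ D * r `^ (- al)) * q ^+ k.
  have r0' := ltW r0; have k0 m : 0 <= 2 ^+ m :> R by rewrite exprn_ge0.
  rewrite exprS -mulrA !powRM ?mulr_ge0//.
  have H (z : R) : 0 < z -> z `^ (- (D + al)) * z `^ D = z `^ (- al).
    move=> z0; rewrite -powRD; last by rewrite (gt_eqF z0) implybT.
    by rewrite opprD addrAC addNr add0r.
  rewrite (_ : _ * _ = c * 2 `^ D * (r `^ (- (D + al)) * r `^ D) *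
     ((2 ^+ k) `^ (- (D + al)) * (2 ^+ k) `^ D)); last by ring.
  by rewrite !H ?exprn_gt0// powRXn.
have -> : c * 2 `^ D / (1 - q) * r `^ (- al) = c * 2 `^ D * r `^ (- al) / (1 - q) by ring.
apply: (int_dyadic (r := fun k => 2 ^+ k.+1 * r) (b := fun k => (2 ^+ k * r) `^ (- (D + al)))) => //.
- by move=> x; rewrite mulr_ge0// powR_ge0.
- by move=> k; rewrite mulr_gt0// exprn_gt0.
- by move=> k; rewrite powR_ge0.
- move=> x; have [rx|rx] := leP r (rho x); last first.
    by exists 0%N; rewrite mul0r mulr_ge0// powR_ge0.
  have [k /andP[k1 k2]] := @exists_pow2 _ (rho x / r) ltac:(by rewrite ler_pdivlMr// mul1r).
  exists k; rewrite -ltr_pdivrMr// k2 mulr1 mul1r.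
  apply: powR_leN; rewrite ?addr_ge0 ?mulr_gt0 ?exprn_gt0//; first exact: ltW.
  by rewrite -ler_pdivlMr.
- by rewrite !mulr_ge0// powR_ge0.
- by move=> k; rewrite E.
Qed.

(** Same rings, shrinking towards rho = 0. Since the sign of al - D is not known, rho^al is bounded
    at the outer radius and rho^(-D) at the inner one. *)
Lemma int_radial_in (al : R) : 0 < al -> exists2 C : R, 0 <= C &
  forall r, 0 < r ->
  (\int[mu]_x ((0 < rho x < r)%R%:R * rho x `^ (al - D))%:E <= (C * r `^ al)%:E)%E.
Proof.
move=> al0; set q := 2 `^ (- al).
have q01 : 0 <= q < 1.
  rewrite powR_ge0/= /q powRN invf_lt1 ?powR_gt0//.
  exact: gt1_powR2.
exists (c * 4 `^ D / (1 - q)).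
  by rewrite divr_ge0 ?mulr_ge0 ?powR_ge0// subr_ge0 ltW//; case/andP: q01.
move=> r r0; have r0' := ltW r0.
have k0 m : 0 <= 2 ^+ m :> R by rewrite exprn_ge0.
pose b k := (2 ^- k * r) `^ al * (2 ^- k.+1 * r) `^ (- D).
have E k : b k * (c * (2 * 2 ^- k * r) `^ D) = (c * 4 `^ D * r `^ al) * q ^+ k.
  have -> : 2 * 2 ^- k * r = 4 * (2 ^- k.+1 * r).
    by rewrite exprS invfM; field; rewrite expf_neq0.
  have z0 : 0 < 2 ^- k.+1 * r by rewrite mulr_gt0// invr_gt0 exprn_gt0.
  rewrite /b [(4 * _) `^ D]powRM ?(ltW z0)//.
  have H : (2 ^- k.+1 * r) `^ (- D) * (2 ^- k.+1 * r) `^ D = 1.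
    by rewrite powRN mulVf// gt_eqF// powR_gt0.
  rewrite -[_ `^ al * _ * _]mulrA [X in _ * X](_ : _ = c * 4 `^ D *
    ((2 ^- k.+1 * r) `^ (- D) * (2 ^- k.+1 * r) `^ D)); last by ring.
  rewrite H mulr1 powRM ?invr_ge0//.
  have -> : (2 ^- k) `^ al = q ^+ k.
    by rewrite -powR_inv1// -powRrM mulN1r powRXn.
  by ring.
have -> : c * 4 `^ D / (1 - q) * r `^ al = c * 4 `^ D * r `^ al / (1 - q) by ring.
(* The radii are doubled because rho <= 2^-k r is not strict, whereas the ball indicators are. *)
apply: (int_dyadic (r := fun k => 2 * 2 ^- k * r) (b := b)) => //.
- by move=> x; rewrite mulr_ge0// powR_ge0.
- by move=> k; rewrite !mulr_gt0// invr_gt0 exprn_gt0.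
- by move=> k; rewrite mulr_ge0 ?powR_ge0.
- move=> x; have [/andP[x0 xr]|_] := boolP (0 < rho x < r); last first.
    by exists 0%N; rewrite mul0r !mulr_ge0// powR_ge0.
  have [k /andP[k1 k2]] := @exists_pow2 _ (r / rho x) ltac:(by rewrite ler_pdivlMr// mul1r ltW).
  have h1 : rho x <= 2 ^- k * r.
    by rewrite mulrC ler_pdivlMr ?exprn_gt0// mulrC -ler_pdivlMr.
  have h2 : 2 ^- k.+1 * r <= rho x.
    by rewrite mulrC ler_pdivrMr ?exprn_gt0// mulrC -ler_pdivrMr// ltW.
  exists k; have -> : rho x < 2 * 2 ^- k * r.
    rewrite -mulrA (le_lt_trans h1)// ltr_pMl ?ltr1n//.
    by rewrite mulr_gt0// invr_gt0 exprn_gt0.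
  rewrite mulr1 mul1r powRD; last by rewrite (gt_eqF x0) implybT.
  apply: ler_pM; rewrite ?powR_ge0//.
    by apply: powR_le => //; exact: ltW.
  by apply: powR_leN => //; rewrite mulr_gt0// invr_gt0 exprn_gt0.
- by rewrite !mulr_ge0// powR_ge0.
- by move=> k; rewrite E.
Qed.

End radial.

Section tail_last.
Context {R : realType} {n : nat}.
Implicit Types a b : 'rV[R]_n.+1.

Lemma rV_tailB a b : rV_tail (a - b) = rV_tail a - rV_tail b.
Proof. by apply/rowP => i; rewrite !mxE. Qed.

Lemma rV_lastB a b : rV_last (a - b) = (rV_last a : R) - (rV_last b : R).
Proof. by rewrite /rV_last !mxE. Qed.

Lemma rV_joinE a : rV_join (rV_tail a, rV_last a) = a.
Proof. exact: rV_splitK. Qed.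

Lemma rV_tail_join (x : 'rV[R]_n) (t : R) : rV_tail (rV_join (x, t)) = x.
Proof. by apply/rowP => j; rewrite !mxE /= liftK. Qed.

Lemma rV_last_join (x : 'rV[R]_n) (t : R) : rV_last (rV_join (x, t)) = t.
Proof. by rewrite /rV_last mxE unlift_none. Qed.

Lemma enorm_tail a : enorm (rV_tail a) <= enorm a.
Proof. by rewrite -[in leRHS](rV_joinE a) enorm_join_ge1. Qed.

Lemma abs_last a : `|rV_last a : R| <= enorm a.
Proof. by rewrite -[in leRHS](rV_joinE a) enorm_join_ge2. Qed.

Lemma enorm_tail_last a : enorm a <= enorm (rV_tail a) + `|rV_last a : R|.
Proof. by rewrite -[in leLHS](rV_joinE a) enorm_join_le. Qed.

Lemma enorm_tailB a b : enorm (rV_tail a - rV_tail b) <= enorm (a - b).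
Proof. by rewrite -rV_tailB enorm_tail. Qed.

Lemma abs_lastB a b : `|(rV_last a : R) - (rV_last b : R)| <= enorm (a - b).
Proof. by rewrite -rV_lastB abs_last. Qed.

Lemma enorm_split a b : enorm (a - b) <=
  enorm (rV_tail a - rV_tail b) + `|(rV_last a : R) - (rV_last b : R)|.
Proof. by rewrite -rV_tailB -rV_lastB enorm_tail_last. Qed.

Lemma measurable_tail d (T : measurableType d) (f : T -> 'rV[R]_n.+1) :
  measurable_fun setT f -> measurable_fun setT (fun x => rV_tail (f x)).
Proof.
move=> mf; apply: measurable_fun_rV => i.
rewrite (_ : (fun _ => _) = (fun x => f x 0 (lift ord_max i))); first by mf.
by apply/funext => x; rewrite mxE.
Qed.

Lemma measurable_last d (T : measurableType d) (f : T -> 'rV[R]_n.+1) :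
  measurable_fun setT f -> measurable_fun setT (fun x => rV_last (f x) : R).
Proof. by move=> mf; rewrite /rV_last; mf. Qed.

End tail_last.

Ltac mfstep2 :=
  match goal with
  | |- measurable_fun _ (fun x => rV_tail _) => apply: measurable_tail
  | |- measurable_fun _ (fun x => rV_last _) => apply: measurable_last
  | _ => mfstep
  end.
Ltac mf ::= cbv beta; repeat (mfstep2; cbv beta).

Section restrict.
Context d (T : measurableType d) (R : realType) (mu : {measure set T -> \bar R}).

Lemma int_restrict (b : T -> bool) (A : set T) (F : T -> \bar R) :
  (forall x, A x <-> b x) ->
  (\int[mu]_(x in A) F x = \int[mu]_x ((b x)%:R%:E * F x))%E.
Proof.
move=> Ab; rewrite integral_mkcond; apply: eq_integral => x _.
rewrite patchE; have [/set_mem /Ab ->|nA] := boolP (x \in A); first by rewrite mul1e.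
case: (boolP (b x)) => bx; last by rewrite mul0e.
by move/negP: nA; case; apply/mem_set/Ab.
Qed.

Lemma int_restrictE (b : T -> bool) (A : set T) (F : T -> R) :
  (forall x, A x <-> b x) ->
  (\int[mu]_(x in A) (F x)%:E = \int[mu]_x ((b x)%:R * F x)%:E)%E.
Proof. by move=> /int_restrict ->; under eq_integral do rewrite -EFinM. Qed.

End restrict.

Section radial_leb.
Context {R : realType}.
Local Open Scope ereal_scope.

Lemma leb_radial_out n (al : R) : (0 < al)%R -> exists2 C : R, (0 <= C)%R &
  forall (a : 'rV[R]_n) r, (0 < r)%R ->
  \int[leb R n]_x ((r <= enorm (x - a))%R%:R * enorm (x - a) `^ (- (n%:R + al)))%:E
    <= (C * r `^ (- al))%:E.
Proof.
move=> al0; have [om om0 vol] := @enorm_ball_bounds R n.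
have vol0 r : (0 < r)%R -> \int[leb R n]_x (enorm x < r)%R%:R%:E <= (om * r `^ n%:R)%:E.
  move=> r0; have := vol 0%R r r0; under eq_integral do rewrite subr0.
  by rewrite (powR_mulrn _ (ltW r0)) => ->.
have me : measurable_fun setT (enorm : 'rV[R]_n -> R) by mf.
have [C C0 HC] := int_radial_out me (ltW om0) (ler0n _ n) vol0 al0.
exists C; first exact: C0.
move=> a r r0; apply: (le_trans _ (HC r r0)).
pose F (x : 'rV[R]_n) := ((r <= enorm x)%R%:R * enorm x `^ (- (n%:R + al)))%:E.
have mF : measurable_fun setT F by rewrite /F; mf.
have F0 x : 0 <= F x by rewrite /F; nneg.
rewrite -[leRHS](leb_shift (- a)%R mF F0); exact: lexx.
Qed.

Lemma leb_radial_in n (al : R) : (0 < al)%R -> exists2 C : R, (0 <= C)%R &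
  forall (a : 'rV[R]_n) r, (0 < r)%R ->
  \int[leb R n]_x ((0 < enorm (x - a) < r)%R%:R * enorm (x - a) `^ (al - n%:R))%:E
    <= (C * r `^ al)%:E.
Proof.
move=> al0; have [om om0 vol] := @enorm_ball_bounds R n.
have vol0 r : (0 < r)%R -> \int[leb R n]_x (enorm x < r)%R%:R%:E <= (om * r `^ n%:R)%:E.
  move=> r0; have := vol 0%R r r0; under eq_integral do rewrite subr0.
  by rewrite (powR_mulrn _ (ltW r0)) => ->.
have me : measurable_fun setT (enorm : 'rV[R]_n -> R) by mf.
have [C C0 HC] := int_radial_in me (ltW om0) (ler0n _ n) vol0 al0.
exists C; first exact: C0.
move=> a r r0; apply: (le_trans _ (HC r r0)).
pose F (x : 'rV[R]_n) := ((0 < enorm x < r)%R%:R * enorm x `^ (al - n%:R))%:E.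
have mF : measurable_fun setT F by rewrite /F; mf.
have F0 x : 0 <= F x by rewrite /F; nneg.
rewrite -[leRHS](leb_shift (- a)%R mF F0); exact: lexx.
Qed.

Lemma nu_interval (a b : R) : (a <= b)%R ->
  \int[nu R]_t (a < t < b)%R%:R%:E = (b - a)%:E.
Proof.
move=> ab.
transitivity (\int[nu R]_t (\1_([set t : R | (a < t < b)%R]) t)%:E).
  by apply: eq_integral => t _; rewrite indic_bool.
have -> : [set t : R | (a < t < b)%R] = `]a, b[%classic.
  by apply/seteqP; split => t /=; rewrite in_itv.
rewrite integral_indic// setIT -[LHS]/(@lebesgue_measure R `]a, b[%classic) lebesgue_measure_itv/= lte_fin.
by case: ltgtP ab => // -> _; rewrite subrr.
Qed.

Lemma nu_radial_out (al : R) : (0 < al)%R -> exists2 C : R, (0 <= C)%R &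
  forall r, (0 < r)%R ->
  \int[nu R]_t ((r <= t)%R%:R * t `^ (- (1 + al)))%:E <= (C * r `^ (- al))%:E.
Proof.
move=> al0.
have vol0 (r : R) : (0 < r)%R -> \int[nu R]_t (`|t| < r)%R%:R%:E <= (2 * r `^ 1)%:E.
  move=> r0; rewrite (powRr1 (ltW r0)) (eq_integral (fun t : measurableTypeR R => (- r < (t : R) < r)%R%:R%:E)); last first.
    by move=> t _; rewrite ltr_norml.
  by rewrite nu_interval ?opprK ?mulr_natl ?mulr2n// ge0_cp// ltW.
have me : measurable_fun setT (fun t : measurableTypeR R => `|t : R|%R) by mf.
have [C C0 HC] := int_radial_out me (ler0n _ 2) ler01 vol0 al0.
exists C; first exact: C0.
move=> r r0; apply: (le_trans _ (HC r r0)); apply: le_int; first by nneg.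
move=> t; rewrite lee_fin; have [rt|rt] := leP r t; last by rewrite mul0r mulr_ge0// powR_ge0.
by rewrite ger0_norm ?rt// (le_trans _ rt)// ltW.
Qed.

End radial_leb.

Lemma cvg_powR_norm (R : realType) (u : nat -> R) (l p : R) : 0 < p ->
  u @ \oo --> l -> (fun k => `|u k| `^ p) @ \oo --> `|l| `^ p.
Proof.
(* The limit 0 is treated apart; elsewhere continuity follows from differentiability of the power on
   ]0, +oo[. *)
move=> p0 ul; have [l0|l0] := eqVneq l 0.
  rewrite l0 normr0 powR0 ?gt_eqF//; apply/cvgrPdist_lt => e e0.
  have e1 : 0 < e `^ p^-1 by rewrite powR_gt0.
  move: ul; rewrite l0 => /cvgrPdist_lt /(_ _ e1); apply: filterS => k.
  rewrite !sub0r !normrN => uk; rewrite ger0_norm ?powR_ge0//.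
  have -> : e = (e `^ p^-1) `^ p by rewrite -powRrM mulVf ?gt_eqF// powRr1 ?ltW.
  by apply: gt0_ltr_powR => //; rewrite nnegrE ?powR_ge0.
have nl0 : 0 < `|l| by rewrite normr_gt0.
have cp : {for `|l|, continuous (@powR R ^~ p)}.
  apply/differentiable_continuous; rewrite -derivable1_diffP.
  by apply: derivable_powR; rewrite in_itv/= nl0.
exact: (cvg_comp _ _ (cvg_norm ul) cp).
Qed.

Lemma limn_einf_le_cst (R : realType) (a : nat -> \bar R) (c : \bar R) :
  (forall k, (a k <= c)%E) -> (limn_einf a <= c)%E.
Proof.
move=> ac; rewrite limn_einf_lim; apply: lime_le; first exact: is_cvg_einfs.
apply: nearW => k; apply: (le_trans _ (ac k)).
by apply: ereal_inf_lbound; exists k => /=.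
Qed.

Section scale1.
Context {R : realType}.
Local Open Scope ereal_scope.

Lemma nu_scale (a : R) (F : R -> \bar R) : (0 < a)%R -> measurable_fun setT F ->
  (forall x, 0 <= F x) -> \int[nu R]_t F (a * t)%R = a^-1%:E * \int[nu R]_t F t.
Proof.
move=> a0 mF F0; have an0 : (a != 0)%R by rewrite gt_eqF.
have := @lebesgue_integral_affine R a 0 an0 F mF F0.
rewrite (gtr0_norm a0) => <-.
by apply: eq_integral => t _; rewrite addr0.
Qed.

End scale1.

(** * A Hardy inequality for differences *)

Section hardy_difference.
Context {R : realType}.
Variables (p m L : R).
Hypotheses (p0 : 0 < p) (m1 : 1 < m) (L0 : 0 < L).
Local Open Scope ereal_scope.

(** [e] is chosen so that (1 + e)^p = K. Scaling by th < 1/2 gains the factor th^(m-1) < 2^(-(m-1));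
    half of that exponent pays for K, and q = K 2^(-(m-1)) is what remains. *)
Let e := ((2 `^ ((m - 1) / 2)) `^ p^-1 - 1)%R.
Let K := (2 `^ ((m - 1) / 2))%R.
Let q := (2 `^ (- ((m - 1) / 2)))%R.
Let M := ((1 + e^-1) `^ p)%R.

Let e0 : (0 < e)%R.
Proof.
rewrite subr_gt0; have {1}<- : (1 `^ p^-1 = 1 :> R)%R by rewrite powR1.
apply: gt0_ltr_powR; rewrite ?invr_gt0 ?nnegrE ?powR_ge0//.
by apply: gt1_powR2; rewrite divr_gt0 ?subr_gt0.
Qed.

Let eK : ((1 + e) `^ p = K)%R.
Proof.
by rewrite /e addrC subrK -powRrM mulVf ?gt_eqF// powRr1// powR_ge0.
Qed.

Let q01 : (0 <= q < 1)%R.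
Proof.
rewrite powR_ge0/= /q powRN invf_lt1 ?powR_gt0//.
by apply: gt1_powR2; rewrite divr_gt0 ?subr_gt0.
Qed.

Let M0 : (0 <= M)%R. Proof. exact: powR_ge0. Qed.

Section fixed_function.
Variables (g : R -> R).
Hypothesis mg : measurable_fun setT (g : measurableTypeR R -> R).

Let D (th : R) := \int[nu R]_t
  ((0 < (t : R) < L)%R%:R * (`|g t - g (th * (t : R))| `^ p * (t : R) `^ (- m)))%:E.

Let S (th : R) (J : nat) := \int[nu R]_t
  ((0 < (t : R) < L)%R%:R * (`|g t - g (th ^+ J * (t : R))| `^ p * (t : R) `^ (- m)))%:E.

(** The difference is split at th t. Substituting t -> th t turns its distant part into th^(m-1)
    times [S th J], over a smaller interval of integration. *)
Let step th J : (4^-1 < th < 2^-1)%R -> S th J.+1 <= M%:E * D th + q%:E * S th J.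
Proof.
move=> /andP[th4 th2]; have th0 : (0 < th)%R by rewrite (lt_trans _ th4)// invr_gt0.
pose G (t : measurableTypeR R) := ((0 < (t : R) < L)%R%:R *
  (`|g t - g (th ^+ J * (t : R))| `^ p * (t : R) `^ (- m)))%:E.
have mG : measurable_fun setT G by rewrite /G; mf.
have G0 t : 0 <= G t by rewrite /G; nneg.
apply: (@le_trans _ _ (\int[nu R]_t (M%:E * ((0 < (t : R) < L)%R%:R *
    (`|g t - g (th * (t : R))| `^ p * (t : R) `^ (- m)))%:E +
    (K * th `^ m)%:E * G (th * (t : R))%R))).
  apply: le_int => t; first by nneg.
  rewrite /G -!EFinM -EFinD lee_fin.
  have [/andP[t0 tL]|_] := boolP (0 < (t : R) < L)%R; last first.
    rewrite !mul0r mulr0 add0r mulr_ge0 ?mulr_ge0 ?powR_ge0//.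
  have tht : (0 < th * (t : R) < L)%R.
    rewrite mulr_gt0//= (le_lt_trans _ tL)// ler_piMl// ?(ltW t0)//.
    by rewrite (le_trans (ltW th2))// invf_le1 ?ler1n.
  rewrite tht !mul1r.
  have -> : ((t : R) `^ (- m) = th `^ m * (th * (t : R)) `^ (- m))%R.
    rewrite powRM ?(ltW th0) ?(ltW t0)// mulrA -powRD ?subrr ?powRr0 ?mul1r//.
    by rewrite (gt_eqF th0) implybT.
  set b := ((th * (t : R)) `^ (- m))%R.
  have b0 : (0 <= b)%R by exact: powR_ge0.
  set a := (th `^ m)%R; have a0 : (0 <= a)%R by exact: powR_ge0.
  have H : (g t - g (th ^+ J.+1 * (t : R)) = (g (th * (t : R)) - g (th ^+ J * (th * (t : R))))
      + (g t - g (th * (t : R))))%R.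
    by rewrite exprSr mulrA; ring.
  have := @powR_normD_small R e (g (th * (t : R)) - g (th ^+ J * (th * (t : R))))%R
     (g t - g (th * (t : R)))%R p (ltW p0) e0.
  rewrite -H eK -/M => {}H.
  apply: (le_trans (ler_wpM2r (mulr_ge0 a0 b0) H)).
  by rewrite le_eqVlt; apply/orP; left; apply/eqP; ring.
have K0 : (0 <= K * th `^ m)%R by rewrite mulr_ge0 ?powR_ge0.
rewrite ge0_integralD; [|by []|by nneg|by mf|by nneg|by mf].
rewrite intZ; [|exact: M0|by nneg].
rewrite intZ; [|exact: K0|by nneg].
rewrite (nu_scale th0 mG G0) muleA -EFinM -/(D th) leeD2l; first by [].
rewrite -/(S th J).
apply: lee_wpmul2r; first by apply: integral_ge0 => t _; nneg.
rewrite lee_fin.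
have -> : (K * th `^ m * th^-1 = K * th `^ (m - 1))%R.
  rewrite -mulrA; congr (_ * _)%R; rewrite powRB; last by rewrite (gt_eqF th0) implybT.
  by rewrite powRr1// ltW.
have -> : q = (K * (2^-1) `^ (m - 1))%R.
  rewrite -powR_inv1// -powRrM mulN1r /K -powRD; last by rewrite pnatr_eq0 implybT.
  by congr (_ `^ _)%R; field.
apply: ler_wpM2l; first exact: powR_ge0.
by apply: powR_le; rewrite ?subr_ge0 ?ltW.
Qed.

(** M / (1 - q) is the fixed point of X -> M + q X and [S th 0] vanishes. Going by induction on the
    finite sums avoids absorbing a possibly infinite quantity into the left side. *)
Let bound th J : (4^-1 < th < 2^-1)%R -> S th J <= (M / (1 - q))%:E * D th.
Proof.
move=> thb; have [q0 q1] := andP q01; have q1' : (0 < 1 - q)%R by rewrite subr_gt0.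
have D0 : 0 <= D th by apply: integral_ge0 => t _; nneg.
elim: J => [|J ih].
  rewrite /S; under eq_integral => t _.
    rewrite expr0 mul1r subrr normr0 powR0 ?gt_eqF// mul0r mulr0; over.
  rewrite /= integral0 mule_ge0// lee_fin divr_ge0//; exact: ltW.
apply: (le_trans (step J thb)).
apply: (@le_trans _ _ (M%:E * D th + q%:E * ((M / (1 - q))%:E * D th))).
  by rewrite leeD2l// lee_wpmul2l ?lee_fin.
have K0 : (0 <= M / (1 - q))%R by rewrite divr_ge0// ltW.
have qK0 : (0 <= q * (M / (1 - q)))%R by rewrite mulr_ge0.
rewrite muleA -EFinM -ge0_muleDl; [|by rewrite lee_fin|by rewrite lee_fin].
rewrite -EFinD (_ : (M + q * (M / (1 - q)) = M / (1 - q))%R)//.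
by field; rewrite gt_eqF.
Qed.

(** The bound on [S th J] is uniform in J, and Fatou's lemma passes it to the limit value [g0]. *)
Lemma hardy_fixed (g0 : R) (th : R) : (4^-1 < th < 2^-1)%R ->
  (forall t, (0 < t < L)%R -> (fun J => g (th ^+ J * t)%R) @ \oo --> g0) ->
  \int[nu R]_t ((0 < (t : R) < L)%R%:R * (`|g t - g0| `^ p * (t : R) `^ (- m)))%:E
  <= (M / (1 - q))%:E * D th.
Proof.
move=> thb gth.
pose f J (t : measurableTypeR R) := ((0 < (t : R) < L)%R%:R *
  (`|g t - g (th ^+ J * (t : R))| `^ p * (t : R) `^ (- m)))%:E.
have fg0 (t : R) : limn_einf (f^~ t) =
    ((0 < (t : R) < L)%R%:R * (`|g t - g0| `^ p * (t : R) `^ (- m)))%:E.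
  apply: (@cvg_limn_einf_sup _ _ _ _).1; apply: cvg_EFin; first by apply: nearW.
  rewrite /f /comp /=.
  have [tL|_] := boolP (0 < (t : R) < L)%R; last first.
    by under eq_fun do rewrite mul0r; rewrite mul0r; exact: cvg_cst.
  under eq_fun do rewrite mul1r; rewrite mul1r.
  apply: cvgMl; apply: cvg_powR_norm => //.
  by apply: cvgB; [exact: cvg_cst|exact: gth].
under eq_integral do rewrite -fg0.
apply: (le_trans (@fatou _ _ R (nu R) setT measurableT f _ _)).
- by move=> J; rewrite /f; mf.
- by move=> J t _; rewrite /f; nneg.
by apply: limn_einf_le_cst => J; exact: bound.
Qed.

End fixed_function.

(* Summing the differences along t, th t, th^2 t, ... costs a geometric series of
   ratio q < 1 because m > 1; averaging over th in (1/4, 1/2) produces the integral in r. *)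
Lemma hardy_difference : exists2 C : R, (0 <= C)%R & forall (g : R -> R) (g0 : R),
  measurable_fun setT (g : measurableTypeR R -> R) ->
  (forall t th : R, (0 < t < L)%R -> (0 < th < 1)%R ->
     (fun J => g (th ^+ J * t)%R) @ \oo --> g0) ->
  \int[nu R]_t ((0 < (t : R) < L)%R%:R * (`|g0 - g t| `^ p * (t : R) `^ (- m)))%:E
  <= C%:E * \int[nu R]_t \int[nu R]_r ((0 < (r : R) < (t : R))%R%:R * ((t : R) < L)%R%:R *
      (`|g t - g r| `^ p * ((t : R) - (r : R)) `^ (- (1 + m))))%:E.
Proof.
have [q0 q1] := andP q01; have q1' : (0 < 1 - q)%R by rewrite subr_gt0.
pose C1 := (M / (1 - q))%R.
have C10 : (0 <= C1)%R by rewrite divr_ge0// ltW.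
exists (4 * C1)%R; first by rewrite mulr_ge0.
move=> g g0 mg gth.
set I := \int[nu R]_t _.
have I0 : 0 <= I by apply: integral_ge0 => t _; nneg.
pose h (th t : R) := ((0 < t < L)%R%:R * (`|g t - g (th * t)| `^ p * t `^ (- m)))%R.
have Ith (th : R) : (4^-1 < th < 2^-1)%R -> I <= C1%:E * \int[nu R]_t (h th t)%:E.
  move=> thb; have := @hardy_fixed g mg g0 th thb.
  rewrite /I; under [X in _ -> X <= _]eq_integral do rewrite distrC.
  apply => t tL; apply: gth => //; have /andP[th4 th2] := thb.
  by rewrite (lt_trans _ th4) ?invr_gt0//= (lt_trans th2)// invf_lt1 ?ltr1n.
(* The left side does not depend on th, so averaging over ]1/4, 1/2[ multiplies it by the length
   1/4. *)
have E4 : 4^-1%:E * I = \int[nu R]_th ((4^-1 < (th : R) < 2^-1)%R%:R%:E * I).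
  rewrite ge0_integralZr; [|by []|by mf|by nneg|exact: I0].
  rewrite nu_interval; last by rewrite lef_pV2 ?posrE// ler_nat.
  by congr (_%:E * _); field.
rewrite -(@lee_pmul2l _ 4^-1%:E) ?lte_fin ?invr_gt0//.
rewrite E4 muleA -EFinM mulrA mulVf// mul1r.
have mh : measurable_fun setT (fun z : measurableTypeR R * measurableTypeR R => h z.1 z.2).
  by rewrite /h; mf.
have h0 th t : (0 <= h th t)%R by rewrite /h; nneg.
apply: (@le_trans _ _ (\int[nu R]_th (C1%:E *
    \int[nu R]_t ((4^-1 < (th : R) < 2^-1)%R%:R * h th t)%:E))).
  apply: le_int => th; first by nneg.
  have [thb|_] := boolP (4^-1 < (th : R) < 2^-1)%R; last first.
    by rewrite mul0e mule_ge0 ?lee_fin//; apply: integral_ge0 => t _; rewrite mul0r.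
  rewrite mul1e; under eq_integral do rewrite mul1r; exact: Ith.
rewrite intZ; [|exact: C10|by nneg].
apply: lee_wpmul2l; first by rewrite lee_fin.
rewrite swap_int; [|by mf|by nneg].
apply: le_int => t; first by nneg.
have [tL|ntL] := boolP (0 < (t : R) < L)%R; last first.
  rewrite integral0_eq; first by apply: integral_ge0 => r _; nneg.
  by move=> th _; rewrite /h (negbTE ntL) mul0r mulr0.
have /andP[t0 tL'] := tL.
(* With r = th t the measure d th becomes dr / t, and t^(-1-m) <= (t - r)^(-1-m) since 0 < t - r <=
   t. *)
pose F (r : measurableTypeR R) := ((4^-1 < (r : R) / t < 2^-1)%R%:R *
   (`|g t - g r| `^ p * (t : R) `^ (- m)))%:E.
have mF : measurable_fun setT F by rewrite /F; mf.
have F0 r : 0 <= F r by rewrite /F; nneg.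
rewrite (eq_integral (fun th : measurableTypeR R => F ((t : R) * (th : R))%R)); last first.
  move=> th _; rewrite /F /h tL mul1r.
  have -> : ((t : R) * (th : R) / t = th)%R by rewrite mulrAC divff ?mul1r// gt_eqF.
  by rewrite [((th : R) * t)%R]mulrC.
rewrite (nu_scale t0 mF F0) -intZ; [|by rewrite invr_ge0 ltW|exact: F0].
apply: le_int => r; first by rewrite mule_ge0// lee_fin invr_ge0 ltW.
rewrite /F -EFinM lee_fin.
have [/andP[r1 r2]|_] := boolP (4^-1 < (r : R) / t < 2^-1)%R; last first.
  by rewrite mul0r mulr0; nneg.
have r0 : (0 < (r : R))%R.
  by move: r1; rewrite ltr_pdivlMr//; apply: lt_trans; rewrite mulr_gt0// invr_gt0.
have rt : ((r : R) < t)%R.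
  move: r2; rewrite ltr_pdivrMr// => /lt_trans; apply.
  by rewrite gtr_pMl// invf_lt1// ltr1n.
rewrite r0 rt tL' !mul1r mulrCA ler_wpM2l ?powR_ge0//.
rewrite -[X in (X * _)%R]powR_inv1 ?(ltW t0)// -powRD; last by rewrite (gt_eqF t0) implybT.
rewrite -opprD; apply: powR_leN; first by rewrite addr_ge0// ltW// (lt_trans _ m1).
  by rewrite subr_gt0.
by rewrite gerBl ltW.
Qed.
End hardy_difference.

(** * The Hardy inequality averaged over lines through the face *)

Section lines.
Context {R : realType}.
Variables (n : nat) (p m L kap : R).
Hypotheses (p0 : 0 < p) (m1 : 1 < m) (L0 : 0 < L) (kap0 : 0 < kap).
Local Open Scope ereal_scope.
Notation E := 'rV[R]_n.

Let kernel_le (a b : E) (t r : R) : (r < t)%R -> (enorm (b - a) < kap * (t - r))%R ->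
  ((t - r) `^ (- (n%:R + 1 + m)) <=
   (kap + 1) `^ (n%:R + 1 + m) * enorm (rV_join (a - b, t - r)) `^ (- (n%:R + 1 + m)))%R.
Proof.
move=> rt bat; have tr0 : (0 < t - r)%R by rewrite subr_gt0.
have M0 : (0 <= n%:R + 1 + m)%R by rewrite !addr_ge0// ltW// (lt_trans _ m1).
have k1 : (0 < kap + 1)%R by rewrite addr_gt0.
have e1 : (enorm (rV_join ((a - b)%R, (t - r)%R)) <= (kap + 1) * (t - r))%R.
  rewrite (le_trans (enorm_join_le _ _))// mulrDl mul1r gtr0_norm// lerD2r.
  by rewrite enormBC ltW.
have e2 : (0 < enorm (rV_join ((a - b)%R, (t - r)%R)))%R.
  by rewrite (lt_le_trans _ (enorm_join_ge2 _ _))// gtr0_norm.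
have := powR_leN M0 e2 e1; rewrite powRM ?(ltW tr0) ?(ltW k1)// powRN.
by rewrite ler_pdivrMl ?powR_gt0.
Qed.

Let G (w : E -> R -> R) (rad : R) (x y : E) (t : R) : R :=
  ((enorm x < rad)%R%:R * ((0 < t < L)%R%:R * (enorm (y - x) < kap * t)%R%:R *
     (`|w x 0 - w y t| `^ p * t `^ (- (n%:R + m)))))%R.

Let H (w : E -> R -> R) (rad : R) (x y : E) (t r : R) : R :=
  ((enorm x < rad)%R%:R * (enorm y < rad)%R%:R * ((0 < r < t)%R%:R * (t < L)%R%:R) *
     (`|w x t - w y r| `^ p * enorm (rV_join ((x - y)%R, (t - r)%R)) `^ (- (n%:R + 1 + m))))%R.

(** The Hardy inequality is used on each line h -> (x + h z, h). Its pair of points differs by (t -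
    r)(z, 1); passing from (x, z) back to the two points costs the Jacobian factor (t - r)^(-n),
    which raises the one-dimensional exponent 1 + m to n + 1 + m. On these lines the first component
    stays in the ball of radius rad + kap L. *)
Lemma trace_lines_coord : exists2 C : R, (0 <= C)%R &
  forall (w : E -> R -> R) (rad : R),
  measurable_fun setT (fun z : E * measurableTypeR R => w z.1 z.2) ->
  (forall x z t th, (0 < t < L)%R -> (0 < th < 1)%R ->
    (fun J => w ((th ^+ J * t) *: z + x)%R (th ^+ J * t)%R) @ \oo --> w x 0%R) ->
  \int[leb R n]_x \int[leb R n]_y \int[nu R]_t (G w rad x y t)%:E <=
  C%:E * \int[leb R n]_x \int[nu R]_t \int[leb R n]_y \int[nu R]_r
    (H w (rad + kap * L)%R x y t r)%:E.
Proof.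
have [C1 C10 hardy] := @hardy_difference R p m L p0 m1.
have [k0 n0] : (0 <= kap /\ 0 <= n%:R :> R)%R by split => //; exact: ltW.
pose C2 := ((kap + 1) `^ (n%:R + 1 + m))%R.
have C20 : (0 <= C2)%R by exact: powR_ge0.
exists (C1 * C2)%R; first by rewrite mulr_ge0.
move=> w rad mw wlim; set R' := (rad + kap * L)%R.
(* Substituting y = x + t z turns the cone into the fixed ball |z| < kap, and dy = t^n dz removes n
   from the exponent of t. *)
have lhsE x : \int[leb R n]_y \int[nu R]_t (G w rad x y t)%:E =
   \int[leb R n]_z \int[nu R]_t ((enorm x < rad)%R%:R * (enorm z < kap)%R%:R *
     ((0 < (t : R) < L)%R%:R * (`|w x 0 - w ((t : R) *: z + x)%R t| `^ p * (t : R) `^ (- m))))%:E.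
  rewrite swap_int; [|by rewrite /G; mf|by rewrite /G; nneg].
  rewrite [RHS]swap_int; [|by mf|by nneg].
  apply: eq_integral => t _.
  have [tL|ntL] := boolP (0 < (t : R) < L)%R; last first.
    rewrite integral0_eq => [|y _]; last by rewrite /G (negbTE ntL) !mul0r mulr0.
    by rewrite integral0_eq => [//|y _]; rewrite !mul0r mulr0.
  have /andP[t0 tL'] := tL; have tn0 : (t != 0 :> R)%R by rewrite gt_eqF.
  pose F (y : E) := (G w rad x y t * (t : R) ^+ n)%:E.
  have mF : measurable_fun setT F by rewrite /F /G; mf.
  have tn : (0 <= (t : R) ^+ n)%R by rewrite exprn_ge0// ltW.
  have F0 y : 0 <= F y by rewrite /F lee_fin mulr_ge0// /G; nneg.
  transitivity (\int[leb R n]_z F ((t : R) *: z + x)%R).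
    rewrite (leb_scale x mF F0 tn0) (gtr0_norm t0) /F.
    under [in RHS]eq_integral do rewrite EFinM.
    rewrite intZr; [|exact: tn|by rewrite /G; nneg].
    by rewrite muleCA -EFinM mulVf ?mule1// expf_neq0.
  apply: eq_integral => z _; rewrite /F /G tL !mul1r; congr (_%:E).
  rewrite addrK enormZ (gtr0_norm t0) mulrC [(kap * t)%R]mulrC ltr_pM2l//.
  rewrite -[in LHS]powR_mulrn ?(ltW t0)//.
  rewrite opprD powRD; last by rewrite tn0 implybT.
  rewrite [(_ `^ (- n%:R))%R]powRN.
  have := powR_gt0 n%:R t0; set X := ((t : R) `^ n%:R)%R => X0.
  by field; rewrite gt_eqF.
under eq_integral do rewrite lhsE.
pose K (x z : E) (t r : R) := ((enorm x < rad)%R%:R * (enorm z < kap)%R%:R *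
   ((0 < (r : R) < (t : R))%R%:R * ((t : R) < L)%R%:R *
     (`|w ((t : R) *: z + x)%R t - w ((r : R) *: z + x)%R r| `^ p *
     ((t : R) - (r : R)) `^ (- (1 + m)))))%R.
apply: (@le_trans _ _ (C1%:E * \int[leb R n]_x \int[leb R n]_z
    \int[nu R]_t \int[nu R]_r (K x z t r)%:E)).
  rewrite -intZ; [|exact: C10|by rewrite /K; nneg].
  apply: le_int => [|x]; first by nneg.
  rewrite -intZ; [|exact: C10|by rewrite /K; nneg].
  apply: le_int => [|z]; first by nneg.
  pose c := ((enorm x < rad)%R%:R * (enorm z < kap)%R%:R : R)%R.
  have c0 : (0 <= c)%R by rewrite /c; nneg.
  under eq_integral do rewrite EFinM -/c.
  rewrite intZ; [|exact: c0|by nneg].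
  have -> : \int[nu R]_t \int[nu R]_r (K x z t r)%:E = c%:E * \int[nu R]_t \int[nu R]_r
     ((0 < (r : R) < (t : R))%R%:R * ((t : R) < L)%R%:R *
     (`|w ((t : R) *: z + x)%R t - w ((r : R) *: z + x)%R r| `^ p *
     ((t : R) - (r : R)) `^ (- (1 + m))))%:E.
    rewrite -intZ; [|exact: c0|by nneg]; apply: eq_integral => t _.
    by rewrite -intZ; [|exact: c0|by nneg].
  rewrite muleCA; apply: lee_wpmul2l; first by rewrite lee_fin.
  apply: (hardy (fun t => w (t *: z + x)%R t) (w x 0%R)); first by mf.
  by move=> t th tL thb; exact: wlim.
rewrite EFinM -muleA; apply: lee_wpmul2l; first by rewrite lee_fin.
pose Q (a b : E) (t r : R) := ((enorm a < R')%R%:R * (enorm b < R')%R%:R *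
   (enorm (b - a) < kap * (t - r))%R%:R * `|w a t - w b r| `^ p : R)%R.
have Q0 a b t r : (0 <= Q a b t r)%R by rewrite /Q; nneg.
(* At fixed heights, x is translated to a = x + t z and then z is replaced by b = a - (t - r) z. *)
have key (t r : R) : (0 < r < t)%R -> (t < L)%R ->
    \int[leb R n]_x \int[leb R n]_z ((enorm x < rad)%R%:R * (enorm z < kap)%R%:R *
     `|w (t *: z + x)%R t - w (r *: z + x)%R r| `^ p)%:E <=
    ((t - r) `^ (- n%:R))%:E * \int[leb R n]_a \int[leb R n]_b (Q a b t r)%:E.
  move=> /andP[r0 rt] tL; have tr0 : (0 < t - r)%R by rewrite subr_gt0.
  have t0 : (0 < t)%R by exact: lt_trans rt.
  rewrite swap_int; [|by mf|by nneg].
  apply: (@le_trans _ _ (\int[leb R n]_z \int[leb R n]_a (Q a (- (t - r) *: z + a)%R t r)%:E)).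
    apply: le_int => [|z]; first by nneg.
    have mQ : measurable_fun setT (fun a : E => (Q a (- (t - r) *: z + a)%R t r)%:E).
      by rewrite /Q; mf.
    rewrite -(leb_shift (t *: z) mQ); last by move=> a; rewrite lee_fin.
    apply: le_int => [|x]; first by nneg.
    rewrite lee_fin /Q.
    have -> : (- (t - r) *: z + (x + t *: z) = r *: z + x)%R.
      by rewrite addrCA addrC -scalerDl opprB subrK.
    rewrite [(x + t *: z)%R]addrC.
    have [xr|_] := ltP (enorm x) rad; last by rewrite !mul0r; nneg.
    have [zk|_] := ltP (enorm z) kap; last by rewrite mulr0 mul0r; nneg.
    have bd (u : R) : (0 < u)%R -> (u < L)%R -> (enorm (u *: z + x) < R')%R.
      move=> u0 uL; rewrite (le_lt_trans (ler_enormD _ _))// addrC /R' ltrD//.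
      by rewrite enormZ gtr0_norm// mulrC; apply: ltr_pM => //; [exact: enorm_ge0|exact: ltW].
    rewrite !bd//; last exact: lt_trans tL.
    have -> : (r *: z + x - (t *: z + x) = - ((t - r) *: z))%R.
      by rewrite opprD addrACA subrr addr0 -scaleNr -scalerDl -scaleNr opprB addrC.
    by rewrite enormN enormZ (gtr0_norm tr0) [((t - r) * _)%R]mulrC ltr_pM2r// zk !mul1r.
  rewrite swap_int; [|by rewrite /Q; mf|by nneg].
  rewrite -intZ; [|exact: powR_ge0|by nneg].
  apply: le_int => [|a]; first by nneg.
  have mQ : measurable_fun setT (fun b : E => (Q a b t r)%:E) by rewrite /Q; mf.
  have kn0 : (- (t - r) != 0)%R by rewrite oppr_eq0 gt_eqF.
  rewrite (leb_scale a mQ _ kn0); last by move=> b; rewrite lee_fin.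
  rewrite normrN gtr0_norm// powRN powR_mulrn//; exact: ltW.
apply: (@le_trans _ _ (\int[nu R]_t \int[nu R]_r \int[leb R n]_x \int[leb R n]_z (K x z t r)%:E)).
  have e1 (x : E) : \int[leb R n]_z \int[nu R]_t \int[nu R]_r (K x z t r)%:E =
      \int[nu R]_t \int[nu R]_r \int[leb R n]_z (K x z t r)%:E.
    rewrite swap_int; [|by rewrite /K; mf|by rewrite /K; nneg].
    apply: eq_integral => t _; apply: swap_int; [by rewrite /K; mf|by rewrite /K; nneg].
  under eq_integral do rewrite e1.
  rewrite swap_int; [|by rewrite /K; mf|by rewrite /K; nneg].
  rewrite le_eqVlt; apply/orP; left; apply/eqP; apply: eq_integral => t _.
  apply: swap_int; [by rewrite /K; mf|by rewrite /K; nneg].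
apply: (@le_trans _ _ (\int[nu R]_t \int[nu R]_r \int[leb R n]_a \int[leb R n]_b
   (C2 * H w R' a b t r)%:E)).
  apply: le_int => [|t]; first by rewrite /K; nneg.
  apply: le_int => [|r]; first by rewrite /K; nneg.
  have [rt|nrt] := orP (orbN (0 < (r : R) < (t : R))%R); last first.
    apply: int0_le => [x|]; last by rewrite /H; nneg.
    by apply: integral0_eq => z _; rewrite /K (negbTE nrt) !mul0r mulr0.
  have [tL|ntL] := orP (orbN ((t : R) < L)%R); last first.
    apply: int0_le => [x|]; last by rewrite /H; nneg.
    by apply: integral0_eq => z _; rewrite /K (negbTE ntL) mulr0 !mul0r mulr0.
  have c0 : (0 <= (t - r) `^ (- (1 + m)))%R by exact: powR_ge0.
  apply: (@le_trans _ _ (((t - r) `^ (- (1 + m)))%:E * \int[leb R n]_x \int[leb R n]_z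
     ((enorm x < rad)%R%:R * (enorm z < kap)%R%:R *
     `|w (t *: z + x)%R t - w (r *: z + x)%R r| `^ p)%:E)).
    apply: le_of_eq; apply: int_eqZ => [//||x]; first by nneg.
    apply: int_eqZ => [//||z]; first by nneg.
    by rewrite -EFinM /K rt tL !mul1r; congr (_%:E); ring.
  apply: (le_trans (lee_wpmul2l _ (key t r rt tL))); first by rewrite lee_fin.
  rewrite muleA -EFinM -powRD; last first.
    by apply/implyP => _; case/andP: rt => _ rt'; rewrite subr_eq0 gt_eqF.
  rewrite -opprD -intZ; [|exact: powR_ge0|by nneg].
  apply: le_int => [|a]; first by nneg.
  rewrite -intZ; [|exact: powR_ge0|by nneg].
  apply: le_int => [|b]; first by nneg.
  rewrite -EFinM lee_fin /H /Q rt tL.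
  have [bat|/negbTE ->] := orP (orbN (enorm (b - a) < kap * ((t : R) - r))%R); last first.
    by rewrite mulr0 mul0r mulr0 mulr_ge0 ?powR_ge0//; nneg.
  have /andP[_ rt'] := rt.
  have := kernel_le rt' bat; rewrite -/C2 => kl.
  have -> : (1 + m + n%:R = n%:R + 1 + m :> R)%R by ring.
  rewrite bat !mulr1 [leLHS]mulrC mulrCA -!mulrA; do 2 (apply: ler_wpM2l; first by []).
  by rewrite mulrCA ler_wpM2l ?powR_ge0.
have e2 (t : R) : \int[nu R]_r \int[leb R n]_a \int[leb R n]_b (C2 * H w R' a b t r)%:E =
    \int[leb R n]_a \int[leb R n]_b \int[nu R]_r (C2 * H w R' a b t r)%:E.
  rewrite swap_int; [|by rewrite /H; mf|by rewrite /H /C2; nneg].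
  apply: eq_integral => a _; apply: swap_int; [by rewrite /H; mf|by rewrite /H /C2; nneg].
under eq_integral do rewrite e2.
rewrite swap_int; [|by rewrite /H; mf|by rewrite /H /C2; nneg].
rewrite -intZ; [|exact: powR_ge0|by rewrite /H; nneg].
rewrite le_eqVlt; apply/orP; left; apply/eqP; apply: eq_integral => a _.
rewrite -intZ; [|exact: powR_ge0|by rewrite /H; nneg].
apply: eq_integral => t _.
rewrite -intZ; [|exact: powR_ge0|by rewrite /H; nneg].
apply: eq_integral => b _.
rewrite -intZ; [|exact: powR_ge0|by rewrite /H; nneg].
by apply: eq_integral => r _; rewrite EFinM.
Qed.
End lines.

(** * Coordinates at a face of the slab *)

Section rV_borel.
Context {R : realType} (d : nat).

Let box (q : 'rV[rat]_d * rat) : set 'rV[R]_d :=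
  [set x | forall i, `|x 0 i - ratr (q.1 0 i)| < ratr q.2].

Let measurable_box q : measurable (box q).
Proof.
pose f (x : 'rV[R]_d) : R := \prod_i (`|x 0 i - ratr (q.1 0 i)| < ratr q.2)%R%:R.
have mf : measurable_fun setT f.
  by apply: measurable_prod => i _; mf.
have -> : box q = f @^-1` `]0, +oo[.
  apply/seteqP; split => x /=; rewrite in_itv/= andbT.
    by move=> xq; apply: prodr_gt0 => i _; rewrite xq ltr0n.
  move=> fx i; apply: contraTT fx => /negbTE xi.
  by rewrite /f (bigD1 i)//= xi mul0r ltxx.
by rewrite -[X in measurable X]setTI; apply: mf => //; exact: measurable_itv.
Qed.

(** Each point of [U] lies in a box with rational centre and radius contained in [U]. These boxes
    are countably many, enumerated through [pickle], and measurable for the sigma-algebra of the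
    coordinates. *)
Lemma open_measurable_rV (U : set 'rV[R]_d) : open U -> measurable U.
Proof.
move=> oU.
pose B (k : nat) := if unpickle k is Some q then
  if `[< box q `<=` U >] then box q else set0 else set0.
suff -> : U = \bigcup_k B k.
  apply: bigcup_measurable => k _; rewrite /B; case: unpickle => // q.
  by case: ifP.
apply/seteqP; split => x; last first.
  move=> [k _]; rewrite /B; case: unpickle => // q.
  by case: ifPn => // /asboolP; apply.
move=> Ux; have /nbhs_ballP[e /= e0 xeU] : nbhs x U by exact: open_nbhs_nbhs.
have e20 : 0 < e / 2 by rewrite divr_gt0.
have [r /andP[r0 re]] : exists r : rat, 0 < (ratr r : R) < e / 2.
  by have [r] := rat_in_itvoo e20; rewrite in_itv/=; exists r.
have H i : exists q : rat, `|x 0 i - ratr q| < ratr r.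
  have h : x 0 i - ratr r < x 0 i + ratr r by rewrite ltrD2l gtrN.
  have [q] := rat_in_itvoo h; rewrite in_itv/= => /andP[q1 q2]; exists q.
  by rewrite ltr_norml ltrBrDr addrC -ltrBrDr opprK q2/= ltrBlDr addrC -ltrBlDr q1.
have [q Hq] := choice H.
pose Q : 'rV[rat]_d * rat := (\row_i q i, r).
exists (pickle Q) => //; rewrite /B pickleK.
have sub : box Q `<=` U.
  move=> y yQ; apply: xeU; rewrite /ball/=; split => // i j; rewrite (ord1 i).
  have := yQ j; rewrite /= mxE => yj.
  rewrite /ball/= -(subrKA (ratr (q j))) (le_lt_trans (ler_normD _ _))//.
  rewrite [ltRHS](splitr e); apply: ltrD; first exact: lt_trans (Hq j) re.
  by rewrite distrC; exact: lt_trans yj re.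
by case: ifPn => [_|/asboolP//] i; rewrite /= mxE.
Qed.

Lemma continuous_measurable_rV (f : 'rV[R]_d -> R) :
  continuous f -> measurable_fun setT f.
Proof.
move=> cf; apply: (measurability _ (RGenOInfty.measurableE R)) => _ [_ [x ->] <-].
rewrite setTI; apply: open_measurable_rV.
move/continuousP : cf; apply; exact: interval_open.
Qed.

End rV_borel.

Section boundary.
Context {R : realType} {n : nat}.
Variables (sg b : R).
Hypothesis sg1 : sg = 1 \/ sg = -1.
Local Open Scope ereal_scope.

(** Signed height above the face x_N = b. It is the distance from inside the strip for sg = 1 at the
    lower face and for sg = -1 at the upper one, so that one argument serves both. *)
Definition bdist (a : 'rV[R]_n.+1) : R := (sg * ((rV_last a : R) - b))%R.

Lemma sg_norm : `|sg|%R = 1%R. Proof. by case: sg1 => ->; rewrite ?normrN normr1. Qed.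

Lemma sg_sqr : (sg * sg = 1)%R. Proof. by case: sg1 => ->; rewrite ?mulrNN mulr1. Qed.

Lemma bdist_join (x : 'rV[R]_n) (t : R) : bdist (rV_join (x, (sg * t + b)%R)) = t.
Proof. by rewrite /bdist rV_last_join addrK mulrA sg_sqr mul1r. Qed.

Lemma bdist_lip (a c : 'rV[R]_n.+1) : (`|bdist a - bdist c| <= enorm (a - c))%R.
Proof.
rewrite /bdist -mulrBr normrM sg_norm mul1r opprD addrACA opprK addNr addr0.
exact: abs_lastB.
Qed.

Lemma measurable_bdist d (T : measurableType d) (f : T -> 'rV[R]_n.+1) :
  measurable_fun setT f -> measurable_fun setT (fun x => bdist (f x)).
Proof. by move=> mf; rewrite /bdist; mf. Qed.

Lemma int_boundary (F : 'rV[R]_n.+1 -> \bar R) : measurable_fun setT F ->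
  (forall x, 0 <= F x) ->
  \int[leb R n.+1]_a F a =
  \int[leb R n]_x \int[nu R]_t F (rV_join (x, (sg * (t : R) + b)%R)).
Proof.
move=> mF F0; refine (etrans (int_leb mF F0) _); apply: eq_integral => x _.
pose G (t : R) := F (rV_join (x, t)).
have mG : measurable_fun setT G by rewrite /G; mf.
have sg0 : (sg != 0)%R by rewrite -normr_eq0 sg_norm oner_neq0.
have := @lebesgue_integral_affine R sg b sg0 G mG (fun t => F0 _).
rewrite sg_norm invr1 mul1e => H.
exact: (esym H).
Qed.

Lemma rV_join_line (x z : 'rV[R]_n) (h : R) :
  rV_join ((h *: z + x)%R, (sg * h + b)%R) = (h *: rV_join (z, sg) + rV_join (x, b))%R.
Proof.
apply/rowP => i; case: (unliftP ord_max i) => [j ->|->].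
  by rewrite !mxE liftK !mxE.
by rewrite !mxE unlift_none mulrC.
Qed.

End boundary.
Ltac mfstep3 :=
  match goal with
  | |- measurable_fun _ (fun x => bdist _ _ _) => apply: measurable_bdist
  | _ => mfstep2
  end.
Ltac mf ::= cbv beta; repeat (mfstep3; cbv beta).

Lemma ler_weights (R : realDomainType) (c1 c2 k A B D q : R) :
  0 <= c1 -> 0 <= c2 -> 0 <= k -> A <= q * (B + D) ->
  c1 * (c2 * (A * k)) <= q * (c1 * (c2 * (B * k)) + c1 * (c2 * (D * k))).
Proof.
move=> c10 c20 k0 h.
rewrite (_ : q * _ = c1 * (c2 * (q * (B + D) * k))); last by ring.
by do 2 (apply: ler_wpM2l => //); exact: ler_wpM2r.
Qed.

(** * Comparison of double integrals and limits *)

Section le_int2.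
Local Open Scope ereal_scope.
Context d1 d2 (T1 : measurableType d1) (T2 : measurableType d2) (R : realType).
Variables (m1 : {sigma_finite_measure set T1 -> \bar R})
  (m2 : {sigma_finite_measure set T2 -> \bar R}).
Implicit Types F G H : T1 -> T2 -> R.
Notation mfun2 F := (measurable_fun [set: T1 * T2] (fun z : T1 * T2 => F z.1 z.2)).

Lemma le_int2 F G : (forall x y, 0 <= F x y)%R -> (forall x y, F x y <= G x y)%R ->
  \int[m1]_x \int[m2]_y (F x y)%:E <= \int[m1]_x \int[m2]_y (G x y)%:E.
Proof.
move=> F0 FG; apply: le_int => x; first by apply: integral_ge0 => y _; rewrite lee_fin.
by apply: le_int => y; rewrite lee_fin.
Qed.

Lemma int2Z (c : R) F : (0 <= c)%R -> (forall x y, 0 <= F x y)%R ->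
  \int[m1]_x \int[m2]_y (c * F x y)%:E = c%:E * \int[m1]_x \int[m2]_y (F x y)%:E.
Proof.
move=> c0 F0; apply: int_eqZ => [//|x|x].
  by apply: integral_ge0 => y _; rewrite lee_fin.
by apply: int_eqZ => // y; rewrite lee_fin.
Qed.

Lemma int2D F G : (forall x y, 0 <= F x y)%R -> (forall x y, 0 <= G x y)%R ->
  mfun2 F -> mfun2 G ->
  \int[m1]_x \int[m2]_y (F x y + G x y)%:E =
  \int[m1]_x \int[m2]_y (F x y)%:E + \int[m1]_x \int[m2]_y (G x y)%:E.
Proof.
move=> F0 G0 mF mG.
have iF0 x : 0 <= \int[m2]_y (F x y)%:E by apply: integral_ge0 => y _; rewrite lee_fin.
have iG0 x : 0 <= \int[m2]_y (G x y)%:E by apply: integral_ge0 => y _; rewrite lee_fin.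
have m1F := measurable_int1 m2 (F := fun x y => (F x y)%:E) (measurable_EFin_fun mF) F0.
have m1G := measurable_int1 m2 (F := fun x y => (G x y)%:E) (measurable_EFin_fun mG) G0.
rewrite -ge0_integralD//; apply: eq_integral => x _.
by rewrite -ge0_integralD//; [move=> y _; exact: F0|mf|move=> y _; exact: G0|mf].
Qed.

Lemma le_int2_add (c : R) H F G : (0 <= c)%R -> (forall x y, 0 <= H x y)%R ->
  (forall x y, 0 <= F x y)%R -> (forall x y, 0 <= G x y)%R -> mfun2 F -> mfun2 G ->
  (forall x y, H x y <= c * (F x y + G x y))%R ->
  \int[m1]_x \int[m2]_y (H x y)%:E <= c%:E *
  (\int[m1]_x \int[m2]_y (F x y)%:E + \int[m1]_x \int[m2]_y (G x y)%:E).
Proof.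
move=> c0 H0 F0 G0 mF mG HFG; rewrite -int2D// -int2Z//; last first.
  by move=> x y; exact: addr_ge0.
exact: le_int2.
Qed.

End le_int2.

Lemma int_exhaust d (T : measurableType d) (R : realType)
    (mu : {measure set T -> \bar R}) (F : T -> \bar R) (f : nat -> T -> \bar R) (c : \bar R) :
  (forall j, measurable_fun setT (f j)) -> (forall j x, 0 <= f j x)%E ->
  (forall x, \forall j \near \oo, f j x = F x) -> (forall j, \int[mu]_x f j x <= c)%E ->
  (\int[mu]_x F x <= c)%E.
Proof.
move=> mf_ f0 fF fc.
have lF x : limn_einf (f^~ x) = F x.
  apply: (@cvg_limn_einf_sup _ _ _ _).1.
  by apply: cvg_near_cst; exact: fF.
under eq_integral do rewrite -lF.
by apply: (le_trans (fatou _ measurableT _ _)) => //; exact: limn_einf_le_cst.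
Qed.

(** Sorts an estimate into a main term in [S] and one coefficient times G + (N + M), the errors that
    vanish along an approximating sequence. *)
Lemma lee_error_comb (R : realType) (K4 C P Ke V1 V2 : R) (S G N M X Y : \bar R) :
  0 <= K4 -> 0 <= C -> 0 <= P -> 0 <= Ke -> 0 <= V1 -> 0 <= V2 ->
  (0 <= S -> 0 <= G -> 0 <= N -> 0 <= M -> X <= P%:E * (S + G) ->
  Y <= K4%:E * (C%:E * X + (Ke%:E * (V1%:E * N) + Ke%:E * (V2%:E * M))) ->
  Y <= (K4 * (C * P))%:E * S + (K4 * (C * P + (Ke * V1 + Ke * V2)))%:E * (G + (N + M)))%E.
Proof.
move=> K40 C0 P0 Ke0 V10 V20 S0 G0 N0 M0 XS /le_trans; apply.
have KV1 : 0 <= Ke * V1 by exact: mulr_ge0.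
have KV2 : 0 <= Ke * V2 by exact: mulr_ge0.
have CP : 0 <= C * P by exact: mulr_ge0.
set W := (G + (N + M))%E.
have GW : (G <= W)%E by rewrite /W leeDl// adde_ge0.
have NW : (N <= W)%E by rewrite /W addeCA leeDl// adde_ge0.
have MW : (M <= W)%E by rewrite /W addeA leeDr// adde_ge0.
have W0 : (0 <= W)%E by exact: le_trans GW.
apply: (@le_trans _ _ (K4%:E * ((C * P)%:E * (S + W) + ((Ke * V1)%:E * W + (Ke * V2)%:E * W)))%E).
  apply: lee_wpmul2l; first by rewrite lee_fin.
  apply: leeD.
    rewrite EFinM -muleA; apply: lee_wpmul2l; first by rewrite lee_fin.
    by apply: (le_trans XS); apply: lee_wpmul2l; [rewrite lee_fin|exact: leeD2l].
  by apply: leeD; rewrite muleA -EFinM; apply: lee_wpmul2l; rewrite // lee_fin.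
apply: le_of_eq; rewrite [((C * P)%:E * (S + W))%E]ge0_muleDr// -addeA.
rewrite -[((Ke * V1)%:E * W + (Ke * V2)%:E * W)%E]ge0_muleDl ?lee_fin// -EFinD.
rewrite -[((C * P)%:E * W + (Ke * V1 + Ke * V2)%:E * W)%E]ge0_muleDl ?lee_fin ?addr_ge0// -EFinD.
rewrite ge0_muleDr; [by rewrite !muleA -!EFinM|by rewrite mule_ge0 ?lee_fin|].
by rewrite mule_ge0 ?lee_fin ?addr_ge0.
Qed.

(** * Trace inequality over cones *)

Section trace_cone.
Context {R : realType}.
Variables (n : nat) (p m L kap : R).
Hypotheses (p0 : 0 < p) (m1 : 1 < m) (L0 : 0 < L) (kap0 : 0 < kap).
Local Open Scope ereal_scope.
Notation E := 'rV[R]_n.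
Notation E1 := 'rV[R]_n.+1.

(** A boolean, so that domains enter as 0-1 factors: all integrals run over the whole space, where
    Tonelli and pointwise comparison apply directly. *)
Definition slab (sg b : R) (a : E1) : bool := (0 < bdist sg b a < L)%R.

Definition seminorm_cyl (sg b rad : R) (u : E1 -> R) : \bar R :=
  \int[leb R n.+1]_a \int[leb R n.+1]_c
    ((enorm (rV_tail a) < rad)%R%:R * (enorm (rV_tail c) < rad)%R%:R *
     ((slab sg b a)%:R * (slab sg b c)%:R *
     (`|u a - u c| `^ p * enorm (a - c) `^ (- (n%:R + 1 + m)))))%:E.

Definition cone_integrand (sg b : R) (f : E -> R) (u : E1 -> R) (x : E) (a : E1) : R :=
  ((slab sg b a)%:R * (enorm (rV_tail a - x) < kap * bdist sg b a)%R%:R *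
     (`|f x - u a| `^ p * bdist sg b a `^ (- (n%:R + m))))%R.

Lemma cone_integrand_ge0 sg b f u x a : (0 <= cone_integrand sg b f u x a)%R.
Proof. by rewrite /cone_integrand; nneg. Qed.

(** Continuity up to the face supplies the limits along lines that the Hardy inequality asks for.
    The pairs with r < t that it produces are part of the full energy of the cylinder. *)
Lemma trace_lines : exists2 C : R, (0 <= C)%R &
  forall (sg b rad : R) (v : E1 -> R), sg = 1%R \/ sg = (-1)%R -> continuous v ->
  \int[leb R n]_x \int[leb R n.+1]_a
    ((enorm x < rad)%R%:R * cone_integrand sg b (fun x => v (rV_join (x, b))) v x a)%:E <=
  C%:E * seminorm_cyl sg b (rad + kap * L) v.
Proof.
have [C C0 HC] := @trace_lines_coord R n p m L kap p0 m1 kap0.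
exists C; first exact: C0.
move=> sg b rad v sg1 cv; have mv := continuous_measurable_rV cv.
pose w (x : E) (t : R) := v (rV_join (x, (sg * t + b)%R)).
have mw : measurable_fun setT (fun z : E * measurableTypeR R => w z.1 z.2).
  by rewrite /w; mf.
have wlim x z t th : (0 < t < L)%R -> (0 < th < 1)%R ->
    (fun J => w ((th ^+ J * t) *: z + x)%R (th ^+ J * t)%R) @ \oo --> w x 0%R.
  move=> _ /andP[th0 th1]; rewrite /w.
  under eq_fun do rewrite rV_join_line.
  rewrite mulr0 add0r.
  have hJ : (fun J => (th ^+ J * t)%R) @ \oo --> (0 : R)%R.
    rewrite -[X in _ --> X](mul0r t); apply: cvgMr_tmp.
    by apply: cvg_expr; rewrite ger0_norm// ltW.
  have vJ : (fun J => (th ^+ J * t) *: rV_join (z, sg) + rV_join (x, b))%R @ \oo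
      --> (rV_join (x, b) : E1).
    rewrite -[X in _ --> X]add0r; apply: cvgD; last exact: cvg_cst.
    by rewrite -[X in _ --> X](scale0r (rV_join (z, sg))); exact: cvgZr_tmp.
  exact: (cvg_comp _ _ vJ (cv _)).
have := HC w rad mw wlim => {HC} H.
refine (le_trans _ (le_trans H _)).
  apply: le_of_eq; apply: eq_integral => x _.
  refine (etrans (@int_boundary R n sg b sg1 _ _ _) _).
  - by rewrite /cone_integrand /slab; mf.
  - by move=> a; rewrite lee_fin mulr_ge0// cone_integrand_ge0.
  apply: eq_integral => y _; apply: eq_integral => t _.
  by rewrite /cone_integrand /slab bdist_join// rV_tail_join /w mulr0 add0r.
apply: lee_wpmul2l; first by rewrite lee_fin.
rewrite /seminorm_cyl.
refine (le_trans _ (le_of_eq (esym (@int_boundary R n sg b sg1 _ _ _)))); last 2 first.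
- by rewrite /slab; mf.
- by move=> a; nneg.
apply: le_int => [|x]; first by nneg.
apply: le_int => [|t]; first by nneg.
refine (le_trans _ (le_of_eq (esym (@int_boundary R n sg b sg1 _ _ _)))); last 2 first.
- by rewrite /slab; mf.
- by move=> a; nneg.
apply: le_int => [|y]; first by nneg.
apply: le_int => [|r]; first by nneg.
rewrite lee_fin /slab !bdist_join// !rV_tail_join rV_joinB.
have -> : (sg * t + b - (sg * r + b) = sg * (t - r))%R by ring.
have -> : enorm (rV_join ((x - y)%R, (sg * (t - r))%R)) = enorm (rV_join ((x - y)%R, (t - r)%R)).
  by case: sg1 => ->; rewrite ?mul1r// mulN1r enorm_joinNr.
rewrite -!mulrA; do 2 (apply: ler_wpM2l; first by []).
rewrite !mulrA -![(_ * _ * enorm _ `^ _)%R]mulrA; apply: ler_wpM2r; first by nneg.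
case: ltP => [r0|_] /=; last by rewrite !mul0r; nneg.
case: ltP => [rt|_] /=; last by rewrite !mul0r; nneg.
case: ltP => [tL|_] /=; last by rewrite !mulr0; nneg.
by rewrite (lt_trans r0 rt) (lt_trans rt tL) !mulr1.
Qed.

Definition seminorm_slab (sg b : R) (u : E1 -> R) : \bar R :=
  \int[leb R n.+1]_a \int[leb R n.+1]_c
    ((slab sg b a)%:R * (slab sg b c)%:R *
     (`|u a - u c| `^ p * enorm (a - c) `^ (- (n%:R + 1 + m))))%:E.

Lemma seminorm_cyl_le sg b rad u : seminorm_cyl sg b rad u <= seminorm_slab sg b u.
Proof.
apply: le_int => [|a]; first by nneg.
apply: le_int => [|c]; first by nneg.
rewrite lee_fin -[leRHS]mul1r ler_pM//; try by nneg.
by case: (_ < _)%R; case: (_ < _)%R; rewrite ?mulr1 ?mul0r ?mulr0.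
Qed.

Lemma slab_volume : exists2 V : R, (0 < V)%R & forall sg b (x : E) (r : R),
  sg = 1%R \/ sg = (-1)%R -> (0 < r)%R ->
  \int[leb R n.+1]_a ((slab sg b a)%:R * (enorm (rV_tail a - x) < r)%R%:R)%:E =
  (V * r ^+ n)%:E.
Proof.
have [om om0 vol] := @enorm_ball_bounds R n.
exists (L * om)%R; first exact: mulr_gt0.
move=> sg b x r sg1 r0.
refine (etrans (@int_boundary R n sg b sg1 _ _ _) _).
- by rewrite /slab; mf.
- by move=> a; nneg.
transitivity (\int[leb R n]_y (L%:E * (enorm (y - x) < r)%R%:R%:E)).
  apply: eq_integral => y _.
  transitivity (\int[nu R]_t ((enorm (y - x) < r)%R%:R%:E * (0 < t < L)%R%:R%:E)).
    by apply: eq_integral => t _; rewrite /slab bdist_join// rV_tail_join -EFinM mulrC.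
  rewrite intZ; [|exact: ler0n|by nneg].
  by rewrite nu_interval ?subr0 1?muleC// ltW.
rewrite intZ; [|exact: ltW|by nneg].
by rewrite vol// -EFinM mulrA.
Qed.

Lemma lee_lim0 (x A : \bar R) (c : R) (B : nat -> \bar R) : (0 <= c)%R ->
  B @ \oo --> 0 -> (forall k, x <= A + c%:E * B k) -> x <= A.
Proof.
move=> c0 B0 xA; apply/lee_addgt0Pr => e e0.
have c1 : (0 < c + 1)%R by rewrite ltr_pwDr.
have : \forall k \near \oo, B k < (e / (c + 1))%:E.
  move/fine_cvgP : B0 => [B1 B2].
  have ec0 : (0 < e / (c + 1))%R by rewrite divr_gt0.
  move/cvgr0_norm_lt : B2 => /(_ _ ec0) B2.
  near=> k; have Bf : B k \is a fin_num by near: k.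
  rewrite -(fineK Bf) lte_fin (le_lt_trans (ler_norm _))//.
  by near: k.
move=> [k _ Bk]; apply: (le_trans (xA k)); apply: leeD => //.
apply: (@le_trans _ _ (c%:E * (e / (c + 1))%:E)).
  by apply: lee_wpmul2l; [rewrite lee_fin|apply/ltW/Bk => /=].
rewrite -EFinM lee_fin mulrA ler_pdivrMr// mulrC ler_wpM2l//; first exact: ltW.
by rewrite lerDl.
Unshelve. all: by end_near. Qed.

Lemma seminorm_cyl_add sg b rad (u v : E1 -> R) : measurable_fun setT u -> measurable_fun setT v ->
  seminorm_cyl sg b rad v <= (2 `^ p)%:E *
    (seminorm_cyl sg b rad u + seminorm_cyl sg b rad (v \- u)%R).
Proof.
move=> mu mv; rewrite /seminorm_cyl.
have p2 : (0 <= 2 `^ p)%R by exact: powR_ge0.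
pose K (w : E1 -> R) a c := ((enorm (rV_tail a) < rad)%R%:R * (enorm (rV_tail c) < rad)%R%:R *
     ((slab sg b a)%:R * (slab sg b c)%:R *
     (`|w a - w c| `^ p * enorm (a - c) `^ (- (n%:R + 1 + m)))) : R)%R.
have K0 w a c : (0 <= K w a c)%R by rewrite /K; nneg.
have mK w : measurable_fun setT w -> measurable_fun setT (fun z : E1 * E1 => K w z.1 z.2).
  by move=> mw; rewrite /K /slab; mf.
have mw : measurable_fun setT (v \- u)%R by exact: measurable_funB.
have mKu := mK u mu; have mKw := mK _ mw.
apply: (@le_int2_add _ _ _ _ R (leb R n.+1) (leb R n.+1) (2 `^ p)%R (K v) (K u) (K (v \- u)%R)) => //.
move=> a c; rewrite /K; apply: ler_weights; [by nneg|by nneg|by nneg|].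
rewrite (_ : v a - v c = (u a - u c) + ((v \- u) a - (v \- u) c))%R; last by rewrite /=; ring.
by apply: powR_normD2; exact: ltW.
Qed.

Definition cone_functional (sg b : R) (f : E -> R) (u : E1 -> R) : \bar R :=
  \int[leb R n]_x \int[leb R n.+1]_a (cone_integrand sg b f u x a)%:E.

(** What the cone estimate takes from [is_trace], in face coordinates and without p-th roots:
    seminorm on the cylinder, L^p norm on the cylinder and L^p norm on the face tend to 0
    separately. *)
Definition approx_trace (sg b : R) (f : E -> R) (u : E1 -> R) : Prop :=
  forall rad : R, (0 < rad)%R -> exists v : nat -> E1 -> R,
  [/\ forall k, continuous (v k),
      (fun k => seminorm_cyl sg b rad (v k \- u)%R) @ \oo --> 0,
      (fun k => \int[leb R n.+1]_a
         ((slab sg b a)%:R * (enorm (rV_tail a) < rad)%R%:R * `|v k a - u a| `^ p)%:E)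
        @ \oo --> 0 &
      (fun k => \int[leb R n]_x
         ((enorm x < rad)%R%:R * `|v k (rV_join (x, b)) - f x| `^ p)%:E) @ \oo --> 0].

(** At height above e the weight is at most e^(-n-m), so replacing f and u by the approximation
    costs fixed multiples of its L^p errors on face and cylinder. These multiples depend on e, but
    the errors vanish in the limit, while the coefficient of the main term is independent of e and
    rad. *)
Let cut_le : exists2 C : R, (0 <= C)%R &
  forall sg b f u (rad e : R), sg = 1%R \/ sg = (-1)%R ->
  measurable_fun setT f -> measurable_fun setT u -> (0 < rad)%R -> (0 < e)%R ->
  approx_trace sg b f u ->
  \int[leb R n]_x \int[leb R n.+1]_a ((enorm x < rad)%R%:R *
     ((e < bdist sg b a)%R%:R * cone_integrand sg b f u x a))%:E <=
  C%:E * seminorm_slab sg b u.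
Proof.
have [C C0 HC] := trace_lines; have [V V0 slabV] := slab_volume.
have [om om0 vol] := @enorm_ball_bounds R n.
exists (4 `^ p * (C * 2 `^ p))%R; first by rewrite !mulr_ge0 ?powR_ge0.
move=> sg b f u rad e sg1 mf_ mu rad0 e0 tr.
(* The cylinder of this radius contains all cones with vertex in the ball of radius rad. *)
set rad' := (rad + kap * L)%R.
have kL : (0 < kap * L)%R by rewrite mulr_gt0.
have rad'0 : (0 < rad')%R by rewrite addr_gt0.
have [v [cv v1 v2 v3]] := tr rad' rad'0.
have mv k := continuous_measurable_rV (cv k).
have K4 : (0 <= 4 `^ p)%R by exact: powR_ge0.
set X := (X in X <= _).
pose Ke := (e `^ (- (n%:R + m)))%R.
have Ke0 : (0 <= Ke)%R by exact: powR_ge0.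
have nm0 : (0 <= n%:R + m)%R by rewrite addr_ge0// ltW// (lt_trans _ m1).
pose N k := \int[leb R n]_x ((enorm x < rad')%R%:R * `|v k (rV_join (x, b)) - f x| `^ p)%:E.
pose M k := \int[leb R n.+1]_a
   ((slab sg b a)%:R * (enorm (rV_tail a) < rad')%R%:R * `|v k a - u a| `^ p)%:E.
pose Gk k := seminorm_cyl sg b rad' (v k \- u)%R.
pose V1 := (V * (kap * L) ^+ n)%R; pose V2 := (om * (kap * L) ^+ n)%R.
have V10 : (0 <= V1)%R by rewrite mulr_ge0 ?exprn_ge0// ltW.
have V20 : (0 <= V2)%R by rewrite mulr_ge0 ?exprn_ge0// ltW.
have N0 k : 0 <= N k by rewrite /N; nneg.
have M0 k : 0 <= M k by rewrite /M; nneg.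
have G0 k : 0 <= Gk k by rewrite /Gk /seminorm_cyl; nneg.
have main k : X <= (4 `^ p)%:E * (C%:E * seminorm_cyl sg b rad' (v k) +
    (Ke%:E * (V1%:E * N k) + Ke%:E * (V2%:E * M k))).
  pose Q1 (x : E) (a : E1) := ((enorm x < rad)%R%:R *
     cone_integrand sg b (fun x => v k (rV_join (x, b))) (v k) x a)%R.
  pose Q2 (x : E) (a : E1) := (((enorm x < rad')%R%:R * `|v k (rV_join (x, b)) - f x| `^ p) *
     ((slab sg b a)%:R * (enorm (rV_tail a - x) < kap * L)%R%:R))%R.
  pose Q3 (x : E) (a : E1) := (((slab sg b a)%:R * (enorm (rV_tail a) < rad')%R%:R * `|v k a - u a| `^ p) *
     (enorm (x - rV_tail a) < kap * L)%R%:R)%R.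
  have Q10 x a : (0 <= Q1 x a)%R by rewrite /Q1 mulr_ge0// cone_integrand_ge0.
  have Q20 x a : (0 <= Q2 x a)%R by rewrite /Q2; nneg.
  have Q30 x a : (0 <= Q3 x a)%R by rewrite /Q3; nneg.
  have mvk := mv k.
  have mQ1 : measurable_fun setT (fun z : E * E1 => Q1 z.1 z.2).
    by rewrite /Q1 /cone_integrand /slab; mf.
  have mQ2 : measurable_fun setT (fun z : E * E1 => Q2 z.1 z.2).
    by rewrite /Q2 /slab; mf.
  have mQ3 : measurable_fun setT (fun z : E * E1 => Q3 z.1 z.2).
    by rewrite /Q3 /slab; mf.
  have mQ23 : measurable_fun setT (fun z : E * E1 => (Ke * Q2 z.1 z.2 + Ke * Q3 z.1 z.2)%R) by mf.
  have Q230 x a : (0 <= Ke * Q2 x a + Ke * Q3 x a)%R by rewrite addr_ge0// mulr_ge0.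
  have KQ2 x a : (0 <= Ke * Q2 x a)%R by rewrite mulr_ge0.
  have KQ3 x a : (0 <= Ke * Q3 x a)%R by rewrite mulr_ge0.
  apply: (@le_trans _ _ ((4 `^ p)%:E * (\int[leb R n]_x \int[leb R n.+1]_a (Q1 x a)%:E +
      \int[leb R n]_x \int[leb R n.+1]_a (Ke * Q2 x a + Ke * Q3 x a)%:E))).
    apply: (@le_int2_add _ _ _ _ R (leb R n) (leb R n.+1) _ _ Q1 (fun x a => Ke * Q2 x a + Ke * Q3 x a)%R) => //.
      by move=> x a; do 2 (apply: mulr_ge0 => //); exact: cone_integrand_ge0.
    move=> x a.
    have rhs0 : (0 <= 4 `^ p * (Q1 x a + (Ke * Q2 x a + Ke * Q3 x a)))%R.
      by rewrite mulr_ge0// !addr_ge0// mulr_ge0.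
    have [xr|/negbTE nxr] := orP (orbN (enorm x < rad)%R); last by rewrite nxr mul0r.
    have [ea|/negbTE nea] := orP (orbN (e < bdist sg b a)%R); last by rewrite nea mul0r mulr0.
    rewrite /cone_integrand.
    have [sa|/negbTE nsa] := orP (orbN (slab sg b a)); last by rewrite nsa !mul0r !mulr0.
    have [ca|/negbTE nca] := orP (orbN (enorm (rV_tail a - x) < kap * bdist sg b a)%R); last first.
      by rewrite nca mulr0 mul0r !mulr0.
    have caL : (enorm (rV_tail a - x) < kap * L)%R.
      by rewrite (lt_trans ca)// ltr_pM2l//; case/andP: sa.
    have ar : (enorm (rV_tail a) < rad')%R.
      rewrite -[rV_tail a](subrK x) addrC (le_lt_trans (ler_enormD _ _))//.
      by rewrite /rad' ltrD.
    have xr' : (enorm x < rad')%R by rewrite (lt_trans xr)// /rad' ltrDl.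
    have xa : (enorm (x - rV_tail a) < kap * L)%R by rewrite enormBC.
    rewrite /Q1 /Q2 /Q3 /cone_integrand xr ea sa ca caL ar xr' xa !mul1r !mulr1.
    have dK : (bdist sg b a `^ (- (n%:R + m)) <= Ke)%R by apply: powR_leN => //; exact: ltW.
    set D := (bdist sg b a `^ _)%R in dK *; have D0 : (0 <= D)%R by exact: powR_ge0.
    (* The path from f x to u a goes through the values of the approximation at (x, b) and at a.
       [trace_lines] bounds the difference of these two values; the other two differences are
       errors. *)
    have := @powR_normD3 R (v k (rV_join (x, b)) - v k a)%R (- (v k (rV_join (x, b)) - f x))%R (v k a - u a)%R p (ltW p0).
    rewrite (_ : _ + _ + _ = f x - u a)%R; last by ring.
    rewrite normrN => /(ler_wpM2r D0) /le_trans; apply.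
    rewrite -mulrA ler_wpM2l// !mulrDl -addrA lerD2l.
    by apply: lerD; rewrite mulrC ler_wpM2r// powR_ge0.
  have E2 : \int[leb R n]_x \int[leb R n.+1]_a (Q2 x a)%:E <= V1%:E * N k.
    apply: le_of_eq; apply: int_eqZ => [//||x]; first by nneg.
    rewrite /Q2; under eq_integral do rewrite EFinM.
    rewrite intZ; [|by nneg|by nneg].
    by rewrite slabV// muleC.
  have E3 : \int[leb R n]_x \int[leb R n.+1]_a (Q3 x a)%:E <= V2%:E * M k.
    rewrite swap_int; [|by mf|by nneg].
    apply: le_of_eq; apply: int_eqZ => [//||a]; first by nneg.
    rewrite /Q3; under eq_integral do rewrite EFinM.
    rewrite intZ; [|by nneg|by nneg].
    by rewrite vol// muleC.
  rewrite int2D; [|exact: KQ2|exact: KQ3|by mf|by mf].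
  have I2 := @int2Z _ _ _ _ R (leb R n) (leb R n.+1) Ke Q2 Ke0 Q20.
  have I3 := @int2Z _ _ _ _ R (leb R n) (leb R n.+1) Ke Q3 Ke0 Q30.
  apply: lee_wpmul2l; first by rewrite lee_fin.
  apply: leeD; first exact: HC.
  apply: leeD.
    by apply: (le_trans (le_of_eq I2)); apply: lee_wpmul2l; [rewrite lee_fin; exact: Ke0|exact: E2].
  by apply: (le_trans (le_of_eq I3)); apply: lee_wpmul2l; [rewrite lee_fin; exact: Ke0|exact: E3].
pose B k := Gk k + (N k + M k).
have B0 : B @ \oo --> 0.
  rewrite -[X in _ --> X]adde0; apply: cvgeD => //.
  by rewrite -[X in _ --> X]adde0; apply: cvgeD.
pose c := (4 `^ p * (C * 2 `^ p + (Ke * V1 + Ke * V2)))%R.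
have P2 : (0 <= 2 `^ p)%R by exact: powR_ge0.
have c0 : (0 <= c)%R by rewrite /c; apply: mulr_ge0 => //; apply: addr_ge0; [exact: mulr_ge0|apply: addr_ge0; exact: mulr_ge0].
apply: (@lee_lim0 _ _ c B c0 B0) => k.
have S0 : 0 <= seminorm_slab sg b u by rewrite /seminorm_slab; nneg.
apply: (lee_error_comb K4 C0 P2 Ke0 V10 V20 S0 (G0 k) (N0 k) (M0 k) _ (main k)).
apply: (le_trans (seminorm_cyl_add _ _ _ mu (mv k))).
apply: lee_wpmul2l; first by rewrite lee_fin.
by apply: leeD; [exact: seminorm_cyl_le|exact: lexx].
Qed.

(** The bound on the truncated integrals is uniform, so exhausting by |x| < j + 1 and height > 1 /
    (j + 1) removes the truncation. *)
Lemma cone_functional_le_seminorm : exists2 C : R, (0 <= C)%R & forall sg b f u, sg = 1%R \/ sg = (-1)%R ->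
  measurable_fun setT f -> measurable_fun setT u -> approx_trace sg b f u ->
  cone_functional sg b f u <= C%:E * seminorm_slab sg b u.
Proof.
have [C C0 HC] := cut_le; exists C; first exact: C0.
move=> sg b f u sg1 mf_ mu tr; rewrite /cone_functional.
pose F (x : E) (a : E1) := (cone_integrand sg b f u x a)%:E.
have mF : measurable_fun setT (fun z : E * E1 => F z.1 z.2).
  by rewrite /F /cone_integrand /slab; mf.
have F0 x a : 0 <= F x a by rewrite lee_fin cone_integrand_ge0.
rewrite -(int_prod (leb R n) (leb R n.+1) mF F0).
pose cutoff (j : nat) (x : E) (a : E1) := ((enorm x < j.+1%:R)%R%:R *
     ((j.+1%:R^-1 < bdist sg b a)%R%:R * cone_integrand sg b f u x a))%R%:E.
have mcut j : measurable_fun setT (fun z : E * E1 => cutoff j z.1 z.2).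
  by rewrite /cutoff /cone_integrand /slab; mf.
have cut0 j x a : 0 <= cutoff j x a.
  by rewrite lee_fin; do 2 (apply: mulr_ge0; first exact: ler0n); exact: cone_integrand_ge0.
apply: (@int_exhaust _ _ _ _ _ (fun j (z : E * E1) => cutoff j z.1 z.2)) => [j|j [x a]|[x a]|j].
- exact: mcut.
- exact: cut0.
- rewrite /cutoff /F /=.
  have [d0|d0] := ltP 0%R (bdist sg b a); last first.
    apply: nearW => j; rewrite /cone_integrand /slab.
    by rewrite [(0 < _)%R]ltNge d0 /= !mul0r !mulr0.
  near=> j.
  have -> : (enorm x < j.+1%:R)%R.
    by near: j; apply: filterS (nbhs_infty_gtr (enorm x)) => j xj; rewrite (lt_le_trans xj)// ler_nat.
  have -> : (j.+1%:R^-1 < bdist sg b a)%R; last by rewrite !mul1r.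
  rewrite invf_plt ?posrE//.
  by near: j; apply: filterS (nbhs_infty_gtr (bdist sg b a)^-1) => j xj; rewrite (lt_le_trans xj)// ler_nat.
- rewrite (int_prod (leb R n) (leb R n.+1) (mcut j) (cut0 j)).
  by apply: HC.
Unshelve. all: by end_near. Qed.

End trace_cone.

Lemma powRDgt0 (R : realType) (r a b : R) : 0 < r -> r `^ (a + b) = r `^ a * r `^ b.
Proof. by move=> r0; rewrite powRD// (gt_eqF r0) implybT. Qed.

Ltac nn := intros; cbv beta; repeat (first [assumption
  | match goal with
    | H : (forall x, is_true _) |- is_true _ => solve [simple apply H]
    | H : (forall x y, is_true _) |- is_true _ => solve [simple apply H]
    end
  | nneg1 | apply: ltW; assumption]; cbv beta).

(** * Symmetrised and factorised multiple integrals *)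

Section le_int2_split.
Local Open Scope ereal_scope.
Context d (T : measurableType d) (R : realType) (mu : {sigma_finite_measure set T -> \bar R}).

(** Estimates on pairs produce one term for each of the two points; exchanging the variables shows
    that both have the same integral. *)
Lemma le_int2_split (c : R) (F J K : T -> T -> \bar R) : (0 < c)%R ->
  (forall x z, 0 <= F x z) -> (forall x z, 0 <= J x z) -> (forall x z, 0 <= K x z) ->
  measurable_fun setT (fun w : T * T => J w.1 w.2) ->
  measurable_fun setT (fun w : T * T => K w.1 w.2) ->
  (forall x z, c%:E * F x z <= J x z + J z x + K x z) ->
  \int[mu]_x \int[mu]_z F x z <= c^-1%:E *
    (\int[mu]_x \int[mu]_z J x z + \int[mu]_x \int[mu]_z J x z + \int[mu]_x \int[mu]_z K x z).
Proof.
move=> c0 F0 J0 K0 mJ mK H.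
have mJ' : measurable_fun setT (fun w : T * T => J w.2 w.1).
  exact: (measurable_fun2 mJ measurable_snd measurable_fst).
rewrite lee_pdivlMl//.
have -> : c%:E * \int[mu]_x \int[mu]_z F x z = \int[mu]_x \int[mu]_z (c%:E * F x z).
  apply/esym; apply: int_eqZ => [|x|x]; first exact: ltW.
    by apply: integral_ge0.
  by apply: int_eqZ; [exact: ltW|exact: F0|].
apply: (@le_trans _ _ (\int[mu]_x \int[mu]_z (J x z + J z x + K x z))).
  apply: le_int => x; first by apply: integral_ge0 => z _; rewrite mule_ge0// lee_fin ltW.
  by apply: le_int => z; rewrite ?mule_ge0// lee_fin ltW.
have m1 (G : T -> T -> \bar R) x : measurable_fun setT (fun w : T * T => G w.1 w.2) ->
    measurable_fun setT (G x).
  by move=> mG; apply: (measurable_fun2 mG).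
have mJx x := m1 _ x mJ.
have mJx' x : measurable_fun setT (J^~ x) by exact: (m1 (fun x z => J z x)).
have mKx x := m1 _ x mK.
have -> : \int[mu]_x \int[mu]_z (J x z + J z x + K x z) =
    \int[mu]_x (\int[mu]_z J x z + \int[mu]_z J z x + \int[mu]_z K x z).
  apply: eq_integral => x _.
  rewrite ge0_integralD//; [|by move=> z _; rewrite adde_ge0|exact: emeasurable_funD].
  by rewrite ge0_integralD.
have I0 (G : T -> T -> \bar R) x : (forall x z, 0 <= G x z) -> 0 <= \int[mu]_z G x z.
  by move=> G0; apply: integral_ge0.
have mI1 := measurable_int1 mu mJ J0.
have mI2 := measurable_int1 mu (F := fun x z => J z x) mJ' (fun x z => J0 z x).
have mI3 := measurable_int1 mu mK K0.
have I1 x : 0 <= \int[mu]_z J x z by apply: integral_ge0.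
have I2 x : 0 <= \int[mu]_z J z x by apply: integral_ge0.
have I3 x : 0 <= \int[mu]_z K x z by apply: integral_ge0.
apply: (le_trans (le_of_eq (ge0_integralD mu measurableT (fun x _ => adde_ge0 (I1 x) (I2 x))
  (emeasurable_funD mI1 mI2) (fun x _ => I3 x) mI3))).
apply: leeD; last exact: lexx.
apply: (le_trans (le_of_eq (ge0_integralD mu measurableT (fun x _ => I1 x) mI1 (fun x _ => I2 x) mI2))).
apply: leeD; first exact: lexx.
by apply: le_of_eq; rewrite (swap_int mu mu mJ' (fun x z => J0 z x)).
Qed.

(** For fixed a and c the integrations in x and z separate, and each has a bound independent of a
    and c. What remains is the energy of the slab points alone. *)
Lemma int4_factor d2 (T2 : measurableType d2) (nu : {sigma_finite_measure set T2 -> \bar R})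
    (k : T2 -> T2 -> R) (A B : T -> T2 -> R) (cA cB : R) :
  (0 <= cA)%R -> (0 <= cB)%R ->
  (forall a c, 0 <= k a c)%R -> (forall x a, 0 <= A x a)%R -> (forall x a, 0 <= B x a)%R ->
  measurable_fun setT (fun w : T2 * T2 => k w.1 w.2) ->
  measurable_fun setT (fun w : T * T2 => A w.1 w.2) ->
  measurable_fun setT (fun w : T * T2 => B w.1 w.2) ->
  (forall a, \int[mu]_x (A x a)%:E <= cA%:E) -> (forall a, \int[mu]_x (B x a)%:E <= cB%:E) ->
  \int[mu]_x \int[mu]_z \int[nu]_a \int[nu]_c (A x a * (B z c * k a c))%:E <=
  (cA * cB)%:E * \int[nu]_a \int[nu]_c (k a c)%:E.
Proof.
move=> cA0 cB0 k0 A0 B0 mk mA mB IA IB.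
pose h a := \int[nu]_c (k a c)%:E.
have h0 a : 0 <= h a by apply: integral_ge0 => c _; rewrite lee_fin.
have mh : measurable_fun setT h.
  by apply: (measurable_int1 nu (F := fun a c => (k a c)%:E)); [mf|move=> a c; rewrite lee_fin].
have step x : \int[mu]_z \int[nu]_a \int[nu]_c (A x a * (B z c * k a c))%:E <=
    \int[nu]_a ((A x a)%:E * (cB%:E * h a)).
  rewrite swap_int; [|by mf; apply: (measurable_fun2 mB)|by move=> z a; apply: integral_ge0 => c _; rewrite lee_fin !mulr_ge0].
  apply: le_int => a; first by apply: integral_ge0 => z _; apply: integral_ge0 => c _; rewrite lee_fin !mulr_ge0.
  apply: (@le_trans _ _ ((A x a)%:E * \int[mu]_z \int[nu]_c (B z c * k a c)%:E)).
    apply: le_of_eq; apply: int2Z => // z c; exact: mulr_ge0.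
  apply: lee_wpmul2l; first by rewrite lee_fin.
  rewrite swap_int; [|by mf|by move=> z c; rewrite lee_fin mulr_ge0].
  apply: (@le_trans _ _ (\int[nu]_c (cB%:E * (k a c)%:E))); last first.
    by apply: le_of_eq; apply: int_eqZ => // c; rewrite lee_fin.
  apply: le_int => c; first by apply: integral_ge0 => z _; rewrite lee_fin mulr_ge0.
  under eq_integral do rewrite mulrC EFinM.
  rewrite intZ//; last by move=> z; rewrite lee_fin.
  by rewrite muleC; apply: lee_wpmul2r; rewrite ?lee_fin.
apply: (@le_trans _ _ (\int[mu]_x \int[nu]_a ((A x a)%:E * (cB%:E * h a)))).
  apply: le_int => x; last exact: step.
  by do 3 (apply: integral_ge0 => ? _); rewrite lee_fin !mulr_ge0.
rewrite swap_int; [|by mf|by move=> x a; rewrite !mule_ge0// lee_fin].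
apply: (@le_trans _ _ (\int[nu]_a ((cA * cB)%:E * h a))); last first.
  by apply: le_of_eq; apply: intZ => //; exact: mulr_ge0.
apply: le_int => a; first by apply: integral_ge0 => x _; rewrite !mule_ge0// lee_fin.
rewrite ge0_integralZr//; [|by mf|by move=> x _; rewrite lee_fin|by rewrite mule_ge0// lee_fin].
by rewrite EFinM -muleA; apply: lee_wpmul2r; rewrite // mule_ge0// lee_fin.
Qed.

End le_int2_split.

(** * Screened energies of the trace *)

Section two_averages.
Local Open Scope ereal_scope.
Context d d2 (T : measurableType d) (T2 : measurableType d2) (R : realType).
Variables (mu : {sigma_finite_measure set T -> \bar R})
  (nu : {sigma_finite_measure set T2 -> \bar R}).
Variables (p V V' D K3 : R) (A : T -> T2 -> R) (w : T -> T -> R) (k : T2 -> T2 -> R)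
  (f : T -> R) (u : T2 -> R).
Hypotheses (p0 : (0 < p)%R) (V0 : (0 < V)%R) (V'0 : (0 <= V')%R) (D0 : (0 <= D)%R) (K30 : (0 <= K3)%R).
Hypotheses (A0 : forall x a, (0 <= A x a)%R) (w0 : forall x z, (0 <= w x z)%R)
  (k0 : forall a c, (0 <= k a c)%R).
Hypotheses (mA : measurable_fun setT (fun v : T * T2 => A v.1 v.2))
  (mw : measurable_fun setT (fun v : T * T => w v.1 v.2))
  (mk : measurable_fun setT (fun v : T2 * T2 => k v.1 v.2))
  (mf_ : measurable_fun setT f) (mu_ : measurable_fun setT u).
Hypotheses (volA : forall x, \int[nu]_a (A x a)%:E = V%:E)
  (volA' : forall a, \int[mu]_x (A x a)%:E <= V'%:E)
  (wC : forall x z, w x z = w z x) (intw : forall x, \int[mu]_z (w x z)%:E <= D%:E).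
Hypothesis wk : forall x z a c,
  (A x a * (A z c * (`|u a - u c| `^ p * w x z)) <= K3 * (A x a * (A z c * k a c)))%R.

Let H (x : T) (a : T2) := (A x a * `|f x - u a| `^ p)%R.
Let H0 x a : (0 <= H x a)%R. Proof. by rewrite /H; nn. Qed.
Let mH : measurable_fun setT (fun v : T * T2 => H v.1 v.2).
Proof. by rewrite /H; mf. Qed.
Let p4 : (0 <= 4 `^ p)%R. Proof. exact: powR_ge0. Qed.
Let V1 : (0 <= V)%R. Proof. exact: ltW. Qed.

Let X1 x z (a c : T2) := (H x a * (A z c * w x z))%R.
Let X3 x z (a c : T2) := (K3 * (A x a * (A z c * k a c)))%R.

Let pointwise x z a c : (A x a * (A z c * (`|f x - f z| `^ p * w x z)) <=
  4 `^ p * (X1 x z a c + X1 z x c a + X3 x z a c))%R.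
Proof.
apply: (@le_trans _ _ (4 `^ p * (X1 x z a c + X1 z x c a + A x a * (A z c * (`|u a - u c| `^ p * w x z))))%R); last first.
  by apply: ler_wpM2l => //; rewrite lerD2l; exact: wk.
rewrite /X1 /H [w z x]wC.
rewrite [leRHS](_ : _ = A x a * (A z c * (4 `^ p * (`|f x - u a| `^ p + `|f z - u c| `^ p + `|u a - u c| `^ p) * w x z)))%R; last by ring.
apply: ler_wpM2l => //; apply: ler_wpM2l => //; apply: ler_wpM2r => //.
have := @powR_normD3 R (f x - u a)%R (- (f z - u c))%R (u a - u c)%R p (ltW p0).
by rewrite (_ : _ + _ + _ = f x - f z)%R ?normrN//; ring.
Qed.

Let J (x z : T) := (4 `^ p * V * w x z)%:E * \int[nu]_a (H x a)%:E.
Let Km (x z : T) := (4 `^ p * K3)%:E * \int[nu]_a \int[nu]_c (A x a * (A z c * k a c))%:E.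
Let J0 x z : 0 <= J x z. Proof. by rewrite /J; nn. Qed.
Let Km0 x z : 0 <= Km x z. Proof. by rewrite /Km; nn. Qed.

Let mJ : measurable_fun setT (fun v : T * T => J v.1 v.2).
Proof.
rewrite /J; apply: emeasurable_funM; first by mf.
apply: (@measurable_int1 _ _ _ _ _ nu (fun w a => (H w.1 a)%:E)); first by mf.
by move=> v a; rewrite lee_fin.
Qed.

Let mKm : measurable_fun setT (fun v : T * T => Km v.1 v.2).
Proof.
rewrite /Km; apply: emeasurable_funM; first exact: measurable_cst.
apply: (@measurable_int1 _ _ _ _ _ nu
  (fun v a => \int[nu]_c (A v.1 a * (A v.2 c * k a c))%:E)); last by nn.
apply: (@measurable_int1 _ _ _ _ _ nu
  (fun v c => (A v.1.1 v.2 * (A v.1.2 c * k v.2 c))%:E)); last by nn.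
by mf.
Qed.

Let int_X1 x z : (4 `^ p)%:E * \int[nu]_a \int[nu]_c (X1 x z a c)%:E = J x z.
Proof.
rewrite /J -mulrA EFinM -muleA; congr (_ * _).
apply: int_eqZ => [|a|a]; [exact: mulr_ge0|by rewrite lee_fin|].
transitivity (\int[nu]_c ((H x a * w x z)%:E * (A z c)%:E)).
  by apply: eq_integral => c _; rewrite -EFinM; congr (_%:E); rewrite /X1; ring.
rewrite intZ; [|exact: mulr_ge0|by move=> c; rewrite lee_fin].
by rewrite volA -!EFinM; congr (_%:E); ring.
Qed.

Let mX1 x z : measurable_fun setT (fun v : T2 * T2 => X1 x z v.1 v.2).
Proof. by rewrite /X1; mf. Qed.
Let mX3 x z : measurable_fun setT (fun v : T2 * T2 => X3 x z v.1 v.2).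
Proof. by rewrite /X3; mf. Qed.
Let X10 x z a c : (0 <= X1 x z a c)%R. Proof. by rewrite /X1; nn. Qed.
Let X30 x z a c : (0 <= X3 x z a c)%R. Proof. by rewrite /X3; nn. Qed.

Let average x z : (V * V)%:E * (`|f x - f z| `^ p * w x z)%:E = \int[nu]_a \int[nu]_c
    (A x a * (A z c * (`|f x - f z| `^ p * w x z)))%:E.
Proof.
have W0 : (0 <= `|f x - f z| `^ p * w x z)%R by nn.
transitivity (\int[nu]_a ((V * (`|f x - f z| `^ p * w x z))%:E * (A x a)%:E)).
  rewrite intZ; [|exact: mulr_ge0|by move=> a; rewrite lee_fin].
  by rewrite volA -!EFinM; congr (_%:E); ring.
apply: eq_integral => a _.
transitivity (\int[nu]_c ((A x a * (`|f x - f z| `^ p * w x z))%:E * (A z c)%:E)).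
  rewrite intZ; [|exact: mulr_ge0|by move=> c; rewrite lee_fin].
  by rewrite volA -!EFinM; congr (_%:E); ring.
by apply: eq_integral => c _; rewrite -EFinM; congr (_%:E); ring.
Qed.

Let FJ x z : (V * V)%:E * (`|f x - f z| `^ p * w x z)%:E <= J x z + J z x + Km x z.
Proof.
have mX1' : measurable_fun setT (fun v : T2 * T2 => X1 z x v.2 v.1) by rewrite /X1; mf.
have I0 (X : T2 -> T2 -> R) : (forall a c, 0 <= X a c)%R -> 0 <= \int[nu]_a \int[nu]_c (X a c)%:E.
  by move=> X0; do 2 (apply: integral_ge0 => ? _); rewrite lee_fin.
rewrite average.
apply: (@le_trans _ _ ((4 `^ p)%:E * (\int[nu]_a \int[nu]_c (X1 x z a c + X1 z x c a)%:E +
    \int[nu]_a \int[nu]_c (X3 x z a c)%:E))).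
  apply: (@le_int2_add _ _ _ _ R nu nu (4 `^ p)%R
    (fun a c => A x a * (A z c * (`|f x - f z| `^ p * w x z)))%R
    (fun a c => X1 x z a c + X1 z x c a)%R (X3 x z) p4) => [a c|a c|//|//||a c].
  - by nn.
  - exact: addr_ge0.
  - exact: measurable_funD.
  - exact: mX3.
  - exact: pointwise.
apply: le_of_eq.
rewrite ge0_muleDr; [|by apply: I0 => a c; exact: addr_ge0|exact: I0].
congr (_ + _).
  rewrite (int2D nu nu (X10 x z) (fun a c => X10 z x c a) (mX1 x z) mX1').
  rewrite ge0_muleDr; [|exact: I0|by apply: I0 => a c; exact: X10].
  rewrite int_X1; congr (_ + _).
  rewrite swap_int; [exact: int_X1|exact: measurable_EFin_fun|by move=> a c; rewrite lee_fin].
rewrite /Km EFinM -muleA; congr (_ * _).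
by apply: int2Z => // a c; nn.
Qed.

(** Averages f x - f z = (f x - u a) - (f z - u c) + (u a - u c) over a near x and c near z, with
    weight [A] of mass V. The first two differences integrate to the same bridge term once the
    kernel [w] is integrated out, with mass at most D; [wk] exchanges the face kernel for the slab
    kernel in the third. *)
Lemma le_int_two_averages : \int[mu]_x \int[mu]_z (`|f x - f z| `^ p * w x z)%:E <=
  ((V * V)^-1 * (2 * (4 `^ p * V * D)))%:E * \int[mu]_x \int[nu]_a (A x a * `|f x - u a| `^ p)%:E +
  ((V * V)^-1 * (4 `^ p * K3 * (V' * V')))%:E * \int[nu]_a \int[nu]_c (k a c)%:E.
Proof.
set TT := \int[mu]_x \int[nu]_a _; set SS := \int[nu]_a \int[nu]_c _.
have T0 : 0 <= TT by rewrite /TT; nn.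
have S0 : 0 <= SS by rewrite /SS; nn.
have IJ : \int[mu]_x \int[mu]_z J x z <= (4 `^ p * V * D)%:E * TT.
  rewrite /TT -intZ; [|by nn|by nn].
  apply: le_int => x; first by nn.
  have IH0 : 0 <= \int[nu]_a (H x a)%:E by nn.
  rewrite /J ge0_integralZr//; [|by mf|by nn].
  apply: lee_wpmul2r; first exact: IH0.
  apply: (@le_trans _ _ ((4 `^ p * V)%:E * \int[mu]_z (w x z)%:E)).
    by apply: le_of_eq; apply: int_eqZ => [|z|z]; [exact: mulr_ge0|by rewrite lee_fin|].
  by rewrite [(_ * D)%:E]EFinM; apply: lee_wpmul2l; [rewrite lee_fin mulr_ge0|exact: intw].
have IK : \int[mu]_x \int[mu]_z Km x z <= (4 `^ p * K3 * (V' * V'))%:E * SS.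
  have h := int4_factor nu V'0 V'0 k0 A0 A0 mk mA mA volA' volA'.
  apply: (@le_trans _ _ ((4 `^ p * K3)%:E * \int[mu]_x \int[mu]_z
     \int[nu]_a \int[nu]_c (A x a * (A z c * k a c))%:E)).
    apply: le_of_eq; apply: int_eqZ => [|x|x]; [exact: mulr_ge0|by nn|].
    by apply: intZ; [exact: mulr_ge0|nn].
  by rewrite [(4 `^ p * K3 * _)%:E]EFinM -muleA; apply: lee_wpmul2l; [rewrite lee_fin mulr_ge0|exact: h].
have VV : (0 < V * V)%R by rewrite mulr_gt0.
have F0 x z : 0 <= (`|f x - f z| `^ p * w x z)%:E by nn.
apply: (le_trans (le_int2_split mu VV F0 J0 Km0 mJ mKm FJ)).
have iV : (0 <= (V * V)^-1)%R by rewrite invr_ge0 ltW.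
have c10 : (0 <= 4 `^ p * V * D)%R by nn.
rewrite !(EFinM (V * V)^-1) -!muleA -ge0_muleDr; [|by rewrite mule_ge0 ?lee_fin// mulr_ge0|by rewrite mule_ge0 ?lee_fin//; nn].
apply: lee_wpmul2l; first by rewrite lee_fin.
apply: leeD; last exact: IK.
rewrite mulr_natl mulr2n EFinD ge0_muleDl ?lee_fin//.
by apply: leeD; exact: IJ.
Qed.

End two_averages.

Section trace_estimates.
Context {R : realType}.
Variables (n : nat) (p m L : R).
Hypotheses (p0 : 0 < p) (m1 : 1 < m) (L0 : 0 < L).
Local Open Scope ereal_scope.
Notation E := 'rV[R]_n.
Notation E1 := 'rV[R]_n.+1.
Notation T3 := (cone_functional p m L 3).
Notation Q3 := (cone_integrand p m L 3).

Lemma shell_volume : exists2 om : R, (0 < om)%R & forall sg b (x : E) (l r rho : R),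
  sg = 1%R \/ sg = (-1)%R -> (l <= r)%R -> (0 < rho)%R ->
  \int[leb R n.+1]_a ((l < bdist sg b a < r)%R%:R * (enorm (rV_tail a - x) < rho)%R%:R)%:E =
  ((r - l) * (om * rho ^+ n))%:E.
Proof.
have [om om0 vol] := @enorm_ball_bounds R n.
exists om; first exact: om0.
move=> sg b x l r rho sg1 lr rho0.
refine (etrans (@int_boundary R n sg b sg1 _ _ _) _).
- by mf.
- by move=> a; nneg.
transitivity (\int[leb R n]_y ((r - l)%:E * (enorm (y - x) < rho)%R%:R%:E)).
  apply: eq_integral => y _.
  transitivity (\int[nu R]_t ((enorm (y - x) < rho)%R%:R%:E * (l < t < r)%R%:R%:E)).
    by apply: eq_integral => t _; rewrite bdist_join// rV_tail_join -EFinM mulrC.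
  rewrite intZ; [|exact: ler0n|by nneg].
  by rewrite nu_interval// muleC.
rewrite intZ; [|by rewrite subr_ge0|by nneg].
by rewrite vol.
Qed.

Let N2 : (0 <= n%:R + n%:R + m)%R.
Proof. by rewrite !addr_ge0// ltW// (lt_trans _ m1). Qed.

(** One slab point a serves both x and z. With r = |x - z|, take its height t in ]r/2, r[ and its
    foot within r/2 of x. Then the foot is within 3r/2 < 3t of z, whence the opening 3, and a lies
    in the slab because r < L. Such points have volume c r^(n+1). *)
Lemma near_energy_le_cone : exists2 C : R, (0 <= C)%R & forall sg b (f : E -> R) (u : E1 -> R), sg = 1%R \/ sg = (-1)%R ->
  measurable_fun setT f -> measurable_fun setT u ->
  \int[leb R n]_x \int[leb R n]_z ((enorm (x - z) < L)%R%:R *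
    (`|f x - f z| `^ p * enorm (x - z) `^ (- (n%:R + m - 1))))%:E <=
  C%:E * T3 sg b f u.
Proof.
have [om om0 vol] := shell_volume.
have [om' om'0 vol'] := @enorm_ball_bounds R n.
pose c := (om / 2 ^+ n.+1)%R.
have c0 : (0 < c)%R by rewrite divr_gt0 ?exprn_gt0.
have p2 : (0 <= 2 `^ p)%R by exact: powR_ge0.
exists (c^-1 * (2 * (2 `^ p * (om' * 2 ^+ n))))%R.
  by rewrite !mulr_ge0 ?invr_ge0 ?exprn_ge0// ltW.
move=> sg b f u sg1 mf_ mu.
pose F (x z : E) := ((enorm (x - z) < L)%R%:R *
    (`|f x - f z| `^ p * enorm (x - z) `^ (- (n%:R + m - 1))))%:E.
(* The points z with |z - x| < 2t have volume of order t^n, so with the factor t^(-n) the integral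
   in z becomes a constant and only the bridge functional is left. *)
pose H (x z : E) (a : E1) := (Q3 sg b f u x a *
   ((enorm (z - x) < 2 * bdist sg b a)%R%:R * bdist sg b a `^ (- n%:R)))%R.
have H0 x z a : (0 <= H x z a)%R by rewrite /H mulr_ge0// ?cone_integrand_ge0//; nneg.
have mH : measurable_fun setT (fun w : E * E * E1 => H w.1.1 w.1.2 w.2).
  by rewrite /H /cone_integrand /slab; mf.
have mHx x z : measurable_fun setT (fun a => H x z a).
  by rewrite /H /cone_integrand /slab; mf.
pose J (x z : E) := (2 `^ p)%:E * \int[leb R n.+1]_a (H x z a)%:E.
have F0 x z : 0 <= F x z by rewrite /F; nneg.
have J0 x z : 0 <= J x z by rewrite /J; nneg; exact: H0.
have mJ : measurable_fun setT (fun w : E * E => J w.1 w.2).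
  rewrite /J; apply: emeasurable_funM; first exact: measurable_cst.
  apply: (@measurable_int1 _ _ _ _ _ (leb R n.+1) (fun w a => (H w.1 w.2 a)%:E)).
    exact: measurable_EFin_fun.
  by move=> w a; rewrite lee_fin.
have FJ x z : c%:E * F x z <= J x z + J z x + 0.
  rewrite adde0 /F; case: ltP => [rL|_]; last by rewrite mul0r mule0 adde_ge0.
  set r := enorm (x - z) in rL *.
  have := enorm_ge0 (x - z); rewrite -/r le_eqVlt => /predU1P[r0|r0].
    have : (x - z == 0)%R by rewrite -enorm_eq0 -/r -r0.
    rewrite subr_eq0 => /eqP ->; rewrite subrr normr0 powR0 ?gt_eqF// mul0r mulr0 mule0.
    by rewrite adde_ge0.
  have r2 : (0 < r / 2)%R by rewrite divr_gt0.
  pose A (a : E1) := ((r / 2 < bdist sg b a < r)%R%:R * (enorm (rV_tail a - x) < r / 2)%R%:R : R)%R.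
  have A0 a : (0 <= A a)%R by rewrite /A; nneg.
  have volA : \int[leb R n.+1]_a (A a)%:E = (c * r ^+ n.+1)%:E.
    rewrite vol// ?ler_pdivrMr// ?ler_peMr ?ler1n// 1?ltW//.
    by congr (_%:E); rewrite /c expr_div_n !exprS; field; rewrite gt_eqF// exprn_gt0.
  pose B := (`|f x - f z| `^ p * r `^ (- (n%:R + n%:R + m)))%R.
  have B0 : (0 <= B)%R by rewrite mulr_ge0// powR_ge0.
  have -> : c%:E * (1%R%:R * (`|f x - f z| `^ p * r `^ (- (n%:R + m - 1))))%R%:E =
     \int[leb R n.+1]_a (B%:E * (A a)%:E).
    rewrite intZ; [|exact: B0|by move=> a; rewrite lee_fin].
    rewrite volA -!EFinM; congr (_%:E).
    rewrite -powR_mulrn ?ltW// mulrC mul1r.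
    have -> : (- (n%:R + m - 1) = - (n%:R + n%:R + m) + n.+1%:R :> R)%R by rewrite -natr1; ring.
    rewrite (powRDgt0 _ _ r0) /B.
    by move: (r `^ n.+1%:R)%R (r `^ (- _))%R (`|_| `^ p)%R => X Y Z; ring.
  apply: (@le_trans _ _ (\int[leb R n.+1]_a ((2 `^ p)%:E * ((H x z a)%:E + (H z x a)%:E)))).
    apply: le_int => a; first by rewrite mule_ge0// lee_fin.
    rewrite -EFinD -!EFinM lee_fin /A.
    have [ra|/negbTE nra] := orP (orbN (r / 2 < bdist sg b a < r)%R); last first.
      by rewrite nra mul0r mulr0 mulr_ge0// addr_ge0.
    have [xa|/negbTE nxa] := orP (orbN (enorm (rV_tail a - x) < r / 2)%R); last first.
      by rewrite nxa mulr0 mulr0 mulr_ge0// addr_ge0.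
    rewrite ra xa !mulr1; have /andP[ra1 ra2] := ra.
    set t := bdist sg b a in ra ra1 ra2 *; have t0 : (0 < t)%R by exact: lt_trans ra1.
    have xa3 : (enorm (rV_tail a - x) < 3 * t)%R by rewrite -/t; lra.
    have za3 : (enorm (rV_tail a - z) < 3 * t)%R.
      by apply: (le_lt_trans (ler_enormB _ x _)); rewrite -/r; lra.
    have xzt : (enorm (x - z) < 2 * t)%R by rewrite -/r; lra.
    have zxt : (enorm (z - x) < 2 * t)%R by rewrite enormBC.
    have sa : slab L sg b a by rewrite /slab -/t t0 (lt_trans ra2).
    rewrite /H /cone_integrand -/t sa xa3 za3 xzt zxt !mul1r.
    have -> : (`|f x - u a| `^ p * t `^ (- (n%:R + m)) * t `^ (- n%:R) +
       `|f z - u a| `^ p * t `^ (- (n%:R + m)) * t `^ (- n%:R) =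
       (`|f x - u a| `^ p + `|f z - u a| `^ p) * t `^ (- (n%:R + n%:R + m)))%R.
      rewrite -!mulrA -(powRDgt0 _ _ t0) -mulrDl; congr (_ * _ `^ _)%R; ring.
    rewrite mulrA /B; apply: ler_pM; [exact: powR_ge0|exact: powR_ge0| |].
      rewrite [(`|f z - _|)%R]distrC.
      exact: (powR_normB_split2 (f x) (u a) (f z) (ltW p0)).
    by apply: powR_leN; rewrite // ltW.
  rewrite intZ; [|exact: p2|by move=> a; rewrite adde_ge0// lee_fin].
  rewrite ge0_integralD//; [|by move=> a _; rewrite lee_fin|by mf|by move=> a _; rewrite lee_fin|by mf].
  by rewrite ge0_muleDr// integral_ge0// => a _; rewrite lee_fin.
have cc0 : (0 <= om' * 2 ^+ n)%R by rewrite mulr_ge0 ?exprn_ge0// ltW.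
have JT : \int[leb R n]_x \int[leb R n]_z J x z = (2 `^ p * (om' * 2 ^+ n))%:E * T3 sg b f u.
  apply: int_eqZ => [|x|x]; first exact: mulr_ge0.
    by apply: integral_ge0 => a _; rewrite lee_fin cone_integrand_ge0.
  rewrite /J; refine (etrans (intZ _ p2 _) _) => [z|].
    by apply: integral_ge0 => a _; rewrite lee_fin.
  rewrite EFinM -muleA; congr (_ * _).
  rewrite swap_int; [|by rewrite /H /cone_integrand /slab; mf|by move=> z a; rewrite lee_fin].
  apply: int_eqZ => [//|a|a]; first by rewrite lee_fin cone_integrand_ge0.
  rewrite /H; have [t0|t0] := ltP 0%R (bdist sg b a); last first.
    have Q0 : (Q3 sg b f u x a = 0)%R by rewrite /cone_integrand /slab [(0 < _)%R]ltNge t0 /= !mul0r.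
    by rewrite Q0 mule0; under eq_integral do rewrite mul0r; rewrite integral0.
  have t2 : (0 < 2 * bdist sg b a)%R by rewrite mulr_gt0.
  transitivity (\int[leb R n]_z ((Q3 sg b f u x a * bdist sg b a `^ (- n%:R))%:E *
     (enorm (z - x) < 2 * bdist sg b a)%R%:R%:E)).
    by apply: eq_integral => z _; rewrite -EFinM; congr (_%:E); ring.
  rewrite intZ; [|by rewrite mulr_ge0 ?cone_integrand_ge0 ?powR_ge0|by nneg].
  rewrite vol'// -!EFinM; congr (_%:E).
  move: (Q3 _ _ _ _ _ _) t0; clear; move: (bdist sg b a) => t q t0.
  rewrite powRN powR_mulrn ?ltW// exprMn; field.
  by rewrite expf_neq0// gt_eqF.
apply: (le_trans (@le_int2_split _ _ _ (leb R n) c F J (fun _ _ => 0) c0 F0 J0 (fun _ _ => lexx _) mJ (measurable_cst _) FJ)).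
rewrite JT; under eq_integral do rewrite integral0.
rewrite integral0 adde0.
have T0 : 0 <= T3 sg b f u by rewrite /cone_functional; nneg; exact: cone_integrand_ge0.
rewrite -ge0_muleDl; [|by rewrite lee_fin mulr_ge0|by rewrite lee_fin mulr_ge0].
rewrite muleA -EFinD -EFinM; apply: le_of_eq; congr (_%:E * _); ring.
Qed.

(** Points in the middle third of the strip whose foot is within L/3 of x belong to the cones over x
    from both faces, so f^+ and f^- are compared through u there. Both weights are at least
    L^(-n-m). *)
Lemma jump_le_cone : exists2 C : R, (0 <= C)%R & forall (bm bp : R) (fp fm : E -> R) (u : E1 -> R),
  (bp - bm = L)%R ->
  measurable_fun setT fp -> measurable_fun setT fm -> measurable_fun setT u ->
  \int[leb R n]_x (`|fp x - fm x| `^ p)%:E <=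
  C%:E * (T3 (-1) bp fp u + T3 1 bm fm u).
Proof.
have [om om0 vol] := shell_volume.
have L3 : (0 < L / 3)%R by rewrite divr_gt0.
pose c := (L / 3 * (om * (L / 3) ^+ n))%R.
have c0 : (0 < c)%R by rewrite !mulr_gt0 ?exprn_gt0 ?invr_gt0.
have p2 : (0 <= 2 `^ p)%R by exact: powR_ge0.
have nm0 : (0 <= n%:R + m)%R by rewrite addr_ge0// ltW// (lt_trans _ m1).
pose K := (L `^ (n%:R + m))%R; have K0 : (0 <= K)%R by exact: powR_ge0.
exists (c^-1 * (2 `^ p * K))%R; first by rewrite !mulr_ge0// invr_ge0 ltW.
move=> bm bp fp fm u bL mfp mfm mu.
rewrite EFinM -muleA lee_pdivlMl//.
pose A (x : E) (a : E1) := ((L / 3 < bdist 1 bm a < L / 3 + L / 3)%R%:R * (enorm (rV_tail a - x) < L / 3)%R%:R : R)%R.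
have A0 x a : (0 <= A x a)%R by rewrite /A; nneg.
have volA x : \int[leb R n.+1]_a (A x a)%:E = c%:E.
  rewrite vol//; [|by left|by rewrite lerDl ltW].
  by congr (_%:E); rewrite /c; ring.
have mA : measurable_fun setT (fun w : E * E1 => A w.1 w.2) by rewrite /A; mf.
pose Qp := Q3 (-1) bp fp u; pose Qm := Q3 1 bm fm u.
have Qp0 x a : (0 <= Qp x a)%R by exact: cone_integrand_ge0.
have Qm0 x a : (0 <= Qm x a)%R by exact: cone_integrand_ge0.
have mQp : measurable_fun setT (fun w : E * E1 => Qp w.1 w.2).
  by rewrite /Qp /cone_integrand /slab; mf.
have mQm : measurable_fun setT (fun w : E * E1 => Qm w.1 w.2).
  by rewrite /Qm /cone_integrand /slab; mf.
apply: (@le_trans _ _ (\int[leb R n]_x \int[leb R n.+1]_a (`|fp x - fm x| `^ p * A x a)%:E)).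
  rewrite -intZ; [|exact: ltW|by nneg].
  apply: le_int => x; first by rewrite mule_ge0// lee_fin ?powR_ge0// ltW.
  under [leRHS]eq_integral do rewrite EFinM.
  by rewrite intZ ?volA 1?muleC ?powR_ge0// => a; rewrite lee_fin.
apply: (@le_trans _ _ ((2 `^ p * K)%:E * (\int[leb R n]_x \int[leb R n.+1]_a (Qp x a)%:E +
   \int[leb R n]_x \int[leb R n.+1]_a (Qm x a)%:E))); last exact: lexx.
apply: (@le_int2_add _ _ _ _ R (leb R n) (leb R n.+1) (2 `^ p * K)%R
  (fun x a => `|fp x - fm x| `^ p * A x a)%R Qp Qm) => //.
- exact: mulr_ge0.
- by move=> x a; rewrite mulr_ge0// powR_ge0.
move=> x a; rewrite /A.
have R0 : (0 <= 2 `^ p * K * (Qp x a + Qm x a))%R by rewrite mulr_ge0 ?mulr_ge0// addr_ge0.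
have [ra|/negbTE nra] := orP (orbN (L / 3 < bdist 1 bm a < L / 3 + L / 3)%R); last first.
  by rewrite nra mul0r mulr0.
have [xa|/negbTE nxa] := orP (orbN (enorm (rV_tail a - x) < L / 3)%R); last first.
  by rewrite nxa !mulr0.
rewrite ra xa !mulr1; have /andP[ra1 ra2] := ra.
have tt : (bdist (-1) bp a = L - bdist 1 bm a)%R by rewrite /bdist -bL; ring.
rewrite /Qp /Qm /cone_integrand /slab tt.
set t := bdist 1 bm a in ra ra1 ra2 *.
rewrite (_ : (0 < t < L)%R); last by apply/andP; split; lra.
rewrite (_ : (0 < L - t < L)%R); last by apply/andP; split; lra.
rewrite (_ : (enorm (rV_tail a - x) < 3 * t)%R); last by lra.
rewrite (_ : (enorm (rV_tail a - x) < 3 * (L - t))%R); last by lra.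
rewrite !mul1r.
have P v : (0 < v)%R -> (v <= L)%R -> (1 <= K * v `^ (- (n%:R + m)))%R.
  move=> v0 vL; rewrite powRN -/K ler_pdivlMr ?powR_gt0// mul1r.
  by apply: powR_le; rewrite // ltW.
have Pt := P t ltac:(lra) ltac:(lra); have Pt' := P (L - t)%R ltac:(lra) ltac:(lra).
apply: (le_trans (powR_normB_split2 (fp x) (u a) (fm x) (ltW p0))).
rewrite -mulrA; apply: ler_wpM2l; first exact: p2.
rewrite [(`|u a - _|)%R]distrC mulrDr.
have aux (y v : R) : (0 <= y -> 1 <= K * v -> y <= K * (y * v))%R.
  by move=> y0 Kv; rewrite mulrCA ler_peMr.
by apply: lerD; apply: aux; rewrite ?powR_ge0.
Qed.

(** Distant cones have no common point, so two slab points of height between L/2 and L are used, one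
    near x and one near z. The slab kernel has the same exponent as the far kernel, and this is
    where the seminorm of u enters besides the bridge functional. *)
Lemma far_energy_le_cone : exists2 C : R, (0 <= C)%R & forall sg b (f : E -> R) (u : E1 -> R),
  sg = 1%R \/ sg = (-1)%R ->
  measurable_fun setT f -> measurable_fun setT u ->
  \int[leb R n]_x \int[leb R n]_z ((L <= enorm (x - z))%R%:R *
    (`|f x - f z| `^ p * enorm (x - z) `^ (- (n%:R + 1 + m))))%:E <=
  C%:E * (T3 sg b f u + seminorm_slab p m L sg b u).
Proof.
have [om om0 vol] := shell_volume.
have [om' om'0 vol'] := @enorm_ball_bounds R n.
have L2 : (0 < L / 2)%R by rewrite divr_gt0.
have m1p : (0 < 1 + m)%R by rewrite addr_gt0// (lt_trans _ m1).
have [Co Co0 HCo] := @leb_radial_out R n (1 + m) m1p.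
pose V := (L / 2 * (om * (L / 2) ^+ n))%R.
have V0 : (0 < V)%R by rewrite !mulr_gt0 ?exprn_gt0 ?invr_gt0.
pose V' := (om' * (L / 2) ^+ n)%R.
have V'0 : (0 <= V')%R by rewrite mulr_ge0 ?exprn_ge0// ltW.
have nm0 : (0 <= n%:R + m)%R by rewrite addr_ge0// ltW// (lt_trans _ m1).
pose M := (n%:R + 1 + m)%R.
have M0 : (0 <= M)%R by rewrite addr_ge0// ?addr_ge0// ltW// (lt_trans _ m1).
pose K := (L `^ (n%:R + m))%R; have K0 : (0 <= K)%R by exact: powR_ge0.
pose D := (Co * L `^ (- (1 + m)))%R; have D0 : (0 <= D)%R by rewrite mulr_ge0// powR_ge0.
have p30 : (0 <= 3 `^ M)%R by exact: powR_ge0.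
pose C1 := ((V * V)^-1 * (2 * (4 `^ p * V * D)))%R.
pose C2 := ((V * V)^-1 * (4 `^ p * 3 `^ M * (V' * V')))%R.
have V0' := ltW V0.
have C10 : (0 <= C1)%R by rewrite /C1; nneg.
have C20 : (0 <= C2)%R by rewrite /C2; nneg.
exists (C1 * K + C2)%R; first by nneg.
move=> sg b f u sg1 mf_ mu.
pose A (x : E) (a : E1) := ((L / 2 < bdist sg b a < L)%R%:R * (enorm (rV_tail a - x) < L / 2)%R%:R : R)%R.
have A0 x a : (0 <= A x a)%R by rewrite /A; nneg.
have volA x : \int[leb R n.+1]_a (A x a)%:E = V%:E.
  rewrite vol//; last by lra.
  by congr (_%:E); rewrite /V; field.
have mA : measurable_fun setT (fun w : E * E1 => A w.1 w.2) by rewrite /A; mf.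
have volA' a : \int[leb R n]_x (A x a)%:E <= V'%:E.
  rewrite -(vol' (rV_tail a) _ L2); apply: le_int => x; first by rewrite lee_fin.
  rewrite lee_fin /A enormBC; case: (_ < _ < _)%R; rewrite ?mul1r// mul0r; exact: ler0n.
pose w (x z : E) := ((L <= enorm (x - z))%R%:R * enorm (x - z) `^ (- M) : R)%R.
have w0 x z : (0 <= w x z)%R by rewrite /w; nneg.
have mw : measurable_fun setT (fun v : E * E => w v.1 v.2) by rewrite /w; mf.
have wC x z : w x z = w z x by rewrite /w enormBC.
have wD x : \int[leb R n]_z (w x z)%:E <= D%:E.
  apply: (le_trans _ (HCo x L L0)); apply: le_of_eq; apply: eq_integral => z _.
  by rewrite /w /M enormBC -addrA.
pose k (a c : E1) := ((slab L sg b a)%:R * (slab L sg b c)%:R *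
     (`|u a - u c| `^ p * enorm (a - c) `^ (- M)))%R.
have k0 a c : (0 <= k a c)%R by rewrite /k; nneg.
have mk : measurable_fun setT (fun v : E1 * E1 => k v.1 v.2) by rewrite /k /slab; mf.
have wk x z a c :
    (A x a * (A z c * (`|u a - u c| `^ p * w x z)) <= 3 `^ M * (A x a * (A z c * k a c)))%R.
  have R0 : (0 <= 3 `^ M * (A x a * (A z c * k a c)))%R by nn.
  have [rL|/negbTE rL] := orP (orbN (L <= enorm (x - z))%R); last first.
    by rewrite {1}/w rL !(mul0r, mulr0).
  have [ra|/negbTE nra] := orP (orbN (L / 2 < bdist sg b a < L)%R); last first.
    by rewrite {1}/A nra !mul0r.
  have [xa|/negbTE nxa] := orP (orbN (enorm (rV_tail a - x) < L / 2)%R); last first.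
    by rewrite {1}/A nxa mulr0 mul0r.
  have [rc|/negbTE nrc] := orP (orbN (L / 2 < bdist sg b c < L)%R); last first.
    by rewrite {2}/A nrc !mul0r mulr0.
  have [zc|/negbTE nzc] := orP (orbN (enorm (rV_tail c - z) < L / 2)%R); last first.
    by rewrite {2}/A nzc mulr0 mul0r mulr0.
  have r0 : (0 < enorm (x - z))%R by exact: lt_le_trans L0 rL.
  rewrite /A ra xa rc zc /k /w rL !mul1r.
  have /andP[ra1 ra2] := ra; have /andP[rc1 rc2] := rc.
  rewrite (_ : slab L sg b a); last by rewrite /slab ra2 (lt_trans L2).
  rewrite (_ : slab L sg b c); last by rewrite /slab rc2 (lt_trans L2).
  rewrite !mul1r.
  have := enorm_ge0 (a - c); rewrite le_eqVlt => /predU1P[ac0|ac0].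
    have : (a - c == 0)%R by rewrite -enorm_eq0 -ac0.
    by rewrite subr_eq0 => /eqP ->; rewrite subrr normr0 powR0 ?gt_eqF// !mul0r mulr0.
  rewrite [leRHS]mulrCA; apply: ler_wpM2l; first exact: powR_ge0.
  (* The feet contribute |x - z| + L and the heights L/2; since L <= |x - z| this is at most 3 |x -
     z|. *)
  have ac3 : (enorm (a - c) <= 3 * enorm (x - z))%R.
    have h1 := enorm_split a c.
    have h2 := ler_enormB (rV_tail a) x (rV_tail c).
    have h3 := ler_enormB x z (rV_tail c).
    have h4 : (enorm (z - rV_tail c) < L / 2)%R by rewrite enormBC.
    have h5 : (`|(rV_last a : R) - rV_last c| <= L / 2)%R.
      have -> : ((rV_last a : R) - rV_last c = sg * (bdist sg b a - bdist sg b c))%R.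
        by rewrite /bdist -mulrBr mulrA sg_sqr// mul1r; ring.
      by rewrite normrM sg_norm// mul1r ler_norml; apply/andP; split; lra.
    lra.
  apply: (@le_trans _ _ (3 `^ M * (3 * enorm (x - z)) `^ (- M))%R); last first.
    by apply: ler_wpM2l; [exact: powR_ge0|exact: powR_leN].
  by rewrite powRM// ?enorm_ge0// mulrA -powRDgt0// subrr powRr0 mul1r.
have HT : \int[leb R n]_x \int[leb R n.+1]_a (A x a * `|f x - u a| `^ p)%:E <= K%:E * T3 sg b f u.
  rewrite /cone_functional -int2Z; [|exact: K0|by move=> x a; exact: cone_integrand_ge0].
  apply: le_int2 => x a; first by nn.
  rewrite /A /cone_integrand.
  have R0 : (0 <= K * (((slab L sg b a)%:R * (enorm (rV_tail a - x) < 3 * bdist sg b a)%R%:R) *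
    (`|f x - u a| `^ p * bdist sg b a `^ (- (n%:R + m)))))%R by nneg.
  have [ra|/negbTE nra] := orP (orbN (L / 2 < bdist sg b a < L)%R); last first.
    by rewrite nra !mul0r.
  have [xa|/negbTE nxa] := orP (orbN (enorm (rV_tail a - x) < L / 2)%R); last first.
    by rewrite nxa mulr0 mul0r.
  have /andP[ra1 ra2] := ra; rewrite ra xa.
  rewrite (_ : slab L sg b a); last by rewrite /slab ra2 (lt_trans L2).
  rewrite (_ : (enorm (rV_tail a - x) < 3 * bdist sg b a)%R); last by lra.
  rewrite !mul1r mulrCA ler_peMr ?powR_ge0//.
  rewrite powRN -/K ler_pdivlMr ?powR_gt0 ?(lt_trans L2)// mul1r.
  by apply: powR_le; rewrite // ltW// (lt_trans L2).
have T0 : 0 <= T3 sg b f u by rewrite /cone_functional; nneg; exact: cone_integrand_ge0.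
have S0 : 0 <= seminorm_slab p m L sg b u by rewrite /seminorm_slab; nneg.
have := @le_int_two_averages _ _ _ _ R (leb R n) (leb R n.+1) p V V' D (3 `^ M)%R A w k f u
  p0 V0 V'0 D0 p30 A0 w0 k0 mA mw mk mf_ mu volA volA' wC wD wk.
move=> h; apply: (@le_trans _ _ (C1%:E * (K%:E * T3 sg b f u) + C2%:E * seminorm_slab p m L sg b u)).
  apply: (@le_trans _ _ (\int[leb R n]_x \int[leb R n]_z (`|f x - f z| `^ p * w x z)%:E)).
    apply: le_int2 => x z; first by nneg.
    by rewrite /w mulrCA.
  apply: (le_trans h); apply: leeD; last exact: lexx.
  by apply: lee_wpmul2l; [rewrite lee_fin|exact: HT].
rewrite muleA -EFinM [leRHS]ge0_muleDr//.
have CK : (0 <= C1 * K)%R by exact: mulr_ge0.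
by apply: leeD; apply: lee_wpmul2r => //; rewrite lee_fin ?lerDl ?lerDr.
Qed.

End trace_estimates.

(** * Mollification with a tent kernel *)

Section integral_bounds.
Context d (T : measurableType d) (R : realType) (mu : {measure set T -> \bar R}).
Implicit Types g h : T -> R.

Lemma integrable_le g h (c : R) : 0 <= c -> measurable_fun setT g -> (forall x, `|g x| <= c * h x) ->
  (\int[mu]_x (h x)%:E < +oo)%E -> (forall x, 0 <= h x) -> mu.-integrable setT (EFin \o g).
Proof.
move=> c0 mg gh hoo h0; apply/integrableP; split; first exact: measurable_EFin_fun.
apply: (@le_lt_trans _ _ (c%:E * \int[mu]_x (h x)%:E)%E).
  rewrite -intZ//; apply: le_int => x; first exact: abse_ge0.
  by rewrite /= -EFinM lee_fin.
exact: lte_mul_pinfty.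
Qed.

Lemma normr_Rintegral_le g (B : R) : mu.-integrable setT (EFin \o g) ->
  (\int[mu]_x (`|g x|)%:E <= B%:E)%E -> `|Rintegral mu setT g| <= B.
Proof.
move=> ig gB; apply: (le_trans (le_normr_Rintegral measurableT ig)).
rewrite /Rintegral -lee_fin fineK//.
by rewrite ge0_fin_numE ?(le_lt_trans gB) ?ltry//; apply: integral_ge0.
Qed.

(** Jensen's inequality, obtained by integrating Young's inequality g b <= g^p / p + b^q / q with
    the constant b = (I / W)^(p-1). Here W only has to bound the mass of [rho]. *)
Lemma jensen_powR (p W I : R) (rho g : T -> R) : 1 < p -> 0 < W -> 0 <= I ->
  (forall x, 0 <= rho x) -> (forall x, 0 <= g x) ->
  measurable_fun setT rho -> measurable_fun setT g ->
  (\int[mu]_x (rho x)%:E <= W%:E -> \int[mu]_x (rho x * g x)%:E = I%:E ->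
  (W * (I / W) `^ p)%:E <= \int[mu]_x (rho x * g x `^ p)%:E)%E.
Proof.
move=> p1 W0 I0 rho0 g0 mrho mg IW Ig.
have p0 : 0 < p by exact: lt_trans p1.
have p10 : 0 < p - 1 by rewrite subr_gt0.
pose q := p / (p - 1).
have q0 : 0 < q by rewrite divr_gt0.
have pq : p^-1 + q^-1 = 1 by rewrite /q; field; rewrite !gt_eqF.
pose A := I / W; have A0 : 0 <= A by rewrite divr_ge0// ltW.
pose b := A `^ (p - 1).
have b0 : 0 <= b by exact: powR_ge0.
have bq : b `^ q = A `^ p by rewrite /b -powRrM /q; congr (_ `^ _); field; rewrite gt_eqF.
have Ab : A * b = A `^ p.
  rewrite /b; move: A0; rewrite le_eqVlt => /predU1P[<-|A0].
    by rewrite mul0r powR0// gt_eqF.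
  by rewrite -{1}(powRr1 (ltW A0)) -powRDgt0//; congr (_ `^ _); ring.
set X := (X in (_ <= X)%E).
have X0 : (0 <= X)%E by apply: integral_ge0 => x _; rewrite lee_fin mulr_ge0// powR_ge0.
have key : ((b * I)%:E <= p^-1%:E * X + (q^-1 * A `^ p * W)%:E)%E.
  apply: (@le_trans _ _ (\int[mu]_x (p^-1%:E * (rho x * g x `^ p)%:E + (q^-1 * A `^ p)%:E * (rho x)%:E))%E).
    rewrite EFinM -Ig -intZ//; last by move=> x; rewrite lee_fin mulr_ge0.
    apply: le_int => x; first by rewrite mule_ge0// lee_fin// mulr_ge0.
    rewrite -!EFinM -EFinD lee_fin.
    have := conjugate_powR (g0 x) b0 p0 q0 pq; rewrite bq => h.
    have := ler_wpM2l (rho0 x) h.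
    rewrite (_ : b * _ = rho x * (g x * b)); last by ring.
    by rewrite (_ : p^-1 * _ + _ = rho x * (g x `^ p / p + A `^ p / q)); last by ring.
  rewrite ge0_integralD; [|by []|by nn|by mf|by nn|by mf].
  rewrite !intZ; [|by nn|by nn|by nn|by nn].
  rewrite [(_ * W)%:E]EFinM; apply: leeD; first exact: lexx.
  by apply: lee_wpmul2l => //; nn.
move: key; case: X X0 => [x|_ _|//]; last by rewrite leey.
rewrite lee_fin => x0; rewrite -EFinM -EFinD !lee_fin => key.
have bI : b * I = W * A `^ p by rewrite -Ab /A; field; rewrite gt_eqF.
have -> : W * A `^ p = p * (b * I - q^-1 * A `^ p * W).
  rewrite bI (_ : q^-1 = 1 - p^-1); first by field; rewrite gt_eqF.
  by rewrite -pq; ring.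
by rewrite -ler_pdivlMl// lerBlDr.
Qed.

End integral_bounds.

(** Arithmetic behind the Lipschitz bound for tent means: A / B and A' / B' are two means,
    numerators and denominators move by O(dl), and the difference is (A - A') / B + A' (B' - B) / (B
    B'). *)
Lemma quotient_diff (R : realType) (d : nat) (k om e e' dl I A A' B B' : R) :
  0 < e -> 0 <= dl -> 0 < k -> 0 <= om -> 0 <= I -> e / 2 <= e' <= 2 * e ->
  k * e ^+ d.+1 <= B -> k * e' ^+ d.+1 <= B' ->
  `|A - A'| <= 2 * dl * I -> `|B - B'| <= 2 * dl * (om * (2 * e) ^+ d) -> `|A'| <= e' * I ->
  `|A / B - A' / B'| <=
  (2 / k + 2 * om * 2 ^+ d / k * (2 ^+ d.+1 / k) * 2) * (dl / e * (I / e ^+ d)).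
Proof.
move=> e0 dl0 k0 om0 I0 /andP[e'1 e'2] Bk Bk' AA BB A'I.
have e'0 : 0 < e' by apply: lt_le_trans e'1; rewrite divr_gt0.
have k0' := ltW k0; have e0' := ltW e0.
have B0 : 0 < B by apply: lt_le_trans Bk; rewrite mulr_gt0// exprn_gt0.
have B'0 : 0 < B' by apply: lt_le_trans Bk'; rewrite mulr_gt0// exprn_gt0.
have -> : A / B - A' / B' = (A - A') / B + A' * (B' - B) / (B * B').
  by field; rewrite !gt_eqF.
apply: (le_trans (ler_normD _ _)).
have ed : 0 < e ^+ d by rewrite exprn_gt0.
rewrite [leRHS]mulrDl; apply: lerD.
  rewrite normrM normfV (gtr0_norm B0) ler_pdivrMr//; apply: (le_trans AA).
  have h0 : 0 <= 2 / k * (dl / e * (I / e ^+ d)) by nn.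
  apply: (le_trans _ (ler_wpM2l h0 Bk)); rewrite exprS le_eqVlt; apply/orP; left; apply/eqP; field.
  by rewrite !gt_eqF.
have BB0 : 0 < B * B' by rewrite mulr_gt0.
rewrite normrM normfV (gtr0_norm BB0) ler_pdivrMr// normrM.
apply: (@le_trans _ _ (e' * I * (2 * dl * (om * (2 * e) ^+ d)))).
  by apply: ler_pM => //; rewrite distrC.
have e2e : e ^+ d.+1 <= 2 ^+ d.+1 * e' ^+ d.+1.
  by rewrite -exprMn; apply: lerXn2r; rewrite ?nnegrE; lra.
have Bk2 : (k * e ^+ d.+1) * (k * (e ^+ d.+1 / 2 ^+ d.+1)) <= B * B'.
  apply: ler_pM => //; [by nn|by nn|].
  apply: (le_trans _ Bk'); apply: ler_wpM2l; first exact: ltW.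
  by rewrite ler_pdivrMr ?exprn_gt0// mulrC.
have h0 : 0 <= 2 * om * 2 ^+ d / k * (2 ^+ d.+1 / k) * 2 * (dl / e * (I / e ^+ d)).
  by nn.
apply: (le_trans _ (ler_wpM2l h0 Bk2)).
rewrite [leRHS](_ : _ = 2 * e * I * (2 * dl * (om * (2 * e) ^+ d))).
  by apply: ler_wpM2r; [nn|apply: ler_wpM2r => //; lra].
rewrite exprMn !exprS; field.
by rewrite !gt_eqF.
Qed.

Section mollifier.
Context {R : realType} (d : nat).
Notation V := 'rV[R]_d.
Notation mu := (leb R d).
Implicit Types (f : V -> R) (x y : V) (e : R).

(** Lipschitz in the centre and the radius together, unlike the indicator of a ball; the means of a
    merely integrable function inherit this. Its mass is of order e^(d+1), by which [mollify]
    divides. *)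
Definition tent e x y : R := (enorm (y - x) < e)%R%:R * (e - enorm (y - x)).

Definition mollify e f x : R :=
  Rintegral mu setT (fun y => tent e x y * f y) / Rintegral mu setT (tent e x).

Definition loc_integrable_ball f x r : Prop :=
  (\int[mu]_y ((enorm (y - x) < r)%R%:R * `|f y|)%:E < +oo)%E.

Lemma tent_ge0 e x y : 0 <= tent e x y.
Proof.
rewrite /tent; case: ltP => [h|_]; last by rewrite mul0r.
by rewrite mul1r subr_ge0 ltW.
Qed.

Lemma tent_le e x y : tent e x y <= e * (enorm (y - x) < e)%R%:R.
Proof.
rewrite /tent; case: ltP => [h|_]; last by rewrite mul0r mulr0.
by rewrite mul1r mulr1 gerBl enorm_ge0.
Qed.

Lemma tent_ge e x y : 0 < e -> e / 2 * (enorm (y - x) < e / 2)%R%:R <= tent e x y.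
Proof.
move=> e0; case: ltP => h; last by rewrite mulr0 tent_ge0.
rewrite mulr1 /tent (_ : (enorm (y - x) < e) = true); first by rewrite mul1r; lra.
by apply: (lt_trans h); lra.
Qed.

Lemma tent_lip e e' x x' y :
  `|tent e x y - tent e' x' y| <= `|e - e'| + enorm (x - x').
Proof.
have h1 := ler_enormB y x x'; have h2 := ler_enormB y x' x.
have h4 := ler_norm (e - e'); have h5 := ler_norm (e' - e).
rewrite (enormBC x' x) in h2; rewrite distrC in h5.
have h6 := enorm_ge0 (x - x').
rewrite /tent; case: ltP => k1; case: ltP => k2; rewrite ?mul1r ?mul0r ler_norml; apply/andP; split; lra.
Qed.

Lemma measurable_tent d' (T : measurableType d') e (g h : T -> V) :
  measurable_fun setT g -> measurable_fun setT h ->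
  measurable_fun setT (fun t => tent e (g t) (h t)).
Proof. by move=> mg mh; rewrite /tent; mf. Qed.

Let mtent e x : measurable_fun setT (tent e x).
Proof. by apply: (measurable_tent e (g := fun=> x) (h := id)); mf. Qed.

Let int_ball x r : (\int[mu]_y (enorm (y - x) < r)%R%:R%:E < +oo)%E.
Proof.
have [om om0 vol] := @enorm_ball_bounds R d.
have [r0|r0] := ltP 0 r; first by rewrite vol// ltry.
rewrite integral0_eq ?ltry// => y _.
by rewrite ltNge (le_trans r0) ?enorm_ge0.
Qed.

Lemma loc_integrable_ballB f (c : R) x r : measurable_fun setT f -> loc_integrable_ball f x r ->
  (\int[mu]_y ((enorm (y - x) < r)%R%:R * `|f y - c|)%:E < +oo)%E.
Proof.
move=> mf_ fx.
apply: (@le_lt_trans _ _ (\int[mu]_y (((enorm (y - x) < r)%R%:R * `|f y|)%:E + `|c|%:E * (enorm (y - x) < r)%R%:R%:E))%E).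
  apply: le_int => y; first by nneg.
  by rewrite -EFinM -EFinD lee_fin [`|c| * _]mulrC -mulrDr ler_wpM2l// ler_normB.
rewrite ge0_integralD; [|by []|by nn|by mf|by nn|by mf].
rewrite intZ; [|by []|by nn].
apply: lte_add_pinfty; first exact: fx.
exact: lte_mul_pinfty.
Qed.

Lemma integrable_tent e f x : 0 < e -> measurable_fun setT f -> loc_integrable_ball f x e ->
  mu.-integrable setT (EFin \o (fun y => tent e x y * f y)).
Proof.
move=> e0 mf_ fx.
apply: (@integrable_le _ _ _ mu _ (fun y => (enorm (y - x) < e)%R%:R * `|f y|) e) => //.
- exact: ltW.
- by apply: measurable_funM => //; exact: mtent.
- move=> y; rewrite normrM ger0_norm ?tent_ge0// mulrA; apply: ler_wpM2r => //.
  exact: tent_le.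
Qed.

Let ball1 x r : loc_integrable_ball (fun=> 1) x r.
Proof.
rewrite /loc_integrable_ball; under eq_integral do rewrite normr1 mulr1.
exact: int_ball.
Qed.

Let itent e x : 0 < e -> mu.-integrable setT (EFin \o tent e x).
Proof.
move=> e0; have := @integrable_tent e (fun=> 1) x e0 (measurable_cst _) (ball1 x e).
by under eq_fun do rewrite mulr1.
Qed.

Lemma tent_mass : exists2 k : R, 0 < k & forall e x, 0 < e ->
  k * e ^+ d.+1 <= Rintegral mu setT (tent e x).
Proof.
have [om om0 vol] := @enorm_ball_bounds R d.
exists (om / 2 ^+ d.+1); first by rewrite divr_gt0 ?exprn_gt0.
move=> e x e0; rewrite -lee_fin /Rintegral fineK; last exact: integrable_fin_num (itent x e0).
have e2 : 0 < e / 2 by rewrite divr_gt0.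
have -> : (om / 2 ^+ d.+1 * e ^+ d.+1)%:E =
    (\int[mu]_y ((e / 2)%:E * (enorm (y - x) < e / 2)%R%:R%:E))%E.
  rewrite intZ; [|exact: ltW|by nneg].
  rewrite vol// -EFinM; congr (_%:E); rewrite exprMn exprVn !exprS; field.
  by rewrite expf_neq0.
apply: le_int => y; first by rewrite mule_ge0// lee_fin// ltW.
by rewrite -EFinM lee_fin tent_ge.
Qed.

Lemma mollifyD e (a : R) f g x : 0 < e -> measurable_fun setT f -> measurable_fun setT g ->
  loc_integrable_ball f x e -> loc_integrable_ball g x e ->
  mollify e (fun y => a * f y + g y) x = a * mollify e f x + mollify e g x.
Proof.
move=> e0 mf_ mg fx gx; rewrite /mollify mulrA -mulrDl; congr (_ / _).
have if_ := integrable_tent e0 mf_ fx; have ig := integrable_tent e0 mg gx.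
rewrite -RintegralZl// -RintegralD//; last first.
  exact: (integrableZl measurableT _ if_).
by congr Rintegral; apply/funext => y; ring.
Qed.

Lemma mollify_cst e (c : R) x : 0 < e -> mollify e (fun=> c) x = c.
Proof.
move=> e0; rewrite /mollify.
have -> : (fun y => tent e x y * c) = (fun y => c * tent e x y) by apply/funext => y; rewrite mulrC.
rewrite RintegralZl//; last exact: itent.
have [k k0 /(_ e x e0) mass] := tent_mass.
rewrite mulfK// gt_eqF// (lt_le_trans _ mass)// mulr_gt0// exprn_gt0//.
Qed.

(** Means fix constants. Subtracting [c] beforehand is what turns bounds by the size of f into
    bounds by its oscillation. *)
Lemma mollify_sub e f (c : R) x : 0 < e -> measurable_fun setT f -> loc_integrable_ball f x e ->
  mollify e f x - c = mollify e (fun y => f y - c) x.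
Proof.
move=> e0 mf_ fx.
have cx : loc_integrable_ball (fun=> - c) x e.
  rewrite /loc_integrable_ball; under eq_integral do rewrite mulrC EFinM.
  rewrite intZ; [|by []|by nn].
  exact: lte_mul_pinfty.
have := @mollifyD e 1 f (fun=> - c) x e0 mf_ (measurable_cst _) fx cx.
by rewrite mollify_cst// mul1r => <-; congr mollify; apply/funext => y; rewrite mul1r.
Qed.

Lemma finite_ball f x r (c : R) : measurable_fun setT f -> loc_integrable_ball f x r ->
  exists2 I : R, 0 <= I & (\int[mu]_y ((enorm (y - x) < r)%R%:R * `|f y - c|)%:E = I%:E)%E.
Proof.
move=> mf_ fx; exists (fine (\int[mu]_y ((enorm (y - x) < r)%R%:R * `|f y - c|)%:E)%E).
  by apply: fine_ge0; nneg.
by rewrite fineK// ge0_fin_numE; [exact: loc_integrable_ballB|nneg].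
Qed.

Lemma mollify_near1 : exists2 C : R, 0 <= C & forall e f (c I : R) x, 0 < e ->
  measurable_fun setT f -> loc_integrable_ball f x e ->
  (\int[mu]_y ((enorm (y - x) < e)%R%:R * `|f y - c|)%:E = I%:E)%E ->
  `|mollify e f x - c| <= C * (I / e ^+ d).
Proof.
have [k k0 mass] := tent_mass.
exists k^-1; first by rewrite invr_ge0 ltW.
move=> e f c I x e0 mf_ fx fI.
rewrite mollify_sub// /mollify.
have mfc : measurable_fun setT (fun y => f y - c) by mf.
have fcx : loc_integrable_ball (fun y => f y - c) x e by rewrite /loc_integrable_ball fI ltry.
have ke : 0 < k * e ^+ d.+1 by rewrite mulr_gt0// exprn_gt0.
have M0 := lt_le_trans ke (mass e x e0).
rewrite normrM normfV (gtr0_norm M0) ler_pdivrMr//.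
have H : `|Rintegral mu setT (fun y => tent e x y * (f y - c))| <= e * I.
  apply: normr_Rintegral_le; first exact: integrable_tent.
  rewrite EFinM -fI -intZ; [|exact: ltW|by nneg].
  apply: le_int => y; first by nneg.
  rewrite -EFinM lee_fin normrM ger0_norm ?tent_ge0// mulrA.
  by apply: ler_wpM2r => //; exact: tent_le.
apply: (le_trans H); rewrite -mulrA ler_pdivlMl//.
have I1 : 0 <= I by rewrite -lee_fin -fI; nneg.
have I0 : 0 <= I / e ^+ d by rewrite divr_ge0// exprn_ge0// ltW.
apply: (le_trans _ (ler_wpM2l I0 (mass e x e0))).
by rewrite exprS le_eqVlt; apply/orP; left; apply/eqP; field; rewrite expf_neq0// gt_eqF.
Qed.

(** Since dl <= e / 2, both tents live in the ball of radius 2e about x, and there they differ by at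
    most 2 dl. With [c] subtracted, numerators are controlled by the oscillation on that ball. *)
Lemma mollify_near2 : exists2 C : R, 0 <= C & forall e e' dl f (c I : R) x x', 0 < e ->
  0 <= dl <= e / 2 -> `|e - e'| <= dl -> enorm (x - x') <= dl ->
  measurable_fun setT f -> loc_integrable_ball f x (2 * e) ->
  (\int[mu]_y ((enorm (y - x) < 2 * e)%R%:R * `|f y - c|)%:E = I%:E)%E ->
  `|mollify e f x - mollify e' f x'| <= C * (dl / e * (I / e ^+ d)).
Proof.
have [k k0 mass] := tent_mass.
have [om om0 vol] := @enorm_ball_bounds R d.
exists (2 / k + 2 * om * 2 ^+ d / k * (2 ^+ d.+1 / k) * 2).
  by rewrite addr_ge0 ?mulr_ge0 ?invr_ge0 ?exprn_ge0// ltW.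
move=> e e' dl f c I x x' e0 /andP[dl0 dle] ee' xx' mf_ fx fI.
have ee2 := ee'; rewrite ler_norml in ee2; have /andP[ee3 ee4] := ee2.
have e'0 : 0 < e' by lra.
have e'2 : e / 2 <= e' <= 2 * e by apply/andP; split; lra.
have mg : measurable_fun setT (fun y => f y - c) by mf.
have gx : loc_integrable_ball (fun y => f y - c) x (2 * e) by rewrite /loc_integrable_ball fI ltry.
have sub r z h : (forall y, enorm (y - z) < r -> enorm (y - x) < 2 * e) ->
    loc_integrable_ball h x (2 * e) -> loc_integrable_ball h z r.
  move=> H; apply: le_lt_trans; apply: le_int => y; first by nneg.
  rewrite lee_fin ler_wpM2r//; case: ltP => [/H ->//|_]; exact: ler0n.
have s1 y : enorm (y - x) < e -> enorm (y - x) < 2 * e by move=> ?; lra.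
have s2 y : enorm (y - x') < e' -> enorm (y - x) < 2 * e.
  by move=> ?; have := ler_enormB y x' x; rewrite (enormBC x' x); lra.
have tlip y : `|tent e x y - tent e' x' y| <= 2 * dl * (enorm (y - x) < 2 * e)%R%:R.
  case: ltP => h.
    by rewrite mulr1 (le_trans (tent_lip _ _ _ _ _))//; lra.
  rewrite /tent !ltNge (_ : (e <= enorm (y - x)) = true); last by lra.
  rewrite (_ : (e' <= enorm (y - x')) = true); first by rewrite !mul0r subrr normr0 mulr0.
  by have := ler_enormB y x' x; rewrite (enormBC x' x); lra.
have sp (a b z : R) : a - b = (a - z) - (b - z) by ring.
have F1 := sub _ _ _ s1 fx; have F2 := sub _ _ _ s2 fx.
have E1 := mollify_sub c e0 mf_ F1; have E2 := mollify_sub c e'0 mf_ F2.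
have -> : mollify e f x - mollify e' f x' =
    mollify e (fun y => f y - c) x - mollify e' (fun y => f y - c) x'.
  by rewrite -E1 -E2; exact: sp.
clear E1 E2 F1 F2.
have ig := integrable_tent e0 mg (sub _ _ _ s1 gx).
have ig' := integrable_tent e'0 mg (sub _ _ _ s2 gx).
rewrite /mollify.
set A := Rintegral _ _ _; set B := Rintegral _ _ _; set A' := Rintegral _ _ _; set B' := Rintegral _ _ _.
have I0 : 0 <= I by rewrite -lee_fin -fI; nneg.
have Bk : k * e ^+ d.+1 <= B by exact: mass.
have Bk' : k * e' ^+ d.+1 <= B' by exact: mass.
have AA : `|A - A'| <= 2 * dl * I.
  rewrite /A /A' -RintegralB//.
  apply: normr_Rintegral_le.
    exact: (integrableB measurableT ig ig').
  rewrite EFinM -fI -intZ; [|by rewrite mulr_ge0|by nneg].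
  apply: le_int => y; first by nneg.
  rewrite -EFinM lee_fin -mulrBl normrM mulrA.
  by apply: ler_wpM2r => //; exact: tlip.
have BB : `|B - B'| <= 2 * dl * (om * (2 * e) ^+ d).
  have i1 := itent x e0; have i2 := itent x' e'0.
  rewrite /B /B' -RintegralB//.
  apply: normr_Rintegral_le.
    exact: (integrableB measurableT i1 i2).
  have e20 : 0 < 2 * e by rewrite mulr_gt0.
  rewrite EFinM -(vol x (2 * e) e20) -intZ; [|by rewrite mulr_ge0|by nneg].
  apply: le_int => y; first by nneg.
  by rewrite -EFinM lee_fin tlip.
have A'I : `|A'| <= e' * I.
  apply: normr_Rintegral_le => //.
  rewrite EFinM -fI -intZ; [|exact: ltW|by nneg].
  apply: le_int => y; first by nneg.
  rewrite -EFinM lee_fin normrM ger0_norm ?tent_ge0// mulrA.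
  apply: ler_wpM2r => //; apply: (le_trans (tent_le _ _ _)).
  by rewrite ler_pM2l//; case: ltP => [/s2 ->//|_]; exact: ler0n.
clearbody A A' B B'.
exact: (@quotient_diff _ d k om e e' dl I A A' B B' e0 dl0 k0 (ltW om0) I0 e'2 Bk Bk' AA BB A'I).
Qed.

Variables (p : R).
Hypothesis p1 : 1 < p.

Let jensen_ball : exists2 C : R, 0 <= C & forall f (c I : R) x r, 0 < r -> measurable_fun setT f ->
  0 <= I -> (\int[mu]_y ((enorm (y - x) < r)%R%:R * `|f y - c|)%:E = I%:E ->
  ((I / r ^+ d) `^ p)%:E <= (C * (r ^+ d)^-1)%:E * \int[mu]_y ((enorm (y - x) < r)%R%:R * `|f y - c| `^ p)%:E)%E.
Proof.
have [om om0 vol] := @enorm_ball_bounds R d.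
exists (om `^ p / om); first by rewrite divr_ge0 ?powR_ge0// ltW.
move=> f c I x r r0 mf_ I0 fI.
have W0 : 0 < om * r ^+ d by rewrite mulr_gt0// exprn_gt0.
have := @jensen_powR _ _ _ mu p (om * r ^+ d) I (fun y => (enorm (y - x) < r)%R%:R) (fun y => `|f y - c|) p1 W0 I0.
move=> /(_ (fun y => ler0n _ _) (fun y => normr_ge0 _)).
have m1 : measurable_fun setT (fun y : V => (enorm (y - x) < r)%R%:R : R) by mf.
have m2 : measurable_fun setT (fun y => `|f y - c|) by mf.
move=> /(_ m1 m2 (le_of_eq (vol x r r0)) fI) h.
have rd0 : 0 < r ^+ d by rewrite exprn_gt0.
have c0 : 0 <= om `^ p / om * (r ^+ d)^-1 by nneg; rewrite ltW.
have := lee_wpmul2l (c0 : (0 <= (om `^ p / om * (r ^+ d)^-1)%:E)%E) h.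
move=> /(le_trans _); apply; rewrite -EFinM lee_fin le_eqVlt; apply/orP; left; apply/eqP.
have -> : I / (om * r ^+ d) = om^-1 * (I / r ^+ d) by field; rewrite !gt_eqF.
have Ir : 0 <= I / r ^+ d by rewrite divr_ge0// ltW.
have oi : om^-1 `^ p = (om `^ p)^-1 by rewrite -powR_inv1 ?(ltW om0)// -powRrM mulN1r powRN.
rewrite (@powRM _ om^-1) ?invr_ge0 ?(ltW om0)// oi.
have op : om `^ p != 0 by rewrite gt_eqF// powR_gt0.
move: ((I / _) `^ p) (om `^ p) op => X Y Y0; field.
by rewrite Y0 !gt_eqF.
Qed.

Lemma mollify_near : exists2 C : R, 0 <= C & forall e f (c : R) x, 0 < e ->
  measurable_fun setT f -> loc_integrable_ball f x e ->
  ((`|mollify e f x - c| `^ p)%:E <=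
  (C * (e ^+ d)^-1)%:E * \int[mu]_y ((enorm (y - x) < e)%R%:R * `|f y - c| `^ p)%:E)%E.
Proof.
have [C1 C10 H1] := mollify_near1; have [C2 C20 H2] := jensen_ball.
exists (C1 `^ p * C2); first by rewrite mulr_ge0// powR_ge0.
move=> e f c x e0 mf_ fx; have [I I0 fI] := finite_ball c mf_ fx.
have Ie : 0 <= I / e ^+ d by rewrite divr_ge0// exprn_ge0// ltW.
have := H2 f c I x e e0 mf_ I0 fI; have cp : 0 <= C1 `^ p by exact: powR_ge0.
move=> /(lee_wpmul2l (cp : (0 <= (C1 `^ p)%:E)%E)).
rewrite muleA -!EFinM mulrA => h; apply: (le_trans _ h).
rewrite lee_fin -powRM//; apply: powR_le => //; first by rewrite ltW// (lt_trans _ p1).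
exact: H1.
Qed.

(** Jensen on the ball of radius 2e replaces the first-power oscillation by its p-th power analogue;
    the gain (dl / e)^p is what compensates a singular kernel at small distances. *)
Lemma mollify_diff : exists2 C : R, 0 <= C & forall e e' dl f (c : R) x x', 0 < e ->
  0 <= dl <= e / 2 -> `|e - e'| <= dl -> enorm (x - x') <= dl ->
  measurable_fun setT f -> loc_integrable_ball f x (2 * e) ->
  ((`|mollify e f x - mollify e' f x'| `^ p)%:E <=
  (C * ((dl / e) `^ p * (e ^+ d)^-1))%:E *
  \int[mu]_y ((enorm (y - x) < 2 * e)%R%:R * `|f y - c| `^ p)%:E)%E.
Proof.
have [C1 C10 H1] := mollify_near2; have [C2 C20 H2] := jensen_ball.
exists ((C1 * 2 ^+ d) `^ p * C2 * (2 ^+ d)^-1); first by rewrite !mulr_ge0// ?powR_ge0// invr_ge0 exprn_ge0.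
move=> e e' dl f c x x' e0 dl0 ee' xx' mf_ fx; have [I I0 fI] := finite_ball c mf_ fx.
have e20 : 0 < 2 * e by rewrite mulr_gt0.
have Ie : 0 <= I / (2 * e) ^+ d by rewrite divr_ge0// exprn_ge0// ltW.
have /andP[dl1 _] := dl0; have de : 0 <= dl / e by rewrite divr_ge0// ltW.
have C12 : 0 <= C1 * 2 ^+ d by rewrite mulr_ge0// exprn_ge0.
have := H2 f c I x (2 * e) e20 mf_ I0 fI.
have cp : 0 <= (C1 * 2 ^+ d) `^ p * (dl / e) `^ p by rewrite mulr_ge0// powR_ge0.
move=> /(lee_wpmul2l (cp : (0 <= ((C1 * 2 ^+ d) `^ p * (dl / e) `^ p)%:E)%E)).
rewrite muleA -!EFinM => h; apply: (@le_trans _ _ _ _ _ _ (le_trans h _)).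
  rewrite lee_fin -!powRM//; [|by rewrite mulr_ge0].
  apply: powR_le => //; first by rewrite ltW// (lt_trans _ p1).
  apply: (le_trans (H1 _ _ _ _ _ _ _ _ e0 dl0 ee' xx' mf_ fx fI)).
  rewrite le_eqVlt; apply/orP; left; apply/eqP; rewrite exprMn; field.
  by rewrite !expf_neq0// ?gt_eqF.
apply: le_of_eq; congr (_%:E * _)%E; rewrite exprMn.
move: (_ `^ p) (_ `^ p) => X Y; field.
by rewrite !expf_neq0// gt_eqF.
Qed.

End mollifier.

(** * Continuity tested with the Euclidean norm *)

Lemma enorm_join_mono (R : realType) n (x : 'rV[R]_n) (s t : R) : `|s| <= `|t| ->
  enorm (rV_join (x, s)) <= enorm (rV_join (x, t)).
Proof.
move=> st; rewrite -(@ler_pXn2r _ 2)// ?nnegrE ?enorm_ge0//.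
rewrite !sqr_enorm_join lerD2l -(real_normK (num_real s)) -(real_normK (num_real t)).
by rewrite lerXn2r// nnegrE.
Qed.

Lemma near_enorm (R : realType) d (a : 'rV[R]_d) (eta : R) : 0 < eta ->
  \forall c \near a, enorm (a - c) < eta.
Proof.
(* Neighbourhoods are those of the sup norm. Dividing by d + 1 keeps the final inequality strict and
   allows d = 0. *)
move=> eta0; pose e := eta / d.+1%:R.
have e0 : 0 < e by rewrite divr_gt0.
apply/nbhs_ballP; exists e => //= c ac.
apply: (le_lt_trans (enorm_le_sum _)).
apply: (@le_lt_trans _ _ (\sum_(i < d) e)).
  by apply: ler_sum => i _; rewrite !mxE; apply: ltW; exact: ac.2.
by rewrite sumr_const card_ord -mulr_natr /e mulrAC ltr_pdivrMr// ltr_pM2l// ltr_nat.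
Qed.

Lemma continuous_enorm (R : realType) d (v : 'rV[R]_d -> R) :
  (forall a, exists K dl : R, [/\ 0 <= K, 0 < dl &
    forall c, enorm (a - c) <= dl -> `|v a - v c| <= K * enorm (a - c)]) -> continuous v.
Proof.
move=> H a; have [K [dl [K0 dl0 vK]]] := H a.
have FF := nbhs_filter a.
apply/cvgrPdist_lt => eta eta0.
have eK : 0 < eta / (K + 1) by rewrite divr_gt0// ltr_wpDl.
near=> c.
have h1 : enorm (a - c) < dl by near: c; exact: near_enorm.
have h2 : enorm (a - c) < eta / (K + 1) by near: c; exact: near_enorm.
apply: (le_lt_trans (vK c (ltW h1))).
apply: (@le_lt_trans _ _ ((K + 1) * enorm (a - c))); first by rewrite ler_wpM2r ?enorm_ge0// lerDl.
by rewrite mulrC -ltr_pdivlMr// ltr_wpDl.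
Unshelve. all: by end_near. Qed.

(** * Limits of geometric Cauchy sequences *)

Section geometric_limit.
Local Open Scope ereal_scope.
Context d (T : measurableType d) (R : realType) (mu : {measure set T -> \bar R}).
Variables (p q : R) (A : nat -> T -> R) (C : R).
Hypotheses (p0 : (0 < p)%R) (q01 : (0 < q < 1)%R) (C0 : (0 <= C)%R).
Hypothesis mA : forall k, measurable_fun setT (A k).
Hypothesis HA : forall k, \int[mu]_x (`|A k.+1 x - A k x| `^ p)%:E <= (C * q ^+ k)%:E.

(** Only half of the decay is used for summing: weighted by h^(-k), the differences still have
    geometric integrals, so their sum [G] is integrable. Where [G] is finite it gives back pointwise
    decay with ratio th = h^(1/p), hence convergence, and |A k - f|^p is at most a constant times
    h^k G. *)
Let h := Num.sqrt q.
Let th := (h `^ p^-1)%R.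
Let q0 : (0 < q)%R. Proof. by case/andP: q01. Qed.
Let h0 : (0 < h)%R. Proof. by rewrite sqrtr_gt0. Qed.
Let hh : (h ^+ 2 = q)%R. Proof. by rewrite sqr_sqrtr// ltW. Qed.
Let h1 : (h < 1)%R.
Proof. by case/andP: q01 => _ q1; rewrite -(@ltr_pXn2r _ 2)// ?nnegrE// ?ltW// hh expr1n. Qed.
Let th0 : (0 < th)%R. Proof. exact: powR_gt0. Qed.
Let thp : (th `^ p = h)%R.
Proof. by rewrite /th -powRrM mulVf ?gt_eqF// powRr1// ltW. Qed.
Let th1 : (th < 1)%R.
Proof.
rewrite ltNge; apply/negP => t1; have := powR_le (ltW p0) ler01 t1.
by rewrite thp powR1 leNgt h1.
Qed.

Let G x := \sum_(k <oo) (h ^- k * `|A k.+1 x - A k x| `^ p)%:E.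

Let g0 k x : 0 <= (h ^- k * `|A k.+1 x - A k x| `^ p)%:E.
Proof. by rewrite lee_fin mulr_ge0 ?powR_ge0// invr_ge0 exprn_ge0// ltW. Qed.

Let mg k : measurable_fun setT (fun x => (h ^- k * `|A k.+1 x - A k x| `^ p)%:E).
Proof. by have m1 := mA k; have m2 := mA k.+1; mf. Qed.

Let intG : \int[mu]_x G x <= (C / (1 - h))%:E.
Proof.
rewrite /G integral_nneseries//.
apply: nneseries_geometric_le => //; first by rewrite ltW.
  by move=> k; apply: integral_ge0 => x _; exact: g0.
move=> k; under eq_integral do rewrite EFinM.
have hk : (0 <= h ^- k)%R by rewrite invr_ge0 exprn_ge0// ltW.
rewrite intZ; [|exact: hk|by nn].
apply: (@le_trans _ _ ((h ^- k)%:E * (C * q ^+ k)%:E)).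
  by apply: lee_wpmul2l; [rewrite lee_fin|exact: HA].
rewrite -EFinM lee_fin -hh -exprM mulnC exprM expr2 le_eqVlt; apply/orP; left; apply/eqP.
by field; rewrite expf_neq0// gt_eqF.
Qed.

Let mG : measurable_fun setT G.
Proof. by apply: ge0_emeasurable_sum => // k x _ _; exact: g0. Qed.

Let G0 x : 0 <= G x.
Proof. by apply: nneseries_ge0 => k _ _; exact: g0. Qed.

Let step k x y : G x = y%:E -> (`|A k.+1 x - A k x| <= y `^ p^-1 * th ^+ k)%R.
Proof.
move=> Gx; have y0 : (0 <= y)%R by rewrite -lee_fin -Gx.
have : (h ^- k * `|A k.+1 x - A k x| `^ p)%:E <= y%:E.
  rewrite -Gx /G (nneseries_split 0 k.+1)//.
  rewrite add0n big_nat_recr//= -addeA addeCA leeDl// adde_ge0//.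
    by apply: sume_ge0 => j _; exact: g0.
  by apply: nneseries_ge0 => j _ _; exact: g0.
rewrite lee_fin ler_pdivrMl ?exprn_gt0// => H.
have p1 : (0 <= p^-1)%R by rewrite invr_ge0 ltW.
have := powR_le p1 (powR_ge0 _ _) H.
rewrite -powRrM mulfV ?gt_eqF// powRr1// => /le_trans; apply.
rewrite powRM ?exprn_ge0 ?(ltW h0)// powRXn ?(ltW h0)// mulrC; exact: lexx.
Qed.

Let tailsum k j x y : G x = y%:E ->
  (`|A (k + j)%N x - A k x| <= y `^ p^-1 * th ^+ k / (1 - th))%R.
Proof.
move=> Gx; have Y0 : (0 <= y `^ p^-1)%R by exact: powR_ge0.
have t1 : (0 < 1 - th)%R by rewrite subr_gt0.
suff : (`|A (k + j)%N x - A k x| <= y `^ p^-1 * th ^+ k * (1 - th ^+ j) / (1 - th))%R.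
  move=> /le_trans; apply; rewrite ler_pM2r ?invr_gt0// ler_piMr//.
    by rewrite mulr_ge0// exprn_ge0// ltW.
  by rewrite gerBl exprn_ge0// ltW.
elim: j => [|j IH]; first by rewrite addn0 subrr normr0 expr0 subrr mulr0 mul0r.
rewrite (_ : _ - _ = (A (k + j.+1)%N x - A (k + j)%N x) + (A (k + j)%N x - A k x))%R; last by ring.
apply: (le_trans (ler_normD _ _)).
rewrite addnS.
apply: (le_trans (lerD (step (k + j) Gx) IH)).
rewrite le_eqVlt; apply/orP; left; apply/eqP; rewrite exprD exprS; field.
by rewrite gt_eqF.
Qed.

Lemma geometric_limit : exists2 f : T -> R, measurable_fun setT f &
  (fun k => \int[mu]_x (`|A k x - f x| `^ p)%:E) @ \oo --> 0.
Proof.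
(* Set to 0 where [G] is infinite, so that the limit exists at every point and is measurable. *)
pose B k x := if G x < +oo then A k x else 0%R.
have mB k : measurable_fun setT (B k).
  apply: measurable_fun_ite; [|exact: mA|exact: measurable_cst].
  by apply: measurable_fun_lte => //; exact: measurable_cst.
have cB x : cvgn (fun k => B k x).
  rewrite /B; case: (ltP (G x) +oo) => Gx; last exact: is_cvg_cst.
  have [y Gy] : exists y, G x = y%:E by exists (fine (G x)); rewrite fineK// ge0_fin_numE.
  have th10 : (0 < 1 - th)%R by rewrite subr_gt0.
  apply: cauchy_cvg; apply/cauchy_exP => eps eps0.
  have : (fun k => y `^ p^-1 * th ^+ k / (1 - th))%R @ \oo --> (0 : R)%R.
    rewrite -[X in _ --> X](mul0r (1 - th)^-1)%R; apply: cvgMr_tmp.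
    rewrite -[X in _ --> X](mulr0 (y `^ p^-1))%R; apply: cvgMl_tmp.
    by apply: cvg_expr; rewrite ger0_norm// ltW.
  move=> /cvgr0_norm_lt /(_ _ eps0) [k _ Hk].
  exists (A k x); exists k => // i /= ki.
  rewrite /ball /= distrC -(subnKC ki); apply: (le_lt_trans (tailsum k (i - k) Gy)).
  by apply: (le_lt_trans (ler_norm _)); apply: Hk => /=.
pose f x := limn (fun k => B k x).
have mf_ : measurable_fun setT f.
  by apply: (measurable_fun_cvg (h := B)) => // x _; exact: cB.
have cC : (0 <= C / (1 - h))%R by rewrite divr_ge0// subr_ge0 ltW.
pose D := (((1 - th)^-1) `^ p * (C / (1 - h)))%R.
have D0 : (0 <= D)%R by rewrite mulr_ge0// powR_ge0.
have Goo : mu.-integrable setT G.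
  apply/integrableP; split; first exact: mG.
  under eq_integral do rewrite gee0_abs//.
  by apply: (le_lt_trans intG); rewrite ltry.
have Gae := integrable_ae measurableT Goo.
exists f; first exact: mf_.
have bound k : \int[mu]_x (`|A k x - f x| `^ p)%:E <= (D * h ^+ k)%:E.
  apply: (@le_trans _ _ (\int[mu]_x (((1 - th)^-1 `^ p * h ^+ k)%:E * G x))).
    apply: ae_ge0_le_integral => //.
    - by have mk := mA k; mf.
    - by move=> x _; rewrite mule_ge0// lee_fin mulr_ge0 ?powR_ge0 ?exprn_ge0// ltW.
    - by mf.
    move: Gae; apply: filterS => x Gx _.
    have Gf : G x \is a fin_num by exact: Gx.
    have Gy : G x = (fine (G x))%:E by rewrite fineK.
    set y := fine (G x) in Gy.
    have y0 : (0 <= y)%R by rewrite -lee_fin -Gy.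
    have th10 : (0 < 1 - th)%R by rewrite subr_gt0.
    have Af : (fun j => A (k + j)%N x) @ \oo --> f x.
      have -> : (fun j => A (k + j)%N x) = (fun j => B (j + k)%N x).
        by apply/funext => j; rewrite /B Gy ltry addnC.
      by have := cB x; rewrite -(cvg_shiftn k).
    have le1 : (`|f x - A k x| <= y `^ p^-1 * th ^+ k / (1 - th))%R.
      have h2 : (fun j => `|A (k + j)%N x - A k x|%R) @ \oo --> `|f x - A k x|%R.
        by apply: cvg_norm; apply: cvgB => //; exact: cvg_cst.
      rewrite -(cvg_lim _ h2)//; apply: limr_le; first by apply/cvg_ex; eexists; exact: h2.
      by apply: nearW => j; exact: tailsum.
    rewrite Gy -EFinM lee_fin distrC.
    apply: (le_trans (powR_le (ltW p0) (normr_ge0 _) le1)).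
    rewrite powRM; [|by rewrite mulr_ge0 ?powR_ge0 ?exprn_ge0// ltW|by rewrite invr_ge0 ltW].
    rewrite powRM; [|exact: powR_ge0|by rewrite exprn_ge0// ltW].
    rewrite -powRrM mulVf ?gt_eqF// powRr1// powRXn ?(ltW th0)// thp.
    by rewrite le_eqVlt; apply/orP; left; apply/eqP; ring.
  rewrite intZ; [|by rewrite mulr_ge0 ?powR_ge0 ?exprn_ge0// ltW|by []].
  have c0 : (0 <= (1 - th)^-1 `^ p * h ^+ k)%R by rewrite mulr_ge0 ?powR_ge0 ?exprn_ge0// ltW.
  apply: (le_trans (lee_wpmul2l (c0 : 0 <= ((1 - th)^-1 `^ p * h ^+ k)%:E) intG)).
  by rewrite -EFinM lee_fin le_eqVlt; apply/orP; left; apply/eqP; rewrite /D; ring.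
apply: (@squeeze_cvge _ _ _ _ (cst 0) _ (fun k => (D * h ^+ k)%:E)).
- by apply: nearW => k; rewrite bound andbT; apply: integral_ge0 => x _; rewrite lee_fin powR_ge0.
- exact: cvg_cst.
- apply: cvg_EFin; first by apply: nearW.
  rewrite -[X in _ --> X](mulr0 D); apply: cvgMl_tmp.
  by apply: cvg_expr; rewrite ger0_norm// ltW.
Qed.

End geometric_limit.

Section clamp.
Context {R : realType}.
Variables lo hi : R.
Hypothesis lohi : lo <= hi.

Definition clamp (t : R) : R := if t < lo then lo else if hi < t then hi else t.

Lemma clamp_bounds t : lo <= clamp t <= hi.
Proof.
by rewrite /clamp; case: (ltP t lo) => h1; case: (ltP hi t) => h2; apply/andP; split => /=; move: lohi; lra.
Qed.

Lemma clamp_dist (t e : R) : lo - e <= t -> t <= hi + e -> 0 <= e -> `|clamp t - t| <= e.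
Proof.
by move=> t1 t2 e0; rewrite /clamp ler_norml; case: (ltP t lo) => h1; case: (ltP hi t) => h2; apply/andP; split => /=; move: lohi; lra.
Qed.

Lemma clamp_lip (t r : R) : `|clamp t - clamp r| <= `|t - r|.
Proof.
have h1 := ler_norm (t - r); have h2 := ler_norm (r - t); rewrite distrC in h2.
rewrite /clamp ler_norml; case: (ltP t lo) => h3; case: (ltP r lo) => h4;
  case: (ltP hi t) => h5; case: (ltP hi r) => h6; apply/andP; split => /=; move: lohi; lra.
Qed.

End clamp.

(** * Approximation by continuous functions *)

Section density.
Context {R : realType}.
Variables (n : nat) (p m L sg b : R) (u : 'rV[R]_n.+1 -> R).
Hypotheses (p1 : 1 < p) (m1 : 1 < m) (mp : m < p) (L0 : 0 < L) (sg1 : sg = 1 \/ sg = -1).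
Local Open Scope ereal_scope.
Notation E := 'rV[R]_n.
Notation E1 := 'rV[R]_n.+1.
Notation M := (n%:R + 1 + m)%R.
Notation slab := (slab L sg b).
Notation S := (seminorm_slab p m L sg b u).
Hypothesis mu : measurable_fun setT u.
Hypothesis LI : forall x r, (r < bdist sg b x)%R -> (bdist sg b x + r < L)%R ->
  loc_integrable_ball u x r.
Hypothesis S_fin : S < +oo.

Let p0 : (0 < p)%R. Proof. exact: lt_trans p1. Qed.
Let m0 : (0 < m)%R. Proof. exact: lt_trans m1. Qed.
Let M0 : (0 <= M)%R. Proof. by rewrite addr_ge0 ?(ltW m0)// addr_ge0. Qed.

(* Pushing the centre into the region 3e <= bdist <= L - 3e moves it by at most 3e
   and keeps the ball of radius 2e inside the slab. *)
Definition inner_point (e : R) (a : E1) : E1 :=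
  rV_join (rV_tail a, (sg * clamp (3 * e)%R (L - 3 * e)%R (bdist sg b a) + b)%R).

Definition interior_mollify (e : R) (a : E1) : R := mollify e u (inner_point e a).

Section fixed_scale.
Variables (e C1 C2 Co Ci : R).
Hypotheses (C10 : (0 <= C1)%R) (C20 : (0 <= C2)%R) (Co0 : (0 <= Co)%R) (Ci0 : (0 <= Ci)%R).
Hypothesis near1 : forall e (f : E1 -> R) (c : R) x, (0 < e)%R ->
  measurable_fun setT f -> loc_integrable_ball f x e ->
  (`|mollify e f x - c| `^ p)%:E <=
  (C1 * (e ^+ n.+1)^-1)%:E * \int[leb R n.+1]_y ((enorm (y - x) < e)%R%:R * `|f y - c| `^ p)%:E.
Hypothesis near2 : forall e e' dl (f : E1 -> R) (c : R) x x', (0 < e)%R ->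
  (0 <= dl <= e / 2)%R -> (`|e - e'| <= dl)%R -> (enorm (x - x') <= dl)%R ->
  measurable_fun setT f -> loc_integrable_ball f x (2 * e)%R ->
  (`|mollify e f x - mollify e' f x'| `^ p)%:E <=
  (C2 * ((dl / e) `^ p * (e ^+ n.+1)^-1))%:E *
  \int[leb R n.+1]_y ((enorm (y - x) < 2 * e)%R%:R * `|f y - c| `^ p)%:E.
Hypothesis radial_out : forall (a : E1) r, (0 < r)%R ->
  \int[leb R n.+1]_c ((r <= enorm (c - a))%R%:R * enorm (c - a) `^ (- M))%:E
    <= (Co * r `^ (- m))%:E.
Hypothesis radial_in : forall (a : E1) r, (0 < r)%R ->
  \int[leb R n.+1]_c ((0 < enorm (c - a) < r)%R%:R * enorm (c - a) `^ (p - M))%:E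
    <= (Ci * r `^ (p - m))%:E.
Hypotheses (e0 : (0 < e)%R) (eL : (6 * e <= L)%R).
Notation psi := (inner_point e).
Notation v := (interior_mollify e).

Let bdist_psi a : bdist sg b (psi a) = clamp (3 * e)%R (L - 3 * e)%R (bdist sg b a).
Proof. exact: bdist_join. Qed.

Let psi_bounds a : (3 * e <= bdist sg b (psi a) <= L - 3 * e)%R.
Proof.
rewrite bdist_psi; apply: clamp_bounds; move: eL; lra.
Qed.

Lemma psi_ball a c : (enorm (c - psi a) < 2 * e)%R -> slab c.
Proof.
move=> h; have := le_lt_trans (bdist_lip b sg1 c (psi a)) h.
have /andP[h1 h2] := psi_bounds a.
by rewrite ltr_norml => /andP[h3 h4]; rewrite /slab; apply/andP; split; move: e0; lra.
Qed.

Let psi_dist a : slab a -> (enorm (psi a - a) <= 3 * e)%R.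
Proof.
move=> /andP[a1 a2]; apply: (le_trans (enorm_split _ _)).
rewrite /inner_point rV_tail_join rV_last_join subrr enorm0 add0r.
have -> : (sg * clamp (3 * e)%R (L - 3 * e)%R (bdist sg b a) + b - rV_last a =
   sg * (clamp (3 * e)%R (L - 3 * e)%R (bdist sg b a) - bdist sg b a))%R.
  by rewrite mulrBr /bdist mulrA sg_sqr// mul1r; ring.
by rewrite normrM sg_norm// mul1r; apply: clamp_dist; move: e0 eL; lra.
Qed.

Let psi_lip a c : (enorm (psi a - psi c) <= enorm (a - c))%R.
Proof.
rewrite /inner_point rV_joinB -[in leRHS](rV_joinE a) -[in leRHS](rV_joinE c) rV_joinB.
apply: enorm_join_mono.
have -> : ((rV_last a : R) - rV_last c = sg * (bdist sg b a - bdist sg b c))%R.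
  by rewrite /bdist -mulrBr mulrA sg_sqr// mul1r; ring.
set x := clamp _ _ _; set y := clamp _ _ _.
have -> : (sg * x + b - (sg * y + b) = sg * (x - y))%R by ring.
by rewrite !normrM ler_wpM2l//; apply: clamp_lip; move: e0 eL; lra.
Qed.

Let LIpsi a : loc_integrable_ball u (psi a) (2 * e)%R.
Proof. by have /andP[h1 h2] := psi_bounds a; apply: LI; move: e0; lra. Qed.

Lemma LIpsi1 a : loc_integrable_ball u (psi a) e.
Proof. by have /andP[h1 h2] := psi_bounds a; apply: LI; move: e0; lra. Qed.

Lemma continuous_interior_mollify : continuous v.
Proof.
apply: continuous_enorm => a; have [C C0 H] := @mollify_near2 R n.+1.
have [I I0 HI] := finite_ball 0%R mu (LIpsi a).
exists (C * (I / e ^+ n.+1) / e)%R, (e / 2)%R; split.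
- by rewrite !mulr_ge0// invr_ge0 ?exprn_ge0// ltW.
- by rewrite divr_gt0.
move=> c ac.
have h := H e e (enorm (a - c)) u 0%R I (psi a) (psi c) e0.
apply: (le_trans (h _ _ _ mu (LIpsi a) HI)).
- by rewrite enorm_ge0.
- by rewrite subrr normr0 enorm_ge0.
- exact: psi_lip.
rewrite le_eqVlt; apply/orP; left; apply/eqP; field.
by rewrite ?expf_neq0 ?gt_eqF.
Qed.

(** The inner point is within 3e of a and the means see a ball of radius 2e about it, whence 5e. All
    errors are thus controlled by the energy of pairs near the diagonal, which vanishes as e tends
    to 0. *)
Definition local_energy (a : E1) : \bar R := \int[leb R n.+1]_c
  ((slab a)%:R * (slab c)%:R * (enorm (a - c) < 5 * e)%R%:R *
    (`|u a - u c| `^ p * enorm (a - c) `^ (- M)))%:E.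

Lemma local_energy_ge0 a : 0 <= local_energy a.
Proof. by rewrite /local_energy; nneg. Qed.

Lemma measurable_local_energy : measurable_fun setT local_energy.
Proof.
apply: (@measurable_int1 _ _ _ _ _ (leb R n.+1) (fun a c =>
  ((slab a)%:R * (slab c)%:R * (enorm (a - c) < 5 * e)%R%:R *
    (`|u a - u c| `^ p * enorm (a - c) `^ (- M)))%:E)); first by rewrite /slab; mf.
by move=> a c; nneg.
Qed.

Let ball_energy a r : (0 < r <= 2 * e)%R -> slab a ->
  \int[leb R n.+1]_c ((enorm (c - psi a) < r)%R%:R * `|u c - u a| `^ p)%:E <=
  ((5 * e) `^ M)%:E * local_energy a.
Proof.
move=> /andP[r0 re] sa; rewrite /local_energy -intZ; [|exact: powR_ge0|by nneg].
apply: le_int => c; first by nneg.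
rewrite -EFinM lee_fin.
have R0 : (0 <= (5 * e) `^ M * ((slab a)%:R * (slab c)%:R * (enorm (a - c) < 5 * e)%R%:R *
    (`|u a - u c| `^ p * enorm (a - c) `^ (- M))))%R by nneg.
case: ltP => [cr|_]; last by rewrite mul0r.
have c2 : (enorm (c - psi a) < 2 * e)%R by exact: lt_le_trans re.
have ac : (enorm (a - c) < 5 * e)%R.
  by have := ler_enormB c (psi a) a; have := psi_dist sa; rewrite (enormBC a c); move: e0; lra.
rewrite ac sa (psi_ball c2) !mul1r distrC.
have := enorm_ge0 (a - c); rewrite le_eqVlt => /predU1P[ac0|ac0].
  have : (a - c == 0)%R by rewrite -enorm_eq0 -ac0.
  by rewrite subr_eq0 => /eqP ->; rewrite subrr normr0 powR0 ?gt_eqF// !mul0r mulr0.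
rewrite mulrCA ler_peMr ?powR_ge0// powRN ler_pdivlMr ?powR_gt0// mul1r.
by apply: powR_le; rewrite // ltW.
Qed.

Let scale_const (C : R) : (C * (e ^+ n.+1)^-1 * (5 * e) `^ M = C * 5 `^ M * e `^ m)%R.
Proof.
rewrite powRM ?(ltW e0)//.
have -> : (M = n.+1%:R + m)%R by rewrite -natr1; ring.
rewrite (@powRDgt0 _ e)// powR_mulrn ?(ltW e0)//.
by field; rewrite expf_neq0// gt_eqF.
Qed.

Let error_at a : slab a ->
  (`|v a - u a| `^ p)%:E <= (C1 * 5 `^ M * e `^ m)%:E * local_energy a.
Proof.
move=> sa; apply: (le_trans (near1 (u a) e0 mu (LIpsi1 a))).
have c0 : (0 <= C1 * (e ^+ n.+1)^-1)%R by rewrite mulr_ge0// invr_ge0 exprn_ge0// ltW.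
have e2 : (0 < e <= 2 * e)%R by rewrite e0/=; move: e0; lra.
apply: (le_trans (lee_wpmul2l (c0 : 0 <= (C1 * (e ^+ n.+1)^-1)%:E) (ball_energy e2 sa))).
by rewrite muleA -EFinM scale_const.
Qed.

(** At scale e the mollification is Lipschitz, with size set by the oscillation of u; the factor |a
    - c|^p will beat the kernel |a - c|^(-n-1-m) because m < p. *)
Let diff_at a c : slab a -> (enorm (a - c) <= e / 2)%R ->
  (`|v a - v c| `^ p)%:E <=
  (C2 * 5 `^ M * (enorm (a - c) `^ p * e `^ (m - p)))%:E * local_energy a.
Proof.
move=> sa ac; have d0 := enorm_ge0 (a - c).
have dl : (0 <= enorm (a - c) <= e / 2)%R by rewrite d0.
have ee : (`|e - e| <= enorm (a - c))%R by rewrite subrr normr0.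
apply: (le_trans (near2 (u a) e0 dl ee (psi_lip a c) mu (LIpsi a))).
set X := (enorm (a - c) / e)%R.
have c0 : (0 <= C2 * (X `^ p * (e ^+ n.+1)^-1))%R.
  by rewrite mulr_ge0// mulr_ge0 ?powR_ge0// invr_ge0 exprn_ge0// ltW.
have e2 : (0 < 2 * e <= 2 * e)%R by rewrite lexx andbT; move: e0; lra.
apply: (le_trans (lee_wpmul2l (c0 : 0 <= (C2 * (X `^ p * (e ^+ n.+1)^-1))%:E) (ball_energy e2 sa))).
rewrite muleA -EFinM; apply: lee_wpmul2r; first exact: local_energy_ge0.
rewrite lee_fin mulrA scale_const /X powRM ?invr_ge0 ?(ltW e0)//.
have -> : (e^-1 `^ p = e `^ (- p))%R by rewrite -powR_inv1 ?(ltW e0)// -powRrM mulN1r.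
rewrite (@powRDgt0 _ e)// le_eqVlt; apply/orP; left; apply/eqP.
by ring.
Qed.

Let mslab : measurable_fun setT (fun a : E1 => (slab a)%:R : R).
Proof. by rewrite /slab; mf. Qed.

Let K (a c : E1) : R := (2 `^ p * ((slab a)%:R * (slab c)%:R * (enorm (a - c) < 5 * e)%R%:R *
    (`|u a - u c| `^ p * enorm (a - c) `^ (- M))))%R.
Let K0 a c : (0 <= K a c)%R. Proof. by rewrite /K; nneg. Qed.
Let mK : measurable_fun setT (fun z : E1 * E1 => K z.1 z.2).
Proof. by rewrite /K /slab; mf. Qed.

Let A1 := (2 `^ p * (C2 * 5 `^ M))%R.
Let A2 := (2 `^ p * (C1 * 5 `^ M))%R.
Let A10 : (0 <= A1)%R. Proof. by rewrite /A1 !mulr_ge0 ?powR_ge0. Qed.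
Let A20 : (0 <= A2)%R. Proof. by rewrite /A2 !mulr_ge0 ?powR_ge0. Qed.

(** Multiplier of the local energy at a. Pairs closer than e/2 use the Lipschitz bound [diff_at],
    the others the size bound [error_at]. Its integral in c does not depend on e, as [int_kk] shows:
    the powers of e cancel in both terms. *)
Let kk (a c : E1) : R := (A1 * e `^ (m - p) * ((0 < enorm (c - a) < e)%R%:R * enorm (c - a) `^ (p - M)) +
   A2 * e `^ m * ((e / 2 <= enorm (c - a))%R%:R * enorm (c - a) `^ (- M)))%R.
Let kk0 a c : (0 <= kk a c)%R.
Proof. by rewrite /kk; nn. Qed.
Let mkk : measurable_fun setT (fun z : E1 * E1 => kk z.1 z.2).
Proof. by rewrite /kk; mf. Qed.

Let int_kk a : \int[leb R n.+1]_c (kk a c)%:E <= (A1 * Ci + A2 * Co * 2 `^ m)%:E.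
Proof.
have e2 : (0 < e / 2)%R by rewrite divr_gt0.
under eq_integral do rewrite /kk EFinD.
rewrite ge0_integralD; [|by []|by nn|by mf|by nn|by mf].
rewrite EFinD; apply: leeD.
  under eq_integral do rewrite EFinM.
  rewrite intZ; [|by rewrite mulr_ge0// powR_ge0|by nneg].
  have c0 : (0 <= A1 * e `^ (m - p))%R by rewrite mulr_ge0// powR_ge0.
  apply: (le_trans (lee_wpmul2l (c0 : 0 <= (A1 * e `^ (m - p))%:E) (radial_in a e0))).
  rewrite -EFinM lee_fin [leLHS](_ : _ = A1 * Ci * (e `^ (m - p) * e `^ (p - m)))%R; last by ring.
  by rewrite -powRDgt0// (_ : m - p + (p - m) = 0)%R ?powRr0 ?mulr1//; ring.
under eq_integral do rewrite EFinM.
rewrite intZ; [|by rewrite mulr_ge0// powR_ge0|by nneg].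
have c0 : (0 <= A2 * e `^ m)%R by rewrite mulr_ge0// powR_ge0.
apply: (le_trans (lee_wpmul2l (c0 : 0 <= (A2 * e `^ m)%:E) (radial_out a e2))).
rewrite -EFinM lee_fin powRM ?invr_ge0 ?(ltW e0)//.
have -> : (2^-1 `^ (- m) = 2 `^ m)%R by rewrite -powR_inv1// -powRrM mulrNN mul1r.
rewrite [leLHS](_ : _ = A2 * Co * 2 `^ m * (e `^ m * e `^ (- m)))%R; last by ring.
by rewrite -powRDgt0// subrr powRr0 mulr1.
Qed.

Let w := (v \- u)%R.
Let J (a c : E1) := ((slab a)%:R * kk a c)%:E * local_energy a.
Let J0 a c : 0 <= J a c.
Proof. by rewrite /J; apply: mule_ge0; [rewrite lee_fin; apply: mulr_ge0; [exact: ler0n|exact: kk0]|exact: local_energy_ge0]. Qed.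
Let mJ : measurable_fun setT (fun z : E1 * E1 => J z.1 z.2).
Proof.
rewrite /J; apply: emeasurable_funM.
  apply: measurable_EFin_fun; apply: measurable_funM; last exact: mkk.
  exact: (measurableT_comp mslab measurable_fst).
exact: (measurableT_comp measurable_local_energy measurable_fst).
Qed.
(** With w = v - u: at short distance v and u are estimated separately, u contributing [K], its own
    energy near the diagonal. At larger distance it is w a and w c that are estimated separately. *)
Let error_pair a c : ((slab a)%:R * (slab c)%:R *
    (`|w a - w c| `^ p * enorm (a - c) `^ (- M)))%:E <= J a c + J c a + (K a c)%:E.
Proof.
have rhs0 : 0 <= J a c + J c a + (K a c)%:E by rewrite !adde_ge0// lee_fin.
have [sa|/negbTE nsa] := orP (orbN (slab a)); last by rewrite nsa !mul0r.
have [sc|/negbTE nsc] := orP (orbN (slab c)); last by rewrite nsc mulr0 mul0r.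
have := enorm_ge0 (a - c); rewrite le_eqVlt => /predU1P[ac0|ac0].
  have : (a - c == 0)%R by rewrite -enorm_eq0 -ac0.
  rewrite subr_eq0 => /eqP ac; move: rhs0; rewrite ac => rhs0.
  by rewrite [(w c - w c)%R]subrr normr0 powR0 ?gt_eqF// !(mul0r, mulr0).
have k0 : (0 <= enorm (a - c) `^ (- M))%R by exact: powR_ge0.
rewrite sa sc !mul1r.
have [h|h] := lerP (enorm (a - c)) (e / 2)%R.
  apply: (@le_trans _ _ (((slab a)%:R * kk a c)%:E * local_energy a + (K a c)%:E)); last first.
    by apply: leeD; [exact: leeDl|].
  apply: (@le_trans _ _ ((2 `^ p * enorm (a - c) `^ (- M))%:E * ((`|v a - v c| `^ p)%:E) +
     (2 `^ p * (`|u a - u c| `^ p * enorm (a - c) `^ (- M)))%:E)).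
    rewrite -EFinM -EFinD lee_fin.
    have := @powR_normD2 R (v a - v c)%R (- (u a - u c))%R p (ltW p0).
    have -> : ((v a - v c) + - (u a - u c) = w a - w c)%R.
      by rewrite /w /=; move: (v a) (v c) (u a) (u c) => x1 x2 x3 x4; ring.
    rewrite normrN.
    move=> /(ler_wpM2r k0) /le_trans; apply.
    by rewrite le_eqVlt; apply/orP; left; apply/eqP; ring.
  apply: leeD; last first.
    rewrite lee_fin /K sa sc (_ : (enorm (a - c) < 5 * e)%R) ?mul1r//.
    by move: e0 h; lra.
  have c0 : (0 <= 2 `^ p * enorm (a - c) `^ (- M))%R by rewrite mulr_ge0// powR_ge0.
  apply: (le_trans (lee_wpmul2l (c0 : 0 <= (2 `^ p * enorm (a - c) `^ (- M))%:E) (diff_at sa h))).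
  rewrite muleA -EFinM; apply: lee_wpmul2r; first exact: local_energy_ge0.
  rewrite lee_fin sa mul1r /kk (enormBC c a) (_ : (0 < enorm (a - c) < e)%R); last first.
    by rewrite ac0/=; move: e0 h; lra.
  apply: ler_wpDr; first by nn.
  rewrite mul1r (@powRDgt0 _ (enorm (a - c)))// /A1 le_eqVlt; apply/orP; left; apply/eqP.
  by ring.
apply: (@le_trans _ _ (((slab a)%:R * kk a c)%:E * local_energy a + ((slab c)%:R * kk c a)%:E * local_energy c)); last first.
  by rewrite leeDl// lee_fin.
apply: (@le_trans _ _ ((2 `^ p * enorm (a - c) `^ (- M))%:E * ((`|w a| `^ p)%:E) +
     (2 `^ p * enorm (a - c) `^ (- M))%:E * ((`|w c| `^ p)%:E))).
  rewrite -!EFinM -EFinD lee_fin.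
  have := @powR_normD2 R (w a) (- w c)%R p (ltW p0).
  rewrite normrN => /(ler_wpM2r k0) /le_trans; apply.
  by rewrite le_eqVlt; apply/orP; left; apply/eqP; ring.
have aux x y : slab x -> (e / 2 < enorm (x - y))%R -> enorm (x - y) = enorm (a - c) ->
    (2 `^ p * enorm (a - c) `^ (- M))%:E * ((`|w x| `^ p)%:E) <= ((slab x)%:R * kk x y)%:E * local_energy x.
  move=> sx xy xyac.
  have c0 : (0 <= 2 `^ p * enorm (a - c) `^ (- M))%R by rewrite mulr_ge0// powR_ge0.
  apply: (le_trans (lee_wpmul2l (c0 : 0 <= (2 `^ p * enorm (a - c) `^ (- M))%:E) (error_at sx))).
  rewrite muleA -EFinM; apply: lee_wpmul2r; first exact: local_energy_ge0.
  rewrite lee_fin sx mul1r /kk (enormBC y x) xyac (_ : (e / 2 <= enorm (a - c))%R); last by rewrite -xyac ltW.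
  apply: ler_wpDl; first by nn.
  rewrite mul1r /A2 le_eqVlt; apply/orP; left; apply/eqP.
  by ring.
by apply: leeD; apply: aux => //; rewrite enormBC.
Qed.

Definition energy : \bar R := \int[leb R n.+1]_a local_energy a.

Let energy0 : 0 <= energy.
Proof. by apply: integral_ge0 => a _; exact: local_energy_ge0. Qed.

Lemma seminorm_error : seminorm_slab p m L sg b w <=
  (2 * (A1 * Ci + A2 * Co * 2 `^ m) + 2 `^ p)%:E * energy.
Proof.
set D := (A1 * Ci + A2 * Co * 2 `^ m)%R.
have D0 : (0 <= D)%R by rewrite /D; nn.
have F0 a c : 0 <= ((slab a)%:R * (slab c)%:R *
    (`|w a - w c| `^ p * enorm (a - c) `^ (- M)))%:E by nneg.
have eK0 a c : 0 <= (K a c)%:E by rewrite lee_fin.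
have meK : measurable_fun setT (fun z : E1 * E1 => (K z.1 z.2)%:E) by exact: (measurable_EFin_fun mK).
have h1 a c : 1%:E * ((slab a)%:R * (slab c)%:R *
    (`|w a - w c| `^ p * enorm (a - c) `^ (- M)))%:E <= J a c + J c a + (K a c)%:E.
  by rewrite mul1e; exact: error_pair.
apply: (le_trans (@le_int2_split _ _ _ (leb R n.+1) 1%R _ J (fun a c => (K a c)%:E) ltr01 F0 J0 eK0 mJ meK h1)).
rewrite invr1 mul1e.
have IJ : \int[leb R n.+1]_a \int[leb R n.+1]_c J a c <= D%:E * energy.
  rewrite /energy -intZ; [|exact: D0|exact: local_energy_ge0].
  apply: le_int => a; first by apply: integral_ge0 => c _; exact: J0.
  have mka : measurable_fun setT (fun c => ((slab a)%:R * kk a c)%:E).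
    apply: measurable_EFin_fun; apply: measurable_funM; first exact: measurable_cst.
    exact: (measurableT_comp mkk (pair1_measurable a)).
  rewrite /J ge0_integralZr; [|by []|exact: mka|by nn|exact: local_energy_ge0].
  apply: lee_wpmul2r; first exact: local_energy_ge0.
  apply: (le_trans _ (int_kk a)); apply: le_int => c; first by rewrite lee_fin; apply: mulr_ge0; [exact: ler0n|exact: kk0].
  rewrite lee_fin; move: (kk0 a c); move: (kk a c) => y y0.
  by case: (slab a); rewrite ?mul1r// mul0r.
have IK : \int[leb R n.+1]_a \int[leb R n.+1]_c (K a c)%:E = (2 `^ p)%:E * energy.
  by apply: int2Z => [|a c]; [exact: powR_ge0|nneg].
clearbody D.
rewrite IK mulr_natl mulr2n EFinD [leRHS]ge0_muleDl ?lee_fin ?powR_ge0 ?addr_ge0//.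
rewrite [(D + D)%:E]EFinD [(D%:E + D%:E) * energy]ge0_muleDl ?lee_fin//.
by apply: leeD; [exact: leeD|exact: lexx].
Qed.

Lemma Lp_error : \int[leb R n.+1]_a ((slab a)%:R * `|w a| `^ p)%:E <=
  (C1 * 5 `^ M * e `^ m)%:E * energy.
Proof.
rewrite /energy -intZ; [|by nn|exact: local_energy_ge0].
apply: le_int => a; first by nneg.
have [sa|/negbTE nsa] := orP (orbN (slab a)); first by rewrite sa mul1r; exact: error_at.
by rewrite nsa mul0r mule_ge0 ?local_energy_ge0//; nn.
Qed.

Lemma psi_bd x : psi (rV_join (x, b)) = rV_join (x, (sg * (3 * e) + b)%R).
Proof.
rewrite /inner_point rV_tail_join; congr (rV_join (x, (sg * _ + b)%R)).
have -> : bdist sg b (rV_join (x, b)) = 0%R.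
  by rewrite /bdist rV_last_join subrr mulr0.
by rewrite /clamp (_ : (0 < 3 * e)%R)// mulr_gt0.
Qed.

(** The value over x is a mean of u on the ball of radius e about height 3e. That ball lies in the
    cone of opening 1 over x, with heights between 2e and 4e, so the weight is at least (4e)^(-n-m)
    while the mean divides by e^(n+1). The outcome e^(m-1) tends to 0 as m > 1. *)
Lemma boundary_error (f : E -> R) : measurable_fun setT f ->
  \int[leb R n]_x (`|v (rV_join (x, b)) - f x| `^ p)%:E <=
  (C1 * 4 `^ (n%:R + m) * e `^ (m - 1))%:E * cone_functional p m L 1 sg b f u.
Proof.
move=> mf_; rewrite /cone_functional -intZ; [|by nn|by move=> x; apply: integral_ge0 => a _; rewrite lee_fin cone_integrand_ge0].
apply: le_int => x; first by nneg.
apply: (le_trans (near1 (f x) e0 mu (LIpsi1 _))).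
have nm0 : (0 <= n%:R + m)%R by rewrite addr_ge0// ltW.
have e4 : (0 < 4 * e)%R by rewrite mulr_gt0.
apply: (@le_trans _ _ ((C1 * (e ^+ n.+1)^-1)%:E * (((4 * e) `^ (n%:R + m))%:E *
   \int[leb R n.+1]_a (cone_integrand p m L 1 sg b f u x a)%:E))).
  apply: lee_wpmul2l; first by nn.
  rewrite -intZ; [|exact: powR_ge0|by move=> a; rewrite lee_fin cone_integrand_ge0].
  apply: le_int => c; first by nneg.
  rewrite -EFinM lee_fin.
  have R0 : (0 <= (4 * e) `^ (n%:R + m) * cone_integrand p m L 1 sg b f u x c)%R.
    by rewrite mulr_ge0 ?powR_ge0 ?cone_integrand_ge0.
  case: ltP => [cx|_]; last by rewrite mul0r.
  have c2 : (enorm (c - psi (rV_join (x, b))) < 2 * e)%R by move: e0; lra.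
  have sc := psi_ball c2.
  move: cx; rewrite psi_bd => cx.
  have := le_lt_trans (bdist_lip b sg1 _ _) cx; rewrite bdist_join// ltr_norml => /andP[t1 t2].
  have := le_lt_trans (enorm_tailB _ _) cx; rewrite rV_tail_join => cx'.
  rewrite /cone_integrand sc (_ : (enorm (rV_tail c - x) < 1 * bdist sg b c)%R); last by move: e0; lra.
  rewrite !mul1r distrC mulrCA ler_peMr ?powR_ge0// powRN.
  have t0 : (0 < bdist sg b c)%R by move: e0; lra.
  rewrite ler_pdivlMr ?powR_gt0// mul1r; apply: powR_le => //; first exact: ltW.
  by move: e0; lra.
rewrite muleA -EFinM; apply: lee_wpmul2r.
  by apply: integral_ge0 => a _; rewrite lee_fin cone_integrand_ge0.
rewrite lee_fin powRM ?(ltW e0)//.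
have -> : (e `^ (n%:R + m) = e ^+ n.+1 * e `^ (m - 1))%R.
  rewrite -powR_mulrn ?(ltW e0)// -powRDgt0//; congr (_ `^ _)%R; rewrite -natr1; ring.
rewrite le_eqVlt; apply/orP; left; apply/eqP; field.
by rewrite expf_neq0// gt_eqF.
Qed.

End fixed_scale.

(** The two boundary values are means over balls centred at heights 3e and 3e/2. Comparing them
    through points c and c' of these balls, at distance at most e + 3e/2 + e/2 = 3e, and integrating
    over x gives e^(m-1), a geometric rate when e is halved. *)
Lemma boundary_step (e C1 : R) : (0 < e)%R -> (6 * e <= L)%R -> (0 <= C1)%R ->
  (forall e (f : E1 -> R) (c : R) x, (0 < e)%R ->
  measurable_fun setT f -> loc_integrable_ball f x e ->
  (`|mollify e f x - c| `^ p)%:E <=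
  (C1 * (e ^+ n.+1)^-1)%:E * \int[leb R n.+1]_y ((enorm (y - x) < e)%R%:R * `|f y - c| `^ p)%:E) ->
  forall om : R, (0 <= om)%R ->
  (forall (a : E) (r : R), (0 < r)%R -> \int[leb R n]_x (enorm (x - a) < r)%R%:R%:E = (om * r ^+ n)%:E) ->
  \int[leb R n]_x (`|interior_mollify (e / 2) (rV_join (x, b)) - interior_mollify e (rV_join (x, b))| `^ p)%:E
  <= (C1 * C1 * 2 ^+ n.+1 * 3 `^ M * om * e `^ (m - 1))%:E * S.
Proof.
move=> e0 eL C10 near1 om om0 vol.
have e20 : (0 < e / 2)%R by rewrite divr_gt0.
have e2L : (6 * (e / 2) <= L)%R by lra.
pose A' x := interior_mollify (e / 2) (rV_join (x, b)).
pose k (a c : E1) := ((slab a)%:R * (slab c)%:R *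
     (`|u a - u c| `^ p * enorm (a - c) `^ (- M)))%R.
have k0 a c : (0 <= k a c)%R by rewrite /k; nneg.
have mk : measurable_fun setT (fun z : E1 * E1 => k z.1 z.2) by rewrite /k /slab; mf.
pose X (x : E) (a : E1) := ((enorm (rV_tail a - x) < e)%R%:R : R)%R.
have X0 x a : (0 <= X x a)%R by rewrite /X; nneg.
have mX : measurable_fun setT (fun z : E * E1 => X z.1 z.2) by rewrite /X; mf.
pose c1 := (C1 * ((e / 2) ^+ n.+1)^-1 * (3 * e) `^ M)%R.
have ie n' : (0 <= (e ^+ n')^-1)%R by rewrite invr_ge0 exprn_ge0// ltW.
have ie2 n' : (0 <= ((e / 2) ^+ n')^-1)%R by rewrite invr_ge0 exprn_ge0// ltW.
have c10 : (0 <= c1)%R by rewrite /c1 !mulr_ge0// powR_ge0.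
pose c2 := (C1 * (e ^+ n.+1)^-1 * c1)%R.
have c20 : (0 <= c2)%R by rewrite /c2 mulr_ge0// mulr_ge0.
(* Used first is that u c is a constant for the mean at scale e/2; in [outer] the resulting value A'
   x is a constant for the mean at scale e. *)
have inner x c : ((enorm (c - inner_point e (rV_join (x, b))) < e)%R%:R * `|u c - A' x| `^ p)%:E <=
    c1%:E * \int[leb R n.+1]_c' (X x c * k c c')%:E.
  have r0 : 0 <= c1%:E * \int[leb R n.+1]_c' (X x c * k c c')%:E by nn.
  case: ltP => [cx|_]; last by rewrite mul0r.
  have c2e : (enorm (c - inner_point e (rV_join (x, b))) < 2 * e)%R by lra.
  have sc := psi_ball e0 eL c2e.
  rewrite mul1r distrC; apply: (le_trans (near1 _ _ (u c) _ e20 mu (LIpsi1 e20 e2L _))).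
  rewrite /c1 [(_ * (3 * e) `^ M)%:E]EFinM -muleA; apply: lee_wpmul2l; first by rewrite lee_fin mulr_ge0.
  rewrite -intZ; [|exact: powR_ge0|by nn].
  apply: le_int => c'; first by nneg.
  rewrite -EFinM lee_fin.
  have r1 : (0 <= (3 * e) `^ M * (X x c * k c c'))%R by nn.
  case: ltP => [cx'|_]; last by rewrite mul0r.
  have c2e' : (enorm (c' - inner_point (e / 2) (rV_join (x, b))) < 2 * (e / 2))%R by lra.
  have sc' := psi_ball e20 e2L c2e'.
  have cc' : (enorm (c - c') <= 3 * e)%R.
    have h1 := ler_enormB c (inner_point e (rV_join (x, b))) c'.
    have h2 := ler_enormB (inner_point e (rV_join (x, b))) (inner_point (e / 2) (rV_join (x, b))) c'.
    have h3 : (enorm (inner_point e (rV_join (x, b)) - inner_point (e / 2) (rV_join (x, b))) <= 3 / 2 * e)%R.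
      rewrite !psi_bd// rV_joinB; apply: (le_trans (enorm_join_le _ _)).
      rewrite subrr enorm0 add0r [X in `|X|%R](_ : _ = sg * (3 / 2 * e))%R; last by field.
      by rewrite normrM sg_norm// mul1r ger0_norm// mulr_ge0// ltW.
    have h4 : (enorm (inner_point (e / 2) (rV_join (x, b)) - c') < e / 2)%R by rewrite enormBC.
    lra.
  have Xc : X x c = 1%R.
    have := le_lt_trans (enorm_tailB _ _) cx; rewrite psi_bd// rV_tail_join /X => ->.
    by [].
  rewrite Xc /k sc sc' !mul1r distrC.
  have := enorm_ge0 (c - c'); rewrite le_eqVlt => /predU1P[ac0|ac0].
    have : (c - c' == 0)%R by rewrite -enorm_eq0 -ac0.
    by rewrite subr_eq0 => /eqP ->; rewrite subrr normr0 powR0 ?gt_eqF// !mul0r mulr0.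
  rewrite mulrCA ler_peMr ?powR_ge0// powRN ler_pdivlMr ?powR_gt0// mul1r.
  by apply: powR_le => //; exact: enorm_ge0.
have outer x : (`|A' x - interior_mollify e (rV_join (x, b))| `^ p)%:E <=
    c2%:E * \int[leb R n.+1]_c \int[leb R n.+1]_c' (X x c * k c c')%:E.
  rewrite distrC; apply: (le_trans (near1 _ _ (A' x) _ e0 mu (LIpsi1 e0 eL _))).
  rewrite /c2 [(_ * c1)%:E]EFinM -muleA; apply: lee_wpmul2l; first by rewrite lee_fin mulr_ge0.
  rewrite -intZ; [|exact: c10|by nn].
  by apply: le_int => c; [nneg|exact: inner].
apply: (@le_trans _ _ (c2%:E * \int[leb R n]_x \int[leb R n.+1]_c \int[leb R n.+1]_c' (X x c * k c c')%:E)).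
  rewrite -intZ; [|exact: c20|by nn].
  by apply: le_int => x; [nneg|exact: outer].
have en0 : (0 <= om * e ^+ n)%R by rewrite mulr_ge0// exprn_ge0// ltW.
apply: (@le_trans _ _ (c2%:E * ((om * e ^+ n)%:E * S))).
  apply: lee_wpmul2l; first by rewrite lee_fin.
  have mXk : measurable_fun setT (fun z : E * E1 => \int[leb R n.+1]_c' (X z.1 z.2 * k z.2 c')%:E).
    apply: (@measurable_int1 _ _ _ _ _ (leb R n.+1) (fun z c' => (X z.1 z.2 * k z.2 c')%:E)); first by mf.
    by nn.
  rewrite swap_int; [|exact: mXk|by nn].
  rewrite /seminorm_slab -intZ; [|exact: en0|by nneg].
  apply: le_int => c; first by nn.
  have mkc : measurable_fun setT (fun z : E * E1 => X z.1 c * k c z.2)%R by mf.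
  rewrite swap_int; [|exact: measurable_EFin_fun|by nn].
  rewrite -intZ; [|exact: en0|by nneg].
  apply: le_int => c'; first by nn.
  under eq_integral do rewrite mulrC EFinM.
  rewrite intZ; [|exact: k0|by nn].
  rewrite /X; under eq_integral do rewrite enormBC.
  by rewrite vol// muleC.
have S0 : 0 <= S by rewrite /seminorm_slab; nneg.
rewrite muleA -EFinM; apply: lee_wpmul2r; first exact: S0.
rewrite lee_fin /c2 /c1 powRM ?(ltW e0)//.
have -> : (e `^ M = e ^+ n.+1 * e * e `^ (m - 1))%R.
  rewrite -exprSr -powR_mulrn ?(ltW e0)// -powRDgt0//; congr (_ `^ _)%R; rewrite -!natr1; ring.
rewrite le_eqVlt; apply/orP; left; apply/eqP; rewrite expr_div_n !exprS; field.
by rewrite !expf_neq0// gt_eqF.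
Qed.

(** Dominated convergence on the product space: the region |a - c| < 5 e k shrinks to the diagonal,
    where the integrand vanishes, and the full energy is the finite dominating function. *)
Lemma energy_cvg (e : nat -> R) : (forall k, 0 < e k)%R -> e @ \oo --> (0 : R)%R ->
  (fun k => energy (e k)) @ \oo --> 0.
Proof.
move=> e0 ecv.
pose g (z : E1 * E1) := ((slab z.1)%:R * (slab z.2)%:R *
     (`|u z.1 - u z.2| `^ p * enorm (z.1 - z.2) `^ (- M)))%:E.
pose f k (z : E1 * E1) := ((slab z.1)%:R * (slab z.2)%:R * (enorm (z.1 - z.2) < 5 * e k)%R%:R *
     (`|u z.1 - u z.2| `^ p * enorm (z.1 - z.2) `^ (- M)))%:E.
have g0 z : 0 <= g z by rewrite /g; nneg.
have f0 k z : 0 <= f k z by rewrite /f; nneg.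
have mg : measurable_fun setT g by rewrite /g /slab; mf.
have mfk k : measurable_fun setT (f k) by rewrite /f /slab; mf.
have ig : (leb R n.+1 \x leb R n.+1)%E.-integrable setT g.
  apply/integrableP; split; first exact: mg.
  under eq_integral do rewrite gee0_abs//.
  by rewrite (int_prod (leb R n.+1) (leb R n.+1) (F := fun a c => g (a, c))).
have fg k z : `|f k z| <= g z.
  rewrite gee0_abs// lee_fin -!mulrA; do 2 (apply: ler_wpM2l => //).
  by apply: ler_piMl; [nneg|case: (_ < _)%R].
have fcv z : f ^~ z @ \oo --> 0.
  apply: cvg_near_cst.
  have := enorm_ge0 (z.1 - z.2); rewrite le_eqVlt => /predU1P[z0|z0].
    apply: nearW => k; rewrite /f.
    have : (z.1 - z.2 == 0)%R by rewrite -enorm_eq0 -z0.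
    rewrite subr_eq0 => /eqP ->; rewrite [(u z.2 - u z.2)%R]subrr normr0 powR0 ?gt_eqF//.
    by rewrite mul0r mulr0.
  have z5 : (0 < enorm (z.1 - z.2) / 5)%R by rewrite divr_gt0.
  move/cvgr0_norm_lt : ecv => /(_ _ z5); apply: filterS => k ek; rewrite /f.
  rewrite ltNge (_ : (5 * e k <= enorm (z.1 - z.2))%R = true) ?mulr0 ?mul0r//.
  have := le_lt_trans (ler_norm _) ek; rewrite ltr_pdivlMr// mulrC => /ltW ->.
  by [].
have [_ _] := @dominated_convergence _ _ _ (leb R n.+1 \x leb R n.+1)%E setT measurableT f (cst 0) g
  mfk (measurable_cst _) (aeW _ (fun z _ => fcv z)) ig (aeW _ (fun z k _ => fg k z)).
rewrite integral0.
have E k : \int[(leb R n.+1 \x leb R n.+1)%E]_z f k z = energy (e k).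
  exact: (@int_prod _ _ _ _ R (leb R n.+1) (leb R n.+1) (fun a c => f k (a, c)) (mfk k) (fun a c => f0 k (a, c))).
by under eq_fun do rewrite E.
Qed.

End density.

Lemma cvge0_le (R : realType) (a B : nat -> \bar R) (c : R) :
  (forall k, 0 <= a k)%E -> (forall k, a k <= c%:E * B k)%E ->
  B @ \oo --> 0%E -> a @ \oo --> 0%E.
Proof.
move=> a0 aB B0; apply: (@squeeze_cvge _ _ _ _ (cst 0%E) _ (fun k => c%:E * B k)%E).
- by apply: nearW => k; rewrite a0 aB.
- exact: cvg_cst.
- by rewrite -[X in _ --> X](mule0 c%:E); apply: cvgeZl.
Qed.

Section interior_approximation.
Context {R : realType}.
Variables (n : nat) (p m L sg b : R) (u : 'rV[R]_n.+1 -> R).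
Hypotheses (p1 : 1 < p) (m1 : 1 < m) (mp : m < p) (L0 : 0 < L) (sg1 : sg = 1 \/ sg = -1).
Local Open Scope ereal_scope.
Notation E := 'rV[R]_n.
Notation E1 := 'rV[R]_n.+1.
Hypothesis mu : measurable_fun setT u.
Hypothesis LI : forall x r, (r < bdist sg b x)%R -> (bdist sg b x + r < L)%R ->
  loc_integrable_ball u x r.
Hypothesis S_fin : seminorm_slab p m L sg b u < +oo.

(** The same sequence yields both halves of the trace theory: its boundary values converge to some
    f, and to a prescribed f as soon as the bridge functional of that f is finite. *)
Lemma interior_approx : exists v : nat -> E1 -> R,
  [/\ forall k, continuous (v k),
   (fun k => seminorm_slab p m L sg b (v k \- u)%R) @ \oo --> 0,
   (fun k => \int[leb R n.+1]_a ((slab L sg b a)%:R * `|v k a - u a| `^ p)%:E) @ \oo --> 0,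
   exists2 f : E -> R, measurable_fun setT f &
     (fun k => \int[leb R n]_x (`|v k (rV_join (x, b)) - f x| `^ p)%:E) @ \oo --> 0 &
   forall f : E -> R, measurable_fun setT f -> cone_functional p m L 1 sg b f u < +oo ->
     (fun k => \int[leb R n]_x (`|v k (rV_join (x, b)) - f x| `^ p)%:E) @ \oo --> 0].
Proof.
have p0 : (0 < p)%R by exact: lt_trans p1.
have m0 : (0 < m)%R by exact: lt_trans m1.
have [C1 C10 near1] := @mollify_near R n.+1 p p1.
have [C2 C20 near2] := @mollify_diff R n.+1 p p1.
have [Co Co0 ro] := @leb_radial_out R n.+1 m m0.
have pm : (0 < p - m)%R by rewrite subr_gt0.
have [Ci Ci0 ri] := @leb_radial_in R n.+1 (p - m) pm.
have [om om0 vol] := @enorm_ball_bounds R n.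
have ME : (n.+1%:R + m = n%:R + 1 + m :> R)%R by rewrite -natr1.
rewrite ME in ro.
have PE : (p - m - n.+1%:R = p - (n%:R + 1 + m) :> R)%R by rewrite -natr1; ring.
rewrite PE in ri.
(* Starting at L/6 makes 3e <= L - 3e hold, so the inner region is nonempty; halving matches
   [boundary_step]. *)
pose e k := (L / 6 * 2^-1 ^+ k)%R.
have e0 k : (0 < e k)%R by rewrite /e !mulr_gt0 ?exprn_gt0// divr_gt0.
have eL k : (6 * e k <= L)%R.
  rewrite /e mulrA [X in (X * _ <= _)%R](_ : _ = L)%R; last by field.
  by rewrite ler_piMr ?(ltW L0)// exprn_ile1//; lra.
have eS k : (e k.+1 = e k / 2)%R by rewrite /e exprS; ring.
have ecv : e @ \oo --> (0 : R)%R.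
  rewrite -[X in _ --> X](mulr0 (L / 6))%R; apply: cvgMl_tmp.
  by apply: cvg_expr; rewrite ger0_norm//; lra.
have e1 k : (e k <= L)%R by have := eL k; have := e0 k; lra.
pose v k := interior_mollify L sg b u (e k).
pose En k := energy p m L sg b u (e k).
have En_cvg : En @ \oo --> 0 by exact: (energy_cvg p1 mu S_fin e0 ecv).
have em k : (e k `^ m <= L `^ m)%R by apply: powR_le => //; apply: ltW.
have En0 k : 0 <= En k by apply: integral_ge0 => a _; exact: local_energy_ge0.
have cv k : continuous (v k).
  exact: (@continuous_interior_mollify R n L sg b u sg1 mu LI (e k) (e0 k) (eL k)).
have mv k := continuous_measurable_rV (cv k).
pose q := (2^-1 `^ (m - 1))%R.
have q01 : (0 < q < 1)%R.
  rewrite /q powR_gt0 ?invr_gt0//=.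
  rewrite -powR_inv1// -powRrM mulN1r powRN invf_lt1 ?powR_gt0//.
  by apply: gt1_powR2; rewrite subr_gt0.
have q0 : (0 <= q)%R by case/andP: q01 => /ltW.
have eq k : (e k `^ (m - 1) = (L / 6) `^ (m - 1) * q ^+ k)%R.
  by rewrite /e powRM ?exprn_ge0 ?invr_ge0 ?divr_ge0 ?(ltW L0)// powRXn// invr_ge0.
have S0 : 0 <= seminorm_slab p m L sg b u by rewrite /seminorm_slab; nneg.
exists v; split.
- exact: cv.
- apply: (cvge0_le _ _ En_cvg) => k; last first.
    exact: (@seminorm_error R n p m L sg b u p1 m1 sg1 mu LI (e k) C1 C2 Co Ci C10 C20 Co0 Ci0 near1 near2 ro ri (e0 k) (eL k)).
  by rewrite /seminorm_slab; nneg.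
- apply: (@cvge0_le _ _ En (C1 * 5 `^ (n%:R + 1 + m) * L `^ m)%R _ _ En_cvg) => k; first by nneg.
  apply: (@le_trans _ _ ((C1 * 5 `^ (n%:R + 1 + m) * e k `^ m)%:E * En k)).
    exact: (@Lp_error R n p m L sg b u p1 m1 sg1 mu LI (e k) C1 C10 near1 (e0 k) (eL k)).
  by apply: lee_wpmul2r => //; rewrite lee_fin; apply: ler_wpM2l => //; nneg.
- have [Sf Sf0] : exists2 y : R, (0 <= y)%R & seminorm_slab p m L sg b u = y%:E.
    exists (fine (seminorm_slab p m L sg b u)); first exact: fine_ge0.
    by rewrite fineK// ge0_fin_numE.
  move=> SE.
  pose D := (C1 * C1 * 2 ^+ n.+1 * 3 `^ (n%:R + 1 + m) * om * (L / 6) `^ (m - 1) * Sf)%R.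
  have D0 : (0 <= D)%R by rewrite /D; have om0' := ltW om0; nneg.
  apply: (@geometric_limit _ _ R (leb R n) p q (fun k x => v k (rV_join (x, b))) D p0 q01 D0).
    by move=> k; have mvk := mv k; mf.
  move=> k; rewrite {1}/v eS.
  apply: (le_trans (@boundary_step R n p m L sg b u p1 m1 sg1 mu LI (e k) C1 (e0 k) (eL k) C10 near1 om (ltW om0) vol)).
  rewrite SE -EFinM lee_fin eq /D le_eqVlt; apply/orP; left; apply/eqP; ring.
- move=> f mf_ Tf.
  have [Tr Tr0] : exists2 y : R, (0 <= y)%R & cone_functional p m L 1 sg b f u = y%:E.
    have T0 : 0 <= cone_functional p m L 1 sg b f u.
      by rewrite /cone_functional; nneg; exact: cone_integrand_ge0.
    exists (fine (cone_functional p m L 1 sg b f u)); first exact: fine_ge0.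
    by rewrite fineK// ge0_fin_numE.
  move=> TE.
  pose D := (C1 * 4 `^ (n%:R + m) * (L / 6) `^ (m - 1) * Tr)%R.
  have q_cvg : (fun k => (q ^+ k)%:E) @ \oo --> 0.
    apply: cvg_EFin; first by apply: nearW.
    by apply: cvg_expr; rewrite ger0_norm//; case/andP: q01.
  apply: (@cvge0_le _ _ _ D _ _ q_cvg) => k; first by nneg.
  apply: (le_trans (@boundary_error R n p m L sg b u m1 sg1 mu LI (e k) C1 C10 near1 (e0 k) (eL k) f mf_)).
  rewrite TE -!EFinM lee_fin eq /D le_eqVlt; apply/orP; left; apply/eqP; ring.
Qed.

End interior_approximation.

(** * Estimates for the traces *)

Section ereal_powers.
Context {R : realType}.
Local Open Scope ereal_scope.
Implicit Types (a : nat -> \bar R) (r : R).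

Lemma le_poweR (x y : \bar R) r : (0 <= r)%R -> 0 <= x -> x <= y -> x `^ r <= y `^ r.
Proof.
move=> r0 x0 xy; apply: gt0_ler_poweR => //; rewrite in_itv/= leey andbT//.
exact: le_trans xy.
Qed.

Lemma cvge0_poweR a r : (0 < r)%R -> (forall k, 0 <= a k) ->
  a @ \oo --> 0 -> (fun k => a k `^ r) @ \oo --> 0.
Proof.
move=> r0 a0 acv.
have H e : (0 < e)%R -> \forall k \near \oo, a k `^ r <= e%:E.
  move=> e0; have e1 : (0 < e `^ r^-1)%R by exact: powR_gt0.
  move/fine_cvgP : acv => [B1 /cvgr0_norm_lt /(_ _ e1) B2].
  near=> k.
  have af : a k \is a fin_num by near: k.
  have ak : (fine (a k) <= e `^ r^-1)%R.
    rewrite ltW// (le_lt_trans (ler_norm _))//; near: k; exact: B2.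
  rewrite -(fineK af) poweR_EFin lee_fin.
  apply: (le_trans (powR_le (ltW r0) _ ak)); first exact: fine_ge0.
  by rewrite -powRrM mulVf ?gt_eqF// powRr1// ltW.
apply/fine_cvgP; split.
  apply: filterS (H 1%R ltr01) => k k1.
  by rewrite ge0_fin_numE ?poweR_ge0// (le_lt_trans k1)// ltry.
apply/cvgr0Pnorm_le => e e0; apply: filterS (H e e0) => k ke.
rewrite ger0_norm ?fine_ge0 ?poweR_ge0//=.
by rewrite -lee_fin fineK// ge0_fin_numE ?poweR_ge0// (le_lt_trans ke)// ltry.
Unshelve. all: by end_near. Qed.

Lemma poweRK (x : \bar R) r : r != 0%R -> 0 <= x -> (x `^ r) `^ r^-1 = x.
Proof. by move=> r0 x0; rewrite -poweRrM mulfV// poweRe1. Qed.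

Lemma poweRVK (x : \bar R) r : r != 0%R -> 0 <= x -> (x `^ r^-1) `^ r = x.
Proof. by move=> r0 x0; rewrite -poweRrM mulVf// poweRe1. Qed.

Lemma cvge0_poweRV a r : (0 < r)%R -> (forall k, 0 <= a k) ->
  (fun k => a k `^ r) @ \oo --> 0 -> a @ \oo --> 0.
Proof.
move=> r0 a0; have ri : (0 < r^-1)%R by rewrite invr_gt0.
move=> /(cvge0_poweR ri (fun k => poweR_ge0 _ _)).
by under eq_fun do rewrite poweRK ?gt_eqF//.
Qed.

Lemma cvge0_split a (b : nat -> \bar R) : (forall k, 0 <= a k) -> (forall k, 0 <= b k) ->
  (fun k => a k + b k) @ \oo --> 0 -> a @ \oo --> 0 /\ b @ \oo --> 0.
Proof.
move=> a0 b0 ab; split; apply: (@squeeze_cvge _ _ _ _ (cst 0) _ (fun k => a k + b k)) => //.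
- by apply: nearW => k; rewrite a0/= leeDl.
- exact: cvg_cst.
- by apply: nearW => k; rewrite b0/= leeDr.
- exact: cvg_cst.
Qed.

End ereal_powers.

Section compact_ball.
Context {R : realType} (d : nat).

Lemma continuous_enormB (x : 'rV[R]_d) : continuous (fun y : 'rV[R]_d => enorm (y - x)).
Proof.
apply: continuous_enorm => a; exists 1, 1; split => // c _.
rewrite mul1r ler_norml; apply/andP; split.
  by have := ler_enormB c a x; rewrite (enormBC c a); lra.
by have := ler_enormB a c x; lra.
Qed.

(** A closed subset of the compact product of the segments [x_i - r, x_i + r]. *)
Lemma compact_enorm_ball (x : 'rV[R]_d) (r : R) : compact [set y : 'rV[R]_d | enorm (y - x) <= r].
Proof.
apply: (@subclosed_compact _ _ [set y : 'rV[R]_d | forall i, `[x 0 i - r, x 0 i + r]%classic (y 0 i)]).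
- have -> : [set y : 'rV[R]_d | enorm (y - x) <= r] = (fun y : 'rV[R]_d => enorm (y - x)) @^-1` [set t | t <= r] by [].
  by apply: closed_comp => [y _|]; [exact: continuous_enormB|exact: closed_le].
- by apply: (@rV_compact R d (fun i => `[x 0 i - r, x 0 i + r]%classic)) => i; exact: segment_compact.
move=> y /= yr i; have := le_trans (coord_enorm (y - x) i) yr.
by rewrite !mxE ler_norml in_itv/= => /andP[h1 h2]; apply/andP; split; lra.
Qed.

Lemma loc_integrable_ball_powR (p : R) (f : 'rV[R]_d -> R) (x : 'rV[R]_d) (r : R) : 1 < p ->
  measurable_fun setT f ->
  (\int[leb R d]_y ((enorm (y - x) < r)%R%:R * `|f y| `^ p)%:E < +oo)%E ->
  loc_integrable_ball f x r.
Proof.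
move=> p1 mf_ fp.
apply: (@le_lt_trans _ _ (\int[leb R d]_y ((enorm (y - x) < r)%R%:R%:E +
   ((enorm (y - x) < r)%R%:R * `|f y| `^ p)%:E))%E).
  apply: le_int => y; first by nneg.
  (* On a set of finite measure, |f| <= 1 + |f|^p reduces integrability to the p-th power. *)
  rewrite -EFinD lee_fin [leRHS](_ : _ = (enorm (y - x) < r)%R%:R * (1 + `|f y| `^ p)); last by rewrite mulrDr mulr1.
  apply: ler_wpM2l => //.
  have [h|h] := lerP `|f y| 1; first by apply: ler_wpDr => //; exact: powR_ge0.
  apply: ler_wpDl => //; rewrite -{1}(powRr1 (normr_ge0 (f y))).
  by apply: ler_powR; exact: ltW.
rewrite ge0_integralD; [|by []|by nneg|by mf|by nneg|by mf].
apply: lte_add_pinfty; last exact: fp.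
have [om om0 vol] := @enorm_ball_bounds R d.
have [r0|r0] := ltP 0 r; first by rewrite vol// ltry.
rewrite integral0_eq ?ltry// => y _.
by rewrite ltNge (le_trans r0) ?enorm_ge0.
Qed.

End compact_ball.

(** * From the strip to face coordinates *)

Section strip.
Context {R : realType}.
Variables (n : nat) (s p L bm bp : R).
Hypotheses (p1 : 1 < p) (bL : bp - bm = L) (L0 : 0 < L).
Local Open Scope ereal_scope.
Notation E := 'rV[R]_n.
Notation E1 := 'rV[R]_n.+1.

Definition side (sg b : R) := sg = 1%R /\ b = bm \/ sg = (-1)%R /\ b = bp.

Lemma side_sg sg b : side sg b -> sg = 1%R \/ sg = (-1)%R.
Proof. by move=> [[-> _]|[-> _]]; [left|right]. Qed.

Lemma strip_slab sg b (a : E1) : side sg b -> strip bm bp a <-> slab L sg b a.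
Proof.
rewrite /strip /slab /bdist /= -bL => -[[-> ->]|[-> ->]]; rewrite ?mul1r ?mulN1r;
  split=> /andP[h1 h2]; apply/andP; split; lra.
Qed.

Let p0 : (0 < p)%R. Proof. exact: lt_trans p1. Qed.

Lemma gagliardoE (d : nat) (sigma : R) (g : 'rV[R]_d -> R) x y :
  gagliardo sigma p g x y = (`|g x - g y| `^ p * enorm (x - y) `^ (- (d%:R + sigma * p)))%R.
Proof. by rewrite /gagliardo powRN. Qed.

Lemma strip_energyE sg b (g g' : E1 -> R) : side sg b ->
  (forall a, strip bm bp a -> g a = g' a) ->
  \int[leb R n.+1]_(x in strip bm bp) \int[leb R n.+1]_(y in strip bm bp) (gagliardo s p g x y)%:E =
  seminorm_slab p (s * p) L sg b g'.
Proof.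
move=> sb gg'; rewrite (int_restrict _ _ (fun x => strip_slab x sb)).
apply: eq_integral => x _.
rewrite (int_restrictE _ _ (fun x => strip_slab x sb)).
have [sx|/negbTE nsx] := orP (orbN (slab L sg b x)); last first.
  rewrite nsx mul0e; symmetry; apply: integral0_eq => y _; by rewrite !mul0r.
rewrite sx mul1e; apply: eq_integral => y _; rewrite mul1r.
have [sy|/negbTE nsy] := orP (orbN (slab L sg b y)); last by rewrite nsy !mul0r.
rewrite sy !mul1r gagliardoE -!gg' ?(strip_slab _ sb)//.
by rewrite -natr1.
Qed.

Lemma cylinder_slab sg b (r : R) (a : E1) : side sg b ->
  cylinder bm bp r a <-> slab L sg b a && (enorm (rV_tail a) < r)%R.
Proof.
move=> sb; rewrite /cylinder /=; split=> [[/(strip_slab _ sb) -> ->]//|/andP[h1 h2]].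
by split => //; apply/(strip_slab _ sb).
Qed.

Lemma cylinder_energyE sg b (r : R) (g g' : E1 -> R) : side sg b ->
  (forall a, strip bm bp a -> g a = g' a) ->
  \int[leb R n.+1]_(x in cylinder bm bp r) \int[leb R n.+1]_(y in cylinder bm bp r)
    (gagliardo s p g x y)%:E =
  seminorm_cyl p (s * p) L sg b r g'.
Proof.
move=> sb gg'; rewrite (int_restrict _ _ (fun x => cylinder_slab r x sb)).
apply: eq_integral => x _.
rewrite (int_restrictE _ _ (fun x => cylinder_slab r x sb)).
have [/andP[sx cx]|/negbTE nsx] := orP (orbN (slab L sg b x && (enorm (rV_tail x) < r)%R)); last first.
  rewrite nsx mul0e; symmetry; apply: integral0_eq => y _.
  by move/negbT : nsx; rewrite negb_and => /orP[] /negbTE ->; rewrite !(mul0r, mulr0).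
rewrite sx cx mul1e; apply: eq_integral => y _; rewrite mul1r.
have [/andP[sy cy]|/negbTE nsy] := orP (orbN (slab L sg b y && (enorm (rV_tail y) < r)%R)); last first.
  rewrite nsy mul0r.
  by move/negbT : nsy; rewrite negb_and => /orP[] /negbTE ->; rewrite !(mul0r, mulr0).
rewrite sy cy !mul1r gagliardoE -!gg' ?(strip_slab _ sb)//.
by rewrite -natr1.
Qed.

Lemma cylinder_LpE sg b (r : R) (g g' : E1 -> R) : side sg b ->
  (forall a, strip bm bp a -> g a = g' a) ->
  \int[leb R n.+1]_(x in cylinder bm bp r) (`|g x| `^ p)%:E =
  \int[leb R n.+1]_a ((slab L sg b a)%:R * (enorm (rV_tail a) < r)%R%:R * `|g' a| `^ p)%:E.
Proof.
move=> sb gg'; rewrite (int_restrictE _ _ (fun x => cylinder_slab r x sb)).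
apply: eq_integral => x _.
have [sx|/negbTE nsx] := orP (orbN (slab L sg b x)); last by rewrite nsx !mul0r.
by rewrite sx/= mul1r gg'//; apply/(strip_slab _ sb).
Qed.

Lemma eball_LpE (r : R) (g : E -> R) :
  \int[leb R n]_(x in eball 0 r) (`|g x| `^ p)%:E =
  \int[leb R n]_x ((enorm x < r)%R%:R * `|g x| `^ p)%:E.
Proof. by apply: int_restrictE => x; rewrite /eball /= subr0. Qed.

Let pV0 : (0 < p^-1)%R. Proof. by rewrite invr_gt0. Qed.

(** A sum of nonnegative roots that tends to 0 has both terms tending to 0, and the p-th roots can
    then be undone. The function [u'] only has to agree with [u] on the strip. *)
Lemma is_trace_approx sg b (u u' : E1 -> R) (f : E -> R) : side sg b ->
  (forall a, strip bm bp a -> u a = u' a) ->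
  is_trace s p bm bp u b f -> approx_trace p (s * p) L sg b f u'.
Proof.
move=> sb uu' [mf_ tr] rad rad0; have [v [cv v1 v2]] := tr rad rad0.
have vu k a : strip bm bp a -> (v k \- u)%R a = (v k \- u')%R a by move=> /uu' /= ->.
have [w1 w2] := cvge0_split (fun k => poweR_ge0 _ _) (fun k => poweR_ge0 _ _) v1.
exists v; split => //.
- have := cvge0_poweRV pV0 _ w2; under eq_fun do rewrite (cylinder_energyE _ sb (vu _)).
  by apply => k; rewrite (cylinder_energyE _ sb (vu k)) /seminorm_cyl; nneg.
- have := cvge0_poweRV pV0 _ w1; under eq_fun do rewrite (cylinder_LpE _ sb (vu _)).
  by apply => k; rewrite (cylinder_LpE _ sb (vu k)); nneg.
- have := cvge0_poweRV pV0 _ v2; under eq_fun do rewrite eball_LpE.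
  by apply => k; rewrite eball_LpE; nneg.
Qed.

Lemma is_trace_limit sg b (u u' : E1 -> R) (f : E -> R) (v : nat -> E1 -> R) : side sg b ->
  (forall a, strip bm bp a -> u a = u' a) -> measurable_fun setT f ->
  (forall k, continuous (v k)) ->
  (fun k => seminorm_slab p (s * p) L sg b (v k \- u')%R) @ \oo --> 0 ->
  (fun k => \int[leb R n.+1]_a ((slab L sg b a)%:R * `|v k a - u' a| `^ p)%:E) @ \oo --> 0 ->
  (fun k => \int[leb R n]_x (`|v k (rV_join (x, b)) - f x| `^ p)%:E) @ \oo --> 0 ->
  is_trace s p bm bp u b f.
Proof.
move=> sb uu' mf_ cv v1 v2 v3; split; first exact: mf_.
move=> r r0; exists v; split; first exact: cv.
- have vu k a : strip bm bp a -> (v k \- u)%R a = (v k \- u')%R a by move=> /uu' /= ->.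
  rewrite -[X in _ --> X]adde0; apply: cvgeD; first by [].
    apply: (cvge0_poweR pV0); first by move=> k; rewrite (cylinder_LpE _ sb (vu k)); nneg.
    under eq_fun do rewrite (cylinder_LpE _ sb (vu _)).
    apply: (cvge0_le (c := 1%R) _ _ v2) => k; first by nneg.
    rewrite mul1e; apply: le_int => a; first by nneg.
    rewrite lee_fin; apply: ler_wpM2r; first by nneg.
    by case: (slab _ _ _ _); case: (_ < _)%R; rewrite ?mulr1 ?mul0r ?mulr0.
  apply: (cvge0_poweR pV0).
    by move=> k; rewrite (cylinder_energyE _ sb (vu k)) /seminorm_cyl; nneg.
  under eq_fun do rewrite (cylinder_energyE _ sb (vu _)).
  apply: (cvge0_le (c := 1%R) _ _ v1) => k; first by rewrite /seminorm_cyl; nneg.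
  by rewrite mul1e; exact: seminorm_cyl_le.
apply: (cvge0_poweR pV0); first by move=> k; rewrite eball_LpE; nneg.
under eq_fun do rewrite eball_LpE.
apply: (cvge0_le (c := 1%R) _ _ v3) => k; first by nneg.
rewrite mul1e; apply: le_int => x; first by nneg.
by rewrite lee_fin; case: (_ < _)%R; rewrite ?mul1r ?mul0r ?powR_ge0.
Qed.

(** Extension by zero. Membership in the Sobolev space gives measurability on the strip, whereas the
    estimates are for functions measurable on the whole space. *)
Definition cutoff (u : E1 -> R) (a : E1) : R := if slab L 1 bm a then u a else 0%R.

Lemma cutoffE u a : strip bm bp a -> u a = cutoff u a.
Proof.
have sb : side 1 bm by left.
by move=> /(strip_slab a sb) sa; rewrite /cutoff sa.
Qed.

Lemma measurable_strip : measurable (strip bm bp : set E1).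
Proof.
have sb : side 1 bm by left.
have -> : strip bm bp = (fun a : E1 => slab L 1 bm a) @^-1` [set true].
  by apply/seteqP; split => a /=; [move=> /(strip_slab a sb)|move=> h; apply/(strip_slab a sb)].
rewrite -[X in measurable X]setTI.
by apply: (_ : measurable_fun setT (fun a : E1 => slab L 1 bm a)) => //; rewrite /slab; mf.
Qed.

Lemma measurable_cutoff u : measurable_fun (strip bm bp) u -> measurable_fun setT (cutoff u).
Proof.
move=> mu.
have -> : cutoff u = u \_ (strip bm bp).
  apply/funext => a; rewrite patchE /cutoff; have sb : side 1 bm by left.
  case: ifPn => sa; first by rewrite mem_set//; apply/(strip_slab a sb).
  by rewrite memNset// => /(strip_slab a sb); apply/negP.
by apply/(measurable_restrictT _ measurable_strip).
Qed.

(** The two inequalities put the closed ball inside the open strip, where it is one of the compact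
    sets tested by [Lp_loc]. *)
Lemma loc_integrable_cutoff u sg b x (r : R) : side sg b -> Lp_loc p (strip bm bp) u ->
  (r < bdist sg b x)%R -> (bdist sg b x + r < L)%R -> loc_integrable_ball (cutoff u) x r.
Proof.
move=> sb [mu Lu] r1 r2; have mc := measurable_cutoff mu.
apply: (loc_integrable_ball_powR p1 mc).
have KS : [set y | enorm (y - x) <= r]%R `<=` strip bm bp.
  move=> y /= yr; apply/(strip_slab y sb).
  have := le_trans (bdist_lip b (side_sg sb) y x) yr; rewrite ler_norml => /andP[h1 h2].
  by rewrite /slab; apply/andP; split; lra.
have h := Lu _ (@compact_enorm_ball R n.+1 x r) KS.
refine (le_lt_trans _ h).
rewrite [leRHS](int_restrictE (leb R n.+1) (b := fun y => (enorm (y - x) <= r)%R))//.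
apply: le_int => y; first by nneg.
rewrite lee_fin; case: ltP => [yr|_]; last by rewrite mul0r; nneg.
by rewrite (ltW yr) !mul1r -cutoffE//; apply: KS => /=; exact: ltW.
Qed.

End strip.

(** * Screened seminorms as near and far energies *)

Section screened_energies.
Context {R : realType}.
Variables (n : nat) (s p L : R).
Hypotheses (p0 : 0 < p) (L0 : 0 < L).
Local Open Scope ereal_scope.
Notation E := 'rV[R]_n.

(** For m = s p the exponent n + m - 1 is n + (s - 1/p) p, so this is the p-th power of the seminorm
    screened to distances below L. *)
Definition near_energy (m : R) (f : E -> R) : \bar R :=
  \int[leb R n]_x \int[leb R n]_z ((enorm (x - z) < L)%R%:R *
    (`|f x - f z| `^ p * enorm (x - z) `^ (- (n%:R + m - 1))))%:E.

(** For m = s p the exponent n + 1 + m is n + (s + 1/p) p. The weight eta(x) eta(y) = L^2 is left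
    out and restored in [screened_geE]. *)
Definition far_energy (m : R) (f : E -> R) : \bar R :=
  \int[leb R n]_x \int[leb R n]_z ((L <= enorm (x - z))%R%:R *
    (`|f x - f z| `^ p * enorm (x - z) `^ (- (n%:R + 1 + m))))%:E.

Lemma near_energy_ge0 m f : 0 <= near_energy m f.
Proof. by rewrite /near_energy; nneg. Qed.

Lemma far_energy_ge0 m f : 0 <= far_energy m f.
Proof. by rewrite /far_energy; nneg. Qed.

Lemma screened_leE (f : E -> R) :
  screened_le (s - p^-1) p (cst L) setT f = near_energy (s * p) f `^ p^-1.
Proof.
congr (_ `^ _); apply: eq_integral => x _.
rewrite (int_restrictE (leb R n) (b := fun y => (enorm (x - y) < L)%R)); last first.
  by move=> y; rewrite /eball /= enormBC; split=> [[]|].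
apply: eq_integral => y _; rewrite gagliardoE; congr (_ * (_ * _ `^ _))%:E.
by field; rewrite gt_eqF.
Qed.

Lemma screened_geE (f : E -> R) :
  screened_ge (s + p^-1) p (cst L) setT f = ((L * L)%:E * far_energy (s * p) f) `^ p^-1.
Proof.
have L20 : (0 <= L * L)%R by rewrite mulr_ge0// ltW.
congr (_ `^ _).
apply: int_eqZ => [//|x|x]; first by nneg.
rewrite (int_restrictE (leb R n) (b := fun y => (L <= enorm (x - y))%R)); last first.
  move=> y; rewrite /eball /= enormBC leNgt; split=> [[_ /negP]//|h].
  by split => //; apply/negP.
apply: int_eqZ => [//|y|y]; first by nneg.
rewrite gagliardoE -EFinM; congr (_%:E).
have -> : (n%:R + (s + p^-1) * p = n%:R + 1 + s * p)%R by field; rewrite gt_eqF.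
by rewrite /=; ring.
Qed.

End screened_energies.

(** * Existence of traces and their bounds *)

Section part1.
Context {R : realType}.
Variables (n : nat) (s p L : R).
Hypotheses (s01 : 0 < s < 1) (p1 : 1 < p) (sp1 : 1 < s * p) (L0 : 0 < L).
Local Open Scope ereal_scope.
Notation E := 'rV[R]_n.
Notation E1 := 'rV[R]_n.+1.

Let p0 : (0 < p)%R. Proof. exact: lt_trans p1. Qed.
Let pV0 : (0 < p^-1)%R. Proof. by rewrite invr_gt0. Qed.

Lemma seminorm_slab_finite (bm bp sg b : R) (u : E1 -> R) : (bp - bm = L)%R -> side bm bp sg b ->
  homogeneous_sobolev s p (strip bm bp) u ->
  seminorm_slab p (s * p) L sg b (cutoff L bm u) < +oo.
Proof.
move=> bL sb [_ Su].
rewrite -(strip_energyE s p bL sb (cutoffE bL u)).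
by apply: (lty_poweRy _ Su); rewrite gt_eqF.
Qed.

Lemma trace_exists (bm bp sg b : R) (u : E1 -> R) : (bp - bm = L)%R -> side bm bp sg b ->
  homogeneous_sobolev s p (strip bm bp) u -> exists f : E -> R, is_trace s p bm bp u b f.
Proof.
move=> bL sb Hu; have Sfin := seminorm_slab_finite bL sb Hu; have [Lu _] := Hu.
have mu := measurable_cutoff bL Lu.1.
have mp : (s * p < p)%R by rewrite gtr_pMl//; case/andP: s01.
have LI x r := loc_integrable_cutoff (x := x) (r := r) p1 bL sb Lu.
have [v [cv v1 v2 [f mf_ v3] _]] := interior_approx p1 sp1 mp L0 (side_sg sb) mu LI Sfin.
by exists f; exact: (is_trace_limit p1 bL sb (cutoffE bL u) mf_ cv v1 v2 v3).
Qed.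

Lemma le_root (X S : \bar R) (C : R) : (0 <= C)%R -> 0 <= X -> 0 <= S ->
  X <= C%:E * S -> X `^ p^-1 <= (C `^ p^-1)%:E * S `^ p^-1.
Proof.
move=> C0 X0 S0 XS; rewrite -poweR_EFin -poweRM//.
exact: (le_poweR (ltW pV0) X0 XS).
Qed.

Lemma part1_bounds : exists2 C : R, (0 < C)%R & forall bm bp : R, (bp - bm = L)%R ->
  forall u : E1 -> R, homogeneous_sobolev s p (strip bm bp) u ->
  forall fp fm : E -> R, is_trace s p bm bp u bp fp -> is_trace s p bm bp u bm fm ->
  let U := sobolev_seminorm s p (strip bm bp) u in
  [/\ \int[leb R n]_x (`|fp x - fm x| `^ p)%:E <= C%:E * U `^ p,
      screened_le (s - p^-1) p (cst L) setT fp <= C%:E * U,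
      screened_le (s - p^-1) p (cst L) setT fm <= C%:E * U,
      screened_ge (s + p^-1) p (cst L) setT fp <= C%:E * U &
      screened_ge (s + p^-1) p (cst L) setT fm <= C%:E * U].
Proof.
(* Opening 3 is the one for which near, jump and far energies are bounded by the bridge
   functional. *)
have k3 : (0 < 3 :> R)%R by [].
have [C0 C00 HT] := @cone_functional_le_seminorm R n p (s * p) L 3 p0 sp1 L0 k3.
have [Ca Ca0 HA] := @near_energy_le_cone R n p (s * p) L p0 sp1.
have [Cb Cb0 HB] := @jump_le_cone R n p (s * p) L p0 sp1 L0.
have [Cc Cc0 HC] := @far_energy_le_cone R n p (s * p) L p0 sp1 L0.
have LL0 : (0 <= L * L)%R by rewrite mulr_ge0// ltW.
pose c1 := (Ca * C0)%R; pose c2 := (L * L * (Cc * (C0 + 1)))%R; pose c3 := (Cb * (C0 + C0))%R.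
have c10 : (0 <= c1)%R by exact: mulr_ge0.
have c20 : (0 <= c2)%R by rewrite /c2; nneg.
have c30 : (0 <= c3)%R by rewrite /c3; nneg.
have q10 : (0 <= c1 `^ p^-1)%R by exact: powR_ge0.
have q20 : (0 <= c2 `^ p^-1)%R by exact: powR_ge0.
(* The summand 1 makes the constant positive. The constants of the seminorms enter after a p-th
   root, that of the jump without. *)
exists (1 + c3 + c1 `^ p^-1 + c2 `^ p^-1)%R; first by rewrite -!addrA ltr_pwDl// !addr_ge0.
set C := (1 + _ + _ + _)%R.
have Cc3 : (c3 <= C)%R by rewrite /C; lra.
have Cc1 : (c1 `^ p^-1 <= C)%R by rewrite /C; lra.
have Cc2 : (c2 `^ p^-1 <= C)%R by rewrite /C; lra.
move=> bm bp bL u Hu fp fm tp tm U.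
have sp_ : side bm bp (-1) bp by right.
have sm_ : side bm bp 1 bm by left.
have mu := measurable_cutoff bL Hu.1.1.
have mfp := tp.1; have mfm := tm.1.
pose S := seminorm_slab p (s * p) L 1 bm (cutoff L bm u).
have Sp : seminorm_slab p (s * p) L (-1) bp (cutoff L bm u) = S.
  by rewrite /S -(strip_energyE s p bL sp_ (cutoffE bL u)) -(strip_energyE s p bL sm_ (cutoffE bL u)).
have Sm : seminorm_slab p (s * p) L 1 bm (cutoff L bm u) = S by exact: erefl.
have S0 : 0 <= S by rewrite /S /seminorm_slab; nneg.
have US : U = S `^ p^-1.
  exact: (congr1 (fun x => x `^ p^-1) (strip_energyE s p bL sm_ (cutoffE bL u))).
clearbody U.
have U0 : 0 <= U by rewrite US; exact: poweR_ge0.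
have pn0 : p != 0%R by rewrite gt_eqF.
have UpS : U `^ p = S by rewrite US; exact: (poweRVK pn0 S0).
have Tp : cone_functional p (s * p) L 3 (-1) bp fp (cutoff L bm u) <= C0%:E * S.
  apply: (le_trans (HT _ _ _ _ (or_intror erefl) mfp mu _)); last by rewrite Sp.
  exact: (is_trace_approx p1 bL sp_ (cutoffE bL u) tp).
have Tm : cone_functional p (s * p) L 3 1 bm fm (cutoff L bm u) <= C0%:E * S.
  apply: (HT _ _ _ _ (or_introl erefl) mfm mu).
  exact: (is_trace_approx p1 bL sm_ (cutoffE bL u) tm).
clearbody S.
have bump (c : R) (X : \bar R) : (0 <= c)%R -> (c `^ p^-1 <= C)%R -> 0 <= X -> X <= c%:E * S ->
    X `^ p^-1 <= C%:E * U.
  move=> c0 cC X0 XS; apply: (le_trans (le_root c0 X0 S0 XS)); rewrite -US.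
  by apply: lee_wpmul2r => //; rewrite lee_fin.
have near sg b f : side bm bp sg b -> measurable_fun setT f ->
    cone_functional p (s * p) L 3 sg b f (cutoff L bm u) <= C0%:E * S ->
    near_energy p L (s * p) f <= c1%:E * S.
  move=> sb mf_ T; apply: (le_trans (HA sg b f (cutoff L bm u) (side_sg sb) mf_ mu)).
  by rewrite /c1 EFinM -muleA; apply: lee_wpmul2l; rewrite // lee_fin.
have far sg b f : side bm bp sg b -> measurable_fun setT f ->
    seminorm_slab p (s * p) L sg b (cutoff L bm u) = S ->
    cone_functional p (s * p) L 3 sg b f (cutoff L bm u) <= C0%:E * S ->
    (L * L)%:E * far_energy p L (s * p) f <= c2%:E * S.
  move=> sb mf_ SE T; rewrite /c2 [(L * L * _)%:E]EFinM -muleA; apply: lee_wpmul2l; first by rewrite lee_fin.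
  apply: (le_trans (HC sg b f (cutoff L bm u) (side_sg sb) mf_ mu)).
  rewrite SE EFinM -muleA; apply: lee_wpmul2l; first by rewrite lee_fin.
  rewrite EFinD ge0_muleDl ?lee_fin// mul1e.
  by apply: leeD; [exact: T|exact: lexx].
split.
- rewrite UpS; apply: (@le_trans _ _ (c3%:E * S)); last by apply: lee_wpmul2r; rewrite // lee_fin.
  apply: (le_trans (HB bm bp fp fm (cutoff L bm u) bL mfp mfm mu)).
  rewrite /c3 EFinM -muleA; apply: lee_wpmul2l; first by rewrite lee_fin.
  rewrite EFinD ge0_muleDl ?lee_fin; [|exact: C00|exact: C00].
  by apply: leeD; [exact: Tp|exact: Tm].
- rewrite screened_leE//; apply: (bump c1 _ c10 Cc1); first exact: near_energy_ge0.
  exact: (near _ _ _ sp_ mfp Tp).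
- rewrite screened_leE//; apply: (bump c1 _ c10 Cc1); first exact: near_energy_ge0.
  exact: (near _ _ _ sm_ mfm Tm).
- rewrite screened_geE//; apply: (bump c2 _ c20 Cc2); first by apply: mule_ge0; [rewrite lee_fin|exact: far_energy_ge0].
  exact: (far _ _ _ sp_ mfp Sp Tp).
- rewrite screened_geE//; apply: (bump c2 _ c20 Cc2); first by apply: mule_ge0; [rewrite lee_fin|exact: far_energy_ge0].
  exact: (far _ _ _ sm_ mfm Sm Tm).
Qed.

End part1.

(** * The extension by averages *)

Section extension_energies.
Context {R : realType}.
Variables (n : nat) (p m L : R).
Hypotheses (p1 : 1 < p) (m1 : 1 < m) (mp : m < p) (L0 : 0 < L).
Local Open Scope ereal_scope.
Notation E := 'rV[R]_n.
Notation E1 := 'rV[R]_n.+1.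
Notation M := (n%:R + 1 + m)%R.

Let p0 : (0 < p)%R. Proof. exact: lt_trans p1. Qed.
Let m0 : (0 < m)%R. Proof. exact: lt_trans m1. Qed.

(** Once the heights are integrated out, a slab energy becomes a double integral of some [H] over
    the face, and it is enough to bound [H] pointwise on the two ranges of |x - z|, the diagonal
    contributing nothing. *)
Lemma near_far_le (c1 c2 : R) (f : E -> R) (H : E -> E -> \bar R) :
  measurable_fun setT f -> (0 <= c1)%R -> (0 <= c2)%R -> (forall x z, 0 <= H x z) ->
  (forall x, H x x = 0) ->
  (forall x z, (0 < enorm (x - z) < L)%R ->
    H x z <= (c1 * (`|f x - f z| `^ p * enorm (x - z) `^ (- (n%:R + m - 1))))%:E) ->
  (forall x z, (L <= enorm (x - z))%R ->
    H x z <= (c2 * (`|f x - f z| `^ p * enorm (x - z) `^ (- M)))%:E) ->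
  \int[leb R n]_x \int[leb R n]_z H x z <=
  (c1 + c2)%:E * (near_energy p L m f + far_energy p L m f).
Proof.
move=> mf_ c10 c20 H0 Hd Hn Hf.
have c120 : (0 <= c1 + c2)%R by exact: addr_ge0.
pose N x z := ((enorm (x - z) < L)%R%:R * (`|f x - f z| `^ p * enorm (x - z) `^ (- (n%:R + m - 1))))%R.
pose F x z := ((L <= enorm (x - z))%R%:R * (`|f x - f z| `^ p * enorm (x - z) `^ (- M)))%R.
have N0 x z : (0 <= N x z)%R by rewrite /N; nneg.
have F0 x z : (0 <= F x z)%R by rewrite /F; nneg.
apply: (@le_trans _ _ (\int[leb R n]_x \int[leb R n]_z ((c1 + c2) * (N x z + F x z))%:E)).
  apply: le_int => x; first by nn.
  apply: le_int => z; first exact: H0.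
  rewrite /N /F; have [h|h] := ltP (enorm (x - z)) L; rewrite ?mul1r ?mul0r ?addr0 ?add0r.
  - have : (0 <= enorm (x - z))%R by exact: enorm_ge0.
    rewrite le_eqVlt => /orP[|r0].
      rewrite eq_sym enorm_eq0 subr_eq0 => /eqP <-.
      by rewrite Hd lee_fin; nneg.
    apply: (le_trans (Hn x z _)); first by rewrite r0 h.
    by rewrite lee_fin; apply: ler_wpM2r; [nneg|lra].
  - apply: (le_trans (Hf x z h)).
    by rewrite lee_fin; apply: ler_wpM2r; [nneg|lra].
rewrite int2Z; [|by []|by nn].
rewrite int2D; [exact: lexx|by []|by []| |].
- by rewrite /N; mf.
- by rewrite /F; mf.
Qed.

(** For fixed x and z the admissible heights satisfy t > |x - z| / kap, and integrating t^(-n-m)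
    there gives |x - z|^(-(n+m-1)). Since t < L, nothing remains beyond kap L, so on the far range
    the exponent can be lowered by 2 at the cost (kap L)^2. *)
Lemma tail_cone_le (kap : R) : (0 < kap)%R -> exists2 C : R, (0 <= C)%R &
  forall sg b (f : E -> R), sg = 1%R \/ sg = (-1)%R -> measurable_fun setT f ->
  cone_functional p m L kap sg b f (fun a => f (rV_tail a)) <=
  C%:E * (near_energy p L m f + far_energy p L m f).
Proof.
move=> k0.
pose al := (n%:R + m - 1)%R.
have al0 : (0 < al)%R by rewrite /al -addrA ltr_wpDl// subr_gt0.
have [Co Co0 HCo] := @nu_radial_out R al al0.
pose c1 := (Co * kap^-1 `^ (- al))%R.
have c10 : (0 <= c1)%R by rewrite /c1 mulr_ge0 ?powR_ge0.
pose c2 := (c1 * (kap * L) ^+ 2)%R.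
have c20 : (0 <= c2)%R by rewrite /c2 mulr_ge0 ?exprn_ge0// mulr_ge0// ltW.
exists (c1 + c2)%R; first exact: addr_ge0.
move=> sg b f sg1 mf_.
pose G x z (t : R) := ((0 < t < L)%R%:R * (enorm (z - x) < kap * t)%R%:R *
     (`|f x - f z| `^ p * t `^ (- (n%:R + m))))%R.
have G0 x z t : (0 <= G x z t)%R by rewrite /G; nneg.
rewrite /cone_functional.
have -> : \int[leb R n]_x \int[leb R n.+1]_a (cone_integrand p m L kap sg b f (fun a => f (rV_tail a)) x a)%:E
   = \int[leb R n]_x \int[leb R n]_z \int[nu R]_t (G x z t)%:E.
  apply: eq_integral => x _.
  rewrite (@int_boundary R n sg b sg1); [|by rewrite /cone_integrand /slab; mf|by move=> a; rewrite lee_fin cone_integrand_ge0].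
  apply: eq_integral => z _; apply: eq_integral => t _.
  by rewrite /cone_integrand /slab bdist_join// rV_tail_join.
have key x z : (0 < enorm (x - z))%R -> \int[nu R]_t (G x z t)%:E <=
    (c1 * (`|f x - f z| `^ p * ((enorm (x - z) < kap * L)%R%:R * enorm (x - z) `^ (- al))))%:E.
  move=> r0.
  have rk : (0 < kap^-1 * enorm (x - z))%R by rewrite mulr_gt0// invr_gt0.
  have [rL|/negbTE rL] := orP (orbN (enorm (x - z) < kap * L)%R); last first.
    apply: int0_le => [t|]; last by nneg.
    rewrite /G enormBC.
    have [tL|/negbTE ->] := orP (orbN (0 < t < L)%R); last by rewrite !mul0r.
    suff -> : (enorm (x - z) < kap * t)%R = false by rewrite mulr0 mul0r.
    apply/negbTE; rewrite -leNgt; move/negbT: rL; rewrite -leNgt; apply: le_trans.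
    by case/andP: tL => _ /ltW tL; exact: ler_wpM2l (ltW k0) _ _ tL.
  rewrite rL mul1r.
  apply: (@le_trans _ _ ((`|f x - f z| `^ p)%:E * \int[nu R]_t
      ((kap^-1 * enorm (x - z) <= t)%R%:R * t `^ (- (1 + al)))%:E)).
    rewrite -intZ; [|by nneg|by nneg].
    apply: le_int => t; first by nn.
    rewrite -EFinM lee_fin /G enormBC.
    have -> : (1 + al = n%:R + m)%R by rewrite /al; ring.
    have [h|/negbTE ->] := orP (orbN (enorm (x - z) < kap * t)%R); last by rewrite mulr0 mul0r; nneg.
    have -> : (kap^-1 * enorm (x - z) <= t)%R by rewrite mulrC ler_pdivrMr// mulrC ltW.
    rewrite h mulr1 mul1r; apply: ler_piMl; first by nneg.
    by case: (_ && _).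
  apply: (@le_trans _ _ ((`|f x - f z| `^ p)%:E * (Co * (kap^-1 * enorm (x - z)) `^ (- al))%:E)).
    by apply: lee_wpmul2l; [nneg|exact: HCo].
  rewrite -EFinM lee_fin powRM ?invr_ge0 ?enorm_ge0 ?(ltW k0)// /c1.
  by rewrite le_eqVlt; apply/orP; left; apply/eqP; ring.
apply: near_far_le => //.
- by move=> x z; nn.
- move=> x; apply: integral0_eq => t _; rewrite /G (subrr (f x)) normr0 powR0 ?gt_eqF//.
  by rewrite mul0r mulr0.
- move=> x z /andP[r0 rL]; apply: (le_trans (key x z r0)).
  rewrite lee_fin; apply: ler_wpM2l; first exact: c10.
  apply: ler_wpM2l; first by nneg.
  by rewrite ler_piMl ?powR_ge0//; case: ltP.
- move=> x z rL; have r0 : (0 < enorm (x - z))%R by exact: lt_le_trans rL.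
  apply: (le_trans (key x z r0)).
  rewrite lee_fin /c2 -mulrA; apply: ler_wpM2l; first exact: c10.
  rewrite [leRHS]mulrCA; apply: ler_wpM2l; first by nneg.
  have -> : (enorm (x - z) `^ (- al) = enorm (x - z) ^+ 2 * enorm (x - z) `^ (- M))%R.
    have -> : (- al = 2%:R + - M)%R by rewrite /al; ring.
    by rewrite (powRDgt0 _ _ r0) (powR_mulrn _ (ltW r0)).
  rewrite mulrA; apply: ler_wpM2r; first by nneg.
  case: ltP => h; last by rewrite mul0r exprn_ge0// mulr_ge0// ltW.
  by rewrite mul1r; apply: lerXn2r; rewrite ?nnegrE ?enorm_ge0 ?mulr_ge0 ?(ltW h) ?(ltW k0) ?(ltW L0).
Qed.

Lemma cone_functionalD sg b (kap : R) (f : E -> R) (u w : E1 -> R) :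
  measurable_fun setT f -> measurable_fun setT u -> measurable_fun setT w ->
  cone_functional p m L kap sg b f (fun a => u a + w a)%R <= (2 `^ p)%:E *
  (cone_functional p m L kap sg b f u + cone_functional p m L kap sg b (fun=> 0%R) w).
Proof.
move=> mf_ mu mw; apply: le_int2_add.
- exact: powR_ge0.
- by move=> x a; exact: cone_integrand_ge0.
- by move=> x a; exact: cone_integrand_ge0.
- by move=> x a; exact: cone_integrand_ge0.
- by rewrite /cone_integrand /slab; mf.
- by rewrite /cone_integrand /slab; mf.
move=> x a; rewrite /cone_integrand -!mulrA -!mulrDr [leRHS]mulrCA; apply: ler_wpM2l; first by nneg.
rewrite [leRHS]mulrCA; apply: ler_wpM2l; first by nneg.
rewrite -mulrDl mulrA; apply: ler_wpM2r; first by nneg.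
rewrite sub0r opprD addrA -[(`|- w a|)%R]normrN opprK.
by rewrite -[(`|w a|)%R]normrN; apply: powR_normD2; exact: ltW.
Qed.

(** Without f, the integral in x is the volume om t^n of a section of the cone, which leaves the
    Hardy weight t^(-m). *)
Lemma cone_functional0 : exists2 C : R, (0 <= C)%R & forall sg b (w : E1 -> R),
  sg = 1%R \/ sg = (-1)%R -> measurable_fun setT w ->
  cone_functional p m L 1 sg b (fun=> 0%R) w =
  C%:E * \int[leb R n.+1]_a ((slab L sg b a)%:R * (`|w a| `^ p * bdist sg b a `^ (- m)))%:E.
Proof.
have [om om0 vol] := @enorm_ball_bounds R n.
exists om; first exact: ltW.
move=> sg b w sg1 mw; rewrite /cone_functional (@swap_int _ _ _ _ _ (leb R n) (leb R n.+1)
  (fun x a => (cone_integrand p m L 1 sg b (fun=> 0%R) w x a)%:E)).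
- apply: int_eqZ => [|a|a]; [exact: ltW|by nneg|].
  have -> : \int[leb R n]_x (cone_integrand p m L 1 sg b (fun=> 0%R) w x a)%:E =
      ((slab L sg b a)%:R * (`|w a| `^ p * bdist sg b a `^ (- (n%:R + m))))%:E *
      \int[leb R n]_x (enorm (x - rV_tail a) < bdist sg b a)%R%:R%:E.
    apply: int_eqZ => [|x|x]; [by nneg|by nneg|].
    rewrite -EFinM; congr (_%:E).
    by rewrite /cone_integrand mul1r sub0r normrN enormBC; ring.
  have [sa|/negbTE ->] := orP (orbN (slab L sg b a)); last by rewrite !mul0r mul0e mule0.
  have [t0 _] := andP sa.
  rewrite sa vol// !mul1r -!EFinM; congr (_%:E).
  rewrite opprD (powRDgt0 _ _ t0) [(bdist _ _ _ `^ (- n%:R))%R]powRN powR_mulrn; [|exact: ltW].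
  have : (bdist sg b a ^+ n != 0)%R by rewrite expf_neq0// gt_eqF.
  by move: (bdist sg b a ^+ n)%R => X X0; field.
- by rewrite /cone_integrand /slab; mf.
- by move=> x a; rewrite lee_fin cone_integrand_ge0.
Qed.

Section cone_mollify.
Variables (sg b : R) (f : E -> R).
Hypotheses (sg1 : sg = 1%R \/ sg = (-1)%R) (mf_ : measurable_fun setT f)
  (lf : forall x r, loc_integrable_ball f x r).

(** The radius of the mean is the height itself, so means shrink to points at the face and the
    function is Lipschitz at the scale of the height. *)
Definition cone_mollify (a : E1) : R := mollify (bdist sg b a) f (rV_tail a).

Lemma measurable_cone_mollify : measurable_fun setT cone_mollify.
Proof.
have mI (g : E -> R) : measurable_fun setT g -> measurable_fun setT
    (fun a : E1 => Rintegral (leb R n) setT (fun y => tent (bdist sg b a) (rV_tail a) y * g y)%R).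
  move=> mg; apply: (measurableT_comp (fine_measurable measurableT)) => /=.
  pose h (a : E1) (y : E) := (tent (bdist sg b a) (rV_tail a) y * g y)%R.
  have mh : measurable_fun setT (fun z : E1 * E => h z.1 z.2) by rewrite /h /tent; mf.
  (* Tonelli gives measurability for nonnegative integrands, so positive and negative parts are
     treated apart. *)
  have -> : (fun a : E1 => \int[leb R n]_y (h a y)%:E) = (fun a : E1 =>
      \int[leb R n]_y (Num.max (h a y) 0)%:E - \int[leb R n]_y (Num.max (- h a y) 0)%:E).
    apply/funext => a; rewrite integralE; congr (_ - _); apply: eq_integral => y _.
      by rewrite funeposE EFin_max.
    by rewrite funenegE EFin_max.
  apply: emeasurable_funB.
    apply: (@measurable_int1 _ _ _ _ _ _ (fun a y => (Num.max (h a y) 0)%:E)); first by mf.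
    by move=> a y; rewrite lee_fin le_max lexx orbT.
  apply: (@measurable_int1 _ _ _ _ _ _ (fun a y => (Num.max (- h a y) 0)%:E)); first by mf.
  by move=> a y; rewrite lee_fin le_max lexx orbT.
have e : cone_mollify = fun a =>
    (Rintegral (leb R n) setT (fun y => tent (bdist sg b a) (rV_tail a) y * f y) /
     Rintegral (leb R n) setT (fun y => tent (bdist sg b a) (rV_tail a) y * 1))%R.
  apply/funext => a; rewrite /cone_mollify /mollify; congr (_ / _)%R.
  by congr Rintegral; apply/funext => y; rewrite mulr1.
rewrite e; apply: measurable_funM; first exact: mI.
by apply: measurable_funV; apply: (mI (fun=> 1%R)); exact: measurable_cst.
Qed.

(** Oscillation of f about the foot of a, at the scale of the height. It bounds both the error and
    the increments of the cone means, and its integral with weight t^(-n-m) is the bridge functional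
    of f with the function constant in height ([int_tail_oscillation]). *)
Definition tail_oscillation (kap : R) (a : E1) : \bar R := \int[leb R n]_y
  ((enorm (y - rV_tail a) < kap * bdist sg b a)%R%:R * `|f y - f (rV_tail a)| `^ p)%:E.

Lemma tail_oscillation_ge0 kap a : 0 <= tail_oscillation kap a.
Proof. by rewrite /tail_oscillation; nneg. Qed.

Lemma measurable_tail_oscillation kap : measurable_fun setT (tail_oscillation kap).
Proof. by rewrite /tail_oscillation; mf. Qed.

Lemma tail_oscillation_le kap kap' a : (kap <= kap')%R -> slab L sg b a ->
  tail_oscillation kap a <= tail_oscillation kap' a.
Proof.
move=> kk /andP[t0 _]; apply: le_int => y; first by nneg.
rewrite lee_fin; apply: ler_wpM2r; first by nneg.
have [h|] := ltP (enorm (y - rV_tail a)) (kap * bdist sg b a)%R; last by move=> _; case: ltP.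
by rewrite (lt_le_trans h)// ler_wpM2r// ltW.
Qed.

Lemma int_tail_oscillation kap :
  \int[leb R n.+1]_a (((slab L sg b a)%:R * bdist sg b a `^ (- (n%:R + m)))%:E * tail_oscillation kap a) =
  cone_functional p m L kap sg b f (fun a => f (rV_tail a)).
Proof.
rewrite /cone_functional (@swap_int _ _ _ _ _ (leb R n) (leb R n.+1)
  (fun x a => (cone_integrand p m L kap sg b f (fun a => f (rV_tail a)) x a)%:E)).
- apply: eq_integral => a _; rewrite -intZ; [|by nneg|by nneg].
  apply: eq_integral => y _; rewrite -EFinM /cone_integrand enormBC; congr (_%:E); ring.
- by rewrite /cone_integrand /slab; mf.
- by move=> x a; rewrite lee_fin cone_integrand_ge0.
Qed.

End cone_mollify.

Lemma cone_mollify_error : exists2 C : R, (0 <= C)%R & forall sg b f,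
  measurable_fun setT f -> (forall x r, loc_integrable_ball f x r) ->
  forall a, slab L sg b a ->
  (`|cone_mollify sg b f a - f (rV_tail a)| `^ p)%:E <=
  (C * (bdist sg b a ^+ n)^-1)%:E * tail_oscillation sg b f 1 a.
Proof.
have [C C0 HC] := @mollify_near R n p p1.
exists C => // sg b f mf_ lf a /andP[t0 _].
apply: (le_trans (HC _ f (f (rV_tail a)) (rV_tail a) t0 mf_ (lf _ _))).
by rewrite /tail_oscillation mul1r.
Qed.

Lemma int_cone_mollify_error : exists2 C : R, (0 <= C)%R & forall sg b f,
  sg = 1%R \/ sg = (-1)%R -> measurable_fun setT f -> (forall x r, loc_integrable_ball f x r) ->
  \int[leb R n.+1]_a ((slab L sg b a)%:R *
    (`|cone_mollify sg b f a - f (rV_tail a)| `^ p * bdist sg b a `^ (- m)))%:E <=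
  C%:E * (near_energy p L m f + far_energy p L m f).
Proof.
have [C1 C10 H1] := cone_mollify_error.
have [C2 C20 H2] := @tail_cone_le 1 ltr01.
exists (C1 * C2)%R; first exact: mulr_ge0.
move=> sg b f sg1 mf_ lf.
rewrite EFinM -muleA; apply: (@le_trans _ _ (C1%:E *
   cone_functional p m L 1 sg b f (fun a => f (rV_tail a)))); last first.
  by apply: lee_wpmul2l; [nneg|exact: H2].
rewrite -(int_tail_oscillation sg b mf_) -intZ; [|by []|]; last first.
  by move=> a; apply: mule_ge0; [nneg|exact: tail_oscillation_ge0].
apply: le_int => a; first by nneg.
have [sa|/negbTE ->] := orP (orbN (slab L sg b a)); last first.
  by rewrite !mul0r mul0e mule0.
have [t0 _] := andP sa.
rewrite sa !mul1r [leLHS]EFinM [leLHS]muleC.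
apply: (le_trans (lee_wpmul2l _ (H1 sg b f mf_ lf a sa))); first by nneg.
rewrite muleA muleA -!EFinM; apply: lee_wpmul2r; first exact: tail_oscillation_ge0.
rewrite lee_fin opprD (powRDgt0 _ _ t0) [(bdist _ _ _ `^ (- n%:R))%R]powRN powR_mulrn; [|exact: ltW].
by rewrite mulrC mulrA.
Qed.

Lemma int_slab_weight sg b (w : E1 -> R) :
  \int[leb R n.+1]_a ((slab L sg b a)%:R * `|w a| `^ p)%:E <=
  (L `^ m)%:E * \int[leb R n.+1]_a ((slab L sg b a)%:R * (`|w a| `^ p * bdist sg b a `^ (- m)))%:E.
Proof.
rewrite -intZ; [|by nneg|by nneg].
apply: le_int => a; first by nneg.
have [sa|/negbTE ->] := orP (orbN (slab L sg b a)); last first.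
  by rewrite !mul0r mule0.
have [t0 tL] := andP sa.
rewrite sa !mul1r -EFinM lee_fin mulrCA; apply: ler_peMr; first by nneg.
by rewrite powRN ler_pdivlMr ?powR_gt0// mul1r; apply: powR_le; rewrite ltW.
Qed.

(** The cone mean is f at the foot plus an error; [tail_cone_le] bounds the first part, and the
    error only needs the weight t^(-m). *)
Lemma cone_mollify_trace : exists2 C : R, (0 <= C)%R & forall sg b f,
  sg = 1%R \/ sg = (-1)%R -> measurable_fun setT f -> (forall x r, loc_integrable_ball f x r) ->
  cone_functional p m L 1 sg b f (cone_mollify sg b f) <=
  C%:E * (near_energy p L m f + far_energy p L m f).
Proof.
have [C1 C10 H1] := int_cone_mollify_error.
have [C2 C20 H2] := @tail_cone_le 1 ltr01.
have [C3 C30 H3] := cone_functional0.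
exists (2 `^ p * (C2 + C3 * C1))%R; first by nneg.
move=> sg b f sg1 mf_ lf; have mF := measurable_cone_mollify sg b mf_.
pose w a := (cone_mollify sg b f a - f (rV_tail a))%R.
have mw : measurable_fun setT w by rewrite /w; mf.
have e : cone_mollify sg b f = (fun a => f (rV_tail a) + w a)%R.
  by apply/funext => a; rewrite /w addrC subrK.
rewrite e; apply: (le_trans (cone_functionalD sg b 1 mf_ _ mw)); first by mf.
rewrite EFinM -muleA; apply: lee_wpmul2l; first by nneg.
have NF0 : 0 <= near_energy p L m f + far_energy p L m f.
  by apply: adde_ge0; [exact: near_energy_ge0|exact: far_energy_ge0].
rewrite EFinD ge0_muleDl ?lee_fin; [|by []|exact: mulr_ge0].
apply: leeD; first exact: H2.
rewrite (H3 sg b w sg1 mw) EFinM -muleA; apply: lee_wpmul2l; first by nneg.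
exact: H1.
Qed.

Lemma int_square_le (c B : R) (G : R -> R) : (0 <= c)%R -> (0 <= B)%R -> (forall t, 0 <= G t)%R ->
  \int[nu R]_t (G t)%:E <= B%:E ->
  \int[nu R]_t \int[nu R]_t' (c * (G t * G t'))%:E <= (c * (B * B))%:E.
Proof.
move=> c0 B0 G0 GB.
rewrite int2Z; [|by []|by nn]; rewrite EFinM; apply: lee_wpmul2l; first by rewrite lee_fin.
apply: (@le_trans _ _ (\int[nu R]_t (B%:E * (G t)%:E))); last first.
  by rewrite intZ; [rewrite EFinM; apply: lee_wpmul2l; rewrite // lee_fin|by []|by nn].
apply: le_int => t; first by nn.
apply: (@le_trans _ _ ((G t)%:E * \int[nu R]_t' (G t')%:E)).
  by rewrite -intZ; [exact: lexx|by nn|by nn].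
by rewrite muleC; apply: lee_wpmul2r; [nn|exact: GB].
Qed.

Let h := (M / 2)%R.

(* A pair at distance d >= rho whose heights are below 2d has
   d^(-M) <= height_weight t * height_weight t', which separates the heights. *)
Let height_weight (rho t : R) : R :=
  ((0 < t < L)%R%:R * (if (t < 2 * rho)%R then rho `^ (- h) else (t / 2) `^ (- h)))%R.

Let height_weight_ge0 rho t : (0 <= height_weight rho t)%R.
Proof. by rewrite /height_weight mulr_ge0//; case: ifP => _; exact: powR_ge0. Qed.

Let h0 : (0 <= h)%R. Proof. by rewrite divr_ge0// !addr_ge0// ltW. Qed.

(** Heights below 2 rho contribute 2 rho times rho^(-h). The others contribute the integral of
    t^(-h), of the same order rho^(1-h), which converges since m > 1 gives h > 1. *)
Let height_weight_near : exists2 B : R, (0 <= B)%R & forall rho, (0 < rho)%R ->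
  \int[nu R]_t (height_weight rho t)%:E <= (B * rho `^ (1 - h))%:E.
Proof.
have al0 : (0 < h - 1)%R.
  by rewrite /h subr_gt0 ltr_pdivlMr// mul1r -addrA ltr_wpDl//; move: m1; lra.
have [Co Co0 HCo] := @nu_radial_out R (h - 1)%R al0.
exists (2 + 2 `^ h * (Co * 2 `^ (- (h - 1))))%R; first by nneg.
move=> rho r0; have r2 : (0 < 2 * rho)%R by rewrite mulr_gt0.
apply: (@le_trans _ _ (\int[nu R]_t ((rho `^ (- h) * (0 < t < 2 * rho)%R%:R)%:E +
    (2 `^ h * ((2 * rho <= t)%R%:R * t `^ (- (1 + (h - 1)))))%:E))).
  apply: le_int => t; first by rewrite lee_fin.
  rewrite -EFinD lee_fin /height_weight.
  have -> : (1 + (h - 1) = h)%R by ring.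
  have [/andP[t0 tL]|/negbTE ->] := orP (orbN (0 < t < L)%R); last by rewrite mul0r; nneg.
  rewrite t0 tL mul1r /=; case: ltP => tr /=; first by rewrite mulr1 mul0r mulr0 addr0.
  rewrite mulr0 add0r mul1r powRM ?invr_ge0 ?(ltW t0)// mulrC.
  by rewrite (_ : 2^-1 `^ (- h) = 2 `^ h)%R// -powR_inv1// -powRrM mulrNN mul1r.
rewrite ge0_integralD; [|by []|by nneg|by mf|by nneg|by mf].
under eq_integral do rewrite EFinM.
under [X in _ + X]eq_integral do rewrite EFinM.
rewrite intZ; [|by nneg|by nneg]; rewrite intZ; [|by nneg|by nneg].
rewrite nu_interval ?(ltW r2)// [X in _ <= X%:E]mulrDl [leRHS]EFinD; apply: leeD.
  rewrite -EFinM lee_fin subr0 (powRDgt0 _ _ r0) powRr1 ?(ltW r0)//.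
  by rewrite le_eqVlt; apply/orP; left; apply/eqP; ring.
apply: (le_trans (lee_wpmul2l _ (HCo _ r2))); first by nneg.
rewrite -EFinM lee_fin powRM ?(ltW r0)// opprB.
by rewrite le_eqVlt; apply/orP; left; apply/eqP; ring.
Qed.

Let height_weight_far rho : (L <= rho)%R ->
  \int[nu R]_t (height_weight rho t)%:E <= (L * rho `^ (- h))%:E.
Proof.
move=> Lr; apply: (@le_trans _ _ ((rho `^ (- h))%:E * \int[nu R]_t (0 < t < L)%R%:R%:E)).
  rewrite -intZ; [|by nneg|by nneg]; apply: le_int => t; first by rewrite lee_fin.
  rewrite -EFinM lee_fin /height_weight mulrC.
  have [/andP[t0 tL]|/negbTE ->] := orP (orbN (0 < t < L)%R); last by rewrite !mulr0.
  rewrite t0 tL !mulr1 (_ : (t < 2 * rho)%R)//.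
  by move: L0; lra.
by rewrite nu_interval ?(ltW L0)// subr0 -EFinM mulrC.
Qed.

(** The pairs whose distance is at least comparable to both heights. For them the Lipschitz bound on
    means is useless and the values of f at the feet are compared instead. *)
Definition far_pair sg b (f : E -> R) (a c : E1) : R :=
  ((slab L sg b a)%:R * (slab L sg b c)%:R *
   ((bdist sg b a < 2 * enorm (a - c))%R%:R * (bdist sg b c < 2 * enorm (a - c))%R%:R) *
   (`|f (rV_tail a) - f (rV_tail c)| `^ p * enorm (a - c) `^ (- M)))%R.

Lemma far_pair_ge0 sg b f a c : (0 <= far_pair sg b f a c)%R.
Proof. by rewrite /far_pair; nneg. Qed.

(** The product form of the bound by [height_weight] makes the double height integral a square:
    (rho^(1-h))^2 is the near kernel, and (L rho^(-h))^2 is L^2 times the far kernel. *)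
Lemma int_far_pair : exists2 C : R, (0 <= C)%R & forall sg b f,
  sg = 1%R \/ sg = (-1)%R -> measurable_fun setT f ->
  \int[leb R n.+1]_a \int[leb R n.+1]_c (far_pair sg b f a c)%:E <=
  C%:E * (near_energy p L m f + far_energy p L m f).
Proof.
have [B B0 HB] := height_weight_near.
exists (B * B + L * L)%R; first by rewrite addr_ge0// mulr_ge0// ltW.
move=> sg b f sg1 mf_.
pose T (x : E) (t : R) : E1 := rV_join (x, (sg * t + b)%R).
pose q x z t r := far_pair sg b f (T x t) (T z r).
have q0 x z t r : (0 <= q x z t r)%R by exact: far_pair_ge0.
have -> : \int[leb R n.+1]_a \int[leb R n.+1]_c (far_pair sg b f a c)%:E =
    \int[leb R n]_x \int[leb R n]_z \int[nu R]_t \int[nu R]_r (q x z t r)%:E.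
  rewrite (@int_boundary R n sg b sg1); [|by rewrite /far_pair /slab; mf|by move=> a; rewrite /far_pair; nneg].
  apply: eq_integral => x _.
  rewrite -(@swap_int _ _ _ _ _ (nu R) (leb R n) (fun t z => \int[nu R]_r (q x z t r)%:E)).
  - apply: eq_integral => t _.
    rewrite (@int_boundary R n sg b sg1); [by []|by rewrite /far_pair /slab; mf|].
    by move=> c; rewrite lee_fin far_pair_ge0.
  - by rewrite /q /far_pair /slab /T; mf.
  - by move=> t z; nn.
have key x z (D : R) : (0 < enorm (x - z))%R -> (0 <= D)%R ->
    \int[nu R]_t (height_weight (enorm (x - z)) t)%:E <= D%:E ->
    \int[nu R]_t \int[nu R]_r (q x z t r)%:E <= (`|f x - f z| `^ p * (D * D))%:E.
  move=> r0 D0 HD; set rho := enorm (x - z) in r0 HD *.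
  apply: (le_trans _ (int_square_le (powR_ge0 _ _) D0 (height_weight_ge0 rho) HD)).
  apply: le_int2 => [t r|t r]; first exact: q0.
  rewrite /q /far_pair /slab !bdist_join// !rV_tail_join.
  set d := enorm (T x t - T z r).
  have rd : (rho <= d)%R by rewrite /rho /d /T rV_joinB; exact: enorm_join_ge1.
  have d0 : (0 < d)%R by exact: lt_le_trans rd.
  have rhs0 : (0 <= `|f x - f z| `^ p * (height_weight rho t * height_weight rho r))%R.
    by rewrite mulr_ge0 ?powR_ge0// mulr_ge0.
  have [ht|/negbTE ->] := orP (orbN (0 < t < L)%R); last by rewrite !mul0r.
  have [hr|/negbTE ->] := orP (orbN (0 < r < L)%R); last by rewrite mulr0 !mul0r.
  have [td|/negbTE ->] := orP (orbN (t < 2 * d)%R); last by rewrite mul0r mulr0 mul0r.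
  have [sd|/negbTE ->] := orP (orbN (r < 2 * d)%R); last by rewrite !mulr0 mul0r.
  rewrite ht hr td sd !mul1r; apply: ler_wpM2l; first by nneg.
  have -> : (- M = - h + - h)%R by rewrite /h; field.
  rewrite powRDgt0//.
  have P v : (0 < v < L)%R -> (v < 2 * d)%R -> (d `^ (- h) <= height_weight rho v)%R.
    move=> hv vd; rewrite /height_weight hv mul1r; case: ltP => _.
      exact: powR_leN.
    apply: powR_leN; [exact: h0|by case/andP: hv => v0 _; rewrite divr_gt0|].
    by rewrite ler_pdivrMr// mulrC ltW.
  by apply: ler_pM; [nneg|nneg|exact: P|exact: P].
apply: near_far_le => //.
- exact: mulr_ge0.
- by rewrite mulr_ge0// ltW.
- by move=> x z; nn.
- move=> x; apply: integral0_eq => t _; apply: integral0_eq => r _.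
  rewrite /q /far_pair !rV_tail_join (subrr (f x)) normr0 powR0 ?gt_eqF//.
  by rewrite mul0r mulr0.
- move=> x z /andP[r0 rL].
  have D0 : (0 <= B * enorm (x - z) `^ (1 - h))%R by nneg.
  apply: (le_trans (key x z _ r0 D0 (HB _ r0))).
  have -> : (- (n%:R + m - 1) = (1 - h) + (1 - h))%R by rewrite /h; field.
  rewrite (@powRDgt0 _ _ (1 - h)%R (1 - h)%R r0) lee_fin.
  by rewrite le_eqVlt; apply/orP; left; apply/eqP; ring.
- move=> x z rL; have r0 : (0 < enorm (x - z))%R by exact: lt_le_trans rL.
  have D0 : (0 <= L * enorm (x - z) `^ (- h))%R by nneg.
  apply: (le_trans (key x z _ r0 D0 (height_weight_far rL))).
  have -> : (- M = - h + - h)%R by rewrite /h; field.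
  rewrite (powRDgt0 _ _ r0) lee_fin.
  by rewrite le_eqVlt; apply/orP; left; apply/eqP; ring.
Qed.

Lemma cone_mollify_diff : exists2 C : R, (0 <= C)%R & forall sg b f,
  sg = 1%R \/ sg = (-1)%R -> measurable_fun setT f -> (forall x r, loc_integrable_ball f x r) ->
  forall a c, slab L sg b a -> (enorm (a - c) <= bdist sg b a / 2)%R ->
  (`|cone_mollify sg b f a - cone_mollify sg b f c| `^ p)%:E <=
  (C * (enorm (a - c) `^ p * bdist sg b a `^ (- p) * (bdist sg b a ^+ n)^-1))%:E *
  tail_oscillation sg b f 2 a.
Proof.
have [C C0 HC] := @mollify_diff R n p p1.
exists C => // sg b f sg1 mf_ lf a c /andP[t0 _] ac.
have r0 : (0 <= enorm (a - c) <= bdist sg b a / 2)%R by rewrite enorm_ge0.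
apply: (le_trans (HC _ _ _ f (f (rV_tail a)) (rV_tail a) (rV_tail c) t0 r0
  (bdist_lip b sg1 a c) (enorm_tailB a c) mf_ (lf _ _))).
by rewrite powRM ?enorm_ge0 ?invr_ge0 ?(ltW t0)// -powR_inv1 ?(ltW t0)// -powRrM mulN1r.
Qed.

(** For a pair with the higher point at height t, distances up to t/2 use the Lipschitz bound.
    Otherwise both heights are below twice the distance, and the pair is compared with f at the
    feet. Integrating the kernel in the second point leaves t^(-n-m) times the oscillation at the
    first, which is T_2 of f and its extension constant in height. *)
Lemma cone_mollify_seminorm : exists2 C : R, (0 <= C)%R & forall sg b f,
  sg = 1%R \/ sg = (-1)%R -> measurable_fun setT f -> (forall x r, loc_integrable_ball f x r) ->
  seminorm_slab p m L sg b (cone_mollify sg b f) <=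
  C%:E * (near_energy p L m f + far_energy p L m f).
Proof.
have [C1 C10 H1] := cone_mollify_error.
have [A1 A10 H2] := cone_mollify_diff.
have [C3 C30 H3] := int_far_pair.
have [Cy Cy0 Hy] := @tail_cone_le 2 (ltr0n _ 2).
have [Co Co0 HCo] := @leb_radial_out R n.+1 m m0.
have pm0 : (0 < p - m)%R by rewrite subr_gt0.
have [Ci Ci0 HCi] := @leb_radial_in R n.+1 (p - m)%R pm0.
have NE : (n.+1%:R = n%:R + 1 :> R)%R by rewrite -natr1.
have p4 : (0 <= 4 `^ p)%R by exact: powR_ge0.
pose A2 := (4 `^ p * C1)%R; have A20 : (0 <= A2)%R by rewrite /A2 mulr_ge0.
pose D := (A1 * Ci + A2 * (Co * 2 `^ m))%R; have D0 : (0 <= D)%R by rewrite /D; nneg.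
exists (2 * D * Cy + 4 `^ p * C3)%R; first by nneg.
move=> sg b f sg1 mf_ lf.
have mF := measurable_cone_mollify sg b mf_.
set F := cone_mollify sg b f in mF *.
pose t (a : E1) : R := bdist sg b a.
(* Two multipliers of the oscillation at a: the Lipschitz one at distances below t and the error one
   at distances at least t/2. The prefactor t^(-n) turns the oscillation into an average. *)
pose kk (a c : E1) := (t a `^ (- n%:R) *
  (A1 * t a `^ (- p) * ((0 < enorm (c - a) < t a)%R%:R * enorm (c - a) `^ (p - M)) +
   A2 * ((t a / 2 <= enorm (c - a))%R%:R * enorm (c - a) `^ (- M))))%R.
have kk0 a c : (0 <= kk a c)%R by rewrite /kk; nneg.
have mkk : measurable_fun setT (fun z : E1 * E1 => kk z.1 z.2) by rewrite /kk /t; mf.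
pose W (a : E1) := tail_oscillation sg b f 2 a.
have W0 a : 0 <= W a by exact: tail_oscillation_ge0.
pose J (a c : E1) := ((slab L sg b a)%:R * kk a c)%:E * W a.
have J0 a c : 0 <= J a c by rewrite /J; apply: mule_ge0; [rewrite lee_fin; nn|].
have mJ : measurable_fun setT (fun z : E1 * E1 => J z.1 z.2).
  rewrite /J; apply: emeasurable_funM; first by rewrite /slab; mf.
  exact: (measurableT_comp (measurable_tail_oscillation sg b mf_ 2) measurable_fst).
pose K (a c : E1) := (4 `^ p * far_pair sg b f a c)%R.
have K0 a c : (0 <= K a c)%R by rewrite /K; apply: mulr_ge0; [|exact: far_pair_ge0].
have meK : measurable_fun setT (fun z : E1 * E1 => (K z.1 z.2)%:E) by rewrite /K /far_pair /slab; mf.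
have KC a c : K a c = K c a.
  rewrite /K /far_pair (enormBC a c) (distrC (f (rV_tail a))); congr (_ * (_ * _ * _))%R.
    by rewrite mulrC.
  by rewrite mulrC.
have int_kk a : (0 < t a)%R -> \int[leb R n.+1]_c (kk a c)%:E <= (D * t a `^ (- (n%:R + m)))%:E.
  move=> t0; have t2 : (0 < t a / 2)%R by rewrite divr_gt0.
  have q0 : (0 <= t a `^ (- n%:R))%R by exact: powR_ge0.
  rewrite /kk; under eq_integral do rewrite EFinM.
  rewrite intZ; [|by []|by nneg].
  under eq_integral do rewrite EFinD.
  rewrite ge0_integralD; [|by []|by nneg|by mf|by nneg|by mf].
  under eq_integral do rewrite EFinM.
  under [X in _ * (_ + X)]eq_integral do rewrite EFinM.
  rewrite intZ; [|by nneg|by nneg]; rewrite intZ; [|by nneg|by nneg].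
  apply: (@le_trans _ _ ((t a `^ (- n%:R))%:E * ((A1 * t a `^ (- p))%:E * (Ci * t a `^ (p - m))%:E +
     A2%:E * (Co * (t a / 2) `^ (- m))%:E))).
    apply: lee_wpmul2l; first by rewrite lee_fin.
    apply: leeD; apply: lee_wpmul2l; try by nneg.
      have := HCi a (t a) t0; rewrite NE.
      by have -> : (p - m - (n%:R + 1) = p - M)%R by ring.
    by have := HCo a _ t2; rewrite NE.
  rewrite -[X in _ * (X + _)]EFinM -[X in _ * (_ + X)]EFinM -EFinD -EFinM lee_fin.
  have -> : ((t a / 2) `^ (- m) = 2 `^ m * t a `^ (- m))%R.
    rewrite powRM ?invr_ge0 ?(ltW t0)// mulrC; congr (_ * _)%R.
    by rewrite -powR_inv1// -powRrM mulrNN mul1r.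
  have -> : (t a `^ (- (n%:R + m)) = t a `^ (- n%:R) * t a `^ (- m))%R by rewrite opprD powRDgt0.
  have e1 : (t a `^ (- p) * t a `^ (p - m) = t a `^ (- m))%R by rewrite -powRDgt0//; congr (_ `^ _)%R; ring.
  rewrite -mulrA [(t a `^ (- p) * _)%R]mulrCA e1 /D.
  by rewrite le_eqVlt; apply/orP; left; apply/eqP; ring.
have main a c : slab L sg b a -> slab L sg b c -> (0 < enorm (a - c))%R -> (t c <= t a)%R ->
    (`|F a - F c| `^ p * enorm (a - c) `^ (- M))%:E <= J a c + J c a + (K a c)%:E.
  move=> sa sc r0 tca; have [ta0 _] := andP sa; have [tc0 _] := andP sc.
  have k0 : (0 <= enorm (a - c) `^ (- M))%R by exact: powR_ge0.
  have [h1|h1] := lerP (enorm (a - c)) (t a / 2)%R.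
    apply: (@le_trans _ _ (J a c)); last by rewrite -addeA leeDl// adde_ge0// lee_fin.
    rewrite EFinM muleC.
    apply: (le_trans (lee_wpmul2l (k0 : 0 <= (enorm (a - c) `^ (- M))%:E) (H2 sg b f sg1 mf_ lf a c sa h1))).
    rewrite muleA -EFinM; apply: lee_wpmul2r; first exact: W0.
    rewrite lee_fin sa mul1r /kk (enormBC c a) (_ : (0 < enorm (a - c) < t a)%R); last first.
      by rewrite r0 (le_lt_trans h1)// ltr_pdivrMr// mulr_natr mulr2n ltrDl.
    rewrite mul1r mulrDr; apply: ler_wpDr; first by nneg.
    rewrite (@powRDgt0 _ _ p (- M)%R r0) [(t a `^ (- n%:R))%R]powRN powR_mulrn ?(ltW ta0)//.
    by rewrite le_eqVlt; apply/orP; left; apply/eqP; rewrite /t; ring.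
  have aux x y : slab L sg b x -> (t x / 2 < enorm (x - y))%R ->
      (4 `^ p * enorm (x - y) `^ (- M))%:E * ((`|F x - f (rV_tail x)| `^ p)%:E) <= J x y.
    move=> sx xy; have [tx0 _] := andP sx.
    have c0 : 0 <= (4 `^ p * enorm (x - y) `^ (- M))%:E.
      by rewrite lee_fin; apply: mulr_ge0; exact: powR_ge0.
    apply: (le_trans (lee_wpmul2l c0 (H1 sg b f mf_ lf x sx))).
    apply: (@le_trans _ _ ((4 `^ p * enorm (x - y) `^ (- M))%:E * ((C1 * (bdist sg b x ^+ n)^-1)%:E * W x))).
      apply: lee_wpmul2l; first exact: c0.
      apply: lee_wpmul2l; last by apply: tail_oscillation_le; rewrite ?ler1n.
      by rewrite lee_fin; apply: mulr_ge0; rewrite // invr_ge0 exprn_ge0// ltW.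
    rewrite /J muleA -[X in X * _ <= _]EFinM; apply: (lee_wpmul2r (W0 x)).
    rewrite lee_fin sx mul1r /kk (enormBC y x) (ltW xy) mulrDr; apply: ler_wpDl.
      apply: mulr_ge0; first exact: powR_ge0.
      by apply: mulr_ge0; apply: mulr_ge0; first [exact: A10|exact: powR_ge0|exact: ler0n].
    rewrite mul1r [(t x `^ (- n%:R))%R]powRN powR_mulrn ?(ltW tx0)//.
    by rewrite le_eqVlt; apply/orP; left; apply/eqP; rewrite /t /A2; ring.
  apply: (@le_trans _ _ ((4 `^ p * enorm (a - c) `^ (- M))%:E * ((`|F a - f (rV_tail a)| `^ p)%:E) +
     (4 `^ p * enorm (a - c) `^ (- M))%:E * ((`|F c - f (rV_tail c)| `^ p)%:E) + (K a c)%:E)).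
    rewrite -!EFinM -!EFinD lee_fin.
    (* The means are compared through f at the two feet; the difference at the feet is a
       [far_pair]. *)
    have := @powR_normD3 R (F a - f (rV_tail a))%R (f (rV_tail c) - F c)%R (f (rV_tail a) - f (rV_tail c))%R p (ltW p0).
    have -> : (F a - f (rV_tail a) + (f (rV_tail c) - F c) + (f (rV_tail a) - f (rV_tail c)) = F a - F c)%R.
      by move: (F a) (F c) (f (rV_tail a)) (f (rV_tail c)) => x1 x2 x3 x4; ring.
    move=> /(ler_wpM2r k0) /le_trans; apply.
    rewrite /K /far_pair sa sc -/(t a) -/(t c) (_ : (t a < 2 * enorm (a - c))%R); last by lra.
    rewrite (_ : (t c < 2 * enorm (a - c))%R) ?mul1r; last by lra.
    rewrite [(`|f (rV_tail c) - F c|)%R]distrC.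
    by rewrite le_eqVlt; apply/orP; left; apply/eqP; ring.
  apply: leeD; last exact: lexx.
  apply: leeD; first exact: aux.
  by rewrite (enormBC a c); apply: aux => //; rewrite enormBC; lra.
have F0 a c : 0 <= ((slab L sg b a)%:R * (slab L sg b c)%:R *
    (`|F a - F c| `^ p * enorm (a - c) `^ (- M)))%:E by nneg.
have eK0 a c : 0 <= (K a c)%:E by rewrite lee_fin.
have pair a c : 1%:E * ((slab L sg b a)%:R * (slab L sg b c)%:R *
    (`|F a - F c| `^ p * enorm (a - c) `^ (- M)))%:E <= J a c + J c a + (K a c)%:E.
  rewrite mul1e.
  have rhs0 : 0 <= J a c + J c a + (K a c)%:E by rewrite !adde_ge0// lee_fin.
  have [sa|/negbTE nsa] := orP (orbN (slab L sg b a)); last by rewrite nsa !mul0r.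
  have [sc|/negbTE nsc] := orP (orbN (slab L sg b c)); last by rewrite nsc mulr0 mul0r.
  have := enorm_ge0 (a - c); rewrite le_eqVlt => /predU1P[ac0|ac0].
    have : (a - c == 0)%R by rewrite -enorm_eq0 -ac0.
    rewrite subr_eq0 => /eqP ac; move: rhs0; rewrite ac => rhs0.
    by rewrite [(F c - F c)%R]subrr normr0 powR0 ?gt_eqF// !(mul0r, mulr0).
  rewrite sa sc !mul1r.
  have [h1|h1] := leP (t c) (t a); first exact: main.
  (* The bound is symmetric in a and c, so the higher point may be taken first. *)
  rewrite distrC (enormBC a c) (addeC (J a c)) KC.
  by apply: main => //; [rewrite enormBC|exact: ltW].
apply: (le_trans (@le_int2_split _ _ _ (leb R n.+1) 1%R _ J (fun a c => (K a c)%:E) ltr01 F0 J0 eK0 mJ meK pair)).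
rewrite invr1 mul1e.
set NF := near_energy p L m f + far_energy p L m f.
have NF0 : 0 <= NF by apply: adde_ge0; [exact: near_energy_ge0|exact: far_energy_ge0].
have IJ : \int[leb R n.+1]_a \int[leb R n.+1]_c J a c <= (D * Cy)%:E * NF.
  rewrite EFinM -muleA; apply: (@le_trans _ _ (D%:E * cone_functional p m L 2 sg b f (fun a => f (rV_tail a)))); last first.
    by apply: lee_wpmul2l; [rewrite lee_fin|exact: Hy].
  rewrite -(int_tail_oscillation sg b mf_) -intZ; [|exact: D0|]; last first.
    by move=> a; apply: mule_ge0; [nneg|exact: tail_oscillation_ge0].
  apply: le_int => a; first by apply: integral_ge0 => c _; exact: J0.
  have mka : measurable_fun setT (fun c => ((slab L sg b a)%:R * kk a c)%:E).
    apply: measurable_EFin_fun; apply: measurable_funM; first exact: measurable_cst.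
    exact: (measurableT_comp mkk (pair1_measurable a)).
  rewrite /J ge0_integralZr; [|by []|exact: mka|by move=> c _; rewrite lee_fin; nn|exact: W0].
  rewrite muleA; apply: lee_wpmul2r; first exact: W0.
  have [sa|/negbTE nsa] := orP (orbN (slab L sg b a)); last first.
    by apply: int0_le => [c|]; rewrite nsa !mul0r// mule0.
  have [t0 _] := andP sa; rewrite sa mul1r.
  by under eq_integral do rewrite mul1r; exact: int_kk.
have IK : \int[leb R n.+1]_a \int[leb R n.+1]_c (K a c)%:E <= (4 `^ p * C3)%:E * NF.
  rewrite /K int2Z; [|by []|by move=> a c; exact: far_pair_ge0].
  by rewrite EFinM -muleA; apply: lee_wpmul2l; [rewrite lee_fin|exact: H3].
clearbody D NF.
have DC0 : (0 <= D * Cy)%R by exact: mulr_ge0.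
have pC0 : (0 <= 4 `^ p * C3)%R by exact: mulr_ge0.
have -> : (2 * D * Cy + 4 `^ p * C3 = D * Cy + D * Cy + 4 `^ p * C3)%R by ring.
rewrite EFinD [leRHS]ge0_muleDl ?lee_fin ?addr_ge0//.
rewrite [(D * Cy + D * Cy)%:E]EFinD [X in _ <= X + _]ge0_muleDl ?lee_fin//.
by apply: leeD; [exact: leeD|exact: IK].
Qed.

End extension_energies.

(** * Interpolation between two functions across the strip *)

Section blend.
Context {R : realType}.
Variables (n : nat) (p m L : R).
Hypotheses (p1 : 1 < p) (m1 : 1 < m) (mp : m < p) (L0 : 0 < L).
Local Open Scope ereal_scope.
Notation E := 'rV[R]_n.
Notation E1 := 'rV[R]_n.+1.
Notation M := (n%:R + 1 + m)%R.

Let p0 : (0 < p)%R. Proof. exact: lt_trans p1. Qed.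
Let m0 : (0 < m)%R. Proof. exact: lt_trans m1. Qed.

Definition blend (sg b : R) (F G : E1 -> R) (a : E1) : R :=
  (F a + bdist sg b a / L * (G a - F a))%R.

Lemma measurable_blend sg b F G : measurable_fun setT F -> measurable_fun setT G ->
  measurable_fun setT (blend sg b F G).
Proof. by move=> mF mG; rewrite /blend; mf. Qed.

(** Seen from the opposite face the two functions change places, so an estimate at the first face
    applies at both. *)
Lemma blend_sym bm bp F G : (bp - bm = L)%R -> blend 1 bm F G = blend (-1) bp G F.
Proof.
move=> bL; apply/funext => a; rewrite /blend.
have -> : (bdist (-1) bp a = L - bdist 1 bm a)%R by rewrite /bdist -bL; ring.
by move: (bdist 1 bm a) (F a) (G a) => t x y; field; rewrite gt_eqF.
Qed.

Lemma slab_weight_bounds sg b (a : E1) : slab L sg b a -> (0 <= bdist sg b a / L <= 1)%R.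
Proof.
case/andP=> t0 tL; rewrite divr_ge0 ?(ltW t0) ?(ltW L0)//=.
by rewrite ler_pdivrMr// mul1r ltW.
Qed.

Lemma norm_scale_powR (l x : R) : (0 <= l <= 1)%R -> (`|l * x| `^ p <= `|x| `^ p)%R.
Proof.
case/andP=> l0 l1; apply: powR_le; rewrite ?normr_ge0 ?(ltW p0)// normrM (ger0_norm l0).
by apply: ler_piMl.
Qed.

Lemma blend_powR sg b F G a : slab L sg b a ->
  (`|blend sg b F G a| `^ p <= 2 `^ p * (`|F a| `^ p + `|G a| `^ p))%R.
Proof.
move=> sa; have l01 := slab_weight_bounds sa.
have -> : (blend sg b F G a = (1 - bdist sg b a / L) * F a + bdist sg b a / L * G a)%R.
  by rewrite /blend; ring.
move: (bdist sg b a / L)%R l01 => l l01.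
apply: (le_trans (powR_normD2 _ _ (ltW p0))); apply: ler_wpM2l; first exact: powR_ge0.
by apply: lerD; apply: norm_scale_powR; lra.
Qed.

(** Product rule: with l the interpolation weight, the increment is (1 - l a)(F a - F c) + l a (G a
    - G c) + (l a - l c)(G c - F c). The last weight is at most |a - c| / L and at most 1, and the
    kernel times its p-th power is integrable in a because 0 < m < p. *)
Lemma blend_seminorm : exists2 C : R, (0 <= C)%R & forall sg b (F G : E1 -> R),
  sg = 1%R \/ sg = (-1)%R -> measurable_fun setT F -> measurable_fun setT G ->
  seminorm_slab p m L sg b (blend sg b F G) <=
  C%:E * (seminorm_slab p m L sg b F + (seminorm_slab p m L sg b G +
    \int[leb R n.+1]_a ((slab L sg b a)%:R * `|G a - F a| `^ p)%:E)).
Proof.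
have [Co Co0 HCo] := @leb_radial_out R n.+1 m m0.
have pm0 : (0 < p - m)%R by rewrite subr_gt0.
have [Ci Ci0 HCi] := @leb_radial_in R n.+1 (p - m)%R pm0.
have NE : (n.+1%:R = n%:R + 1 :> R)%R by rewrite -natr1.
pose D := (L `^ (- p) * (Ci * L `^ (p - m)) + Co * L `^ (- m))%R.
have D0 : (0 <= D)%R by rewrite /D; nneg.
have p40 : (0 <= 4 `^ p)%R by exact: powR_ge0.
exists (4 `^ p * (1 + D))%R; first by rewrite mulr_ge0// addr_ge0.
move=> sg b F G sg1 mF mG.
pose kk (a c : E1) := (L `^ (- p) * ((0 < enorm (a - c) < L)%R%:R * enorm (a - c) `^ (p - M)) +
  (L <= enorm (a - c))%R%:R * enorm (a - c) `^ (- M))%R.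
have kk0 a c : (0 <= kk a c)%R by rewrite /kk; nneg.
pose k (a c : E1) : R := ((slab L sg b a)%:R * (slab L sg b c)%:R)%R.
pose P (a c : E1) : R := (k a c * (`|F a - F c| `^ p * enorm (a - c) `^ (- M)))%R.
pose Q (a c : E1) : R := (k a c * (`|G a - G c| `^ p * enorm (a - c) `^ (- M)))%R.
pose T (a c : E1) : R := (((slab L sg b c)%:R * `|G c - F c| `^ p) * kk a c)%R.
have P0 a c : (0 <= P a c)%R by rewrite /P /k; nneg.
have Q0 a c : (0 <= Q a c)%R by rewrite /Q /k; nneg.
have T0 a c : (0 <= T a c)%R by rewrite /T; nn.
have mP : measurable_fun setT (fun z : E1 * E1 => P z.1 z.2) by rewrite /P /k /slab; mf.
have mQ : measurable_fun setT (fun z : E1 * E1 => Q z.1 z.2) by rewrite /Q /k /slab; mf.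
have mT : measurable_fun setT (fun z : E1 * E1 => T z.1 z.2) by rewrite /T /kk /slab; mf.
have QT0 a c : (0 <= Q a c + T a c)%R by rewrite addr_ge0.
have H0 a c : (0 <= k a c * (`|blend sg b F G a - blend sg b F G c| `^ p * enorm (a - c) `^ (- M)))%R.
  by rewrite /k; nneg.
have pt a c : (k a c * (`|blend sg b F G a - blend sg b F G c| `^ p * enorm (a - c) `^ (- M)) <=
    4 `^ p * (P a c + (Q a c + T a c)))%R.
  have rhs0 : (0 <= 4 `^ p * (P a c + (Q a c + T a c)))%R by rewrite mulr_ge0// addr_ge0.
  have [sa|/negbTE nsa] := orP (orbN (slab L sg b a)); last by rewrite /k nsa !mul0r.
  have [sc|/negbTE nsc] := orP (orbN (slab L sg b c)); last by rewrite /k nsc mulr0 mul0r.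
  have := enorm_ge0 (a - c); rewrite le_eqVlt => /predU1P[ac0|ac0].
    have : (a - c == 0)%R by rewrite -enorm_eq0 -ac0.
    rewrite subr_eq0 => /eqP ac; move: rhs0; rewrite ac => rhs0.
    by rewrite (subrr (blend sg b F G c)) normr0 powR0 ?gt_eqF// !(mul0r, mulr0).
  rewrite /P /Q /T /k sa sc !mul1r.
  have r0 : (0 <= enorm (a - c) `^ (- M))%R by exact: powR_ge0.
  have la := slab_weight_bounds sa; have lc := slab_weight_bounds sc.
  pose l := ((bdist sg b a - bdist sg b c) / L)%R.
  have -> : (blend sg b F G a - blend sg b F G c = (1 - bdist sg b a / L) * (F a - F c) +
      bdist sg b a / L * (G a - G c) + l * (G c - F c))%R.
    rewrite /blend /l; move: (bdist sg b a) (bdist sg b c) (F a) (F c) (G a) (G c) => x1 x2 x3 x4 x5 x6.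
    by field; rewrite gt_eqF.
  apply: (le_trans (ler_wpM2r r0 (powR_normD3 _ _ _ (ltW p0)))).
  rewrite -[leLHS]mulrA; apply: ler_wpM2l; first exact: p40.
  rewrite [leLHS]mulrDl [X in (X + _ <= _)%R]mulrDl -[leLHS]addrA; apply: lerD.
    by apply: ler_wpM2r; [exact: r0|apply: norm_scale_powR; move: la; move: (_ / L)%R => z; lra].
  apply: lerD; first by apply: ler_wpM2r; [exact: r0|exact: norm_scale_powR].
  rewrite normrM powRM ?normr_ge0// [(_ * `|G c - F c| `^ p)%R]mulrC -[leLHS]mulrA.
  apply: ler_wpM2l; first exact: powR_ge0.
  have lr : (`|l| <= enorm (a - c) / L)%R.
    rewrite /l normrM normrV ?unitfE ?gt_eqF// (gtr0_norm L0).
    by apply: ler_wpM2r; [rewrite invr_ge0 ltW|exact: bdist_lip].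
  rewrite /kk; have [h|h] := ltP (enorm (a - c)) L.
    rewrite mul0r addr0 ac0 /= mul1r (@powRDgt0 _ _ p (- M)%R ac0) mulrA.
    apply: ler_wpM2r; first exact: r0.
    apply: (le_trans (powR_le (ltW p0) (normr_ge0 l) lr)).
    rewrite powRM ?enorm_ge0 ?invr_ge0 ?(ltW L0)// mulrC.
    by rewrite -powR_inv1 ?(ltW L0)// -powRrM mulN1r.
  rewrite andbF mul0r mulr0 add0r mul1r; apply: ler_piMl; first exact: r0.
  have l1 : (`|l| <= 1)%R.
    have -> : (l = bdist sg b a / L - bdist sg b c / L)%R by rewrite /l mulrBl.
    by move: la lc; move: (bdist sg b a / L)%R (bdist sg b c / L)%R => x y; rewrite ler_norml; lra.
  by have := powR_le (ltW p0) (normr_ge0 l) l1; rewrite powR1.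
have IT : \int[leb R n.+1]_a \int[leb R n.+1]_c (T a c)%:E <=
    D%:E * \int[leb R n.+1]_a ((slab L sg b a)%:R * `|G a - F a| `^ p)%:E.
  rewrite (@swap_int _ _ _ _ _ (leb R n.+1) (leb R n.+1) (fun a c => (T a c)%:E));
    [|exact: (measurable_EFin_fun mT)|by move=> a c; rewrite lee_fin].
  rewrite -intZ; [|exact: D0|by nneg].
  apply: le_int => c; first by nn.
  rewrite /T; under eq_integral do rewrite EFinM.
  rewrite intZ; [|by nneg|by nn].
  rewrite muleC; apply: lee_wpmul2r; first by nneg.
  rewrite /kk; under eq_integral do rewrite EFinD.
  rewrite ge0_integralD; [|by []|by nneg|by mf|by nneg|by mf].
  rewrite /D EFinD; apply: leeD.
    under eq_integral do rewrite EFinM.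
    rewrite intZ; [|by nneg|by nneg]; rewrite [leRHS]EFinM; apply: lee_wpmul2l; first by nneg.
    have := HCi c L L0; rewrite NE.
    by have -> : (p - m - (n%:R + 1) = p - M)%R by ring.
  by have := HCo c L L0; rewrite NE.
apply: (le_trans (le_int2 (leb R n.+1) (leb R n.+1) H0 pt)).
have PQT0 a c : (0 <= P a c + (Q a c + T a c))%R by rewrite addr_ge0.
rewrite int2Z; [|exact: p40|exact: PQT0].
rewrite [(4 `^ p * _)%:E]EFinM -muleA; apply: lee_wpmul2l; first by rewrite lee_fin.
have mQT : measurable_fun setT (fun z : E1 * E1 => Q z.1 z.2 + T z.1 z.2)%R.
  exact: (measurable_funD mQ mT).
rewrite (int2D (leb R n.+1) (leb R n.+1) P0 QT0 mP mQT).
rewrite (int2D (leb R n.+1) (leb R n.+1) Q0 T0 mQ mT).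
set I := \int[leb R n.+1]_a ((slab L sg b a)%:R * `|G a - F a| `^ p)%:E in IT *.
have I0 : 0 <= I by rewrite /I; nneg.
have SF0 : 0 <= seminorm_slab p m L sg b F by rewrite /seminorm_slab; nneg.
have SG0 : 0 <= seminorm_slab p m L sg b G by rewrite /seminorm_slab; nneg.
have D1 : (1 <= 1 + D)%R by rewrite lerDl.
have D10 : (0 <= 1 + D)%R by exact: le_trans D1.
have bump (X : \bar R) : 0 <= X -> X <= (1 + D)%:E * X.
  by move=> X0; rewrite -{1}[X]mul1e; apply: lee_wpmul2r; rewrite // lee_fin.
rewrite ge0_muleDr; [|exact: SF0|exact: adde_ge0].
apply: leeD; first exact: (bump _ SF0).
rewrite ge0_muleDr; [|exact: SG0|exact: I0].
apply: leeD; first exact: (bump _ SG0).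
apply: (le_trans IT); apply: lee_wpmul2r; first exact: I0.
by rewrite lee_fin lerDr.
Qed.

Lemma slab_side bm bp (a : E1) : (bp - bm = L)%R -> slab L (-1) bp a = slab L 1 bm a.
Proof.
move=> bL; rewrite /slab; have -> : (bdist (-1) bp a = L - bdist 1 bm a)%R by rewrite /bdist -bL; ring.
by rewrite subr_gt0 andbC ltrBlDr ltrDl.
Qed.

Lemma int_slab_tail sg b (w : E -> R) : sg = 1%R \/ sg = (-1)%R -> measurable_fun setT w ->
  (forall x, 0 <= w x)%R ->
  \int[leb R n.+1]_a ((slab L sg b a)%:R * w (rV_tail a))%:E = L%:E * \int[leb R n]_x (w x)%:E.
Proof.
move=> sg1 mw w0.
rewrite (@int_boundary R n sg b sg1); [|by rewrite /slab; mf|by nn].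
apply: int_eqZ => [|x|x]; [exact: ltW|by nn|].
under eq_integral do rewrite /slab bdist_join// rV_tail_join mulrC EFinM.
by rewrite intZ; [rewrite nu_interval ?(ltW L0)// subr0 muleC|by nn|by nneg].
Qed.

(** The correction carries a factor t / L, and t^p against the Hardy weight t^(-m) is bounded by
    L^(p-m), so an unweighted L^p norm of G - F is enough. *)
Lemma blend_trace : exists2 C : R, (0 <= C)%R & forall sg b (f : E -> R) (F G : E1 -> R),
  sg = 1%R \/ sg = (-1)%R -> measurable_fun setT f -> measurable_fun setT F -> measurable_fun setT G ->
  cone_functional p m L 1 sg b f (blend sg b F G) <=
  C%:E * (cone_functional p m L 1 sg b f F +
    \int[leb R n.+1]_a ((slab L sg b a)%:R * `|G a - F a| `^ p)%:E).
Proof.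
have [C1 C10 H1] := @cone_functional0 R n p m L.
pose D := (C1 * (L `^ (- p) * L `^ (p - m)))%R.
have D0 : (0 <= D)%R by rewrite /D; nneg.
exists (2 `^ p * (1 + D))%R; first by nneg.
move=> sg b f F G sg1 mf_ mF mG.
pose w a := (bdist sg b a / L * (G a - F a))%R.
have mw : measurable_fun setT w by rewrite /w; mf.
have e := @cone_functionalD R n p m L p1 sg b 1%R f F w mf_ mF mw.
rewrite -[blend sg b F G]/(fun a => F a + w a)%R; apply: (le_trans e).
rewrite EFinM -muleA; apply: lee_wpmul2l; first by nneg.
set I := \int[leb R n.+1]_a ((slab L sg b a)%:R * `|G a - F a| `^ p)%:E.
have I0 : 0 <= I by rewrite /I; nneg.
have T0 : 0 <= cone_functional p m L 1 sg b f F.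
  by apply: integral_ge0 => x _; apply: integral_ge0 => a _; rewrite lee_fin cone_integrand_ge0.
have W : cone_functional p m L 1 sg b (fun=> 0%R) w <= D%:E * I.
  rewrite (H1 sg b w sg1 mw) /D EFinM -muleA; apply: lee_wpmul2l; first by rewrite lee_fin.
  rewrite -intZ; [|by nneg|by nneg]; apply: le_int => a; first by nneg.
  have [sa|/negbTE ->] := orP (orbN (slab L sg b a)); last by rewrite !mul0r mule0.
  have [t0 tL] := andP sa.
  rewrite sa !mul1r -EFinM lee_fin /w normrM powRM ?normr_ge0//.
  rewrite (ger0_norm (divr_ge0 (ltW t0) (ltW L0))).
  rewrite powRM ?invr_ge0 ?(ltW t0) ?(ltW L0)//.
  rewrite (_ : L^-1 `^ p = L `^ (- p))%R; last first.
    by rewrite -powR_inv1 ?(ltW L0)// -powRrM mulN1r.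
  have -> : (bdist sg b a `^ p * L `^ (- p) * `|G a - F a| `^ p * bdist sg b a `^ (- m) =
      L `^ (- p) * (bdist sg b a `^ p * bdist sg b a `^ (- m)) * `|G a - F a| `^ p)%R by ring.
  apply: ler_wpM2r; first exact: powR_ge0.
  apply: ler_wpM2l; first exact: powR_ge0.
  by rewrite -(@powRDgt0 _ _ p (- m)%R t0); apply: powR_le; rewrite ?subr_ge0 ltW.
have T1 : cone_functional p m L 1 sg b f F <= (1 + D)%:E * cone_functional p m L 1 sg b f F.
  by rewrite -{1}[X in X <= _]mul1e; apply: lee_wpmul2r; rewrite // lee_fin lerDl.
rewrite ge0_muleDr; [|exact: T0|exact: I0].
apply: leeD; first exact: T1.
by apply: (le_trans W); apply: lee_wpmul2r; rewrite // lee_fin lerDr.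
Qed.

End blend.

Lemma lte_EFinM_pinfty (R : realType) (c : R) (x : \bar R) :
  0 <= c -> (x < +oo -> c%:E * x < +oo)%E.
Proof. by move=> c0 x0; apply: lte_mul_pinfty; rewrite ?lee_fin. Qed.

(** * The extension operator *)

Section extension.
Context {R : realType}.
Variables (n : nat) (p m L : R).
Hypotheses (p1 : 1 < p) (m1 : 1 < m) (mp : m < p) (L0 : 0 < L).
Local Open Scope ereal_scope.
Notation E := 'rV[R]_n.
Notation E1 := 'rV[R]_n.+1.

Let p0 : (0 < p)%R. Proof. exact: lt_trans p1. Qed.

Definition screened_energy (f : E -> R) : \bar R := near_energy p L m f + far_energy p L m f.

Lemma screened_energy_ge0 f : 0 <= screened_energy f.
Proof. by apply: adde_ge0; [exact: near_energy_ge0|exact: far_energy_ge0]. Qed.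

Definition jump_energy (f g : E -> R) : \bar R := \int[leb R n]_x (`|f x - g x| `^ p)%:E.

Lemma jump_energy_ge0 f g : 0 <= jump_energy f g.
Proof. by rewrite /jump_energy; nneg. Qed.

Definition regular_data (f : E -> R) :=
  measurable_fun setT f /\ forall x r, loc_integrable_ball f x r.

Lemma int_mollify_error_slab : exists2 C : R, (0 <= C)%R & forall sg b f,
  sg = 1%R \/ sg = (-1)%R -> regular_data f ->
  \int[leb R n.+1]_a ((slab L sg b a)%:R *
    `|cone_mollify sg b f a - f (rV_tail a)| `^ p)%:E <= C%:E * screened_energy f.
Proof.
have [C C0 HC] := @int_cone_mollify_error R n p m L p1 m1 L0.
exists (L `^ m * C)%R; first by nneg.
move=> sg b f sg1 [mf_ lf].
have e := @int_slab_weight R n p m L m1 sg b (fun a : E1 => cone_mollify sg b f a - f (rV_tail a))%R.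
apply: (le_trans e).
rewrite EFinM -muleA; apply: lee_wpmul2l; first by nneg.
exact: HC.
Qed.

Section two_sides.
Variables (sg b sg' b' : R).
Hypotheses (sg1 : sg = 1%R \/ sg = (-1)%R) (sg1' : sg' = 1%R \/ sg' = (-1)%R).
Hypothesis same_slab : forall a : E1, slab L sg' b' a = slab L sg b a.

Lemma seminorm_slab_side u : seminorm_slab p m L sg' b' (u : E1 -> R) = seminorm_slab p m L sg b u.
Proof.
by apply: eq_integral => a _; apply: eq_integral => c _; rewrite !same_slab.
Qed.

Variables (f g : E -> R).
Hypotheses (rf : regular_data f) (rg : regular_data g).
Notation F := (cone_mollify sg b f).
Notation G := (cone_mollify sg' b' g).

(** G - F is split at g and f above the same foot: two errors of means, and the jump g - f, constant
    in height, whose integral picks up the factor L. *)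
Lemma mollify_jump (C1 : R) : (0 <= C1)%R -> (forall sg b f,
  sg = 1%R \/ sg = (-1)%R -> regular_data f ->
  \int[leb R n.+1]_a ((slab L sg b a)%:R *
    `|cone_mollify sg b f a - f (rV_tail a)| `^ p)%:E <= C1%:E * screened_energy f) ->
  \int[leb R n.+1]_a ((slab L sg b a)%:R * `|G a - F a| `^ p)%:E <=
  (4 `^ p)%:E * (C1%:E * screened_energy g + (C1%:E * screened_energy f + L%:E * jump_energy g f)).
Proof.
move=> C10 H1.
have mG := measurable_cone_mollify sg' b' rg.1; have mF := measurable_cone_mollify sg b rf.1.
have mg := rg.1; have mf_ := rf.1.
pose A a := ((slab L sg' b' a)%:R * `|G a - g (rV_tail a)| `^ p)%R.
pose B a := ((slab L sg b a)%:R * `|F a - f (rV_tail a)| `^ p)%R.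
pose D a := ((slab L sg b a)%:R * `|g (rV_tail a) - f (rV_tail a)| `^ p)%R.
have A0 a : (0 <= A a)%R by rewrite /A; nneg.
have B0 a : (0 <= B a)%R by rewrite /B; nneg.
have D0 a : (0 <= D a)%R by rewrite /D; nneg.
have mA : measurable_fun setT A by rewrite /A /slab; mf.
have mB : measurable_fun setT B by rewrite /B /slab; mf.
have mD : measurable_fun setT D by rewrite /D /slab; mf.
apply: (@le_trans _ _ (\int[leb R n.+1]_a ((4 `^ p)%:E * ((A a)%:E + ((B a)%:E + (D a)%:E))))).
  apply: le_int => a; first by nneg.
  rewrite -!EFinD -EFinM lee_fin /A /B /D same_slab -!mulrDr mulrCA.
  apply: ler_wpM2l; first by nneg.
  have := @powR_normD3 R (G a - g (rV_tail a))%R (f (rV_tail a) - F a)%R (g (rV_tail a) - f (rV_tail a))%R p (ltW p0).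
  have -> : (G a - g (rV_tail a) + (f (rV_tail a) - F a) + (g (rV_tail a) - f (rV_tail a)) = G a - F a)%R.
    by move: (F a) (G a) (f (rV_tail a)) (g (rV_tail a)) => x1 x2 x3 x4; ring.
  by rewrite [(`|f (rV_tail a) - F a|)%R]distrC addrA.
rewrite intZ; [|by nneg|by move=> a; rewrite -!EFinD lee_fin !addr_ge0].
apply: lee_wpmul2l; first by nneg.
rewrite ge0_integralD; [|by []|by move=> a _; rewrite lee_fin|exact: (measurable_EFin_fun mA)|by move=> a _; rewrite -EFinD lee_fin addr_ge0|exact: (emeasurable_funD (measurable_EFin_fun mB) (measurable_EFin_fun mD))].
rewrite ge0_integralD; [|by []|by move=> a _; rewrite lee_fin|exact: (measurable_EFin_fun mB)|by move=> a _; rewrite lee_fin|exact: (measurable_EFin_fun mD)].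
apply: leeD; first exact: H1.
apply: leeD; first exact: H1.
have e := @int_slab_tail R n L L0 sg b (fun x => `|g x - f x| `^ p)%R sg1.
by apply: le_of_eq; apply: e; [mf|nneg].
Qed.

End two_sides.

Definition extension (bm bp : R) (fp fm : E -> R) : E1 -> R :=
  blend L 1 bm (cone_mollify 1 bm fm) (cone_mollify (-1) bp fp).

Lemma measurable_extension bm bp fp fm : measurable_fun setT fp -> measurable_fun setT fm ->
  measurable_fun setT (extension bm bp fp fm).
Proof.
by move=> mfp mfm; apply: measurable_blend; exact: measurable_cone_mollify.
Qed.

Lemma extension_seminorm : exists2 C : R, (0 <= C)%R & forall bm bp fp fm, (bp - bm = L)%R ->
  regular_data fp -> regular_data fm ->
  seminorm_slab p m L 1 bm (extension bm bp fp fm) <=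
  C%:E * (screened_energy fp + (screened_energy fm + jump_energy fp fm)).
Proof.
have [C1 C10 H1] := int_mollify_error_slab.
have [C2 C20 H2] := @cone_mollify_seminorm R n p m L p1 m1 mp L0.
have [C3 C30 H3] := @blend_seminorm R n p m L p1 m1 mp L0.
have p40 : (0 <= 4 `^ p)%R by exact: powR_ge0.
have L0' := ltW L0.
exists (C3 * (C2 + 4 `^ p * (C1 + L)))%R; first by rewrite mulr_ge0 ?addr_ge0 ?mulr_ge0 ?addr_ge0.
move=> bm bp fp fm bL rp rm.
have ss a : slab L (-1) bp (a : E1) = slab L 1 bm a by exact: slab_side.
have l1 : (1 : R)%R = 1%R \/ (1 : R)%R = (-1)%R by left.
have r1 : (-1 : R)%R = 1%R \/ (-1 : R)%R = (-1)%R by right.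
apply: (le_trans (H3 _ bm _ _ l1 (measurable_cone_mollify 1 bm rm.1) (measurable_cone_mollify (-1) bp rp.1))).
rewrite EFinM -muleA; apply: lee_wpmul2l; first by rewrite lee_fin.
have Sm : _ <= C2%:E * screened_energy fm := H2 1%R bm fm l1 rm.1 rm.2.
have Sp : _ <= C2%:E * screened_energy fp := H2 (-1)%R bp fp r1 rp.1 rp.2.
have J := mollify_jump l1 r1 ss rm rp C10 H1.
have e := seminorm_slab_side ss (cone_mollify (-1) bp fp).
have {e} Sp := le_trans (le_of_eq (esym e)) Sp.
clear H1 H2 H3.
have a0 := screened_energy_ge0 fp; have c0 := screened_energy_ge0 fm.
have d0 := jump_energy_ge0 fp fm.
move: (screened_energy fp) (screened_energy fm) (jump_energy fp fm) a0 c0 d0 Sm Sp J.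
move=> a c d a0 c0 d0.
move: (seminorm_slab _ _ _ _ _ _) => X; move: (seminorm_slab _ _ _ _ _ _) => Y.
move: (integral _ _ _) => Z Sm Sp J.
set K := (4 `^ p)%R in p40 J *; clearbody K.
have KC1 : (0 <= K * (C1 + L))%R by rewrite mulr_ge0// addr_ge0.
apply: (@le_trans _ _ (C2%:E * c + (C2%:E * a + (K * (C1 + L))%:E * (a + (c + d))))).
  apply: leeD; first exact: Sm.
  apply: leeD; first exact: Sp.
  apply: (le_trans J); rewrite EFinM -muleA; apply: lee_wpmul2l; first by rewrite lee_fin.
  rewrite ge0_muleDr; [|exact: a0|exact: adde_ge0].
  have mono (k x : R) (y : \bar R) : (k <= x)%R -> 0 <= y -> k%:E * y <= x%:E * y.
    by move=> kx y0; apply: lee_wpmul2r; rewrite // lee_fin.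
  apply: leeD; first by apply: mono => //; rewrite lerDl.
  rewrite ge0_muleDr; [|exact: c0|exact: d0].
  by apply: leeD; apply: mono => //; rewrite ?lerDl ?lerDr.
rewrite EFinD [leRHS]ge0_muleDl ?lee_fin//.
rewrite addeA; apply: leeD; last exact: lexx.
rewrite -ge0_muleDr; [|exact: c0|exact: a0].
apply: lee_wpmul2l; first by rewrite lee_fin.
by rewrite addeC; apply: leeD; rewrite ?leeDl.
Qed.

Lemma blend_trace_finite sg b sg' b' (f g : E -> R) :
  sg = 1%R \/ sg = (-1)%R -> sg' = 1%R \/ sg' = (-1)%R ->
  (forall a : E1, slab L sg' b' a = slab L sg b a) ->
  regular_data f -> regular_data g -> screened_energy f < +oo -> screened_energy g < +oo ->
  jump_energy g f < +oo ->
  cone_functional p m L 1 sg b f (blend L sg b (cone_mollify sg b f) (cone_mollify sg' b' g)) < +oo.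
Proof.
move=> sg1 sg1' ss rf rg ff fg jfg.
have [C1 C10 H1] := int_mollify_error_slab.
have [C2 C20 H2] := @cone_mollify_trace R n p m L p1 m1 L0.
have [C3 C30 H3] := @blend_trace R n p m L p1 mp L0.
apply: (le_lt_trans (H3 sg b f _ _ sg1 rf.1 (measurable_cone_mollify sg b rf.1) (measurable_cone_mollify sg' b' rg.1))).
apply: (lte_EFinM_pinfty C30); apply: lte_add_pinfty.
  exact: (le_lt_trans (H2 sg b f sg1 rf.1 rf.2) (lte_EFinM_pinfty C20 ff)).
apply: (le_lt_trans (mollify_jump sg1 sg1' ss rf rg C10 H1)).
apply: lte_EFinM_pinfty; first exact: powR_ge0.
apply: lte_add_pinfty; first exact: lte_EFinM_pinfty C10 fg.
apply: lte_add_pinfty; first exact: lte_EFinM_pinfty C10 ff.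
exact: lte_EFinM_pinfty (ltW L0) jfg.
Qed.

Lemma extension_trace_finite bm bp fp fm : (bp - bm = L)%R ->
  regular_data fp -> regular_data fm -> screened_energy fp < +oo -> screened_energy fm < +oo ->
  jump_energy fp fm < +oo ->
  cone_functional p m L 1 1 bm fm (extension bm bp fp fm) < +oo /\
  cone_functional p m L 1 (-1) bp fp (extension bm bp fp fm) < +oo.
Proof.
move=> bL rp rm fp_ fm_ j.
have l1 : (1 : R)%R = 1%R \/ (1 : R)%R = (-1)%R by left.
have r1 : (-1 : R)%R = 1%R \/ (-1 : R)%R = (-1)%R by right.
have ss a : slab L (-1) bp (a : E1) = slab L 1 bm a by exact: slab_side.
split; first exact: (blend_trace_finite l1 r1 ss rm rp fm_ fp_ j).
have j' : jump_energy fm fp < +oo.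
  have -> : jump_energy fm fp = jump_energy fp fm by apply: eq_integral => x _; rewrite distrC.
  exact: j.
rewrite /extension (blend_sym L0 _ _ bL).
exact: (blend_trace_finite r1 l1 (fun a => esym (ss a)) rp rm fp_ fm_ j').
Qed.

(** Each cone mean differs from its boundary data, extended constantly in height, by a function in
    L^p of the whole slab; local integrability of the data thus passes to the extension, up to the
    boundary. *)
Lemma extension_Lp_ball bm bp fp fm (r : R) : (bp - bm = L)%R ->
  regular_data fp -> regular_data fm -> screened_energy fp < +oo -> screened_energy fm < +oo ->
  \int[leb R n]_x ((enorm x < r)%R%:R * `|fp x| `^ p)%:E < +oo ->
  \int[leb R n]_x ((enorm x < r)%R%:R * `|fm x| `^ p)%:E < +oo ->
  \int[leb R n.+1]_a ((slab L 1 bm a)%:R * ((enorm (rV_tail a) < r)%R%:R *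
    `|extension bm bp fp fm a| `^ p))%:E < +oo.
Proof.
move=> bL rp rm fp_ fm_ lp lm.
have [C1 C10 H1] := int_mollify_error_slab.
have l1 : (1 : R)%R = 1%R \/ (1 : R)%R = (-1)%R by left.
have r1 : (-1 : R)%R = 1%R \/ (-1 : R)%R = (-1)%R by right.
have side sg b f : sg = 1%R \/ sg = (-1)%R -> regular_data f -> screened_energy f < +oo ->
    (forall a : E1, slab L sg b a = slab L 1 bm a) ->
    \int[leb R n]_x ((enorm x < r)%R%:R * `|f x| `^ p)%:E < +oo ->
    \int[leb R n.+1]_a ((slab L 1 bm a)%:R * ((enorm (rV_tail a) < r)%R%:R *
      `|cone_mollify sg b f a| `^ p))%:E < +oo.
  move=> sg1 rf ff ss lf; have mf_ := rf.1; have mF := measurable_cone_mollify sg b rf.1.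
  pose A (a : E1) : R := ((slab L sg b a)%:R * `|cone_mollify sg b f a - f (rV_tail a)| `^ p)%R.
  pose w (x : E) : R := ((enorm x < r)%R%:R * `|f x| `^ p)%R.
  pose B (a : E1) : R := ((slab L sg b a)%:R * w (rV_tail a))%R.
  have A0 a : (0 <= A a)%R by rewrite /A; nneg.
  have w0 x : (0 <= w x)%R by rewrite /w; nneg.
  have B0 a : (0 <= B a)%R by rewrite /B; apply: mulr_ge0.
  have mw : measurable_fun setT w by rewrite /w; mf.
  have mA : measurable_fun setT A by rewrite /A /slab; mf.
  have mB : measurable_fun setT B by rewrite /B /slab; mf.
  apply: (@le_lt_trans _ _ (\int[leb R n.+1]_a ((2 `^ p)%:E * ((A a)%:E + (B a)%:E)))).
    apply: le_int => a; first by nneg.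
    rewrite -EFinD -EFinM lee_fin /A /B /w ss -mulrDr.
    rewrite [leRHS]mulrCA; apply: ler_wpM2l; first exact: ler0n.
    have [h|/negbTE ->] := orP (orbN (enorm (rV_tail a) < r)%R); last first.
      by rewrite !mul0r addr0 mulr_ge0// powR_ge0.
    rewrite h !mul1r.
    have := @powR_normD2 R (cone_mollify sg b f a - f (rV_tail a))%R (f (rV_tail a)) p (ltW p0).
    by rewrite subrK.
  rewrite intZ; [|by nneg|by move=> a; rewrite -EFinD lee_fin addr_ge0].
  apply: lte_EFinM_pinfty; first exact: powR_ge0.
  rewrite ge0_integralD; [|by []|by move=> a _; rewrite lee_fin|exact: (measurable_EFin_fun mA)|by move=> a _; rewrite lee_fin|exact: (measurable_EFin_fun mB)].
  apply: lte_add_pinfty.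
    exact: (le_lt_trans (H1 sg b f sg1 rf) (lte_EFinM_pinfty C10 ff)).
  have e := @int_slab_tail R n L L0 sg b w sg1 mw w0.
  apply: (le_lt_trans (le_of_eq e)); exact: lte_EFinM_pinfty (ltW L0) lf.
have Fm := side 1%R bm fm l1 rm fm_ (fun=> erefl) lm.
have Fp := side (-1)%R bp fp r1 rp fp_ (fun a => slab_side a bL) lp.
have mm := measurable_cone_mollify 1 bm rm.1.
have mp_ := measurable_cone_mollify (-1) bp rp.1.
pose A (a : E1) : R := ((slab L 1 bm a)%:R * ((enorm (rV_tail a) < r)%R%:R * `|cone_mollify 1 bm fm a| `^ p))%R.
pose B (a : E1) : R := ((slab L 1 bm a)%:R * ((enorm (rV_tail a) < r)%R%:R * `|cone_mollify (-1) bp fp a| `^ p))%R.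
have A0 a : (0 <= A a)%R by rewrite /A; nneg.
have B0 a : (0 <= B a)%R by rewrite /B; nneg.
have mA : measurable_fun setT A by rewrite /A /slab; mf.
have mB : measurable_fun setT B by rewrite /B /slab; mf.
apply: (@le_lt_trans _ _ (\int[leb R n.+1]_a ((2 `^ p)%:E * ((A a)%:E + (B a)%:E)))).
  apply: le_int => a; first by nneg.
  rewrite -EFinD -EFinM lee_fin /A /B -!mulrDr.
  have [sa|/negbTE ->] := orP (orbN (slab L 1 bm a)); last by rewrite !mul0r mulr0.
  rewrite sa mul1r mul1r [leRHS]mulrCA; apply: ler_wpM2l; first exact: ler0n.
  exact: (blend_powR p1 L0 _ _ sa).
have AF : \int[leb R n.+1]_a (A a)%:E < +oo by exact: Fm.
have BF : \int[leb R n.+1]_a (B a)%:E < +oo by exact: Fp.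
clear Fm Fp; clearbody A B.
rewrite intZ; [|exact: powR_ge0|by move=> a; rewrite -EFinD lee_fin addr_ge0].
apply: lte_EFinM_pinfty; first exact: powR_ge0.
rewrite ge0_integralD; [|by []|by move=> a _; rewrite lee_fin|exact: (measurable_EFin_fun mA)|by move=> a _; rewrite lee_fin|exact: (measurable_EFin_fun mB)].
exact: lte_add_pinfty AF BF.
Qed.

(** Inside the strip both heights are positive, so both means are genuine averages and linearity
    holds at every point. *)
Lemma extension_linear bm bp (a : R) fp fm gp gm (x : E1) :
  regular_data fp -> regular_data fm -> regular_data gp -> regular_data gm ->
  (bm < rV_last x < bp)%R ->
  extension bm bp (fun y => a * fp y + gp y)%R (fun y => a * fm y + gm y)%R x =
  (a * extension bm bp fp fm x + extension bm bp gp gm x)%R.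
Proof.
move=> [mfp lfp] [mfm lfm] [mgp lgp] [mgm lgm] /andP[x1 x2].
have t1 : (0 < bdist 1 bm x)%R by rewrite /bdist mul1r subr_gt0.
have t2 : (0 < bdist (-1) bp x)%R by rewrite /bdist mulN1r opprB subr_gt0.
rewrite /extension /blend /cone_mollify.
rewrite (mollifyD a t1 mfm mgm (lfm _ _) (lgm _ _)) (mollifyD a t2 mfp mgp (lfp _ _) (lgp _ _)).
by ring.
Qed.

End extension.

(** * Roots of sums of extended reals *)

Section ereal_root.
Context {R : realType}.
Local Open Scope ereal_scope.
Implicit Types (x y : \bar R) (q : R).

(** The sum is at most twice the larger term; the factor 2^q is harmless for the final constant. *)
Lemma poweRD_le q x y : (0 <= q)%R -> 0 <= x -> 0 <= y ->
  (x + y) `^ q <= (2 `^ q)%:E * (x `^ q + y `^ q).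
Proof.
move=> q0 + +; wlog xy : x y / x <= y => [H x0 y0|x0 y0].
  have [xy|/ltW yx] := leP x y; first exact: H.
  by rewrite addeC [x `^ q + _]addeC; exact: H.
apply: (@le_trans _ _ ((2%:E * y) `^ q)).
  apply: le_poweR; [exact: q0|exact: adde_ge0|].
  by rewrite mule_natl mule2n; exact: leeD.
rewrite poweRM// poweR_EFin; apply: lee_wpmul2l; first by rewrite lee_fin powR_ge0.
by rewrite leeDr// poweR_ge0.
Qed.

Lemma poweRD5_le q (a b c d e : \bar R) : (0 <= q)%R ->
  0 <= a -> 0 <= b -> 0 <= c -> 0 <= d -> 0 <= e ->
  (a + b + (c + d + e)) `^ q <= (2 `^ q * (2 `^ q * 2 `^ q))%:E *
    (a `^ q + b `^ q + (c `^ q + d `^ q + e `^ q)).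
Proof.
move=> q0 a0 b0 c0 d0 e0; set k := (2 `^ q)%R.
have k1 : (1 <= k)%R by rewrite -(powRr0 2); apply: ler_powR; rewrite ?ler1n.
have k0 : (0 <= k)%R by exact: le_trans k1.
have kk x : 0 <= x -> x <= k%:E * x.
  by move=> x0; rewrite -{1}[x]mul1e; apply: lee_wpmul2r; rewrite // lee_fin.
have P x : 0 <= x `^ q by exact: poweR_ge0.
apply: (le_trans (poweRD_le q0 _ _)); [exact: adde_ge0|by rewrite !adde_ge0|].
rewrite [(k * (k * k))%:E]EFinM -muleA; apply: lee_wpmul2l; first by rewrite lee_fin.
rewrite [leRHS]ge0_muleDr ?adde_ge0//; apply: leeD.
  apply: (le_trans (poweRD_le q0 a0 b0)); apply: lee_wpmul2r; first exact: adde_ge0.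
  by rewrite lee_fin ler_peMl.
rewrite EFinM -muleA; apply: (le_trans (poweRD_le q0 _ e0)); first exact: adde_ge0.
apply: lee_wpmul2l; first by rewrite lee_fin.
rewrite [leRHS]ge0_muleDr ?adde_ge0//; apply: leeD; first exact: poweRD_le.
exact: kk.
Qed.

End ereal_root.

(** * The extension for given boundary data *)

Section part2.
Context {R : realType}.
Variables (n : nat) (s p L : R).
Hypotheses (s01 : 0 < s < 1) (p1 : 1 < p) (sp1 : 1 < s * p) (L0 : 0 < L).
Local Open Scope ereal_scope.
Notation E := 'rV[R]_n.
Notation E1 := 'rV[R]_n.+1.

Let p0 : (0 < p)%R. Proof. exact: lt_trans p1. Qed.
Let pV0 : (0 < p^-1)%R. Proof. by rewrite invr_gt0. Qed.
Let mp : (s * p < p)%R.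
Proof. by rewrite gtr_pMl//; case/andP: s01. Qed.

Lemma Lp_loc_ball (f : E -> R) x r : Lp_loc p setT f ->
  \int[leb R n]_y ((enorm (y - x) < r)%R%:R * `|f y| `^ p)%:E < +oo.
Proof.
case=> mf_ /(_ _ (@compact_enorm_ball R n x r) (fun y _ => I)); apply: le_lt_trans.
rewrite [leRHS](int_restrictE (leb R n) (b := fun y => (enorm (y - x) <= r)%R)); last by move=> y; split.
apply: le_int => y; first by nneg.
rewrite lee_fin; apply: ler_wpM2r; first by nneg.
by have [h|h] := ltP (enorm (y - x)) r; [rewrite (ltW h)|exact: ler0n].
Qed.

Lemma Lp_loc_regular (f : E -> R) : Lp_loc p setT f -> regular_data f.
Proof.
move=> lf; have mf_ := lf.1; split=> // x r.
exact: (loc_integrable_ball_powR p1 mf_ (Lp_loc_ball x r lf)).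
Qed.

Lemma screened_energy_finite (f : E -> R) :
  screened_le (s - p^-1) p (cst L) setT f < +oo ->
  screened_ge (s + p^-1) p (cst L) setT f < +oo -> screened_energy p (s * p) L f < +oo.
Proof.
have pn0 : (p^-1 != 0)%R by rewrite gt_eqF.
have LL : (0 < L * L)%R by rewrite mulr_gt0.
rewrite screened_leE// screened_geE// => H1 H2; apply: lte_add_pinfty.
  exact: (lty_poweRy pn0 H1).
have := lte_EFinM_pinfty (_ : 0 <= (L * L)^-1)%R (lty_poweRy pn0 H2).
by rewrite muleA -EFinM mulVf ?gt_eqF// mul1e; apply; rewrite invr_ge0 ltW.
Qed.

Lemma screened_energy_root (f : E -> R) :
  far_energy p L (s * p) f `^ p^-1 =
  ((L * L)^-1 `^ p^-1)%:E * screened_ge (s + p^-1) p (cst L) setT f.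
Proof.
have LL : (0 < L * L)%R by rewrite mulr_gt0.
have LL' : (0 <= (L * L)^-1)%R by rewrite invr_ge0 ltW.
have f0 := far_energy_ge0 p L (s * p) f.
rewrite screened_geE// -poweR_EFin -poweRM ?lee_fin//; last first.
  by apply: mule_ge0 => //; rewrite lee_fin ltW.
by rewrite muleA -EFinM mulVf ?gt_eqF// mul1e.
Qed.

Variables (fp fm : E -> R).
Hypothesis D : trace_data s p L fp fm.

Let rp : regular_data fp. Proof. by case: D => h _ _ _ _; exact: Lp_loc_regular. Qed.
Let rm : regular_data fm. Proof. by case: D => _ h _ _ _; exact: Lp_loc_regular. Qed.
Let ep : screened_energy p (s * p) L fp < +oo.
Proof. by case: D => _ _ _ [h _] [h' _]; exact: screened_energy_finite. Qed.
Let em : screened_energy p (s * p) L fm < +oo.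
Proof. by case: D => _ _ _ [_ h] [_ h']; exact: screened_energy_finite. Qed.
Let jf : jump_energy p fp fm < +oo. Proof. by case: D. Qed.

Variables (bm bp : R).
Hypothesis bL : (bp - bm = L)%R.
Notation u := (extension L bm bp fp fm).

Let sm : side bm bp 1 bm. Proof. by left. Qed.
Let mu : measurable_fun setT u.
Proof. exact: (measurable_extension L bm bp rp.1 rm.1). Qed.

Lemma extension_seminormE sg b : side bm bp sg b ->
  sobolev_seminorm s p (strip bm bp) u = seminorm_slab p (s * p) L sg b u `^ p^-1.
Proof.
move=> sb; rewrite /sobolev_seminorm; congr (_ `^ _).
exact: (strip_energyE s p bL sb (fun a _ => erefl)).
Qed.

Lemma extension_homogeneous : homogeneous_sobolev s p (strip bm bp) u.
Proof.
split; last first.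
  rewrite (extension_seminormE sm); apply: poweR_lty.
  have [C C0 HC] := @extension_seminorm R n p (s * p) L p1 sp1 mp L0.
  apply: (le_lt_trans (HC bm bp fp fm bL rp rm)).
  apply: (lte_EFinM_pinfty C0); apply: lte_add_pinfty; first exact: ep.
  by apply: lte_add_pinfty; [exact: em|exact: jf].
split; first exact: measurable_funTS.
move=> K cK Ks.
(* A compact set lies in a bounded cylinder, where [extension_Lp_ball] applies. *)
have [r Hr] : exists r : R, forall a, K a -> (enorm (rV_tail a) < r)%R.
  have : bounded_set [set enorm (a - 0) | a in K].
    apply: compact_bounded; apply: continuous_compact cK.
    exact/continuous_subspaceT/continuous_enormB.
  case=> M [_ HM]; exists (M + 2)%R => a Ka.
  have : (`|enorm (a - 0)| <= M + 1)%R by apply: HM; [rewrite ltrDl|exists a].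
  rewrite subr0 ger0_norm ?enorm_ge0// => h.
  by apply: (le_lt_trans (enorm_tail a)); apply: (le_lt_trans h); rewrite ltrD2l ltr1n.
have lp : Lp_loc p setT fp by case: D.
have lm : Lp_loc p setT fm by case: D.
have bp_ := Lp_loc_ball 0 r lp; have bm_ := Lp_loc_ball 0 r lm.
have bp' : \int[leb R n]_x ((enorm x < r)%R%:R * `|fp x| `^ p)%:E < +oo.
  by apply: le_lt_trans bp_; apply: le_of_eq; apply: eq_integral => x _; rewrite subr0.
have bm' : \int[leb R n]_x ((enorm x < r)%R%:R * `|fm x| `^ p)%:E < +oo.
  by apply: le_lt_trans bm_; apply: le_of_eq; apply: eq_integral => x _; rewrite subr0.
apply: le_lt_trans (extension_Lp_ball p1 sp1 L0 bL rp rm ep em bp' bm').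
rewrite [leLHS](int_restrictE (leb R n.+1) (b := fun a => `[< K a >])); last first.
  by move=> a; split=> [/asboolP|/asboolP].
apply: le_int => a; first by nneg.
rewrite lee_fin mulrA; apply: ler_wpM2r; first by nneg.
case: asboolP => [Ka|_]; last by nneg.
by rewrite (Hr _ Ka) mulr1 (_ : slab L 1 bm a)//; apply/(strip_slab bL a sm); exact: Ks.
Qed.

(** The approximations required by [is_trace] are the interior mollifications of the extension
    itself; finiteness of the bridge functional makes their boundary values converge to [f]. *)
Lemma extension_trace sg b (f : E -> R) : side bm bp sg b -> measurable_fun setT f ->
  cone_functional p (s * p) L 1 sg b f u < +oo -> is_trace s p bm bp u b f.
Proof.
move=> sb mf_ Tf; have Hu := extension_homogeneous; have [Lu _] := Hu.
have Sfin := seminorm_slab_finite p1 bL sb Hu.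
have mu' := measurable_cutoff bL Lu.1.
have LI x r := loc_integrable_cutoff (x := x) (r := r) p1 bL sb Lu.
have Tf' : cone_functional p (s * p) L 1 sg b f (cutoff L bm u) < +oo.
  apply: le_lt_trans Tf; apply: le_of_eq; apply: eq_integral => x _; apply: eq_integral => a _.
  rewrite /cone_integrand.
  have [sa|/negbTE ->] := orP (orbN (slab L sg b a)); last by rewrite !mul0r.
  by rewrite -(cutoffE bL)//; apply/(strip_slab bL a sb).
have [v [cv v1 v2 _ v3]] := interior_approx p1 sp1 mp L0 (side_sg sb) mu' LI Sfin.
exact: (is_trace_limit p1 bL sb (cutoffE bL u) mf_ cv v1 v2 (v3 f mf_ Tf')).
Qed.

Lemma extension_traces : is_trace s p bm bp u bp fp /\ is_trace s p bm bp u bm fm.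
Proof.
have [T1 T2] := extension_trace_finite p1 sp1 mp L0 bL rp rm ep em jf.
split; first by apply: (@extension_trace (-1)); [right|exact: rp.1|].
by apply: (extension_trace sm rm.1).
Qed.

End part2.

Section part2_bound.
Context {R : realType}.
Variables (n : nat) (s p L : R).
Hypotheses (s01 : 0 < s < 1) (p1 : 1 < p) (sp1 : 1 < s * p) (L0 : 0 < L).
Local Open Scope ereal_scope.
Notation E := 'rV[R]_n.

(** Here a, d and b, e stand for the roots of the near and far seminorms of the two data and j for
    the jump; [l] is the cost of dropping the weight L^2. The constant 1 + c (1 + l) dominates both
    c and c l, and is positive. *)
Lemma lee_sum5 (c l : R) (a b d e j S : \bar R) : (0 <= c)%R -> (0 <= l)%R ->
  0 <= a -> 0 <= b -> 0 <= d -> 0 <= e -> 0 <= j ->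
  S <= c%:E * (a + l%:E * b + (d + l%:E * e + j)) ->
  S <= (1 + c * (1 + l))%:E * j + (1 + c * (1 + l))%:E * a + (1 + c * (1 + l))%:E * d +
    (1 + c * (1 + l))%:E * b + (1 + c * (1 + l))%:E * e.
Proof.
move=> c0 l0 a0 b0 d0 e0 j0 H; apply: (le_trans H).
set C := (1 + c * (1 + l))%R.
have C1 : (c <= C)%R by rewrite /C mulrDr mulr1 addrCA lerDl addr_ge0// mulr_ge0.
have C2 : (c * l <= C)%R by rewrite /C mulrDr mulr1 addrA lerDr addr_ge0.
have mono (k : R) (y : \bar R) : (k <= C)%R -> 0 <= y -> k%:E * y <= C%:E * y.
  by move=> kx y0; apply: lee_wpmul2r; rewrite // lee_fin.
have lb : 0 <= l%:E * b by rewrite mule_ge0.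
have le_ : 0 <= l%:E * e by rewrite mule_ge0.
rewrite ge0_muleDr; [|exact: adde_ge0|by rewrite !adde_ge0].
rewrite ge0_muleDr; [|exact: a0|exact: lb].
rewrite ge0_muleDr; [|exact: adde_ge0|exact: j0].
rewrite ge0_muleDr; [|exact: d0|exact: le_].
rewrite !muleA -!EFinM.
have -> : C%:E * j + C%:E * a + C%:E * d + C%:E * b + C%:E * e =
   C%:E * a + C%:E * b + (C%:E * d + C%:E * e + C%:E * j).
  by rewrite [C%:E * j + _]addeC -!addeA; congr (_ + _);
     rewrite [RHS]addeC -!addeA addeC -!addeA; congr (_ + _); rewrite addeC -!addeA.
by apply: leeD; [apply: leeD|apply: leeD; [apply: leeD|]]; exact: mono.
Qed.

Lemma extension_bound : exists2 C : R, (0 < C)%R & forall bm bp : R, (bp - bm = L)%R ->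
  forall fp fm : E -> R, trace_data s p L fp fm ->
  sobolev_seminorm s p (strip bm bp) (extension L bm bp fp fm) <=
  C%:E * Lp_norm_on p setT (fun x => fp x - fm x)%R
  + C%:E * screened_le (s - p^-1) p (cst L) setT fp
  + C%:E * screened_le (s - p^-1) p (cst L) setT fm
  + C%:E * screened_ge (s + p^-1) p (cst L) setT fp
  + C%:E * screened_ge (s + p^-1) p (cst L) setT fm.
Proof.
have p0 : (0 < p)%R by exact: lt_trans p1.
have pV0 : (0 <= p^-1)%R by rewrite invr_ge0 ltW.
have mp : (s * p < p)%R by rewrite gtr_pMl//; case/andP: s01.
have [C0 C00 HC] := @extension_seminorm R n p (s * p) L p1 sp1 mp L0.
pose l := ((L * L)^-1 `^ p^-1)%R; have l0 : (0 <= l)%R by exact: powR_ge0.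
pose c := (C0 `^ p^-1 * (2 `^ p^-1 * (2 `^ p^-1 * 2 `^ p^-1)))%R.
have c0 : (0 <= c)%R by rewrite /c; nneg.
exists (1 + c * (1 + l))%R; first by rewrite ltr_pwDl// mulr_ge0// addr_ge0.
move=> bm bp bL fp fm D.
have sm : side bm bp 1 bm by left.
have [lp lm _ _ _] := D.
have rp := Lp_loc_regular p1 lp; have rm := Lp_loc_regular p1 lm.
rewrite (extension_seminormE s p fp fm bL sm).
have Np := near_energy_ge0 p L (s * p) fp; have Nm := near_energy_ge0 p L (s * p) fm.
have Fp := far_energy_ge0 p L (s * p) fp; have Fm := far_energy_ge0 p L (s * p) fm.
have J := jump_energy_ge0 p fp fm.
apply: lee_sum5 => //; try exact: poweR_ge0.
apply: (le_trans (le_poweR pV0 _ (HC bm bp fp fm bL rp rm))).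
  by rewrite /seminorm_slab; nneg.
rewrite poweRM; [|by rewrite lee_fin|]; last first.
  by apply: adde_ge0; [|apply: adde_ge0]; [exact: screened_energy_ge0|exact: screened_energy_ge0|exact: J].
rewrite poweR_EFin /c EFinM -muleA; apply: lee_wpmul2l; first by rewrite lee_fin powR_ge0.
apply: (le_trans (poweRD5_le pV0 Np Fp Nm Fm J)).
have eJ : Lp_norm_on p setT (fun x => fp x - fm x)%R = jump_energy p fp fm `^ p^-1 by [].
move: (@screened_energy_root R n s p L p1 L0 fp) (@screened_energy_root R n s p L p1 L0 fm).
move: (@screened_leE R n s p L p0 fp) (@screened_leE R n s p L p0 fm) eJ.
move: (Lp_norm_on _ _ _) (screened_le _ _ _ _ fp) (screened_le _ _ _ _ fm) => X1 X2 X3.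
move: (screened_ge _ _ _ _ fp) (screened_ge _ _ _ _ fm) => X4 X5.
move: (near_energy _ _ _ fp) (near_energy _ _ _ fm) (far_energy _ _ _ fp) (far_energy _ _ _ fm) => Y1 Y2 Y3 Y4.
by move: (jump_energy _ _ _) => Y5 -> -> -> -> ->.
Qed.

End part2_bound.

(* N = n + 1 *)
Theorem theorem1p5 (R : realType) (n : nat) (s p L : R) :
  (1 <= n)%N -> 0 < s < 1 -> 1 < p -> 1 < s * p -> 0 < L ->
  (exists2 C : R, 0 < C &
    forall bm bp : R, bm < bp -> bp - bm = L ->
    forall u : 'rV[R]_n.+1 -> R, homogeneous_sobolev s p (strip bm bp) u ->
    (exists fp fm : 'rV[R]_n -> R,
      is_trace s p bm bp u bp fp /\ is_trace s p bm bp u bm fm) /\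
    (forall fp fm : 'rV[R]_n -> R,
      is_trace s p bm bp u bp fp -> is_trace s p bm bp u bm fm ->
      let U := sobolev_seminorm s p (strip bm bp) u in
      [/\ (\int[leb R n]_x (`|fp x - fm x| `^ p)%:E <= C%:E * U `^ p)%E,
          (screened_le (s - p^-1) p (cst L) setT fp <= C%:E * U)%E,
          (screened_le (s - p^-1) p (cst L) setT fm <= C%:E * U)%E,
          (screened_ge (s + p^-1) p (cst L) setT fp <= C%:E * U)%E &
          (screened_ge (s + p^-1) p (cst L) setT fm <= C%:E * U)%E])) /\
  (exists2 C : R, 0 < C &
    forall bm bp : R, bm < bp -> bp - bm = L ->
    exists E : ('rV[R]_n -> R) -> ('rV[R]_n -> R) -> ('rV[R]_n.+1 -> R),
      (forall (a : R) (fp fm gp gm : 'rV[R]_n -> R),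
        trace_data s p L fp fm -> trace_data s p L gp gm ->
        {ae leb R n.+1, forall x, strip bm bp x ->
          E (fun y => a * fp y + gp y) (fun y => a * fm y + gm y) x
          = a * E fp fm x + E gp gm x}) /\
      (forall fp fm : 'rV[R]_n -> R, trace_data s p L fp fm ->
        [/\ homogeneous_sobolev s p (strip bm bp) (E fp fm),
            is_trace s p bm bp (E fp fm) bp fp,
            is_trace s p bm bp (E fp fm) bm fm &
            (sobolev_seminorm s p (strip bm bp) (E fp fm) <=
              C%:E * Lp_norm_on p setT (fun x => fp x - fm x)%R
              + C%:E * screened_le (s - p^-1) p (cst L) setT fp
              + C%:E * screened_le (s - p^-1) p (cst L) setT fm
              + C%:E * screened_ge (s + p^-1) p (cst L) setT fp
              + C%:E * screened_ge (s + p^-1) p (cst L) setT fm)%E])).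
Proof.
move=> _ s01 p1 sp1 L0; split.
  have [C C0 HC] := @part1_bounds R n s p L p1 sp1 L0.
  exists C => // bm bp _ bL u Hu; split; last exact: (HC bm bp bL u Hu).
  have [fp Tp] := @trace_exists R n s p L s01 p1 sp1 L0 bm bp (-1) bp u bL (or_intror (conj erefl erefl)) Hu.
  have [fm Tm] := @trace_exists R n s p L s01 p1 sp1 L0 bm bp 1 bm u bL (or_introl (conj erefl erefl)) Hu.
  by exists fp, fm.
have [C C0 HC] := @extension_bound R n s p L s01 p1 sp1 L0.
(* The constant is fixed before the faces: it depends on them through L only. *)
exists C => // bm bp _ bL; exists (extension L bm bp); split.
  move=> a fp fm gp gm [lfp lfm _ _ _] [lgp lgm _ _ _]; apply: aeW => x xs.
  by apply: extension_linear => //; exact: (Lp_loc_regular p1).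
move=> fp fm D.
have [Tp Tm] := extension_traces s01 p1 sp1 L0 D bL.
split; [exact: (extension_homogeneous s01 p1 sp1 L0 D bL)|exact: Tp|exact: Tm|].
exact: HC.
Qed.
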